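(* Let $d\in\mathbb{N}$ ($d\ge 1$), $\alpha\in(1,2)$, $q_0=(\alpha-1)/d$, $b\in\mathbb{R}^d$ and $q>q_0$. Let $u_0\in L^1(\mathbb{R}^d)\cap L^\infty(\mathbb{R}^d)$ with $u_0\ge0$ and $\|u_0\|_1>0$, and let $u(t,x)$ be the solution of $$u_t-\Delta^{\alpha/2}u+b\cdot\nabla\left(u|u|^q\right)=0,\qquad u(0,x)=u_0(x).$$ Then for every $\gamma$ with $0<\gamma<\min\{d(q-q_0),1\}/\alpha$, $$\lim_{t\to\infty}t^{\gamma}\left\|1-\frac{u(t,\cdot)}{(P_tu_0)(\cdot)}\right\|_\infty=0.$$
   Context: $\Delta^{\alpha/2}$ is the fractional Laplacian, $\widehat{\Delta^{\alpha/2}\phi}(\xi)=-|\xi|^\alpha\widehat\phi(\xi)$. Its heat kernel is $p(t,x)=(2\pi)^{-d}\int_{\mathbb{R}^d}e^{-ix\cdot\xi}e^{-t|\xi|^\alpha}\,d\xi$ for $t>0$, $x\in\mathbb{R}^d$, and $(P_tf)(x)=\int_{\mathbb{R}^d}p(t,x-y)f(y)\,dy$ is the stable semigroup. ''Solution'' means the (unique, global) mild solution: $u\in C([0,\infty);L^1(\mathbb{R}^d))\cap C((0,\infty);L^\infty(\mathbb{R}^d))$ with $u(0)=u_0$ and, for $t>0$, $x\in\mathbb{R}^d$, $$u(t,x)=(P_tu_0)(x)+\int_0^t\int_{\mathbb{R}^d} b\cdot\nabla_z p(t-s,x-z)\,u(s,z)|u(s,z)|^{q}\,dz\,ds.$$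 For $u_0\ge0$ the solution is non-negative. $\|\cdot\|_\infty$ is the $L^\infty(\mathbb{R}^d)$ norm in the space variable. *)

(* Defs.v *)
From HB Require Import structures.
From mathcomp Require Import all_boot all_order all_algebra.
From mathcomp Require Import all_classical all_reals all_analysis.
From mathcomp Require Import complex.
Set Implicit Arguments.
Unset Strict Implicit.
Unset Printing Implicit Defensive.
Import Order.TTheory GRing.Theory Num.Theory.
Import numFieldNormedType.Exports.
Local Open Scope classical_set_scope.
Local Open Scope ring_scope.

Section measurable_rV.
Context {R : realType} {n : nat}.

Definition coord_rV (i : 'I_n) (x : 'rV[R]_n) : measurableTypeR R := x ord0 i.

Let rV_set0 : g_sigma_preimage coord_rV set0.
Proof. exact: sigma_algebra0. Qed.

Let rV_setC A : g_sigma_preimage coord_rV A -> g_sigma_preimage coord_rV (~` A).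
Proof. exact: sigma_algebraC. Qed.

Let rV_bigcup (F : (set 'rV[R]_n)^nat) :
  (forall i, g_sigma_preimage coord_rV (F i)) ->
  g_sigma_preimage coord_rV (\bigcup_i (F i)).
Proof. exact: sigma_algebra_bigcup. Qed.

HB.instance Definition _ := @isMeasurable.Build default_measure_display
  'rV[R]_n (g_sigma_preimage coord_rV) rV_set0 rV_setC rV_bigcup.

Lemma measurable_coord_rV i : measurable_fun [set: 'rV[R]_n] (coord_rV i).
Proof.
move=> _ Y mY; rewrite setTI; apply: sub_sigma_algebra => /=.
rewrite -bigcup_seq/=; exists i => /=; first by rewrite mem_index_enum.
by exists Y => //; rewrite setTI.
Qed.

Lemma measurable_fun_rVP d (T : measurableType d) (f : T -> 'rV[R]_n) :
  (forall i, measurable_fun [set: T] (coord_rV i \o f)) ->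
  measurable_fun [set: T] f.
Proof.
move=> mf _ A; rewrite setTI; move: A.
apply: smallest_sub => /=; first split=> [|A mA|F mF] /=.
- by rewrite preimage_set0.
- by rewrite setTD -preimage_setC; exact: measurableC.
- by rewrite preimage_bigcup; exact: bigcup_measurable.
move=> A; rewrite -bigcup_seq => -[i _ [B mB <-]]/=.
by rewrite setTI -[X in measurable X]setTI; exact: mf.
Qed.

End measurable_rV.

Section lebesgue_rV.
Context {R : realType}.

Definition cons_rV n (p : measurableTypeR R * 'rV[R]_n) : 'rV[R]_n.+1 :=
  \row_i if unlift ord0 i is Some j then p.2 ord0 j else p.1.

Lemma cons_rV0 n a (v : 'rV[R]_n) : cons_rV (a, v) ord0 ord0 = a.
Proof. by rewrite mxE unlift_none. Qed.

Lemma cons_rVS n a (v : 'rV[R]_n) i :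
  cons_rV (a, v) ord0 (lift ord0 i) = v ord0 i.
Proof. by rewrite mxE liftK. Qed.

Lemma measurable_cons_rV n : measurable_fun setT (@cons_rV n).
Proof.
apply: measurable_fun_rVP => i; case: (unliftP ord0 i) => [j|] ->.
  rewrite (_ : _ \o _ = coord_rV j \o snd).
    by apply: measurableT_comp => //; exact: measurable_coord_rV.
  by apply/funext => -[a v]; exact: cons_rVS.
rewrite (_ : _ \o _ = fst)//.
by apply/funext => -[a v]; exact: cons_rV0.
Qed.

Definition uncons_rV n (x : 'rV[R]_n.+1) : measurableTypeR R * 'rV[R]_n :=
  (x ord0 ord0, \row_i x ord0 (lift ord0 i)).

Lemma cons_rVK n : cancel (@cons_rV n) (@uncons_rV n).
Proof.
move=> [a v]; congr pair; first exact: cons_rV0.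
by apply/rowP => i; rewrite mxE cons_rVS.
Qed.

Lemma measurable_uncons_rV n : measurable_fun setT (@uncons_rV n).
Proof.
apply/measurable_fun_pairP; split; first exact: measurable_coord_rV.
apply: measurable_fun_rVP => i.
rewrite (_ : _ \o _ = coord_rV (lift ord0 i)); first exact: measurable_coord_rV.
by apply/funext => x; rewrite /coord_rV /= mxE.
Qed.

Section step.
Context {n : nat}.
Variable mu : {sigma_finite_measure set 'rV[R]_n -> \bar R}.

Definition lebesgue_rV_step : set 'rV[R]_n.+1 -> \bar R :=
  pushforward (lebesgue_measure \x mu)%E (@cons_rV n).

Let step0 : lebesgue_rV_step set0 = 0%E.
Proof. by rewrite /lebesgue_rV_step /pushforward preimage_set0 measure0. Qed.

Let step_ge0 A : (0 <= lebesgue_rV_step A)%E.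
Proof. by rewrite /lebesgue_rV_step /pushforward; apply: measure_ge0. Qed.

Let step_sigma_additive : semi_sigma_additive lebesgue_rV_step.
Proof.
by have mf := @measurable_cons_rV n; exact: measure_semi_sigma_additive.
Qed.

HB.instance Definition _ := isMeasure.Build _ _ _ lebesgue_rV_step
  step0 step_ge0 step_sigma_additive.

Let step_sigma_finite : sigma_finite setT lebesgue_rV_step.
Proof.
have /sigma_finiteP[F [TF ndF Foo]] := sigma_finiteT (@lebesgue_measure R).
have /sigma_finiteP[G [TG ndG Goo]] := sigma_finiteT mu.
exists (fun k => @uncons_rV n @^-1` (F k `*` G k)).
  rewrite -preimage_bigcup (_ : \bigcup_k _ = setT) ?preimage_setT//.
  apply/seteqP; split=> // -[x y] _.
  have [i _ Fx] : (\bigcup_i F i) x by rewrite -TF.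
  have [j _ Gy] : (\bigcup_j G j) y by rewrite -TG.
  exists (maxn i j) => //; split => /=.
    by move: x Fx; exact/subsetPset/ndF/leq_maxl.
  by move: y Gy; exact/subsetPset/ndG/leq_maxr.
move=> k; have [mF Fk] := Foo k; have [mG Gk] := Goo k; split.
  rewrite -[X in measurable X]setTI; apply: measurable_uncons_rV => //.
  exact: measurableX.
rewrite /lebesgue_rV_step /pushforward -comp_preimage.
rewrite (_ : _ \o _ = id) ?preimage_id; last first.
  by apply/funext => p /=; rewrite cons_rVK.
by rewrite product_measure1E// lte_mul_pinfty// ge0_fin_numE.
Qed.

HB.instance Definition _ := Measure_isSigmaFinite.Build _ _ _ lebesgue_rV_step
  step_sigma_finite.

End step.

Fixpoint lebesgue_rV (n : nat) : {sigma_finite_measure set 'rV[R]_n -> \bar R} :=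
  if n is m.+1 then lebesgue_rV_step (lebesgue_rV m)
  else dirac (0 : 'rV[R]_0).

End lebesgue_rV.

Lemma lebesgue_rV_box (R : realType) n (A : 'I_n -> set (measurableTypeR R)) :
  (forall i, measurable (A i)) ->
  lebesgue_rV n [set x | forall i, A i (coord_rV i x)] =
  (\prod_(i < n) lebesgue_measure (A i))%E.
Proof.
elim: n A => [|n IH] A mA.
  rewrite big_ord0 /= diracE mem_set//=; by case.
rewrite big_ord_recl -(IH (fun i => A (lift ord0 i)))// -product_measure1E//.
- rewrite /= /lebesgue_rV_step /pushforward; congr (_ _).
  apply/seteqP; split=> -[a v] /=.
    move=> Av; split; first by have := Av ord0; rewrite /coord_rV cons_rV0.
    by move=> i; have := Av (lift ord0 i); rewrite /coord_rV cons_rVS.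
  case=> Aa Av i; rewrite /coord_rV; case: (unliftP ord0 i) => [j|] ->.
    by rewrite cons_rVS; exact: Av.
  by rewrite cons_rV0.
- rewrite (_ : [set x | _] = \bigcap_(i in [set: 'I_n])
      (coord_rV i @^-1` A (lift ord0 i))).
    apply: fin_bigcap_measurable => // i _.
    rewrite -[X in measurable X]setTI; exact: measurable_coord_rV.
  by apply/seteqP; split=> x /= Ax i; [move=> _|]; exact: Ax.
Qed.

Section mild_solution.
Context {R : realType} {d : nat}.
Implicit Types (x y z xi : 'rV[R]_d) (t s : R).

Local Notation leb := (@lebesgue_rV R d).

Definition dotp x y : R := \sum_(i < d) x ord0 i * y ord0 i.

(* Euclidean norm; the library's norm on matrices is the sup norm. *)
Definition enorm x : R := Num.sqrt (dotp x x).

Definition grad (f : 'rV[R]_d -> R) x : 'rV[R]_d :=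
  \row_i 'D_(delta_mx ord0 i) f x.

Definition cexpi (theta : R) : R[i] := (cos theta +i* sin theta)%C.

Definition cintegral (f : 'rV[R]_d -> R[i]) : R[i] :=
  ((\int[leb]_x complex.Re (f x)) +i* (\int[leb]_x complex.Im (f x)))%C.

(* The integral is real (the integrand is conjugated by xi -> - xi), so that
   taking the real part only serves to land in R. *)
Definition heat_kernel (alpha t : R) x : R :=
  (2 * pi) ^- d *
  complex.Re (cintegral (fun xi =>
    cexpi (- dotp x xi) * (expR (- (t * enorm xi `^ alpha)))%:C%C)).

Definition stable_semigroup (alpha t : R) (f : 'rV[R]_d -> R) x : R :=
  \int[leb]_y (heat_kernel alpha t (x - y) * f y).

(* b . nabla_z p(t - s, x - z) u |u|^q : the gradient is that of the function
   z |-> p(t - s, x - z). *)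
Definition duhamel_integrand (alpha q : R) (b : 'rV[R]_d)
    (u : R -> 'rV[R]_d -> R) t x s z : R :=
  dotp b (grad (fun z => heat_kernel alpha (t - s) (x - z)) z) *
  (u s z * `|u s z| `^ q).

(* Elements of L^1 and L^oo are represented by Borel functions.  The integrals
   of the library are total, so the absolute convergence of the Duhamel
   integral, implicit in the mild formulation, is spelled out. *)
Record mild_solution (alpha q : R) (b : 'rV[R]_d) (u0 : 'rV[R]_d -> R)
    (u : R -> 'rV[R]_d -> R) : Prop := {
  mild_L1 : forall t, 0 <= t -> u t \in Lfun leb 1%E ;
  mild_continuous_L1 : forall t, 0 <= t ->
    'N[leb]_1[EFin \o (u s \- u t)%R]%E @[s --> within `[0, +oo[ (nbhs t)]
      --> 0%E ;
  mild_Loo : forall t, 0 < t -> u t \in Lfun leb +oo%E ;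
  mild_continuous_Loo : forall t, 0 < t ->
    'N[leb]_+oo[EFin \o (u s \- u t)%R]%E @[s --> t] --> 0%E ;
  mild_init : u 0 = u0 %[ae leb] ;
  mild_convergence : forall t x, 0 < t ->
    (\int[lebesgue_measure]_(s in `]0%R, t[)
      \int[leb]_z `|duhamel_integrand alpha q b u t x s z|%:E < +oo)%E ;
  mild_duhamel : forall t x, 0 < t ->
    u t x = stable_semigroup alpha t u0 x +
      \int[lebesgue_measure]_(s in `]0, t[)
        (\int[leb]_z duhamel_integrand alpha q b u t x s z)
}.

End mild_solution.

(* Main.v *)
(** Write P_t for the stable semigroup, p_t for its kernel and f(a) = a|a|^q.

    Kernel.  The one-sided (alpha/2)-stable law is approximated by normalised
    sums of independent Pareto variables, so that p_1 is a limit of Gaussian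
    mixtures.  This gives p_1(x) >= c (1 + |x|^2)^(-(d + alpha)/2), a
    two-sided estimate of p_1(x) - p_1(y), and |b . grad p_t| <= C t^(-1/alpha) p_t.

    A priori bounds.  The mild formula can be restarted at any tau > 0: its
    defect is invariant under the translation by b and integrable, hence zero.
    On short time windows u is then the L^1 limit of the splitting scheme
    v |-> P_h (v - lam (f(v) - f(v(. - (h/lam) b)))), which is monotone for
    small lam.  Consequently 0 <= u <= ||u_0||_oo, the mass does not increase,
    and, since p_h is bounded below near the diagonal, ||u(t)||_oo <= C t^(-d/alpha).

    Comparison.  For fixed T and x, y(t) = (P_(T-t) u(t))(x) satisfies
    y(t) <= P_T u_0(x) + C int_0^t (T-s)^(-1/alpha) s^(-sigma) y(s) ds with
    gamma + 1 - 1/alpha < sigma < min(qd/alpha, 1).  The total weight is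
    O(T^(-(gamma + delta))) for some delta > 0, so that y <= 2 P_T u_0(x) for
    large T, and hence |u(T,x) - P_T u_0(x)| <= C' T^(-(gamma + delta)) P_T u_0(x). *)
Require Import Defs.
From HB Require Import structures.
From mathcomp Require Import all_boot all_order all_algebra.
From mathcomp Require Import all_classical all_reals all_analysis.
From mathcomp Require Import measurable_realfun lebesgue_integral_under.
From mathcomp Require Import ess_sup_inf.
From mathcomp Require Import ring lra.
Set Implicit Arguments.
Unset Strict Implicit.
Unset Printing Implicit Defensive.
Import Order.TTheory GRing.Theory Num.Theory.
Import numFieldNormedType.Exports.
Local Open Scope classical_set_scope.
Local Open Scope ring_scope.

(** The mild formula gives no regularity in space, so sign, sup bound and mass cannot be obtained by
    testing the equation. They are transferred from the scheme through one functional, [pos], the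
    integral of max (v - k, 0), which is continuous in L^1. The windows on which the scheme
    converges have a length depending on a sup bound only, so that they chain.

    Increments along b break the circle, because |b . grad p| taken at two points dominates them.

    In the comparison the flux is bounded by s^(-sigma) u with sigma < 1, although the decay
    suggests the power qd/alpha, which may fail to be integrable at 0; boundedness of u allows any
    smaller power. The factor 2 results from iterating the inequality for y from a constant bound,
    each round halving the excess over 2 P_T u_0(x). *)

Lemma integrable_fubini_G d1 d2 (T1 : measurableType d1) (T2 : measurableType d2)
    (R : realType) (m1 : {sigma_finite_measure set T1 -> \bar R})
    (m2 : {sigma_finite_measure set T2 -> \bar R}) (f : T1 * T2 -> \bar R) :
  (m1 \x m2)%E.-integrable setT f -> m2.-integrable setT (fubini_G m1 f).
Proof.
move=> fi; have /integrableP[mf _] := fi.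
apply/integrableP; split; first exact: (measurable_fubini_G fi).
apply: le_lt_trans ((integrable21ltyP _ _ mf).1 fi); apply: ge0_le_integral => //.
- by apply: measurableT_comp => //; exact: (measurable_fubini_G fi).
- apply: (measurable_fun_fubini_tonelli_G (abse \o f)) => //=.
  exact: measurableT_comp.
- move=> y _; apply: le_abse_integral => //.
  exact: measurableT_comp.
Qed.

(** * Lebesgue integration on row vectors *)

Section Rfubini.
Context d1 d2 (T1 : measurableType d1) (T2 : measurableType d2) (R : realType).
Variables (m1 : {sigma_finite_measure set T1 -> \bar R})
  (m2 : {sigma_finite_measure set T2 -> \bar R}).
Variables (D : set T1) (E : set T2) (f : T1 -> T2 -> R).
Hypotheses (mD : measurable D) (mE : measurable E).
Hypothesis mf : measurable_fun (D `*` E) (fun p => f p.1 p.2).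
Hypothesis intf : (\int[m1]_(x in D) \int[m2]_(y in E) `|f x y|%:E < +oo)%E.

Let g (p : T1 * T2) : R := ((fun p => f p.1 p.2) \_ (D `*` E)) p.

Let mg : measurable_fun setT g.
Proof. by apply/(measurable_restrictT _ _).1 => //; exact: measurableX. Qed.

Let gE x y : g (x, y) = ((fun x => (f x \_ E) y) \_ D) x.
Proof.
rewrite /g !patchE; case: (asboolP (D x)) => Dx; last first.
  by rewrite memNset ?memNset //=; case.
case: (asboolP (E y)) => Ey; last by rewrite memNset ?(mem_set Dx)/= ?patchE ?memNset //=; case.
by rewrite mem_set ?(mem_set Dx) ?patchE ?(mem_set Ey).
Qed.

Let gEx x : (fun y => (g (x, y))%:E) =
  if x \in D then (EFin \o f x) \_ E else cst 0%E.
Proof.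
apply/funext => y; rewrite gE patchE; case: ifP => // _.
by rewrite !patchE; case: ifP.
Qed.

Let gEy y : (fun x => (g (x, y))%:E) =
  if y \in E then (EFin \o f ^~ y) \_ D else cst 0%E.
Proof.
apply/funext => x; rewrite gE patchE; case: ifPn => xD; rewrite ?patchE.
  by case: ifPn; rewrite //= patchE xD.
by case: ifPn; rewrite //= patchE (negbTE xD).
Qed.

Let ig : (m1 \x m2)%E.-integrable setT (EFin \o g).
Proof.
apply/integrable12ltyP => /=; first exact/measurable_EFinP.
apply: le_lt_trans intf; rewrite [leRHS]integral_mkcond/=.
rewrite le_eqVlt; apply/orP; left; apply/eqP; apply: eq_integral => x _.
rewrite patchE; have := gEx x; case: ifPn => xD /funeqP gxE.
  under eq_integral do rewrite -abse_EFin gxE.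
  rewrite [RHS]integral_mkcond; apply: eq_integral => y _.
  by rewrite !patchE; case: ifPn; rewrite //= normr0.
by under eq_integral do rewrite -abse_EFin gxE /= normr0; rewrite integral0.
Qed.

Let F1E x : x \in D -> (\int[m2]_y (g (x, y))%:E = \int[m2]_(y in E) (f x y)%:E)%E.
Proof. by move=> xD; rewrite gEx xD [RHS]integral_mkcond. Qed.

Let F2E y : y \in E -> (\int[m1]_x (g (x, y))%:E = \int[m1]_(x in D) (f x y)%:E)%E.
Proof. by move=> xD; rewrite gEy xD [RHS]integral_mkcond. Qed.

Let ae_fin1 : {ae m1, forall x, (\int[m2]_y (g (x, y))%:E)%E \is a fin_num}.
Proof.
have := ae_integrable1 ig; apply: filterS => x ix.
exact: integrable_fin_num.
Qed.

Let ae_fin2 : {ae m2, forall y, (\int[m1]_x (g (x, y))%:E)%E \is a fin_num}.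
Proof.
have := ae_integrable2 ig; apply: filterS => x ix.
exact: integrable_fin_num.
Qed.

Let G1 : (EFin \o (fun x => \int[m2]_(y in E) f x y)) \_ D =
  (fun x => (fine (\int[m2]_y (g (x, y))%:E))%:E).
Proof.
apply/funext => x; rewrite patchE; case: ifPn => xD; first by rewrite F1E.
by rewrite gEx (negbTE xD) integral0.
Qed.

Let G2 : (EFin \o (fun y => \int[m1]_(x in D) f x y)) \_ E =
  (fun y => (fine (\int[m1]_x (g (x, y))%:E))%:E).
Proof.
apply/funext => x; rewrite patchE; case: ifPn => xD; first by rewrite F2E.
by rewrite gEy (negbTE xD) integral0.
Qed.

Let mg1 : measurable_fun setT (fun x => (\int[m2]_y (g (x, y))%:E)%E).
Proof. by have /integrableP[] := integrable_fubini_F ig. Qed.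

Let mg2 : measurable_fun setT (fun y => (\int[m1]_x (g (x, y))%:E)%E).
Proof. by have /integrableP[] := integrable_fubini_G ig. Qed.

Let fineint1 : m1.-integrable setT (fun x => (fine (\int[m2]_y (g (x, y))%:E))%:E).
Proof.
apply: le_integrable (integrable_fubini_F ig) => //=.
- by apply/measurable_EFinP; apply: measurableT_comp mg1; exact: fine_measurable.
- move=> x _; rewrite /fubini_F/=.
  by case: (\int[m2]_y _)%E => //=; rewrite normr0 leey.
Qed.

Let fineint2 : m2.-integrable setT (fun y => (fine (\int[m1]_x (g (x, y))%:E))%:E).
Proof.
apply: le_integrable (integrable_fubini_G ig) => //=.
- by apply/measurable_EFinP; apply: measurableT_comp mg2; exact: fine_measurable.
- move=> x _; rewrite /fubini_G/=.
  by case: (\int[m1]_y _)%E => //=; rewrite normr0 leey.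
Qed.

Lemma integrable_Rintegral1 :
  m1.-integrable D (EFin \o (fun x => \int[m2]_(y in E) f x y)).
Proof. by apply/(integrable_mkcond _ mD).2; rewrite G1; exact: fineint1. Qed.

Lemma integrable_Rintegral2 :
  m2.-integrable E (EFin \o (fun y => \int[m1]_(x in D) f x y)).
Proof. by apply/(integrable_mkcond _ mE).2; rewrite G2; exact: fineint2. Qed.

(** The inner real integrals are [fine] of extended ones, which are finite only almost everywhere;
    where they are infinite [fine] returns 0, and this alters the outer integrands on null sets
    only. *)
Lemma Rintegral_fubini : \int[m1]_(x in D) (\int[m2]_(y in E) f x y) =
  \int[m2]_(y in E) (\int[m1]_(x in D) f x y).
Proof.
rewrite /Rintegral; congr fine.
rewrite [LHS]integral_mkcond [RHS]integral_mkcond.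
have -> : (fun x => (fine (\int[m2]_(y in E) (f x y)%:E))%:E) \_ D =
  (fun x => (fine (\int[m2]_y (g (x, y))%:E))%:E) by exact: G1.
have -> : (fun y => (fine (\int[m1]_(x in D) (f x y)%:E))%:E) \_ E =
  (fun x => (fine (\int[m1]_y (g (y, x))%:E))%:E) by exact: G2.
transitivity (\int[m1]_x \int[m2]_y (g (x, y))%:E)%E.
  apply: ae_eq_integral => //.
  - by case/integrableP: fineint1.
  - by have := ae_fin1; apply: filterS => x xfin _; rewrite fineK.
rewrite (Fubini ig); apply: ae_eq_integral => //.
- by case/integrableP: fineint2.
- by have := ae_fin2; apply: filterS => x xfin _; rewrite fineK.
Qed.

End Rfubini.

Section rV_measurable.
Context d (T : measurableType d) {R : realType} {n : nat}.
Implicit Types f g : T -> 'rV[R]_n.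

Lemma measurable_rV_coord f i : measurable_fun setT f ->
  measurable_fun setT (fun x => f x ord0 i : R).
Proof.
by move=> mf; exact: (measurableT_comp (measurable_coord_rV i) mf).
Qed.

Lemma measurable_rVD f g : measurable_fun setT f -> measurable_fun setT g ->
  measurable_fun setT (fun x => f x + g x).
Proof.
move=> mf mg; apply: measurable_fun_rVP => i.
rewrite (_ : _ \o _ = (fun x => f x ord0 i + g x ord0 i)).
  by apply: measurable_funD; exact: measurable_rV_coord.
by apply/funext => x; rewrite /coord_rV /= mxE.
Qed.

Lemma measurable_rVN f : measurable_fun setT f ->
  measurable_fun setT (fun x => - f x).
Proof.
move=> mf; apply: measurable_fun_rVP => i.
rewrite (_ : _ \o _ = (fun x => - f x ord0 i)).
  by apply: measurableT_comp => //; exact: measurable_rV_coord.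
by apply/funext => x; rewrite /coord_rV /= mxE.
Qed.

Lemma measurable_rVB f g : measurable_fun setT f -> measurable_fun setT g ->
  measurable_fun setT (fun x => f x - g x).
Proof. by move=> mf mg; apply: measurable_rVD => //; exact: measurable_rVN. Qed.

Lemma measurable_rVZ (h : T -> R) f : measurable_fun setT h ->
  measurable_fun setT f -> measurable_fun setT (fun x => h x *: f x).
Proof.
move=> mh mf; apply: measurable_fun_rVP => i.
rewrite (_ : _ \o _ = (fun x => h x * f x ord0 i)).
  by apply: measurable_funM => //; exact: measurable_rV_coord.
by apply/funext => x; rewrite /coord_rV /= mxE.
Qed.

Lemma measurable_dotp f g : measurable_fun setT f -> measurable_fun setT g ->
  measurable_fun setT (fun x => dotp (f x) (g x)).
Proof.
move=> mf mg; apply: measurable_sum => i.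
by apply: measurable_funM; exact: measurable_rV_coord.
Qed.

End rV_measurable.

Section affine1.
Context {R : realType}.
Variables (s a : R).
Hypothesis s0 : s != 0.

Let phi (x : measurableTypeR R) : measurableTypeR R := s * x + a.

Let mphi : measurable_fun setT phi.
Proof. by apply: measurable_funD => //; exact: measurable_funM. Qed.

Let pushphi : {measure set (measurableTypeR R) -> \bar R} :=
  measure_function_pushforward__canonical__measure_function_Measure
    lebesgue_measure mphi.

Let nu : {measure set (measurableTypeR R) -> \bar R} :=
  mscale (NngNum (normr_ge0 s)) pushphi.

(** Uniqueness of Lebesgue measure reduces the claim to half-open intervals. A negative [s] reverses
    the interval, so that the preimage is closed on the other side; its length is the same. *)
Let nuE A : measurable A -> lebesgue_measure A = nu A.
Proof.
apply: lebesgue_measure_unique => _ [[p q]] _ <- /=.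
rewrite /nu /= /mscale /pushforward /= lebesgue_measure_itv /=.
have [sp|sn|/eqP] := ltgtP 0 s; last by rewrite eq_sym (negbTE s0).
- rewrite /pushforward; have -> : phi @^-1` `]p, q]%classic = `](p - a) / s, (q - a) / s]%classic.
    apply/seteqP; split=> x /=; rewrite !in_itv/= /phi.
      by rewrite ltr_pdivrMr// ler_pdivlMr// (mulrC x) ltrBlDr lerBrDr.
    by rewrite ltr_pdivrMr// ler_pdivlMr// (mulrC x) ltrBlDr lerBrDr.
  rewrite lebesgue_measure_itv /= !lte_fin ltr_pM2r ?invr_gt0// ltrD2r.
  case: ifPn => _; last by rewrite mule0.
  by rewrite -!EFinB -EFinM gtr0_norm//; congr EFin; field; rewrite gt_eqF.
- rewrite /pushforward; have -> : phi @^-1` `]p, q]%classic = `[(q - a) / s, (p - a) / s[%classic.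
    apply/seteqP; split=> x /=; rewrite !in_itv/= /phi.
      by rewrite ltr_ndivlMr// ler_ndivrMr// (mulrC x) ltrBlDr lerBrDr andbC.
    by rewrite ltr_ndivlMr// ler_ndivrMr// (mulrC x) ltrBlDr lerBrDr andbC.
  rewrite lebesgue_measure_itv /= !lte_fin ltr_nM2r ?invr_lt0// ltrD2r.
  case: ifPn => _; last by rewrite mule0.
  by rewrite -!EFinB -EFinM ltr0_norm//; congr EFin; field; rewrite lt_eqF.
Qed.

Lemma ge0_integral_affine1 (f : R -> \bar R) : measurable_fun setT f ->
  (forall x, 0 <= f x)%E ->
  (\int[lebesgue_measure]_x f x =
   `|s|%:E * \int[lebesgue_measure]_x f (s * x + a)%R)%E.
Proof.
move=> mf f0.
rewrite (eq_measure_integral nu) => [|A mA _]; last exact: nuE.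
rewrite ge0_integral_mscale//=; congr (_ * _)%E.
by rewrite /= ge0_integral_pushforward.
Qed.

End affine1.

Section integral_rV.
Context {R : realType}.
Local Open Scope ereal_scope.

Lemma ge0_integral_rVS n (f : 'rV[R]_n.+1 -> \bar R) : measurable_fun setT f ->
  (forall x, 0 <= f x) ->
  \int[lebesgue_rV n.+1]_x f x =
  \int[lebesgue_measure]_a \int[lebesgue_rV n]_v f (cons_rV (a, v)).
Proof.
move=> mf f0; have mc := @measurable_cons_rV R n.
rewrite [LHS](_ : _ = \int[pushforward (lebesgue_measure \x lebesgue_rV n)%E (@cons_rV R n)]_x f x)//.
rewrite ge0_integral_pushforward// fubini_tonelli1//=.
exact: measurableT_comp.
Qed.

(** Induction on the dimension: the map acts coordinatewise, so the one-dimensional substitution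
    contributes one factor [|s|] and the induction hypothesis the others. *)
Lemma ge0_integral_rV_affine n (s : R) (a : 'rV[R]_n) (f : 'rV[R]_n -> \bar R) :
  s != 0%R -> measurable_fun setT f -> (forall x, 0 <= f x) ->
  \int[lebesgue_rV n]_x f x =
  (`|s| ^+ n)%:E * \int[lebesgue_rV n]_x f (s *: x + a)%R.
Proof.
move=> s0; elim: n a f => [|n IH] a f mf f0.
  rewrite expr0 mul1e; apply: eq_integral => x _; congr f.
  by apply/rowP; case.
have mc := @measurable_cons_rV R n.
rewrite !ge0_integral_rVS//; last first.
  by apply: measurableT_comp => //; apply: measurable_rVD => //; exact: measurable_rVZ.
set a' : 'rV[R]_n := (\row_i a ord0 (lift ord0 i))%R.
have consE x v : (s *: cons_rV (x, v) + a)%R =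
    cons_rV ((s * x + a ord0 ord0)%R : measurableTypeR R, (s *: v + a')%R).
  apply/rowP => i; rewrite !mxE; case: unliftP => [j|] -> /=; by rewrite ?mxE.
have mF : measurable_fun setT (fun x => \int[lebesgue_rV n]_v f (cons_rV (x, v))).
  apply: (measurable_fun_fubini_tonelli_F (fun p => f (cons_rV p))) => //.
  exact: measurableT_comp.
rewrite (ge0_integral_affine1 (a ord0 ord0) s0 mF); last first.
  by move=> x; apply: integral_ge0.
transitivity (`|s|%:E * \int[lebesgue_measure]_x ((`|s| ^+ n)%:E *
    \int[lebesgue_rV n]_v f (cons_rV ((s * x + a ord0 ord0)%R : measurableTypeR R, (s *: v + a')%R)))).
  congr (_ * _); apply: eq_integral => x _; rewrite (IH a')//.
  apply: measurableT_comp => //; apply: measurableT_comp => //.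
rewrite ge0_integralZl//.
- rewrite muleA -EFinM -exprS; congr (_ * _).
  by apply: eq_integral => x _; apply: eq_integral => v _; rewrite consE.
- apply: (measurable_fun_fubini_tonelli_F (fun p : measurableTypeR R * 'rV[R]_n => f (cons_rV ((s * p.1 + a ord0 ord0)%R : measurableTypeR R, (s *: p.2 + a')%R)))) => //.
  apply: measurableT_comp => //; apply: measurableT_comp => //.
  apply: measurable_fun_pair; last by apply: measurable_rVD => //; exact: measurable_rVZ.
  by apply: measurable_funD => //; exact: measurable_funM.
- by move=> x _; apply: integral_ge0.
Qed.

End integral_rV.

Section Rintegral_extra.
Context d (T : measurableType d) {R : realType} (mu : {measure set T -> \bar R}).
Variable D : set T.
Hypothesis mD : measurable D.

Lemma integrable_le (f g : T -> R) : measurable_fun D f ->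
  (forall x, D x -> `|f x| <= g x) -> mu.-integrable D (EFin \o g) ->
  mu.-integrable D (EFin \o f).
Proof.
move=> mf fg; apply: le_integrable => //; first exact/measurable_EFinP.
by move=> x Dx; rewrite /= lee_fin (le_trans (fg _ Dx))// ler_norm.
Qed.

Lemma integrable_ge0P (f : T -> R) : measurable_fun D f ->
  (forall x, D x -> 0 <= f x) -> (\int[mu]_(x in D) (f x)%:E < +oo)%E ->
  mu.-integrable D (EFin \o f).
Proof.
move=> mf f0 fi; apply/integrableP; split; first exact/measurable_EFinP.
rewrite (eq_integral (fun x => (f x)%:E)) // => x /set_mem Dx /=.
by rewrite ger0_norm// f0.
Qed.

Lemma EFin_Rintegral (f : T -> R) : mu.-integrable D (EFin \o f) ->
  (\int[mu]_(x in D) f x)%:E = (\int[mu]_(x in D) (f x)%:E)%E.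
Proof. by move=> fi; rewrite fineK//; exact: integrable_fin_num. Qed.

Lemma integrableRD (f g : T -> R) : mu.-integrable D (EFin \o f) ->
  mu.-integrable D (EFin \o g) -> mu.-integrable D (EFin \o (fun x => f x + g x)).
Proof. exact: integrableD. Qed.

Lemma integrableRB (f g : T -> R) : mu.-integrable D (EFin \o f) ->
  mu.-integrable D (EFin \o g) -> mu.-integrable D (EFin \o (fun x => f x - g x)).
Proof. exact: integrableB. Qed.

Lemma integrableRZ (k : R) (f : T -> R) : mu.-integrable D (EFin \o f) ->
  mu.-integrable D (EFin \o (fun x => k * f x)).
Proof. exact: integrableZl. Qed.

Lemma integrableR_sum I (r : seq I) (P : pred I) (f : I -> T -> R) :
  (forall i, P i -> mu.-integrable D (EFin \o f i)) ->
  mu.-integrable D (EFin \o (fun x => \sum_(i <- r | P i) f i x)).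
Proof.
move=> fi; rewrite (_ : _ \o _ = (fun x => \sum_(i <- r | P i) (EFin \o f i) x)%E).
  exact: integrable_sum.
by apply/funext => x /=; rewrite sumEFin.
Qed.

Lemma Rintegral_sum I (r : seq I) (f : I -> T -> R) :
  (forall i, mu.-integrable D (EFin \o f i)) ->
  \int[mu]_(x in D) (\sum_(i <- r) f i x) = \sum_(i <- r) \int[mu]_(x in D) f i x.
Proof.
move=> fi; elim: r => [|i r IH].
  under eq_Rintegral do rewrite big_nil.
  by rewrite big_nil Rintegral_cst// mul0r.
under eq_Rintegral do rewrite big_cons.
rewrite big_cons RintegralD//; last exact: integrableR_sum.
by rewrite IH.
Qed.

Lemma integrable_abs (f : T -> R) : mu.-integrable D (EFin \o f) ->
  mu.-integrable D (EFin \o (fun x => `|f x|)).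
Proof. exact: integrable_norm. Qed.

Lemma ler_norm_Rintegral (f g : T -> R) : measurable_fun D f ->
  (forall x, D x -> `|f x| <= g x) -> mu.-integrable D (EFin \o g) ->
  `|\int[mu]_(x in D) f x| <= \int[mu]_(x in D) g x.
Proof.
move=> mf fg gi; have fi := integrable_le mf fg gi.
apply: le_trans (le_normr_Rintegral mD fi) _.
by apply: le_Rintegral => //; exact: integrable_abs.
Qed.

Lemma Rintegral_dct (f_ : nat -> T -> R) (f g : T -> R) :
  (forall n, measurable_fun D (f_ n)) ->
  (forall x, D x -> f_ n x @[n --> \oo] --> f x) ->
  mu.-integrable D (EFin \o g) ->
  (forall n x, D x -> `|f_ n x| <= g x) ->
  [/\ mu.-integrable D (EFin \o f),
   (\int[mu]_(x in D) f_ n x) @[n --> \oo] --> \int[mu]_(x in D) f x &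
   (\int[mu]_(x in D) `|f_ n x - f x|) @[n --> \oo] --> (0 : R)].
Proof.
move=> mf_ ff gi fg.
have mf : measurable_fun D f by exact: measurable_fun_cvg ff.
have [] := @dominated_convergence _ _ _ mu D mD (fun n x => (f_ n x)%:E)
  (EFin \o f) (EFin \o g).
- by move=> n; exact/measurable_EFinP.
- exact/measurable_EFinP.
- by apply: aeW => x Dx; apply: cvg_EFin; [exact: nearW|exact: ff].
- exact: gi.
- by apply: aeW => x n Dx; rewrite lee_fin fg.
move=> fi c1 c2; split => //.
- apply: fine_cvg => /=; rewrite EFin_Rintegral//.
- exact: (@fine_cvg _ _ _ _ (fun n => \int[mu]_(x in D) `|(f_ n x)%:E - (EFin \o f) x|)%E 0 c1).
Qed.

End Rintegral_extra.

Section caratheodory.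
Context d (T : measurableType d) {R : realType}.
Variables (a b : R) (f : R -> T -> R).
Hypothesis mf : forall s, a < s < b -> measurable_fun setT (f s).
Hypothesis cf : forall s y, a < s < b -> {for s, continuous (f ^~ y)}.

(** Joint measurability from separate conditions: sampling [s] on finer and finer grids gives
    functions that are measurable slab by slab, and continuity in [s] makes them converge
    pointwise. *)
Lemma measurable_caratheodory :
  measurable_fun (`]a, b[ `*` [set: T]) (fun p : R * T => f p.1 p.2).
Proof.
have [ba|ab] := leP b a.
  by rewrite set_itv_ge ?bnd_simp -?leNgt// set0X; exact: measurable_fun_set0.
have ba0 : 0 < b - a by rewrite subr_gt0.
have mD : measurable (`]a, b[ `*` [set: T] : set (R * T)) by exact: measurableX.
pose t n s := n.+1%:R * (s - a) / (b - a).
(* Midpoint of the [k]-th of [n.+1] cells: unlike an endpoint of a cell, it always lies in the open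
   interval where [mf] applies. *)
pose v n k : R := a + (k%:R + 2^-1) * (b - a) / n.+1%:R.
pose I n k : set R := [set s | k%:R <= t n s < k.+1%:R].
have vab n k : (k < n.+1)%N -> a < v n k < b.
  move=> kn; rewrite /v ltrDl; apply/andP; split; first by rewrite divr_gt0// mulr_gt0// ltr_wpDl.
  rewrite -ltrBrDl ltr_pdivrMr// (mulrC (b - a)) ltr_pM2r//.
  have : k%:R + 1 <= n.+1%:R :> R by rewrite natr1 ler_nat.
  by move: (n.+1%:R) => N; lra.
pose g n (p : R * T) := f (v n (Num.truncn (t n p.1))) p.2.
have tk n s : a < s < b -> 0 <= t n s < n.+1%:R.
  move=> /andP[as1 sb]; rewrite /t divr_ge0 ?mulr_ge0 ?subr_ge0 ?ltW//=.
  by rewrite ltr_pdivrMr// ltr_pM2l// ltrD2r.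
have mg n : measurable_fun (`]a, b[ `*` [set: T]) (g n).
  move=> _ Y mY.
  rewrite (_ : _ `&` _ = \bigcup_(k < n.+1) ((`]a, b[ `&` I n k) `*` (f (v n k) @^-1` Y))).
    apply: bigcup_measurable => k /= kn; apply: measurableX.
      apply: measurableI => //.
      rewrite (_ : I n k = t n @^-1` `[k%:R, k.+1%:R[).
        rewrite -[X in measurable X]setTI.
        have : measurable_fun setT (t n).
          apply: measurable_funM => //; apply: measurable_funM => //.
          by apply: measurable_funB.
        by apply.
      by apply/seteqP; split=> s /=; rewrite in_itv.
    by rewrite -[X in measurable X]setTI; apply: mf => //; exact: vab.
  apply/seteqP; split=> [[s y] [[/= sab _] gY]|[s y] [k kn [/= [sab Isk] fY]]].
    rewrite in_itv/= in sab; have /andP[t0 tn] := tk n s sab.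
    exists (Num.truncn (t n s)) => /=.
      by rewrite -(ltr_nat R) (le_lt_trans _ tn)// truncn_le.
    split; last exact: gY.
    split; first by rewrite /= in_itv.
    by rewrite /= /I/= truncn_le t0 truncnS_gt.
  split; first by split.
  rewrite /= /g/=.
  suff -> : Num.truncn (t n s) = k by [].
  exact/truncn_def.
apply: (measurable_fun_cvg mg) => -[s y] [/= sab _].
rewrite in_itv/= in sab.
apply: (@cvg_comp _ _ _ (fun n => v n (Num.truncn (t n s))) (f ^~ y) _ (nbhs s)); last exact: cf.
apply/cvgrPdist_le => /= e e0.
near=> n.
have /andP[t0 tn] := tk n s sab.
have /andP[h1 h2] := truncn_itv t0.
rewrite /v; set k := Num.truncn _ in h1 h2 *.
have nS : 0 < n.+1%:R :> R by [].
have {}h1 : k%:R * (b - a) / n.+1%:R <= s - a.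
  by rewrite ler_pdivrMr// (mulrC (s - a)) -ler_pdivlMr.
have {}h2 : s - a < (k%:R + 1) * (b - a) / n.+1%:R.
  by rewrite natr1 ltr_pdivlMr// (mulrC (s - a)) -ltr_pdivrMr.
have ne : (b - a) / n.+1%:R <= e.
  rewrite ler_pdivrMr// mulrC -ler_pdivrMr//.
  near: n; apply: filterS (nbhs_infty_ger ((b - a) / e)) => m /= hm.
  by rewrite (le_trans hm)// ler_nat.
have -> : s - (a + (k%:R + 2^-1) * (b - a) / n.+1%:R) =
  (s - a) - k%:R * (b - a) / n.+1%:R - (b - a) / n.+1%:R / 2 by field; rewrite ?pnatr_eq0.
have ez : (k%:R + 1) * (b - a) / n.+1%:R = k%:R * (b - a) / n.+1%:R + (b - a) / n.+1%:R by ring.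
rewrite ez in h2.
set X := k%:R * (b - a) / n.+1%:R in h1 h2 *; set Y := (b - a) / n.+1%:R in h2 ne *.
rewrite ler_norml; apply/andP; split; lra.
Unshelve. all: end_near. Qed.

End caratheodory.

Section integral_transport.
Context d (T : measurableType d) {R : realType} (mu : {measure set T -> \bar R}).
Variables (phi : T -> T) (c : R).
Hypotheses (c0 : 0 < c) (mphi : measurable_fun setT phi).
Hypothesis ge0E : forall f : T -> \bar R, measurable_fun setT f ->
  (forall x, 0 <= f x)%E -> (\int[mu]_x f x = c%:E * \int[mu]_x f (phi x))%E.

Lemma integrable_transport (f : T -> R) : mu.-integrable setT (EFin \o f) ->
  mu.-integrable setT (EFin \o (f \o phi)).
Proof.
move=> /integrableP[/measurable_EFinP mf fi]; apply/integrableP; split.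
  by apply/measurable_EFinP; exact: (measurableT_comp mf).
rewrite ge0E in fi => //; last by apply/measurable_EFinP; exact: measurableT_comp.
rewrite (_ : (\int[_]_x _)%E = (c^-1)%:E * (c%:E *
  \int[mu]_x `|(EFin \o f) (phi x)|))%E; last first.
  by rewrite muleA -EFinM mulVf ?gt_eqF// mul1e.
by rewrite lte_mul_pinfty// lee_fin invr_ge0 ltW.
Qed.

Lemma Rintegral_transport (f : T -> R) : mu.-integrable setT (EFin \o f) ->
  \int[mu]_x f x = c * \int[mu]_x f (phi x).
Proof.
move=> fi; have /integrableP[mf _] := fi.
have fai := integrable_transport fi.
rewrite /Rintegral -[c in RHS]/(fine c%:E) -fineM//; last exact: integrable_fin_num.
congr fine; rewrite integralE [in RHS]integralE muleBr//; last first.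
  by apply: fin_num_adde_defr; exact: integrable_pos_fin_num.
rewrite ge0E => //; last exact/measurable_funepos.
rewrite [X in (_ - X)%E = _]ge0E => //; last exact/measurable_funeneg.
by f_equal; [|f_equal]; f_equal; apply: eq_integral => x _;
  rewrite !(funeposE, funenegE).
Qed.

End integral_transport.

Section integral_rV_affine.
Context {R : realType} {n : nat}.
Variables (s : R) (a : 'rV[R]_n).
Hypothesis s0 : s != 0.
Local Notation L := (@lebesgue_rV R n).

Lemma measurable_rV_affine : measurable_fun setT (fun x : 'rV[R]_n => s *: x + a).
Proof. by apply: measurable_rVD => //; exact: measurable_rVZ. Qed.

Let sn0 : 0 < `|s| ^+ n. Proof. by rewrite exprn_gt0// normr_gt0. Qed.

Lemma integrable_rV_affine (f : 'rV[R]_n -> R) : L.-integrable setT (EFin \o f) ->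
  L.-integrable setT (EFin \o (fun x => f (s *: x + a))).
Proof.
apply: (integrable_transport sn0 measurable_rV_affine) => g mg g0.
exact: ge0_integral_rV_affine.
Qed.

Lemma Rintegral_rV_affine (f : 'rV[R]_n -> R) : L.-integrable setT (EFin \o f) ->
  \int[L]_x f x = `|s| ^+ n * \int[L]_x f (s *: x + a).
Proof.
apply: (Rintegral_transport sn0 measurable_rV_affine) => g mg g0.
exact: ge0_integral_rV_affine.
Qed.

End integral_rV_affine.

Section integral_affine1.
Context {R : realType}.
Variables (s a : R).
Hypothesis s0 : s != 0.
Local Notation mu := (@lebesgue_measure R).

Let sn0 : 0 < `|s|. Proof. by rewrite normr_gt0. Qed.

Let maff : measurable_fun setT (fun x : measurableTypeR R => s * x + a : measurableTypeR R).
Proof. by apply: measurable_funD => //; exact: measurable_funM. Qed.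

Lemma integrable_affine1 (f : R -> R) : mu.-integrable setT (EFin \o f) ->
  mu.-integrable setT (EFin \o (fun x => f (s * x + a))).
Proof.
apply: (integrable_transport sn0 maff) => g mg g0.
exact: ge0_integral_affine1.
Qed.

Lemma Rintegral_affine1 (f : R -> R) : mu.-integrable setT (EFin \o f) ->
  \int[mu]_x f x = `|s| * \int[mu]_x f (s * x + a).
Proof.
apply: (Rintegral_transport sn0 maff) => g mg g0.
exact: ge0_integral_affine1.
Qed.

End integral_affine1.

Section integral_rV_translation.
Context {R : realType} {n : nat}.
Variable a : 'rV[R]_n.
Local Notation L := (@lebesgue_rV R n).

Lemma ge0_integral_rV_translate (f : 'rV[R]_n -> \bar R) :
  measurable_fun setT f -> (forall x, 0 <= f x)%E ->
  (\int[L]_x f (x + a)%R = \int[L]_x f x)%E.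
Proof.
move=> mf f0; rewrite [RHS](ge0_integral_rV_affine a (oner_neq0 R))//.
by rewrite normr1 expr1n mul1e; under [RHS]eq_integral do rewrite scale1r.
Qed.

Lemma integrable_rV_translate (f : 'rV[R]_n -> R) :
  L.-integrable setT (EFin \o f) -> L.-integrable setT (EFin \o (fun x => f (x + a))).
Proof.
move=> /(integrable_rV_affine a (oner_neq0 R)); apply: eq_integrable => // x _ /=.
by rewrite scale1r.
Qed.

Lemma integrable_rV_reflect (f : 'rV[R]_n -> R) :
  L.-integrable setT (EFin \o f) -> L.-integrable setT (EFin \o (fun x => f (a - x))).
Proof.
have m1 : (-1 : R) != 0 by rewrite oppr_eq0 oner_neq0.
move=> /(integrable_rV_affine a m1); apply: eq_integrable => // x _ /=.
by rewrite scaleN1r addrC.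
Qed.

Lemma Rintegral_rV_translate (f : 'rV[R]_n -> R) :
  L.-integrable setT (EFin \o f) -> \int[L]_x f (x + a) = \int[L]_x f x.
Proof.
move=> fi; rewrite [RHS](Rintegral_rV_affine a (oner_neq0 R))//.
by rewrite normr1 expr1n mul1r; under [RHS]eq_Rintegral do rewrite scale1r.
Qed.

Lemma Rintegral_rV_reflect (f : 'rV[R]_n -> R) :
  L.-integrable setT (EFin \o f) -> \int[L]_x f (a - x) = \int[L]_x f x.
Proof.
have m1 : (-1 : R) != 0 by rewrite oppr_eq0 oner_neq0.
move=> fi; rewrite [RHS](Rintegral_rV_affine a m1)// normrN normr1 expr1n mul1r.
by under [RHS]eq_Rintegral do rewrite scaleN1r addrC.
Qed.

End integral_rV_translation.


Lemma measurable_cos {R : realType} : measurable_fun setT (@cos R).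
Proof. by apply: continuous_measurable_fun => x; exact: continuous_cos. Qed.

Lemma measurable_sin {R : realType} : measurable_fun setT (@sin R).
Proof. by apply: continuous_measurable_fun => x; exact: continuous_sin. Qed.

(** * Gaussian Fourier transforms *)

Definition gauss1 {R : realType} (s x : R) : R := expR (- (s * x ^+ 2)).

Section gauss1.
Context {R : realType}.
Variable s : R.
Hypothesis s0 : 0 < s.
Local Notation mu := (@lebesgue_measure R).
Local Notation e := (@gauss1 R).

Lemma measurable_gauss1 r : measurable_fun setT (e r).
Proof.
apply: measurableT_comp => //; apply: measurableT_comp => //.
by apply: measurable_funM => //; exact: measurable_funX.
Qed.

Lemma integral_gauss1 r : 0 < r ->
  (\int[mu]_x (e r x)%:E = (Num.sqrt (pi / r))%:E)%E.
Proof.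
move=> r0; have sr0 : 0 < Num.sqrt r by rewrite sqrtr_gt0.
have := @ge0_integral_affine1 R (Num.sqrt r) 0 (lt0r_neq0 sr0)
  (fun x => (gauss_fun x)%:E).
rewrite integralT_gauss => /(_ _ _) H.
have {H} : ((Num.sqrt pi)%:E = `|Num.sqrt r|%:E * \int[mu]_x (e r x)%:E)%E.
  rewrite H.
  - congr (_ * _)%E; apply: eq_integral => x _; congr EFin.
    by rewrite /gauss_fun addr0 exprMn sqr_sqrtr// ltW.
  - by apply/measurable_EFinP; exact: measurable_gauss_fun.
  - by move=> x; rewrite lee_fin gauss_fun_ge0.
rewrite ger0_norm ?ltW// => H.
rewrite sqrtrM ?pi_ge0// sqrtrV ?ltW// EFinM H muleAC -EFinM divff ?mul1e//.
by rewrite gt_eqF.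
Qed.

Lemma integrable_gauss1 r : 0 < r -> mu.-integrable setT (EFin \o e r).
Proof.
move=> r0; apply: integrable_ge0P => //.
- exact: measurable_gauss1.
- by move=> x _; exact: expR_ge0.
- by rewrite integral_gauss1// ltry.
Qed.

(** Half of the exponent pays for the linear factor; the left-hand side is the majorant for
    differentiating under the integral below. *)
Lemma gauss1_lin_le x : (1 + `|x|) * e s x <= (2 + 2 / s) * e (s / 2) x.
Proof.
have h1 : 1 + `|x| <= 2 + x ^+ 2.
  by rewrite -(real_normK (num_real x)); have := sqr_ge0 (`|x| - 1); nra.
have h2 : 2 + x ^+ 2 <= (2 + 2 / s) * (1 + s / 2 * x ^+ 2).
  have -> : (2 + 2 / s) * (1 + s / 2 * x ^+ 2) = 2 + x ^+ 2 + (2 / s + s * x ^+ 2).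
    by field; rewrite gt_eqF.
  by rewrite lerDl addr_ge0//; [rewrite divr_ge0// ltW|rewrite mulr_ge0 ?sqr_ge0// ltW].
have h3 : 1 + s / 2 * x ^+ 2 <= expR (s / 2 * x ^+ 2) by exact: expR_ge1Dx.
have -> : e s x = e (s / 2) x * e (s / 2) x by rewrite /gauss1 -expRD; congr expR; field.
rewrite mulrA ler_wpM2r ?expR_ge0// -ler_pdivlMr ?expR_gt0// /gauss1 -expRN opprK.
apply: (le_trans h1); apply: (le_trans h2); rewrite ler_wpM2l// addr_ge0//.
by rewrite mulr_ge0// invr_ge0 ltW.
Qed.

Lemma integrable_gauss1_lin :
  mu.-integrable setT (EFin \o (fun x => (1 + `|x|) * e s x)).
Proof.
apply: (@integrable_le _ _ _ mu setT measurableT _ (fun x => (2 + 2 / s) * e (s / 2) x)) => //.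
- apply: measurable_funM; last exact: measurable_gauss1.
  by apply: measurable_funD => //; exact: measurableT_comp.
- move=> x _; rewrite ger0_norm ?gauss1_lin_le//.
  by rewrite mulr_ge0 ?expR_ge0// addr_ge0.
- by apply: integrableRZ => //; apply: integrable_gauss1; rewrite divr_gt0.
Qed.

Lemma is_derive_mulrl (k x : R) : is_derive x 1 (fun y => k * y) k.
Proof.
have -> : (fun y : R => k * y) = k *: (@id R) by apply/funext.
by apply: is_derive_eq; rewrite /GRing.scale /= mulr1.
Qed.

Lemma is_derive_cosM (k x : R) :
  is_derive x 1 (fun y => cos (k * y)) (- sin (k * x) * k).
Proof.
exact: (@is_derive1_comp _ cos (fun y => k * y) x _ _ (is_derive_cos _) (is_derive_mulrl k x)).
Qed.

Lemma is_derive_sinM (k x : R) :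
  is_derive x 1 (fun y => sin (k * y)) (cos (k * x) * k).
Proof.
exact: (@is_derive1_comp _ sin (fun y => k * y) x _ _ (is_derive_sin _) (is_derive_mulrl k x)).
Qed.

Lemma is_derive_gauss1 (r x : R) :
  is_derive x 1 (fun y => expR (r * y ^+ 2)) (expR (r * x ^+ 2) * (r * (2 * x))).
Proof.
have h : is_derive x 1 (fun y : R => r * y ^+ 2) (r * (2 * x)).
  have -> : (fun y : R => r * y ^+ 2) = r *: ((@id R) ^+ 2) by apply/funext.
  by apply: is_derive_eq; rewrite /GRing.scale /= expr1 mulr1 -mulr_natl.
exact: (@is_derive1_comp _ expR (fun y => r * y ^+ 2) x _ _ (is_derive_expR _) h).
Qed.

Lemma continuous_gauss1 r : continuous (e r).
Proof.
have -> : e r = (fun y => expR (- r * y ^+ 2)).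
  by apply/funext => y; rewrite /gauss1 mulNr.
move=> y; apply: differentiable_continuous; apply/derivable1_diffP.
by have [] := is_derive_gauss1 (- r) y.
Qed.

Let F x := \int[mu]_y (cos (x * y) * e s y).

Let measurable_cosM (k : R) : measurable_fun setT (fun y : R => cos (k * y)).
Proof.
by apply: measurableT_comp; [exact: measurable_cos|exact: measurable_funM].
Qed.

Let measurable_sinM (k : R) : measurable_fun setT (fun y : R => sin (k * y)).
Proof.
by apply: measurableT_comp; [exact: measurable_sin|exact: measurable_funM].
Qed.

Let int_cos k : mu.-integrable setT (EFin \o (fun y => cos (k * y) * e s y)).
Proof.
apply: (@integrable_le _ _ _ mu setT measurableT _ (e s)) => //.
- by apply: measurable_funM; [exact: measurable_cosM|exact: measurable_gauss1].
- move=> x _; rewrite normrM (ger0_norm (expR_ge0 _)) ler_piMl ?expR_ge0//.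
  by rewrite ler_norml cos_geN1 cos_le1.
- exact: integrable_gauss1.
Qed.

Let int_sin k : mu.-integrable setT (EFin \o (fun y => y * (sin (k * y) * e s y))).
Proof.
apply: (@integrable_le _ _ _ mu setT measurableT _ (fun x => (1 + `|x|) * e s x)) => //.
- apply: measurable_funM => //.
  by apply: measurable_funM; [exact: measurable_sinM|exact: measurable_gauss1].
- move=> x _; rewrite normrM ler_pM//; first by rewrite lerDr.
  rewrite normrM (ger0_norm (expR_ge0 _)) ler_piMl ?expR_ge0//.
  by rewrite ler_norml sin_geN1 sin_le1.
- exact: integrable_gauss1_lin.
Qed.

Let dF (x : R) : is_derive x 1 F (- \int[mu]_y (y * (sin (x * y) * e s y))).
Proof.
have d1 (k y : R) : is_derive k 1 (fun k => cos (k * y) * e s y) (- y * (sin (k * y) * e s y)).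
  have -> : (fun k => cos (k * y) * e s y) = e s y *: (fun k => cos (y * k) : R).
    by apply/funext => z; rewrite mulrC [z * y]mulrC.
  have := is_derive_cosM y k => ?.
  by apply: is_derive_eq; rewrite /GRing.scale /= [y * k]mulrC; ring.
have par k y : partial1of2 (fun k y => cos (k * y) * e s y) k y = - y * (sin (k * y) * e s y).
  by rewrite partial1of2E; exact: derive_val.
have Ix : `](x - 1), (x + 1)[%classic x by rewrite /= in_itv/=; apply/andP; split; lra.
have key := @derivable_under_integral R _ _ mu (fun k y => cos (k * y) * e s y) setT
  measurableT x (x - 1) (x + 1) Ix _ _ (fun x => (1 + `|x|) * e s x) _ integrable_gauss1_lin.
have key2 := @differentiation_under_integral R _ _ mu (fun k y => cos (k * y) * e s y) setT
  measurableT x (x - 1) (x + 1) Ix _ _ (fun x => (1 + `|x|) * e s x) _ integrable_gauss1_lin.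
have D1 : forall k y : R, `](x - 1), (x + 1)[%classic k -> [set: R] y ->
   derivable ((fun k : R => cos (k * y) * e s y) : R -> R) k 1 by move=> k y _ _; have := d1 k y.
have G0 : forall y : R, 0 <= (1 + `|y|) * e s y.
  by move=> y; rewrite mulr_ge0 ?expR_ge0// addr_ge0.
have Gub : forall k y : R, `](x - 1), (x + 1)[%classic k -> [set: R] y ->
   `|partial1of2 (fun k y => cos (k * y) * e s y) k y| <= (1 + `|y|) * e s y.
  move=> k y _ _; rewrite par normrM normrN ler_pM//; first by rewrite lerDr.
  rewrite normrM (ger0_norm (expR_ge0 _)) ler_piMl ?expR_ge0//.
  by rewrite ler_norml sin_geN1 sin_le1.
apply: DeriveDef; first exact: key.
rewrite -derive1E [LHS]key2//.
transitivity (\int[mu]_y (-1 * (y * (sin (x * y) * e s y)))).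
  by apply: eq_Rintegral => y _; rewrite par; ring.
by rewrite RintegralZl// mulN1r.
Qed.

(** Integration by parts: the integrand is the derivative of [sin (x * y) * e s y]. Its integrals
    over [-n, n] are boundary terms of size at most [2 * e s n%:R], and they tend to the whole
    integral. *)
Let ibp (x : R) : \int[mu]_y (x * (cos (x * y) * e s y) - 2 * s * (y * (sin (x * y) * e s y))) = 0.
Proof.
pose h y := sin (x * y) * e s y.
pose k y := x * (cos (x * y) * e s y) - 2 * s * (y * (sin (x * y) * e s y)).
have dh (y : R) : is_derive y 1 h (k y).
  have d1 := is_derive_sinM x y.
  have d2 := is_derive_gauss1 (- s) y.
  have -> : h = (fun y => sin (x * y)) * (fun y => expR (- s * y ^+ 2)).
    by apply/funext => z; rewrite /h /gauss1 -mulNr.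
  apply: is_derive_eq; rewrite /k /GRing.scale /= mulNr.
  by rewrite /gauss1; ring.
have ki : mu.-integrable setT (EFin \o k).
  exact: (integrableRB measurableT (integrableRZ measurableT x (int_cos x))
    (integrableRZ measurableT (2 * s) (int_sin x))).
have mk : measurable_fun setT k by case/integrableP: ki => /measurable_EFinP.
have ck : continuous k.
  have cid : continuous (fun y : R => y) by move=> ?.
  have cs c : continuous (fun y : R => c * y) by move=> ?; apply: cvgM => //; exact: cvg_cst.
  move=> y; apply: cvgB; apply: cvgM; try exact: cvg_cst.
    apply: cvgM; first by apply: continuous_comp; [exact: cs|exact: continuous_cos].
    exact: continuous_gauss1.
  apply: cvgM => //; apply: cvgM; first by apply: continuous_comp; [exact: cs|exact: continuous_sin].
  exact: continuous_gauss1.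
have [||||_ H2 _] := @Rintegral_dct _ _ _ mu setT measurableT
  (fun n => k \_ `[(- n%:R), n%:R]) k (fun x => `|k x|).
- by move=> n; apply/(measurable_restrictT _ _).1 => //; exact: measurable_funTS.
- move=> y _; apply: cvg_near_cst; apply: filterS (nbhs_infty_ger `|y|) => n ny.
  by rewrite patchE mem_set//= in_itv/= -ler_norml.
- exact: integrable_abs.
- by move=> n y _; rewrite patchE; case: ifP => //; rewrite normr0.
have H3 : (fun n : nat => \int[mu]_x (k \_ `[(- n%:R), n%:R]) x) @ \oo --> (0 : R).
  apply/cvgrPdist_le => eps eps0; near=> n.
  have n0 : 0 < n%:R :> R by near: n; exact: nbhs_infty_gtr.
  have nn : - n%:R < n%:R :> R by lra.
  rewrite sub0r normrN -Rintegral_mkcond /Rintegral.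
  rewrite (@continuous_FTC2 _ k h)//.
  - rewrite -EFinB /= /h.
    have -> : e s (- n%:R) = e s n%:R by rewrite /gauss1 sqrrN.
    rewrite -mulrBl normrM (ger0_norm (expR_ge0 _)).
    have hs : `|sin (x * n%:R) - sin (x * - n%:R)| <= 2.
      rewrite (le_trans (ler_normB _ _))// (_ : 2 = 1 + 1 :> R)// lerD//.
        by rewrite ler_norml sin_geN1 sin_le1.
      by rewrite ler_norml sin_geN1 sin_le1.
    rewrite (@le_trans _ _ (2 * e s n%:R)) ?ler_wpM2r ?expR_ge0//.
    rewrite /gauss1 expRN -ler_pdivlMl// invf_ple ?posrE ?expR_gt0 ?mulr_gt0//.
    rewrite (le_trans _ (expR_ge1Dx _))//.
    have n1 : 1 <= n%:R :> R by near: n; exact: nbhs_infty_ger.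
    rewrite (@le_trans _ _ (s * n%:R))//.
      rewrite -ler_pdivrMl//; near: n; exact: nbhs_infty_ger.
    rewrite (@le_trans _ _ (s * n%:R ^+ 2)) ?lerDr//.
    by rewrite ler_pM2l// expr2 ler_peMl// ltW.
  - exact: continuous_subspaceT.
  - split.
    + by move=> y _; have [] := dh y.
    + apply: cvg_at_right_filter; apply: differentiable_continuous.
      by apply/derivable1_diffP; have [] := dh (- n%:R).
    + apply: cvg_at_left_filter; apply: differentiable_continuous.
      by apply/derivable1_diffP; have [] := dh (n%:R).
  - by move=> y _; rewrite derive1E; have := dh y => ?; exact: derive_val.
exact: (cvg_unique _ H2 H3).
Unshelve. all: end_near. Qed.

(** By [dF] and [ibp], F' = - x / (2 s) F; hence [F] times exp(x^2 / (4 s)) is constant, and its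
    value at 0 is the Gaussian integral. *)
Lemma Rintegral_cos_gauss1 x : \int[mu]_y (cos (x * y) * e s y) =
  Num.sqrt (pi / s) * expR (- (x ^+ 2 / (4 * s))).
Proof.
have sn0 : s != 0 by rewrite gt_eqF.
have E (y : R) : \int[mu]_z (z * (sin (y * z) * e s z)) = y / (2 * s) * F y.
  have := ibp y; rewrite RintegralB//; last 2 first.
    exact: (integrableRZ _ _ (int_cos y)).
    exact: (integrableRZ _ _ (int_sin y)).
  rewrite (RintegralZl _ measurableT (int_cos y)) (RintegralZl _ measurableT (int_sin y)) -/(F y) => /eqP.
  rewrite subr_eq0 => /eqP H.
  by rewrite mulrAC H mulrC mulKf// mulf_neq0.
have D (y : R) : is_derive y 1 (fun y => F y * expR ((4 * s)^-1 * y ^+ 2)) 0.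
  have d1 := dF y; have d2 := is_derive_gauss1 (4 * s)^-1 y.
  have -> : (fun y => F y * expR ((4 * s)^-1 * y ^+ 2)) =
    F * (fun y => expR ((4 * s)^-1 * y ^+ 2)) by apply/funext.
  by apply: is_derive_eq; rewrite E /GRing.scale /=; field.
have := is_derive_0_is_cst x 0 D.
rewrite expr0n/= mulr0 expR0 mulr1 => H.
have -> : \int[mu]_y (cos (x * y) * e s y) = F 0 * expR (- (x ^+ 2 / (4 * s))).
  by rewrite -H -mulrA -expRD [_^-1 * _]mulrC subrr expR0 mulr1.
congr (_ * _); rewrite /F /Rintegral.
under eq_integral do rewrite mul0r cos0 mul1r.
by rewrite integral_gauss1.
Qed.

Lemma Rintegral_sin_gauss1 x : \int[mu]_y (sin (x * y) * e s y) = 0.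
Proof.
have si : mu.-integrable setT (EFin \o (fun y => sin (x * y) * e s y)).
  apply: (@integrable_le _ _ _ mu setT measurableT _ (e s)) => //.
  - by apply: measurable_funM; [exact: measurable_sinM|exact: measurable_gauss1].
  - move=> y _; rewrite normrM (ger0_norm (expR_ge0 _)) ler_piMl ?expR_ge0//.
    by rewrite ler_norml sin_geN1 sin_le1.
  - exact: integrable_gauss1.
have m10 : (-1 : R) != 0 by rewrite oppr_eq0 oner_neq0.
have := Rintegral_affine1 0 m10 si; rewrite normrN normr1 mul1r.
rewrite (_ : (\int[mu]_x0 (sin (x * (-1 * x0 + 0)) * e s (-1 * x0 + 0))) =
  - (\int[mu]_y (sin (x * y) * e s y))); last first.
  rewrite -[RHS]mulN1r -RintegralZl//; apply: eq_Rintegral => y _.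
  by rewrite addr0 mulN1r /gauss1 sqrrN mulrN sinN mulNr mulN1r.
lra.
Qed.

(** A phase is allowed because the cosine of a sum does not factor over the coordinates: integrating
    out some coordinates leaves the others in the phase. The sine part drops out by parity. *)
Lemma integral_cosD_gauss1 th x :
  (\int[mu]_y (cos (th + x * y) * e s y)%:E =
   (cos th * (Num.sqrt (pi / s) * expR (- (x ^+ 2 / (4 * s)))))%:E)%E.
Proof.
have si : mu.-integrable setT (EFin \o (fun y => sin (x * y) * e s y)).
  apply: (@integrable_le _ _ _ mu setT measurableT _ (e s)) => //.
  - by apply: measurable_funM; [exact: measurable_sinM|exact: measurable_gauss1].
  - move=> y _; rewrite normrM (ger0_norm (expR_ge0 _)) ler_piMl ?expR_ge0//.
    by rewrite ler_norml sin_geN1 sin_le1.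
  - exact: integrable_gauss1.
transitivity (\int[mu]_y (cos th * (cos (x * y) * e s y) - sin th * (sin (x * y) * e s y))%:E)%E.
  by apply: eq_integral => y _; rewrite cosD; congr EFin; ring.
rewrite -EFin_Rintegral//; last first.
  exact: (integrableRB measurableT (integrableRZ measurableT (cos th) (int_cos x))
    (integrableRZ measurableT (sin th) si)).
congr EFin; rewrite RintegralB//; last 2 first.
  exact: (integrableRZ measurableT _ (int_cos x)).
  exact: (integrableRZ measurableT _ si).
by rewrite (RintegralZl _ measurableT (int_cos x)) (RintegralZl _ measurableT si) Rintegral_cos_gauss1 Rintegral_sin_gauss1 mulr0 subr0.
Qed.

End gauss1.


Section dotp.
Context {R : realType} {n : nat}.
Implicit Types x y z : 'rV[R]_n.

Lemma dotpC x y : dotp x y = dotp y x.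
Proof. by apply: eq_bigr => i _; rewrite mulrC. Qed.

Lemma dotpDl x y z : dotp (x + y) z = dotp x z + dotp y z.
Proof. by rewrite -big_split; apply: eq_bigr => i _; rewrite mxE mulrDl. Qed.

Lemma dotpZl k x y : dotp (k *: x) y = k * dotp x y.
Proof. by rewrite mulr_sumr; apply: eq_bigr => i _; rewrite mxE mulrA. Qed.

Lemma dotpDr x y z : dotp z (x + y) = dotp z x + dotp z y.
Proof. by rewrite dotpC dotpDl !(dotpC z). Qed.

Lemma dotpZr k x y : dotp x (k *: y) = k * dotp x y.
Proof. by rewrite dotpC dotpZl dotpC. Qed.

Lemma dotpNl x y : dotp (- x) y = - dotp x y.
Proof. by rewrite -scaleN1r dotpZl mulN1r. Qed.

Lemma dotpNr x y : dotp x (- y) = - dotp x y.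
Proof. by rewrite dotpC dotpNl dotpC. Qed.

Lemma dotpBl x y z : dotp (x - y) z = dotp x z - dotp y z.
Proof. by rewrite dotpDl dotpNl. Qed.

Lemma dotpBr x y z : dotp z (x - y) = dotp z x - dotp z y.
Proof. by rewrite dotpDr dotpNr. Qed.

Lemma dotp0l x : dotp 0 x = 0.
Proof. by rewrite -(scale0r 0) dotpZl mul0r. Qed.

Lemma dotp_ge0 x : 0 <= dotp x x.
Proof. by apply: sumr_ge0 => i _; rewrite -expr2 sqr_ge0. Qed.

Lemma dotp_eq0 x : (dotp x x == 0) = (x == 0).
Proof.
apply/eqP/eqP => [x0|->]; last by rewrite dotp0l.
apply/rowP => i; rewrite mxE.
have /eqP := x0; rewrite psumr_eq0; last by move=> j _; rewrite -expr2 sqr_ge0.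
by move=> /allP /(_ i); rewrite mem_index_enum => /(_ isT) /=; rewrite -expr2 sqrf_eq0 => /eqP.
Qed.

Lemma dotp_CS x y : dotp x y ^+ 2 <= dotp x x * dotp y y.
Proof.
have [->|y0] := eqVneq y 0; first by rewrite dotpC !dotp0l mulr0 expr0n.
have yy : 0 < dotp y y by rewrite lt_neqAle eq_sym dotp_eq0 y0 dotp_ge0.
have := dotp_ge0 (dotp y y *: x - dotp x y *: y).
rewrite dotpBl !dotpBr !dotpZl !dotpZr (dotpC y x) => h.
have : 0 <= dotp y y * (dotp x x * dotp y y - dotp x y ^+ 2) by apply: le_trans h _; lra.
by rewrite pmulr_rge0// subr_ge0.
Qed.

Lemma enorm_ge0 x : 0 <= enorm x. Proof. exact: sqrtr_ge0. Qed.

Lemma enorm_sqr x : enorm x ^+ 2 = dotp x x.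
Proof. by rewrite sqr_sqrtr// dotp_ge0. Qed.

Lemma dotp_enorm x y : `|dotp x y| <= enorm x * enorm y.
Proof.
rewrite -(@ler_pXn2r _ 2)// ?nnegrE ?mulr_ge0 ?enorm_ge0//.
by rewrite real_normK ?num_real// exprMn !enorm_sqr dotp_CS.
Qed.

Lemma enormD x y : enorm (x + y) <= enorm x + enorm y.
Proof.
rewrite -(@ler_pXn2r _ 2)// ?nnegrE ?addr_ge0 ?enorm_ge0//.
rewrite enorm_sqr sqrrD !enorm_sqr dotpDl !dotpDr (dotpC y x).
have := le_trans (ler_norm _) (dotp_enorm x y).
by set z := _ * _; lra.
Qed.

Lemma enormN x : enorm (- x) = enorm x.
Proof. by rewrite /enorm dotpNl dotpNr opprK. Qed.

Lemma enormZ k x : enorm (k *: x) = `|k| * enorm x.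
Proof. by rewrite /enorm dotpZl dotpZr mulrA -expr2 sqrtrM ?sqr_ge0// sqrtr_sqr. Qed.

Lemma coord_le_enorm x i : `|x ord0 i| <= enorm x.
Proof.
rewrite -(@ler_pXn2r _ 2)// ?nnegrE ?enorm_ge0// real_normK ?num_real// enorm_sqr.
rewrite /dotp (bigD1 i)//= -expr2 lerDl.
by apply: sumr_ge0 => j _; rewrite -expr2 sqr_ge0.
Qed.

Lemma measurable_nsq : measurable_fun setT (fun x : 'rV[R]_n => dotp x x).
Proof. exact: measurable_dotp. Qed.

Lemma measurable_enorm : measurable_fun setT (@enorm R n).
Proof.
apply: measurableT_comp; last exact: measurable_nsq.
by apply: continuous_measurable_fun; exact: sqrt_continuous.
Qed.

End dotp.

Lemma dotp_cons {R : realType} n (a b : R) (v w : 'rV[R]_n) :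
  dotp (cons_rV (a, v)) (cons_rV (b, w)) = a * b + dotp v w.
Proof.
rewrite /dotp big_ord_recl !cons_rV0; congr (_ + _).
by apply: eq_bigr => i _; rewrite !cons_rVS.
Qed.

Lemma uncons_rVK {R : realType} n (x : 'rV[R]_n.+1) :
  x = cons_rV (x ord0 ord0 : measurableTypeR R, \row_i x ord0 (lift ord0 i)).
Proof. by apply/rowP => i; rewrite mxE; case: unliftP => [j|] -> /=; rewrite ?mxE. Qed.

Section integral_rV0.
Context {R : realType}.
Local Open Scope ereal_scope.

Lemma integral_rVS n (f : 'rV[R]_n.+1 -> R) :
  (lebesgue_rV n.+1).-integrable setT (EFin \o f) ->
  \int[lebesgue_rV n.+1]_x (f x)%:E =
  \int[lebesgue_measure]_a \int[lebesgue_rV n]_v (f (cons_rV (a, v)))%:E.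
Proof.
move=> fi; have /integrableP[/measurable_EFinP mf fi2] := fi.
have mc := @measurable_cons_rV R n.
have fci : (lebesgue_measure \x lebesgue_rV n)%E.-integrable setT (EFin \o (f \o @cons_rV R n)).
  apply/integrable12ltyP.
    by apply/measurable_EFinP; exact: (measurableT_comp mf mc).
  move: fi2; rewrite ge0_integral_rVS//.
  by apply: measurableT_comp => //; exact/measurable_EFinP.
transitivity (\int[pushforward (lebesgue_measure \x lebesgue_rV n)%E (@cons_rV R n)]_x (EFin \o f) x) => //.
rewrite integral_pushforward//; last exact/measurable_EFinP.
by rewrite preimage_setT -integral12_prod_meas1.
Qed.

Lemma integral_rV0 (f : 'rV[R]_0 -> R) :
  \int[lebesgue_rV 0]_x (f x)%:E = (f 0%R)%:E.
Proof.
rewrite [LHS]integral_dirac//; last first.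
  rewrite (_ : (fun x => _) = cst (f 0%R)%:E)//.
  by apply/funext => x /=; congr (f _)%:E; apply/rowP; case.
by rewrite diracE mem_set// mul1e.
Qed.

Lemma measurable_rV_prod n (g : R -> R) : measurable_fun setT g ->
  measurable_fun setT (fun x : 'rV[R]_n => \prod_(i < n) g (x ord0 i))%R.
Proof.
move=> mg; apply: measurable_prod => i _.
by apply: (measurableT_comp mg); exact: measurable_rV_coord.
Qed.

Lemma integral_rV_prod n (g : R -> R) (c : R) : measurable_fun setT g ->
  (forall x, 0 <= g x)%R -> \int[lebesgue_measure]_x (g x)%:E = c%:E ->
  \int[lebesgue_rV n]_x (\prod_(i < n) g (x ord0 i))%:E = (c ^+ n)%:E.
Proof.
move=> mg g0 gc; elim: n => [|n IH].
  by rewrite (integral_rV0 (fun x => \prod_(i < 0) g (x ord0 i))%R) big_ord0 expr0.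
rewrite ge0_integral_rVS; last 2 first.
- by apply/measurable_EFinP; exact: measurable_rV_prod.
- by move=> x; rewrite lee_fin prodr_ge0.
transitivity (\int[lebesgue_measure]_a ((c ^+ n)%:E * (g a)%:E)).
  apply: eq_integral => a _; rewrite -IH -ge0_integralZr//.
  - apply: eq_integral => v _; rewrite big_ord_recl !cons_rV0 mulrC EFinM.
    by congr (_%:E * _); apply: eq_bigr => i _; rewrite cons_rVS.
  - by apply/measurable_EFinP; exact: measurable_rV_prod.
  - by move=> x _; rewrite lee_fin prodr_ge0.
  - by rewrite lee_fin.
rewrite ge0_integralZl//.
- by rewrite gc -EFinM exprSr.
- exact/measurable_EFinP.
- by move=> x _; rewrite lee_fin.
- by rewrite lee_fin exprn_ge0// -lee_fin -gc integral_ge0// => x _; rewrite lee_fin.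
Qed.

End integral_rV0.

Definition gaussd {R : realType} n (s : R) (x : 'rV[R]_n) : R :=
  expR (- (s * dotp x x)).

Section gaussd.
Context {R : realType}.
Variable s : R.
Hypothesis s0 : 0 < s.

Lemma gaussdE n (x : 'rV[R]_n) : gaussd s x = \prod_(i < n) gauss1 s (x ord0 i).
Proof. by rewrite /gaussd /dotp mulr_sumr -sumrN expR_sum. Qed.

Lemma gaussd_ge0 n (x : 'rV[R]_n) : 0 <= gaussd s x. Proof. exact: expR_ge0. Qed.

Lemma measurable_gaussd n : measurable_fun setT (@gaussd R n s).
Proof.
rewrite (_ : @gaussd R n s = fun x => \prod_(i < n) gauss1 s (x ord0 i)).
  by apply: measurable_rV_prod; exact: measurable_gauss1.
by apply/funext => x; exact: gaussdE.
Qed.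

Lemma integral_gaussd n :
  (\int[lebesgue_rV n]_x (gaussd s x)%:E = (Num.sqrt (pi / s) ^+ n)%:E)%E.
Proof.
under eq_integral do rewrite gaussdE.
apply: integral_rV_prod; first exact: measurable_gauss1.
  by move=> x; exact: expR_ge0.
exact: integral_gauss1.
Qed.

Lemma integrable_gaussd n : (lebesgue_rV n).-integrable setT (EFin \o @gaussd R n s).
Proof.
apply: integrable_ge0P => //; first exact: measurable_gaussd.
  by move=> x _; exact: gaussd_ge0.
by rewrite integral_gaussd ltry.
Qed.

Lemma integrable_cosD_gaussd n th (x : 'rV[R]_n) : (lebesgue_rV n).-integrable setT
  (EFin \o (fun y => cos (th + dotp x y) * gaussd s y)).
Proof.
apply: (@integrable_le _ _ _ (lebesgue_rV n) _ _ _ (@gaussd R n s)) => //.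
- apply: measurable_funM; last exact: measurable_gaussd.
  apply: measurableT_comp; first exact: measurable_cos.
  by apply: measurable_funD => //; exact: measurable_dotp.
- move=> y _; rewrite normrM (ger0_norm (gaussd_ge0 _)) ler_piMl ?gaussd_ge0//.
  by rewrite ler_norml cos_geN1 cos_le1.
- exact: integrable_gaussd.
Qed.

Lemma integral_cosD_gaussd n th (x : 'rV[R]_n) :
  (\int[lebesgue_rV n]_y (cos (th + dotp x y) * gaussd s y)%:E =
   (cos th * (Num.sqrt (pi / s) ^+ n * expR (- (dotp x x / (4 * s)))))%:E)%E.
Proof.
elim: n th x => [|n IH] th x.
  rewrite (integral_rV0 (fun y => cos (th + dotp x y) * gaussd s y)).
  rewrite /gaussd /dotp !big_ord0 mulr0 mul0r addr0 oppr0 expR0 expr0.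
  by congr EFin; ring.
rewrite integral_rVS; last exact: integrable_cosD_gaussd.
rewrite (uncons_rVK x); set a := x ord0 ord0; set v : 'rV[R]_n := \row_i _.
pose c := Num.sqrt (pi / s) ^+ n * expR (- (dotp v v / (4 * s))).
transitivity (\int[lebesgue_measure]_t (c * (cos (th + a * t) * gauss1 s t))%:E)%E.
  apply: eq_integral => t _.
  transitivity (\int[lebesgue_rV n]_w ((gauss1 s t)%:E * (cos ((th + a * t) + dotp v w) * gaussd s w)%:E))%E.
    apply: eq_integral => w _; rewrite dotp_cons addrA -EFinM; congr EFin.
    by rewrite /gaussd dotp_cons -expr2 mulrDr opprD expRD -/(gauss1 s t); ring.
  rewrite integralZl//; last exact: integrable_cosD_gaussd.
  by rewrite IH -EFinM; congr EFin; rewrite /c; ring.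
under eq_integral do rewrite EFinM.
rewrite integralZl//.
  rewrite integral_cosD_gauss1// -EFinM; congr EFin.
  have -> : dotp (cons_rV (a : measurableTypeR R, v)) (cons_rV (a : measurableTypeR R, v)) / (4 * s) =
    a ^+ 2 / (4 * s) + dotp v v / (4 * s) by rewrite dotp_cons expr2 mulrDl.
  rewrite /c opprD expRD (exprS _ n).
  by move: (Num.sqrt (pi / s) ^+ n) (Num.sqrt (pi / s)) (expR _) (expR _) (cos th) => *; ring.
apply: (@integrable_le _ _ _ (@lebesgue_measure R) _ _ _ (gauss1 s)) => //.
- apply: measurable_funM; last exact: measurable_gauss1.
  apply: measurableT_comp; first exact: measurable_cos.
  by apply: measurable_funD => //; exact: measurable_funM.
- move=> y _; rewrite normrM (ger0_norm (expR_ge0 _)) ler_piMl ?expR_ge0//.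
  by rewrite ler_norml cos_geN1 cos_le1.
- exact: integrable_gauss1.
Qed.

End gaussd.


Section Rintegral_domain.
Context d (T : measurableType d) {R : realType} (mu : {measure set T -> \bar R}).
Variable D : set T.
Hypothesis mD : measurable D.

Lemma integrable_patch (f : T -> R) : mu.-integrable D (EFin \o f) <->
  mu.-integrable setT (EFin \o (f \_ D)).
Proof. by rewrite -restrict_EFin; exact: integrable_mkcond. Qed.

Lemma Rintegral_le_dom (E : set T) (f : T -> R) : measurable E -> E `<=` D ->
  mu.-integrable D (EFin \o f) -> (forall x, D x -> 0 <= f x) ->
  \int[mu]_(x in E) f x <= \int[mu]_(x in D) f x.
Proof.
move=> mE ED fi f0; have fiE := integrableS mD mE ED fi.
rewrite -lee_fin !EFin_Rintegral//; apply: ge0_subset_integral => //.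
by case/integrableP: fi.
Qed.

End Rintegral_domain.

Lemma integrable_patch_itv {R : realType} (i : interval R) (f : R -> R) :
  (@lebesgue_measure R).-integrable [set` i] (EFin \o f) <->
  (@lebesgue_measure R).-integrable setT (EFin \o (f \_ [set` i])).
Proof.
have mi : measurable ([set` i] : set (measurableTypeR R)) by exact: measurable_itv.
exact: (integrable_patch (@lebesgue_measure R) mi f).
Qed.

Lemma mem_itv_oy {R : realType} (a x : R) : (x \in `]a, +oo[%classic) = (a < x).
Proof. by apply/idP/idP; rewrite inE/= in_itv/= andbT. Qed.

Lemma mem_itv_oo {R : realType} (a b x : R) : (x \in `]a, b[%classic) = (a < x < b).
Proof. by apply/idP/idP; rewrite inE/= in_itv/=. Qed.

Lemma powR_le_base {R : realType} (r x y : R) : 0 <= r -> 0 <= x -> x <= y ->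
  x `^ r <= y `^ r.
Proof.
move=> r0 x0 xy; apply: ge0_ler_powR => //; rewrite nnegrE//.
exact: le_trans xy.
Qed.

Lemma powR_ge_base {R : realType} (r x y : R) : r <= 0 -> 0 < x -> x <= y ->
  y `^ r <= x `^ r.
Proof.
move=> r0 x0 xy; rewrite -[r]opprK !(powRN _ (- r)) lef_pV2 ?posrE ?powR_gt0//; last exact: lt_le_trans xy.
by apply: powR_le_base; rewrite ?oppr_ge0// ltW.
Qed.

Lemma expRN1_lt1 {R : realType} : expR (-1) < 1 :> R.
Proof. by rewrite -[ltRHS]expR0 ltr_expR; lra. Qed.

Section ge0_bigcup.
Context d (T : measurableType d) {R : realType} (mu : {measure set T -> \bar R}).

Lemma ge0_integral_bigcup_le (F : (set T)^nat) (f : T -> R) (M : \bar R) :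
  nondecreasing_seq F -> (forall i, measurable (F i)) -> measurable_fun (\bigcup_i F i) f ->
  (forall x, (\bigcup_i F i) x -> 0 <= f x) ->
  (forall i, \int[mu]_(x in F i) (f x)%:E <= M)%E ->
  (\int[mu]_(x in \bigcup_i F i) (f x)%:E <= M)%E.
Proof.
move=> ndF mF mf f0 fM.
have h := @ge0_nondecreasing_set_cvg_integral _ _ _ F (EFin \o f) mu ndF mF _ _.
have {}h := h _ _.
have c : (\int[mu]_(x in F i) (f x)%:E @[i --> \oo] --> \int[mu]_(x in \bigcup_i F i) (f x)%:E)%E.
  apply: h => [i|i x Fx].
    apply/measurable_EFinP; apply: measurable_funS mf => //.
      by apply: bigcup_measurable => // k _; exact: mF.
    by move=> x Fx; exists i.
  by rewrite lee_fin f0//; exists i.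
rewrite -(cvg_lim _ c)//; apply: lime_le; first by apply/cvg_ex; eexists; exact: c.
exact: nearW.
Qed.

End ge0_bigcup.

Section power_integrals.
Context {R : realType}.
Local Notation mu := (@lebesgue_measure R).

Lemma integral_powR (r a b : R) : r + 1 != 0 -> 0 < a -> a < b ->
  (\int[mu]_(x in `[a, b]) (x `^ r)%:E =
   ((b `^ (r + 1) - a `^ (r + 1)) / (r + 1))%:E)%E.
Proof.
move=> r1 a0 ab.
have D (x : R) : 0 < x -> is_derive x 1 (fun y : R => (r + 1)^-1 * y `^ (r + 1)) (x `^ r).
  move=> x0; have d1 := is_derive1_powR (r + 1) x0.
  have -> : (fun y : R => (r + 1)^-1 * y `^ (r + 1)) = (r + 1)^-1 *: (fun y => y `^ (r + 1)).
    by apply/funext.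
  by apply: is_derive_eq; rewrite /GRing.scale /= mulKf// addrK.
have C (x : R) : 0 < x -> {for x, continuous (fun y : R => (r + 1)^-1 * y `^ (r + 1))}.
  move=> x0; apply: differentiable_continuous.
  by apply/derivable1_diffP; have [] := D x x0.
rewrite (@continuous_FTC2 _ (fun x => x `^ r) (fun y : R => (r + 1)^-1 * y `^ (r + 1)))//.
- by rewrite -EFinB; congr EFin; rewrite -mulrBr mulrC.
- apply/continuous_in_subspaceT => x; rewrite inE/= in_itv/= => /andP[ax _].
  apply: differentiable_continuous; apply/derivable1_diffP.
  by apply: derivable_powR; rewrite in_itv/= (lt_le_trans a0).
- split.
  + move=> x; rewrite in_itv/= => /andP[ax _].
    by have [] := D x (lt_trans a0 ax).
  + by apply: cvg_at_right_filter; exact: C.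
  + by apply: cvg_at_left_filter; apply: C; exact: lt_trans ab.
- move=> x; rewrite in_itv/= => /andP[ax _]; rewrite derive1E.
  by have := D x (lt_trans a0 ax) => ?; exact: derive_val.
Qed.

Lemma integral_powR_infty (r : R) : r < -1 ->
  (\int[mu]_(x in `[1%R, +oo[) (x `^ r)%:E <= (- (r + 1)^-1)%:E)%E.
Proof.
move=> r1; have r1n : r + 1 < 0 by lra.
have -> : `[1%R, +oo[%classic = \bigcup_n `[1%R, n%:R : R]%classic.
  apply/seteqP; split=> x /=.
    rewrite in_itv/= andbT => x1; exists (Num.truncn x).+1 => //=.
    by rewrite in_itv/= x1 ltW// truncnS_gt.
  by move=> [n _] /=; rewrite !in_itv/= andbT => /andP[].
apply: ge0_integral_bigcup_le.
- move=> m n mn; apply/subsetPset => x /=; rewrite !in_itv/= => /andP[-> h].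
  by rewrite (le_trans h)// ler_nat.
- by move=> i; exact: measurable_itv.
- by apply: measurable_funTS; exact: measurable_powR.
- by move=> x _; exact: powR_ge0.
move=> n; have [n1|n1] := ltP (1 : R) n%:R; last first.
  have [->|n1'] := eqVneq (n%:R : R) 1.
    by rewrite set_itv1 integral_set1 lee_fin oppr_ge0 invr_le0 ltW.
  rewrite set_itv_ge ?bnd_simp -?ltNge ?lt_neqAle ?n1'//.
  by rewrite integral_set0 lee_fin oppr_ge0 invr_le0 ltW.
rewrite integral_powR ?lt_eqF// lee_fin powR1 mulrBl mul1r.
by rewrite gerDr pmulr_rle0 ?invr_le0 ?ltW// powR_gt0// (lt_trans _ n1).
Qed.

Lemma integral_powR0 (r T : R) : -1 < r -> 0 < T ->
  (\int[mu]_(x in `]0%R, T]) (x `^ r)%:E <= (T `^ (r + 1) / (r + 1))%:E)%E.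
Proof.
move=> r1 T0; have r1p : 0 < r + 1 by lra.
have -> : `]0%R, T]%classic = \bigcup_n `[n.+1%:R^-1 : R, T]%classic.
  apply/seteqP; split=> x /=.
    rewrite in_itv/= => /andP[x0 xT]; exists (Num.truncn x^-1) => //=.
    rewrite in_itv/= xT andbT invf_ple ?posrE//; exact/ltW/truncnS_gt.
  move=> [n _] /=; rewrite !in_itv/= => /andP[h ->]; rewrite andbT.
  by apply: lt_le_trans h; rewrite invr_gt0.
apply: ge0_integral_bigcup_le.
- move=> m n mn; apply/subsetPset => x /=; rewrite !in_itv/= => /andP[h ->].
  by rewrite andbT (le_trans _ h)// lef_pV2 ?posrE// ler_nat.
- by move=> i; exact: measurable_itv.
- by apply: measurable_funTS; exact: measurable_powR.
- by move=> x _; exact: powR_ge0.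
have B : 0 <= T `^ (r + 1) / (r + 1) by rewrite divr_ge0 ?powR_ge0// ltW.
move=> n; have [n1|n1] := ltP (n.+1%:R^-1 : R) T; last first.
  have [->|n1'] := eqVneq T (n.+1%:R^-1 : R).
    by rewrite set_itv1 integral_set1 lee_fin divr_ge0 ?powR_ge0// ltW.
  by rewrite set_itv_ge ?bnd_simp -?ltNge ?lt_neqAle ?n1'// integral_set0 lee_fin.
rewrite integral_powR ?gt_eqF ?invr_gt0// lee_fin ler_pM2r ?invr_gt0//.
by rewrite lerBlDr lerDl powR_ge0.
Qed.

End power_integrals.

(** * Approximation of the one-sided stable law *)

Section stable_law.
Context {R : realType}.
Variable beta : R.
Hypothesis beta01 : 0 < beta < 1.
Local Notation mu := (@lebesgue_measure R).

Let b0 : 0 < beta. Proof. by case/andP: beta01. Qed.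
Let b1 : beta < 1. Proof. by case/andP: beta01. Qed.
Let ib1 : 1 < beta^-1. Proof. by rewrite invf_gt1. Qed.
Let ib0 : 0 < beta^-1. Proof. by rewrite invr_gt0. Qed.

(** The image of Lebesgue measure on ]0, +oo[ under v |-> v^(-1/beta) is beta x^(-1-beta) dx, up to
    a factor the Levy measure of the stable subordinator. The integral of [hl l] is therefore its
    Laplace exponent up to that factor, and [kap] below is Gamma(1 - beta). *)
Definition hl (l v : R) : R := 1 - expR (- (l * v `^ (- beta^-1))).

Lemma hl_ge0 l v : 0 <= l -> 0 <= hl l v.
Proof.
by move=> l0; rewrite subr_ge0 -expR0 ler_expR oppr_le0 mulr_ge0// powR_ge0.
Qed.

Lemma hl_le1 l v : hl l v <= 1.
Proof. by rewrite gerBl expR_ge0. Qed.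

Lemma measurable_hl l : measurable_fun setT (hl l).
Proof.
apply: measurable_funB => //; apply: measurableT_comp => //.
apply: measurableT_comp => //; apply: measurable_funM => //.
Qed.

Lemma hl_scale l v : 0 < l -> 0 < v -> hl l (l `^ beta * v) = hl 1 v.
Proof.
move=> l0 v0; rewrite /hl powRM ?powR_ge0// ?ltW// -powRrM mulrN divff ?gt_eqF//.
by rewrite powR_inv1 ?ltW// mulrA divff ?gt_eqF.
Qed.

Lemma hl_le_powR l v : hl l v <= l * v `^ (- beta^-1).
Proof. by rewrite /hl lerBlDr; have := expR_ge1Dx (- (l * v `^ (- beta^-1))); lra. Qed.

Lemma integrable_hl1 : mu.-integrable `]0, +oo[ (EFin \o hl 1).
Proof.
apply: integrable_ge0P => //.
- by apply: measurable_funTS; exact: measurable_hl.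
- by move=> x _; exact: hl_ge0.
have -> : `]0, +oo[%classic = `]0, 1[%classic `|` `[1, +oo[%classic :> set R.
  apply/seteqP; split=> x /=; rewrite !in_itv/= ?andbT.
    by move=> x0; have [x1|x1] := ltP x 1; [left; rewrite x0|right].
  by case=> [/andP[]//|]; exact: lt_le_trans.
have mh D : measurable_fun D (EFin \o hl 1).
  by apply/measurable_EFinP; apply: measurable_funTS; exact: measurable_hl.
rewrite ge0_integral_setU//; last 3 first.
- exact: mh.
- by move=> x _; rewrite lee_fin hl_ge0.
- apply/disj_setPS => x /= []; rewrite !in_itv/= andbT => /andP[_ x1].
  by rewrite leNgt x1.
apply: lte_add_pinfty.
  apply: (@le_lt_trans _ _ (\int[mu]_(x in `]0%R, 1%R[) (cst 1 x)))%E.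
    apply: ge0_le_integral => //=.
    - by move=> x _; rewrite lee_fin hl_ge0.
    - exact: mh.
    - by move=> x _; rewrite lee_fin hl_le1.
  by rewrite integral_cst//= lebesgue_measure_itv /= lte01 mul1e sube0 ltry.
  apply: (@le_lt_trans _ _ (\int[mu]_(x in `[1%R, +oo[) (x `^ (- beta^-1))%:E))%E.
    apply: ge0_le_integral => //=.
    - by move=> x _; rewrite lee_fin hl_ge0.
    - exact: mh.
    - by apply/measurable_EFinP; apply: measurable_funTS; exact: measurable_powR.
    - by move=> x _; rewrite lee_fin -[leRHS]mul1r hl_le_powR.
  have r1 : - beta^-1 < -1 by rewrite ltrN2.
  exact: le_lt_trans (integral_powR_infty r1) (ltry _).
Qed.

Definition kap : R := \int[mu]_(v in `]0, +oo[) hl 1 v.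

Definition Hl (l N : R) : R := \int[mu]_(v in `]0, N[) hl l v.

(** The substitution v = l^beta w removes [l] from the integrand ([hl_scale]); this homogeneity is
    where the power l^beta of the limit law comes from. *)
Lemma kap_scale l : 0 < l ->
  mu.-integrable `]0, +oo[ (EFin \o hl l) /\
  \int[mu]_(v in `]0, +oo[) hl l v = l `^ beta * kap.
Proof.
move=> l0; have lb : 0 < l `^ beta by exact: powR_gt0.
have i1 : mu.-integrable setT (EFin \o (hl 1 \_ `]0, +oo[)).
  by apply: (proj1 (integrable_patch_itv _ _)); exact: integrable_hl1.
have lbV : (l `^ beta)^-1 != 0 by rewrite gt_eqF// invr_gt0.
have E : (fun x => (hl 1 \_ `]0, +oo[) ((l `^ beta)^-1 * x + 0)) = hl l \_ `]0, +oo[.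
  apply/funext => x; rewrite addr0 !patchE !mem_itv_oy.
  rewrite pmulr_rgt0; last by rewrite invr_gt0.
  have [x0|x0] := boolP (0 < x); last by [].
  transitivity (hl l (l `^ beta * ((l `^ beta)^-1 * x))).
    by rewrite hl_scale//; rewrite mulr_gt0// invr_gt0.
  by rewrite mulVKf; [|rewrite gt_eqF].
split.
  apply: (proj2 (integrable_patch_itv _ _)); rewrite -E.
  exact: (integrable_affine1 0 lbV i1).
rewrite /kap [in RHS]Rintegral_mkcond (Rintegral_affine1 0 lbV i1) E.
rewrite -Rintegral_mkcond gtr0_norm; last by rewrite invr_gt0.
rewrite mulrA divff; last by rewrite gt_eqF.
by rewrite mul1r.
Qed.

Lemma integrable_hl l N : 0 < l -> mu.-integrable `]0, N[ (EFin \o hl l).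
Proof.
move=> l0; apply: integrableS (proj1 (kap_scale l0)) => //.
by apply: subset_itvl; rewrite bnd_simp.
Qed.

Lemma Hl_le l N : 0 < l -> Hl l N <= l `^ beta * kap.
Proof.
move=> l0; have [i1 <-] := kap_scale l0.
apply: Rintegral_le_dom => //; first by apply: subset_itvl; rewrite bnd_simp.
by move=> x _; exact/hl_ge0/ltW.
Qed.

(** For v < l^beta the quantity l v^(-1/beta) exceeds 1, so that the integrand is at least 1 -
    exp(-1). *)
Lemma Hl_ge l N : 0 < l -> 0 < N ->
  (1 - expR (- 1)) * Num.min N (l `^ beta) <= Hl l N.
Proof.
move=> l0 N0; set m := Num.min _ _.
have m0 : 0 < m by rewrite lt_min N0 powR_gt0.
have mN : m <= N by rewrite ge_min lexx.
have e1 : 0 <= 1 - expR (-1) :> R by rewrite subr_ge0 ltW// expRN1_lt1.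
have -> : (1 - expR (- 1)) * m = \int[mu]_(v in `]0, m[) (1 - expR (-1)).
  rewrite Rintegral_cst//= lebesgue_measure_itv/= lte_fin m0 /=; congr (_ * _); lra.
apply: (@le_trans _ _ (Hl l m)); last first.
  apply: Rintegral_le_dom => //; first by apply: subset_itvl; rewrite bnd_simp.
    exact: integrable_hl.
  by move=> x _; exact/hl_ge0/ltW.
have im : mu.-integrable `]0, m[ (EFin \o cst (1 - expR (-1) : R)).
  apply: integrable_ge0P => //=.
  by rewrite integral_cst//= lebesgue_measure_itv/= lte_fin m0 -EFinB -EFinM ltry.
apply: le_Rintegral => //; first exact: integrable_hl.
move=> x /=; rewrite in_itv/= => /andP[x0 xm]; rewrite lerD2l lerN2 ler_expR lerN2.
have xl : x <= l `^ beta by rewrite ltW// (lt_le_trans xm)// ge_min lexx orbT.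
rewrite powRN -ler_pdivrMr ?invr_gt0 ?powR_gt0// invrK mul1r.
have lE : (l `^ beta) `^ beta^-1 = l by rewrite -powRrM divff ?gt_eqF// powRr1// ltW.
by rewrite -[leRHS]lE; apply: powR_le_base => //; rewrite ltW.
Qed.

Lemma kap_gt0 : 0 < kap.
Proof.
have := Hl_le 1 ltr01; rewrite powR1 mul1r; apply: lt_le_trans.
apply: lt_le_trans (Hl_ge ltr01 ltr01); rewrite powR1 minxx mulr1 subr_gt0.
exact: expRN1_lt1.
Qed.

Lemma Hl_cvg l : 0 < l -> Hl l (kap * n.+1%:R) @[n --> \oo] --> l `^ beta * kap.
Proof.
move=> l0; have [i1 <-] := kap_scale l0.
have i1' : mu.-integrable setT (EFin \o (hl l \_ `]0, +oo[)).
  exact/integrable_patch_itv.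
rewrite Rintegral_mkcond.
have E n : Hl l (kap * n.+1%:R) = \int[mu]_x (hl l \_ `]0, kap * n.+1%:R[) x.
  by rewrite /Hl Rintegral_mkcond.
under eq_fun do rewrite E.
have [||||_ + _] := @Rintegral_dct _ _ _ mu setT measurableT
  (fun n => hl l \_ `]0, kap * n.+1%:R[) (hl l \_ `]0, +oo[) (hl l \_ `]0, +oo[) => //.
- move=> n; apply/(measurable_restrictT _ _).1 => //.
  by apply: measurable_funTS; exact: measurable_hl.
- move=> x _; apply: cvg_near_cst; near=> n.
  rewrite !patchE mem_itv_oo mem_itv_oy; case: (ltP 0 x) => //= x0.
  suff -> : x < kap * n.+1%:R by [].
  rewrite -ltr_pdivrMl ?kap_gt0//.
  near: n; apply: filterS (nbhs_infty_ger (kap^-1 * x)) => n h.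
  by rewrite (le_lt_trans h)// ltr_nat.
- move=> n x _; rewrite !patchE mem_itv_oo mem_itv_oy.
  case: (ltP 0 x) => //= x0; last by rewrite normr0.
  case: ifP => _; first by rewrite ger0_norm// hl_ge0// ltW.
  by rewrite (_ : point = 0 :> R)// normr0 hl_ge0// ltW.
Unshelve. all: end_near. Qed.

End stable_law.


Section elementary.
Context {R : realType}.

Lemma bernoulli_le (y : R) n : 0 <= y <= 1 -> 1 - y ^+ n <= n%:R * (1 - y).
Proof.
move=> /andP[y0 y1]; elim: n => [|n IH]; first by rewrite expr0 subrr mul0r.
rewrite exprS -natr1 mulrDl mul1r.
have yn : y ^+ n <= 1 by rewrite exprn_ile1.
have : 0 <= (1 - y) * (1 - y ^+ n) by rewrite mulr_ge0 ?subr_ge0.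
by nra.
Qed.

Lemma expR_neg_ub (y : R) : 1 - y <= expR (- y).
Proof. by have := expR_ge1Dx (- y); rewrite addrC. Qed.

Lemma expR_neg_lb (y : R) : 0 <= y < 1 -> expR (- (y / (1 - y))) <= 1 - y.
Proof.
move=> /andP[y0 y1]; have z0 : 0 < 1 - y by lra.
rewrite expRN invf_ple ?posrE ?expR_gt0//; apply: le_trans (expR_ge1Dx _).
by rewrite le_eqVlt; apply/orP; left; apply/eqP; field; rewrite gt_eqF.
Qed.

Lemma one_minus_expR_lb (y : R) : y * expR (- y) <= 1 - expR (- y).
Proof.
have h := expR_ge1Dx y; have e := expR_gt0 (- y).
have : (1 + y) * expR (- y) <= expR y * expR (- y) by rewrite ler_pM2r.
by rewrite -expRD subrr expR0; lra.
Qed.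

(** Each factor is squeezed, exp(- y / (1 - y)) <= 1 - y <= exp(- y) with y = [x_ n / n.+1%:R],
    before the power [n.+1] is taken. *)
Lemma exprn_1B_cvg (x_ : nat -> R) (x : R) : (forall n, 0 <= x_ n) ->
  x_ n @[n --> \oo] --> x ->
  (1 - x_ n / n.+1%:R) ^+ n.+1 @[n --> \oo] --> expR (- x).
Proof.
move=> x0 xx.
have y_0 : x_ n / n.+1%:R @[n --> \oo] --> (0 : R).
  rewrite -(mulr0 x); apply: cvgM => //.
  exact: cvg_harmonic.
apply: (@squeeze_cvgr _ _ _ _ (fun n => expR (- (x_ n / (1 - x_ n / n.+1%:R))))
  (fun n => expR (- x_ n))).
- near=> n.
  have y1 : x_ n / n.+1%:R < 1 by near: n; exact: (cvgr_lt (0 : R)).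
  have y0 : 0 <= x_ n / n.+1%:R by rewrite divr_ge0.
  have xE : x_ n = n.+1%:R * (x_ n / n.+1%:R) by rewrite mulrC divfK.
  set y := x_ n / n.+1%:R in y0 y1 xE *.
  have -> : expR (- (x_ n / (1 - y))) = expR (- (y / (1 - y))) ^+ n.+1.
    by rewrite -expRM_natl {1}xE; congr expR; ring.
  have -> : expR (- x_ n) = expR (- y) ^+ n.+1 by rewrite -expRM_natl xE mulrN.
  have z0 : 0 <= 1 - y by lra.
  by apply/andP; split; rewrite lerXn2r ?nnegrE ?expR_ge0// ?expR_neg_ub// expR_neg_lb// y0.
- apply: continuous_cvg; first exact: continuous_expR.
  apply: cvgN; have -> : x = x / (1 - 0) by rewrite subr0 divr1.
  apply: cvgM => //; apply: cvgV; first by rewrite subr0 oner_eq0.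
  by apply: cvgB => //; exact: cvg_cst.
- apply: continuous_cvg; first exact: continuous_expR.
  exact: cvgN.
Unshelve. all: end_near. Qed.

End elementary.

(** * Laplace transforms of the Pareto jumps *)

Section psi.
Context {R : realType}.
Variable beta : R.
Hypothesis beta01 : 0 < beta < 1.
Local Notation mu := (@lebesgue_measure R).
Local Notation kap := (kap beta).
Local Notation Hl := (Hl beta).
Local Notation hl := (hl beta).

Let b0 : 0 < beta. Proof. by case/andP: beta01. Qed.
Let b1 : beta < 1. Proof. by case/andP: beta01. Qed.
Let ib0 : 0 < beta^-1. Proof. by rewrite invr_gt0. Qed.

(* For v uniform on ]0, 1[, the variable [jump n v] has a Pareto law of index
   beta, the constant [kap] being chosen so that the n-th power of its Laplace
   transform [psi n] at l tends to exp (- l ^ beta). *)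
Definition jump n (v : R) : R := (kap * n%:R * v) `^ (- beta^-1).

Definition psi n (l : R) : R := \int[mu]_(v in `]0, 1[) expR (- (l * jump n v)).

Lemma measurable_jump n : measurable_fun setT (jump n).
Proof.
by apply: (measurableT_comp (measurable_powR _)); exact: measurable_funM.
Qed.

Lemma jump_ge0 n v : 0 <= jump n v. Proof. exact: powR_ge0. Qed.

Lemma lebesgue_itv01 : (mu `]0%R, 1%R[ = 1)%E.
Proof. by rewrite lebesgue_measure_itv/= lte01 sube0. Qed.

Lemma integrable_itv01 (f : R -> R) (M : R) : measurable_fun setT f ->
  (forall v, 0 < v < 1 -> `|f v| <= M) -> mu.-integrable `]0, 1[ (EFin \o f).
Proof.
move=> mf fM; apply: (@integrable_le _ _ _ mu _ _ _ (cst M)) => //.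
- exact: measurable_funTS.
apply/integrableP; split; first exact/measurable_EFinP.
by rewrite /= integral_cst// [X in (_ * X)%E]lebesgue_itv01 mule1 ltry.
Qed.

Let mexp n l : measurable_fun setT (fun v => expR (- (l * jump n v))).
Proof.
apply: measurableT_comp => //; apply: measurableT_comp => //.
by apply: measurable_funM => //; exact: measurable_jump.
Qed.

Let exp01 n l v : 0 <= l -> 0 <= expR (- (l * jump n v)) <= 1.
Proof.
by move=> l0; rewrite expR_ge0 -expR0 ler_expR oppr_le0 mulr_ge0 ?jump_ge0.
Qed.

Lemma psi_ge0 n l : 0 <= psi n l.
Proof. by apply: Rintegral_ge0 => x _; exact: expR_ge0. Qed.

Let Nn n : (0 < n)%N -> 0 < kap * n%:R.
Proof. by move=> n0; rewrite mulr_gt0 ?kap_gt0// ltr0n. Qed.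

(** Stretching ]0, 1[ to ]0, kap n[ turns 1 minus the integrand into [hl l]: a Pareto jump sees the
    Levy measure cut off at small jumps. *)
Lemma psiE n l : 0 < l -> (0 < n)%N ->
  psi n l = 1 - Hl l (kap * n%:R) / (kap * n%:R).
Proof.
move=> l0 n0; have N0 := Nn n0; set N := kap * n%:R in N0 *.
have mh : measurable_fun setT (fun v => hl l (N * v)).
  by apply: (measurableT_comp (measurable_hl _ _)); exact: measurable_funM.
have ih : mu.-integrable `]0, 1[ (EFin \o (fun v => hl l (N * v))).
  apply: (@integrable_itv01 _ 1) => // v _.
  by rewrite ger0_norm ?hl_le1// hl_ge0// ltW.
have -> : psi n l = \int[mu]_(v in `]0, 1[) (cst 1 v - hl l (N * v)).
  by apply: eq_Rintegral => v _; rewrite /hl /jump -/N /= opprB addrC subrK.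
rewrite RintegralB//; last by apply: (@integrable_itv01 _ 1) => // v _; rewrite normr1.
rewrite Rintegral_cst// [X in fine X]lebesgue_itv01 mulr1; congr (_ - _).
have NN : N != 0 by rewrite gt_eqF.
have ip : mu.-integrable setT (EFin \o (hl l \_ `]0, N[)).
  by apply/integrable_patch_itv; exact: integrable_hl.
have E2 : \int[mu]_(v in `]0, 1[) hl l (N * v) =
    \int[mu]_x (hl l \_ `]0, N[) (N * x + 0).
  rewrite Rintegral_mkcond; apply: eq_Rintegral => x _.
  rewrite addr0 !patchE !mem_itv_oo pmulr_rgt0; last exact: N0.
  by rewrite gtr_pMr; [|exact: N0].
have E3 : Hl l N = `|N| * \int[mu]_x (hl l \_ `]0, N[) (N * x + 0).
  by rewrite /Hl Rintegral_mkcond; exact: Rintegral_affine1.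
rewrite E2 E3 gtr0_norm; last exact: N0.
by rewrite mulrAC divff; [rewrite mul1r|exact: NN].
Qed.

Lemma psi_le1 n l : 0 <= l -> psi n l <= 1.
Proof.
move=> l0.
have -> : 1 = \int[mu]_(v in `]0, 1[) cst 1 v :> R.
  by rewrite Rintegral_cst// [X in fine X]lebesgue_itv01 mulr1.
apply: le_Rintegral => //.
- by apply: (@integrable_itv01 _ 1) => // v _; rewrite ger0_norm ?expR_ge0//; case/andP: (exp01 n v l0).
- by apply: (@integrable_itv01 _ 1) => // v _; rewrite normr1.
- by move=> v _; case/andP: (exp01 n v l0).
Qed.

(** Bernoulli's inequality makes the bound uniform in [n]; it will control the probability of large
    sums. *)
Lemma psi_lb n l : 0 < l -> (0 < n)%N -> 1 - psi n l ^+ n <= l `^ beta.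
Proof.
move=> l0 n0; have N0 := Nn n0.
apply: (le_trans (bernoulli_le _ _)); first by rewrite psi_ge0 psi_le1// ltW.
rewrite psiE// opprB addrC subrK.
have k0 := kap_gt0 beta01; have nn : 0 < n%:R :> R by rewrite ltr0n.
have -> : n%:R * (Hl l (kap * n%:R) / (kap * n%:R)) = Hl l (kap * n%:R) / kap.
  by field; rewrite !gt_eqF.
by rewrite ler_pdivrMr// Hl_le.
Qed.

Definition psi_rate : R := (1 - expR (- 1)) / kap.

Lemma psi_rate_gt0 : 0 < psi_rate.
Proof. by rewrite divr_gt0 ?kap_gt0// subr_gt0 expRN1_lt1. Qed.

(** Uniform in [n], this is the majorant for the passage to the limit on the Fourier side. When
    l^beta exceeds kap n the estimate [Hl_ge] saturates; but then even the smallest possible jump is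
    large enough. *)
Lemma psi_ub n l : 0 < l -> (0 < n)%N ->
  psi n l ^+ n <= expR (- (psi_rate * l `^ beta)).
Proof.
move=> l0 n0; have N0 := Nn n0; have k0 := kap_gt0 beta01.
have nn : 0 < n%:R :> R by rewrite ltr0n.
have [lN|Nl] := leP (l `^ beta) (kap * n%:R).
  have h : psi n l <= expR (- ((1 - expR (-1)) * l `^ beta / (kap * n%:R))).
    apply: le_trans (expR_neg_ub _); rewrite psiE; [|exact: l0|exact: n0].
    rewrite lerD2l lerN2 ler_pM2r; last by rewrite invr_gt0.
    by have := Hl_ge beta01 l0 N0; rewrite (min_idPr lN).
  apply: (le_trans (lerXn2r n _ _ h)); rewrite ?nnegrE ?psi_ge0 ?expR_ge0//.
  rewrite -expRM_natl ler_expR le_eqVlt; apply/orP; left; apply/eqP.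
  by rewrite /psi_rate; field; rewrite !gt_eqF.
(* [y] is [l] times the lower bound of [jump n] on ]0, 1[. It is at least 1 here, so that it
   dominates y^beta = l^beta / (kap n). *)
set y := l * (kap * n%:R) `^ (- beta^-1).
have h : psi n l <= expR (- y).
  have -> : expR (- y) = \int[mu]_(v in `]0, 1[) cst (expR (- y)) v.
    by rewrite Rintegral_cst// [X in fine X]lebesgue_itv01 mulr1.
  apply: le_Rintegral => //.
  - by apply: (@integrable_itv01 _ 1) => // v _; rewrite ger0_norm ?expR_ge0//; case/andP: (exp01 n v (ltW l0)).
  - by apply: (@integrable_itv01 _ (expR (- y))) => // v _; rewrite ger0_norm ?expR_ge0.
  move=> v /=; rewrite in_itv/= => /andP[v0 v1]; rewrite ler_expR lerN2 ler_pM2l//.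
  apply: powR_ge_base; rewrite ?oppr_le0 ?(ltW ib0) ?mulr_gt0//.
  by rewrite ler_piMr// ltW.
apply: (le_trans (lerXn2r n _ _ h)); rewrite ?nnegrE ?psi_ge0 ?expR_ge0//.
rewrite -expRM_natl ler_expR mulrN lerN2.
have y1 : 1 <= y.
  rewrite /y powRN -(@ler_pdivrMr _ _ _ _) ?invr_gt0 ?powR_gt0// invrK mul1r.
  have -> : l = (l `^ beta) `^ beta^-1 by rewrite -powRrM divff ?gt_eqF// powRr1// ltW.
  by apply: powR_le_base; rewrite // ltW.
have yb : l `^ beta / (kap * n%:R) <= y.
  apply: le_trans (ler1_powR y1 (ltW b1)).
  rewrite /y (@powRM _ l _ beta) ?powR_ge0 ?(ltW l0)// -powRrM mulNr mulVf ?gt_eqF//.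
  by rewrite powR_inv1// ltW.
apply: (@le_trans _ _ (n%:R * (l `^ beta / (kap * n%:R)))); last by rewrite ler_pM2l.
have -> : n%:R * (l `^ beta / (kap * n%:R)) = kap^-1 * l `^ beta by field; rewrite !gt_eqF.
rewrite ler_wpM2r ?powR_ge0// /psi_rate -[leRHS]mul1r ler_wpM2r ?invr_ge0 ?(ltW k0)//.
Qed.

Lemma psi_cvg l : 0 < l -> psi n.+1 l ^+ n.+1 @[n --> \oo] --> expR (- l `^ beta).
Proof.
move=> l0; have k0 := kap_gt0 beta01.
have -> : (fun n => psi n.+1 l ^+ n.+1) =
    (fun n => (1 - (Hl l (kap * n.+1%:R) / kap) / n.+1%:R) ^+ n.+1).
  apply/funext => n; congr (_ ^+ _); rewrite psiE//; congr (_ - _).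
  by rewrite invfM mulrA.
apply: exprn_1B_cvg.
  move=> n; apply: divr_ge0; last exact: ltW.
  by apply: Rintegral_ge0 => v _; apply: hl_ge0; exact: ltW.
rewrite -[X in _ --> X](mulfK (lt0r_neq0 k0)); apply: cvgM; last exact: cvg_cst.
exact: Hl_cvg.
Qed.

End psi.


Lemma measurable_invr {R : realType} : measurable_fun setT (fun x : R => x^-1).
Proof.
rewrite (_ : (fun _ => _) = (fun x : R => x * (x ^+ 2) `^ (-1))).
  apply: measurable_funM => //.
  by apply: (measurableT_comp (measurable_powR _)); exact: measurable_funX.
apply/funext => x; rewrite powR_inv1 ?sqr_ge0//.
have [->|x0] := eqVneq x 0; first by rewrite mul0r invr0.
by rewrite expr2 invfM mulrA divff// mul1r.
Qed.

(** * Integrability of stretched exponentials *)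

Section exp_integrable.
Context {R : realType}.
Local Notation mu := (@lebesgue_measure R).

Lemma integrable_expabs (k : R) : 0 < k ->
  mu.-integrable setT (EFin \o (fun x => expR (- (k * `|x|)))).
Proof.
move=> k0.
have ip : mu.-integrable setT (EFin \o exponential_pdf k).
  exact: integrable_exponential_pdf.
have m1 : (-1 : R) != 0 by rewrite oppr_eq0 oner_neq0.
have ip2 := integrable_affine1 0 m1 ip.
apply: (@integrable_le _ _ _ mu _ _ _
  (fun x => k^-1 * (exponential_pdf k x + exponential_pdf k (-1 * x + 0)))) => //.
- apply: measurableT_comp => //; apply: measurableT_comp => //.
  by apply: measurable_funM => //; exact: measurableT_comp.
- have eE y : 0 <= y -> exponential_pdf k y = k * expR (- (k * y)).
    by move=> y0; rewrite exponential_pdfE// mulNr.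
  move=> x _; rewrite ger0_norm ?expR_ge0// -ler_pdivrMl ?invr_gt0// invrK.
  rewrite addr0 mulN1r; have [x0|x0] := leP 0 x.
    rewrite (ger0_norm x0) -eE// lerDl.
    by apply: exponential_pdf_ge0; exact: ltW.
  have nx0 : 0 <= - x by rewrite oppr_ge0 ltW.
  rewrite (ltr0_norm x0) -eE// lerDr.
  by apply: exponential_pdf_ge0; exact: ltW.
- by apply: integrableRZ => //; exact: integrableRD.
Qed.

Lemma integrable_rV_prod n (g : R -> R) : (forall x, 0 <= g x) ->
  mu.-integrable setT (EFin \o g) ->
  (lebesgue_rV n).-integrable setT (EFin \o (fun x => \prod_(i < n) g (x ord0 i))).
Proof.
move=> g0 gi; have /integrableP[/measurable_EFinP mg _] := gi.
apply: integrable_ge0P => //; first exact: measurable_rV_prod.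
  by move=> x _; exact: prodr_ge0.
rewrite (integral_rV_prod n mg g0 (c := \int[mu]_x g x)) ?ltry//.
by rewrite EFin_Rintegral.
Qed.

(** With [y] the norm of xi this bounds the symbol |xi|^(2 beta) below by |xi| - 1, so that
    exponentials of the norm dominate the stretched ones. *)
Lemma powR_sqr_ge (beta y : R) : 2^-1 <= beta -> 0 <= y -> y - 1 <= (y ^+ 2) `^ beta.
Proof.
move=> b12 y0; have [y1|y1] := leP y 1.
  by rewrite (le_trans _ (powR_ge0 _ _))// subr_le0.
apply: (@le_trans _ _ y); first by rewrite gerBl.
rewrite -[leLHS](ger0_norm y0) -sqrtr_sqr -powR12_sqrt ?sqr_ge0//.
by apply: ler_powR => //; rewrite expr_ge1// ltW.
Qed.

Variable n : nat.
Implicit Types xi : 'rV[R]_n.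

Lemma sum_coord_enorm xi : \sum_(i < n) `|xi ord0 i| <= n%:R * enorm xi.
Proof.
apply: le_trans (ler_sum _ (fun i _ => coord_le_enorm xi i)) _.
by rewrite sumr_const card_ord mulr_natl.
Qed.

Lemma integrable_exp_enorm (c : R) : 0 < c -> (lebesgue_rV n).-integrable setT
  (EFin \o (fun xi : 'rV[R]_n => expR (- (c * enorm xi)))).
Proof.
(* The denominator [n.+1] instead of [n] also covers dimension zero. *)
move=> c0; pose k := c / n.+1%:R.
have k0 : 0 < k by rewrite divr_gt0.
apply: (@integrable_le _ _ _ (lebesgue_rV n) _ _ _
   (fun x => \prod_(i < n) (expR (- (k * `|x ord0 i|))))) => //.
- apply: measurableT_comp => //; apply: measurableT_comp => //.
  by apply: measurable_funM => //; exact: measurable_enorm.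
- move=> xi _; rewrite ger0_norm ?expR_ge0// -expR_sum ler_expR sumrN lerN2 -mulr_sumr.
  apply: le_trans (ler_wpM2l (ltW k0) (sum_coord_enorm xi)) _.
  rewrite mulrA ler_wpM2r ?enorm_ge0// /k -mulrA ler_piMr ?(ltW c0)//.
  by rewrite mulrC ler_pdivrMr// mul1r ler_nat.
- apply: (@integrable_rV_prod n (fun x => expR (- (k * `|x|)))).
    by move=> x; exact: expR_ge0.
  exact: integrable_expabs.
Qed.

Lemma measurable_stretched (c beta : R) : measurable_fun setT
  (fun xi : 'rV[R]_n => expR (- (c * (dotp xi xi) `^ beta))).
Proof.
apply: measurableT_comp => //; apply: measurableT_comp => //.
apply: measurable_funM => //.
apply: (measurableT_comp (measurable_powR _)); exact: measurable_nsq.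
Qed.

Lemma integrable_stretched (c beta : R) : 0 < c -> 2^-1 <= beta ->
  (lebesgue_rV n).-integrable setT
  (EFin \o (fun xi => (1 + enorm xi) * expR (- (c * (dotp xi xi) `^ beta)))).
Proof.
move=> c0 b12; apply: (@integrable_le _ _ _ (lebesgue_rV n) _ _ _
  (fun xi => (expR c * (1 + 2 / c)) * expR (- (c / 2 * enorm xi)))) => //.
- apply: measurable_funM; last exact: measurable_stretched.
  by apply: measurable_funD => //; exact: measurable_enorm.
- move=> xi _; have y0 := enorm_ge0 xi.
  rewrite ger0_norm ?mulr_ge0 ?expR_ge0 ?addr_ge0//.
  have h := powR_sqr_ge b12 y0; rewrite enorm_sqr in h.
  set y := enorm xi in y0 h *.
  have h1 : expR (- (c * dotp xi xi `^ beta)) <= expR c * expR (- (c * y)).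
    rewrite -expRD ler_expR; have := ler_wpM2l (ltW c0) h; lra.
  have h2 : (1 + y) * expR (- (c * y)) <= (1 + 2 / c) * expR (- (c / 2 * y)).
    have -> : expR (- (c * y)) = expR (- (c / 2 * y)) * expR (- (c / 2 * y)).
      by rewrite -expRD; congr expR; field.
    rewrite mulrA ler_wpM2r ?expR_ge0//.
    rewrite -ler_pdivlMr ?expR_gt0// expRN invrK.
    apply: (@le_trans _ _ ((1 + 2 / c) * (1 + c / 2 * y))).
      have -> : (1 + 2 / c) * (1 + c / 2 * y) = 1 + y + (2 / c + c / 2 * y).
        by field; rewrite gt_eqF.
      by rewrite lerDl addr_ge0// ?mulr_ge0 ?invr_ge0// ltW.
    by rewrite ler_wpM2l ?expR_ge1Dx// addr_ge0// mulr_ge0 ?invr_ge0 ?ltW.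
  rewrite -[leRHS]mulrA; apply: le_trans (ler_wpM2l (expR_ge0 c) h2).
  by rewrite mulrCA ler_wpM2l// addr_ge0.
- by apply: integrableRZ => //; apply: integrable_exp_enorm; rewrite divr_gt0.
Qed.

Lemma integrable_stretched0 (c beta : R) : 0 < c -> 2^-1 <= beta ->
  (lebesgue_rV n).-integrable setT
  (EFin \o (fun xi : 'rV[R]_n => expR (- (c * (dotp xi xi) `^ beta)))).
Proof.
move=> c0 b12; apply: integrable_le (integrable_stretched c0 b12) => //.
  exact: measurable_stretched.
move=> xi _; rewrite ger0_norm ?expR_ge0// -[leLHS]mul1r ler_wpM2r ?expR_ge0//.
by rewrite lerDl enorm_ge0.
Qed.

End exp_integrable.

Section cube.
Context {R : realType} {n : nat}.
Local Notation L := (lebesgue_rV n).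

(** The sample space of [n] independent uniform variables; expectations are integrals over it. *)
Definition cube : set 'rV[R]_n := [set U | forall i, 0 < U ord0 i < 1].

Lemma measurable_cube : measurable cube.
Proof.
rewrite (_ : cube = \bigcap_(i in [set: 'I_n]) (coord_rV i @^-1` `]0, 1[)).
  apply: fin_bigcap_measurable => // i _.
  rewrite -[X in measurable X]setTI; exact: measurable_coord_rV.
apply/seteqP; split=> x /= Ax i; rewrite /coord_rV; first by move=> _; rewrite /= in_itv/=; exact: Ax.
by have := Ax i I; rewrite /= in_itv/=.
Qed.

Lemma cube_patch_prod (g : R -> R) :
  (fun U : 'rV[R]_n => \prod_(i < n) g (U ord0 i)) \_ cube =
  (fun U => \prod_(i < n) (g \_ `]0, 1[) (U ord0 i)).
Proof.
apply/funext => U; rewrite patchE; case: ifPn; rewrite ?inE ?notin_setE => Uc.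
  by apply: eq_bigr => i _; rewrite patchE mem_itv_oo (Uc i).
have [i Ui] : exists i, ~~ (0 < U ord0 i < 1).
  apply: contrapT => h; apply: Uc => i; apply: contrapT => h2; apply: h.
  by exists i; exact/negP.
by rewrite (bigD1 i)//= patchE mem_itv_oo (negbTE Ui) (_ : point = 0 :> R)// mul0r.
Qed.

Lemma integral_cube_prod (g : R -> R) (c : R) : measurable_fun setT g ->
  (forall x, 0 <= g x) -> (\int[lebesgue_measure]_(x in `]0%R, 1%R[) (g x)%:E = c%:E)%E ->
  (\int[L]_(U in cube) (\prod_(i < n) g (U ord0 i))%:E = (c ^+ n)%:E)%E.
Proof.
move=> mg g0 gc.
rewrite [LHS]integral_mkcond.
have -> : (fun U : 'rV[R]_n => (\prod_(i < n) g (U ord0 i))%:E) \_ cube =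
   (fun U => (\prod_(i < n) (g \_ `]0, 1[) (U ord0 i))%:E).
  apply/funext => U; have /(congr1 (fun h => h U)) := cube_patch_prod g.
  by rewrite !patchE; case: ifP => _ <-.
apply: integral_rV_prod.
- by apply/(measurable_restrictT _ _).1 => //; exact: measurable_funTS.
- by move=> x; rewrite patchE; case: ifP.
- rewrite -gc [RHS]integral_mkcond; apply: eq_integral => x _.
  by rewrite !patchE; case: ifP.
Qed.

Lemma lebesgue_cube : L cube = 1%E.
Proof.
have h1 : (\int[lebesgue_measure]_(x in `]0%R, 1%R[) (cst 1 x : R)%:E = 1%:E)%E.
  rewrite (eq_integral (cst 1%E))//.
  by rewrite integral_cst// [X in (_ * X)%E]lebesgue_itv01 mule1.
have := integral_cube_prod (measurable_cst (1 : R)) (fun _ => ler01) h1.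
rewrite expr1n.
rewrite (eq_integral (cst 1%E)).
  by rewrite integral_cst ?mul1e//; exact: measurable_cube.
by move=> U _; rewrite big1.
Qed.

Lemma integrable_cube (f : 'rV[R]_n -> R) (M : R) : measurable_fun setT f ->
  (forall U, cube U -> `|f U| <= M) -> L.-integrable cube (EFin \o f).
Proof.
move=> mf fM; have mc := measurable_cube.
apply: (@integrable_le _ _ _ L _ mc _ (cst M)) => //.
- exact: measurable_funTS.
apply/integrableP; split; first exact/measurable_EFinP.
by rewrite /= integral_cst// [X in (_ * X)%E]lebesgue_cube mule1 ltry.
Qed.

Lemma Rintegral_cube_cst (c : R) : \int[L]_(U in cube) cst c U = c.
Proof. by rewrite Rintegral_cst ?[X in fine X]lebesgue_cube ?mulr1//; exact: measurable_cube. Qed.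

End cube.

Lemma sqrtVX {R : realType} (r : R) (k : nat) : 0 < r ->
  (Num.sqrt r)^-1 ^+ k = r `^ (- (k%:R / 2)).
Proof.
move=> r0; rewrite -powR12_sqrt ?(ltW r0)// -powRN -powR_mulrn ?powR_ge0// -powRrM.
by congr (_ `^ _); rewrite mulNr mulrC.
Qed.

(** * Sums of independent jumps and Gaussian mixtures *)

Section stable_sum.
Context {R : realType}.
Variable beta : R.
Hypothesis beta01 : 0 < beta < 1.
Local Notation mu := (@lebesgue_measure R).
Local Notation kap := (kap beta).
Local Notation L := (@lebesgue_rV R).

Let b0 : 0 < beta. Proof. by case/andP: beta01. Qed.
Let k0 : 0 < kap. Proof. exact: kap_gt0. Qed.

Definition ssum n (U : 'rV[R]_n) : R := \sum_(i < n) jump beta n (U ord0 i).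

Lemma measurable_ssum n : measurable_fun setT (@ssum n).
Proof.
apply: measurable_sum => i.
by apply: (measurableT_comp (measurable_jump _ _)); exact: measurable_rV_coord.
Qed.

Lemma ssum_ge0 n (U : 'rV[R]_n) : 0 <= ssum U.
Proof. by apply: sumr_ge0 => i _; exact: jump_ge0. Qed.

Lemma jump_le_ssum n (U : 'rV[R]_n) i : jump beta n (U ord0 i) <= ssum U.
Proof.
by rewrite /ssum (bigD1 i)//= lerDl sumr_ge0// => j _; exact: jump_ge0.
Qed.

(** A deterministic bound, useful for fixed [n] only: it keeps negative powers of [ssum] bounded,
    hence integrable, but it degenerates as [n] grows. *)
Lemma ssum_lb n (U : 'rV[R]_n) : (0 < n)%N -> cube U ->
  (kap * n%:R) `^ (- beta^-1) <= ssum U.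
Proof.
case: n U => // n U _ cU; apply: le_trans (jump_le_ssum U ord0).
have /andP[U0 U1] := cU ord0.
apply: powR_ge_base; rewrite ?oppr_le0 ?invr_ge0 ?(ltW b0) ?mulr_gt0 ?ltr0n//.
by rewrite ler_piMr ?mulr_ge0 ?(ltW k0)// ltW.
Qed.

Lemma ssum_gt0 n (U : 'rV[R]_n) : (0 < n)%N -> cube U -> 0 < ssum U.
Proof.
move=> n0 cU; apply: lt_le_trans (ssum_lb n0 cU).
by rewrite powR_gt0// mulr_gt0// ltr0n.
Qed.

Lemma psi0 n : psi beta n 0 = 1.
Proof.
rewrite /psi; under eq_Rintegral do rewrite mul0r oppr0 expR0.
by rewrite Rintegral_cst// [X in fine X]lebesgue_itv01 mulr1.
Qed.

Lemma psi_ub0 n l : 0 <= l -> (0 < n)%N ->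
  psi beta n l ^+ n <= expR (- (psi_rate beta * l `^ beta)).
Proof.
rewrite le_eqVlt => /predU1P[<- _|l0 n0]; last exact: psi_ub.
by rewrite psi0 expr1n powR0 ?gt_eqF// mulr0 oppr0 expR0.
Qed.

Lemma measurable_exp_ssum n l : measurable_fun setT
  (fun U : 'rV[R]_n => expR (- (l * ssum U))).
Proof.
apply: measurableT_comp => //; apply: measurableT_comp => //.
by apply: measurable_funM => //; exact: measurable_ssum.
Qed.

Lemma ssum_laplaceE n l : 0 <= l ->
  (\int[L n]_(U in cube) (expR (- (l * ssum U)))%:E = (psi beta n l ^+ n)%:E)%E.
Proof.
move=> l0.
have -> : (fun U : 'rV[R]_n => (expR (- (l * ssum U)))%:E) =
  (fun U => (\prod_(i < n) expR (- (l * jump beta n (U ord0 i))))%:E).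
  by apply/funext => U; rewrite -expR_sum sumrN -mulr_sumr.
apply: (integral_cube_prod (g := fun v => expR (- (l * jump beta n v)))).
- apply: measurableT_comp => //; apply: measurableT_comp => //.
  by apply: measurable_funM => //; exact: measurable_jump.
- by move=> x; exact: expR_ge0.
rewrite /psi EFin_Rintegral//; apply: (@integrable_itv01 _ _ 1).
  apply: measurableT_comp => //; apply: measurableT_comp => //.
  by apply: measurable_funM => //; exact: measurable_jump.
move=> v _; rewrite ger0_norm ?expR_ge0// -expR0 ler_expR oppr_le0.
by rewrite mulr_ge0// jump_ge0.
Qed.

Lemma exp_ssum_le1 n l (U : 'rV[R]_n) : 0 <= l -> expR (- (l * ssum U)) <= 1.
Proof. by move=> l0; rewrite -expR0 ler_expR oppr_le0 mulr_ge0// ssum_ge0. Qed.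

Lemma integrable_exp_ssum n l : 0 <= l ->
  (L n).-integrable cube (EFin \o (fun U : 'rV[R]_n => expR (- (l * ssum U)))).
Proof.
move=> l0; apply: (integrable_cube (M := 1)); first exact: measurable_exp_ssum.
by move=> U _; rewrite ger0_norm ?expR_ge0// exp_ssum_le1.
Qed.

Lemma ssum_laplace n l : 0 <= l ->
  \int[L n]_(U in cube) expR (- (l * ssum U)) = psi beta n l ^+ n.
Proof. by move=> l0; rewrite /Rintegral ssum_laplaceE. Qed.

Lemma integrable_1Bexp_ssum n l : 0 <= l ->
  (L n).-integrable cube (EFin \o (fun U : 'rV[R]_n => 1 - expR (- (l * ssum U)))).
Proof.
move=> l0; apply: (integrable_cube (M := 1)).
  by apply: measurable_funB => //; exact: measurable_exp_ssum.
by move=> U _; rewrite ger0_norm ?subr_ge0 ?exp_ssum_le1// gerBl expR_ge0.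
Qed.

(** Plays the role of Markov's inequality for sums without a finite mean: 1 - exp(- l S) is at least
    1 - exp(-1) once S exceeds 1 / l. *)
Lemma ssum_laplace_tail n l : (0 < n)%N -> 0 < l ->
  \int[L n]_(U in cube) (1 - expR (- (l * ssum U))) <= l `^ beta.
Proof.
move=> n0 l0; have mc := @measurable_cube R n.
rewrite (@RintegralB _ _ _ (L n) cube (cst 1))//; last 2 first.
- apply: (integrable_cube (M := 1)) => // U _; by rewrite normr1.
- by apply: integrable_exp_ssum; exact: ltW.
by rewrite Rintegral_cube_cst ssum_laplace ?(ltW l0)// psi_lb.
Qed.

(** A sum below [r] forces every jump below [r], that is, every coordinate above [a]; independence
    gives (1 - a)^n <= exp(- n a). The lower bounds on kap n and [r] ensure a <= 1. *)
Lemma ssum_lt_prob n r : 1 <= kap * n%:R -> 1 <= r ->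
  \int[L n]_(U in cube) (\1_[set U | ssum U < r] U : R) <= expR (- (r `^ (- beta) / kap)).
Proof.
move=> N1 r1; have r0 : 0 < r by exact: lt_le_trans r1.
have N0 : 0 < kap * n%:R by exact: lt_le_trans N1.
have n0 : 0 < n%:R :> R by move: N0; rewrite pmulr_rgt0.
set a := r `^ (- beta) / (kap * n%:R).
have a0 : 0 < a by rewrite divr_gt0// powR_gt0.
have a1 : a <= 1.
  rewrite ler_pdivrMr// mul1r; apply: le_trans N1.
  by rewrite -[leRHS](powRr0 r) ler_powR// oppr_le0 ltW.
pose g (v : R) : R := \1_(`]a, 1[%classic) v.
have mg : measurable_fun setT g by exact: measurable_indic.
have g0 v : 0 <= g v by rewrite /g.
have gc : (\int[mu]_(x in `]0%R, 1%R[) (g x)%:E = (1 - a)%:E)%E.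
  rewrite integral_indic//.
  have -> : `]a, 1[%classic `&` `]0, 1[%classic = `]a, 1[%classic :> set R.
    by apply: setIidl => x /=; rewrite !in_itv/= => /andP[ax ->]; rewrite (lt_trans a0 ax).
  have : (mu `]a, 1%R[ = (1 - a)%:E)%E; last by [].
  rewrite lebesgue_measure_itv/= lte_fin; case: ltP => [_|a1']; first by rewrite -EFinB.
  have a1E : a = 1 by apply/eqP; rewrite eq_le a1 a1'.
  by rewrite a1E subrr.
have gp := @integral_cube_prod R n g (1 - a) mg g0 gc.
have igp : (L n).-integrable cube (EFin \o (fun U : 'rV[R]_n => \prod_(i < n) g (U ord0 i))).
  apply: (integrable_cube (M := 1)); first exact: measurable_rV_prod.
  move=> U _; rewrite ger0_norm ?prodr_ge0//.
  have : 0 <= \prod_(i < n) g (U ord0 i) <= 1; last by case/andP.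
  apply: (big_ind (fun x => 0 <= x <= 1)) => [|x y|i _]; first by rewrite ler01 lexx.
    by move=> /andP[x0 x1] /andP[y0 y1]; rewrite mulr_ge0 ?mulr_ile1.
  by rewrite g0 /= /g indicE; case: (_ \in _).
have mS : measurable [set U : 'rV[R]_n | ssum U < r].
  rewrite (_ : [set U | _] = @ssum n @^-1` `]-oo, r[).
    by rewrite -[X in measurable X]setTI; apply: measurable_ssum.
  by apply/seteqP; split=> U /=; rewrite in_itv.
apply: (@le_trans _ _ (\int[L n]_(U in cube) \prod_(i < n) g (U ord0 i))).
  apply: le_Rintegral => //; first exact: measurable_cube.
    apply: (integrable_cube (M := 1)); first exact: measurable_indic.
    by move=> U _; rewrite indicE; case: (_ \in _); rewrite ?normr1 ?normr0.
  move=> U cU; rewrite indicE; case: (boolP (U \in _)) => [|_]; last exact: prodr_ge0.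
  rewrite inE/= => SU; rewrite big1// => i _; rewrite /g indicE mem_itv_oo.
  have /andP[U0 ->] := cU i; rewrite andbT.
  suff -> : a < U ord0 i by [].
  have := le_lt_trans (jump_le_ssum U i) SU; rewrite /jump => h.
  have x0 : 0 < kap * n%:R * U ord0 i by rewrite mulr_gt0.
  rewrite ltr_pdivrMr// mulrC ltNge; apply/negP => h2.
  have := @powR_ge_base _ (- beta^-1) _ _ _ x0 h2.
  rewrite oppr_le0 invr_ge0 (ltW b0) => /(_ isT).
  rewrite -powRrM mulrNN divff ?gt_eqF// powRr1 ?(ltW r0)// leNgt.
  by rewrite h.
rewrite /Rintegral gp /=.
have -> : expR (- (r `^ (- beta) / kap)) = expR (- a) ^+ n.
  rewrite -expRM_natl mulrN /a; congr (expR (- _)); field.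
  by rewrite !gt_eqF.
by rewrite lerXn2r ?nnegrE ?expR_ge0 ?subr_ge0// expR_neg_ub.
Qed.

(** The sum reaches [r] with probability at least c1 r^(-beta), and exceeds B r with probability at
    most C1 (B r)^(-beta); a large [B] makes the second at most half of the first. *)
Lemma ssum_band : exists B c : R, [/\ 0 < B, 0 < c & forall n r,
  1 <= kap * n%:R -> 1 <= r ->
  c * r `^ (- beta) <=
  \int[L n]_(U in cube) (\1_[set U | r <= ssum U <= B * r] U : R)].
Proof.
pose c1 := expR (- kap^-1) / kap; pose C1 : R := (1 - expR (- 1))^-1.
have c10 : 0 < c1 by rewrite divr_gt0 ?expR_gt0.
have C10 : 0 < C1 by rewrite invr_gt0 subr_gt0 expRN1_lt1.
(* Solves C1 B^(-beta) = c1 / 2. *)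
pose B := (2 * C1 / c1) `^ beta^-1.
have B0 : 0 < B by rewrite powR_gt0// divr_gt0// mulr_gt0.
have BE : C1 * B `^ (- beta) = c1 / 2.
  rewrite /B -powRrM mulrN mulVf ?gt_eqF// powR_inv1; last first.
    by rewrite divr_ge0//; [rewrite mulr_ge0// ltW|exact: ltW].
  by field; rewrite (gt_eqF c10) (gt_eqF C10).
exists B, (c1 / 2); split=> //; first by rewrite divr_gt0.
move=> n r N1 r1; have r0 : 0 < r by exact: lt_le_trans r1.
have n0 : (0 < n)%N.
  rewrite lt0n; apply/eqP => nE; move: N1; rewrite nE mulr0; lra.
have mc := @measurable_cube R n.
have mS : measurable [set U : 'rV[R]_n | ssum U < r].
  rewrite (_ : [set U | _] = @ssum n @^-1` `]-oo, r[).
    by rewrite -[X in measurable X]setTI; apply: measurable_ssum.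
  by apply/seteqP; split=> U /=; rewrite in_itv.
have mB : measurable [set U : 'rV[R]_n | r <= ssum U <= B * r].
  rewrite (_ : [set U | _] = @ssum n @^-1` `[r, B * r]).
    by rewrite -[X in measurable X]setTI; apply: measurable_ssum.
  by apply/seteqP; split=> U /=; rewrite in_itv.
have Bri : 0 < (B * r)^-1 by rewrite invr_gt0 mulr_gt0.
have i1 A : measurable A -> (L n).-integrable cube (EFin \o (\1_A : 'rV[R]_n -> R)).
  move=> mA; apply: (integrable_cube (M := 1)); first exact: measurable_indic.
  by move=> U _; rewrite indicE; case: (_ \in _); rewrite ?normr1 ?normr0.
have i2 := integrable_1Bexp_ssum n (ltW Bri).
have ic : (L n).-integrable cube (EFin \o cst (1 : R)).
  by apply: (integrable_cube (M := 1)) => // U _; rewrite normr1.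
(* A minorant of the indicator of the band: beyond B r the last term is at least 1, by the choice of
   [C1]. *)
pose G (U : 'rV[R]_n) := cst 1 U - \1_[set U | ssum U < r] U - C1 * (1 - expR (- ((B * r)^-1 * ssum U))).
have iG : (L n).-integrable cube (EFin \o G).
  apply: integrableRB => //; first by apply: integrableRB => //; exact: i1.
  exact: integrableRZ.
apply: (@le_trans _ _ (\int[L n]_(U in cube) G U)); last first.
  apply: le_Rintegral => //; first exact: i1.
  move=> U cU; have S0 := ssum_ge0 U; rewrite /G /=.
  have e0 : 0 <= C1 * (1 - expR (- ((B * r)^-1 * ssum U))).
    by rewrite mulr_ge0 ?(ltW C10)// subr_ge0 exp_ssum_le1// ltW.
  rewrite !indicE; have [Sr|rS] := ltP (ssum U) r => /=.
    rewrite (mem_set (Sr : [set U | ssum U < r] U)) subrr sub0r.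
    by apply: (@le_trans _ _ 0); [rewrite oppr_le0|case: (_ \in _)].
  rewrite memNset ?subr0 => [|/=]; last by apply/negP; rewrite -leNgt.
  have [SB|BS] := leP (ssum U) (B * r).
    by rewrite mem_set /=; [rewrite gerBl|rewrite rS].
  rewrite memNset /= ?subr_le0; last by move=> /andP[_]; rewrite leNgt BS.
  rewrite -ler_pdivrMl// invrK mulr1 lerD2l lerN2 ler_expR lerN2.
  by rewrite mulrC ler_pdivlMr ?mul1r ?mulr_gt0// ltW.
rewrite RintegralB//; last 2 first.
- by apply: integrableRB => //; exact: i1.
- exact: integrableRZ.
rewrite RintegralB//; last exact: i1.
rewrite RintegralZl// Rintegral_cube_cst.
have h1 := ssum_lt_prob N1 r1.
have h2 := ssum_laplace_tail n0 Bri.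
have h3 : C1 * ((B * r)^-1) `^ beta = c1 / 2 * r `^ (- beta).
  rewrite -BE -mulrA -powRM ?(ltW B0) ?(ltW r0)// -[(B * r)^-1]powR_inv1 ?mulr_ge0 ?ltW//.
  by rewrite -powRrM mulN1r.
have h4 := ler_wpM2l (ltW C10) h2; rewrite h3 in h4.
have h5 : c1 * r `^ (- beta) <= 1 - expR (- (r `^ (- beta) / kap)).
  apply: le_trans (one_minus_expR_lb _).
  have rb1 : r `^ (- beta) <= 1 by rewrite -[leRHS](powRr0 r) ler_powR// oppr_le0 ltW.
  have -> : c1 * r `^ (- beta) = r `^ (- beta) / kap * expR (- kap^-1) by rewrite /c1; ring.
  rewrite ler_wpM2l ?divr_ge0 ?powR_ge0 ?(ltW k0)//.
  by rewrite ler_expR lerN2 ler_piMl ?invr_ge0 ?(ltW k0).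
lra.
Qed.

(* Up to a constant, [jint n d (dotp x x)] is the density at x of a centred
   Gaussian whose variance is twice the random time [ssum]; it tends to p(1, x). *)
Definition jint n D (A : R) : R := \int[L n]_(U in cube)
  ((Num.sqrt (ssum U))^-1 ^+ D * expR (- (A / (4 * ssum U)))).

Lemma measurable_jint n D A : measurable_fun setT (fun U : 'rV[R]_n =>
  (Num.sqrt (ssum U))^-1 ^+ D * expR (- (A / (4 * ssum U)))).
Proof.
have mV (f : 'rV[R]_n -> R) : measurable_fun setT f -> measurable_fun setT (fun U => (f U)^-1).
  by move=> mf; exact: (measurableT_comp measurable_invr mf).
apply: measurable_funM.
  apply: measurable_funX; apply: mV; apply: measurableT_comp (@measurable_ssum n).
  by apply: continuous_measurable_fun; exact: sqrt_continuous.
apply: measurableT_comp => //; apply: measurableT_comp => //.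
apply: measurable_funM => //; apply: mV; apply: measurable_funM => //.
exact: measurable_ssum.
Qed.

Lemma jint_integrand_ge0 n D A (U : 'rV[R]_n) :
  0 <= (Num.sqrt (ssum U))^-1 ^+ D * expR (- (A / (4 * ssum U))).
Proof. by rewrite mulr_ge0 ?expR_ge0// exprn_ge0// invr_ge0 sqrtr_ge0. Qed.

Lemma integrable_jint n D A : (0 < n)%N -> 0 <= A -> (L n).-integrable cube
  (EFin \o (fun U : 'rV[R]_n => (Num.sqrt (ssum U))^-1 ^+ D * expR (- (A / (4 * ssum U))))).
Proof.
move=> n0 A0; set m := (kap * n%:R) `^ (- beta^-1).
have m0 : 0 < m by rewrite powR_gt0// mulr_gt0// ltr0n.
apply: (integrable_cube (M := (Num.sqrt m)^-1 ^+ D)); first exact: measurable_jint.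
move=> U cU; rewrite ger0_norm ?jint_integrand_ge0//.
have Sm := ssum_lb n0 cU; have S0 := ssum_gt0 n0 cU.
rewrite -[leRHS]mulr1 ler_pM ?expR_ge0 ?exprn_ge0 ?invr_ge0 ?sqrtr_ge0//.
  rewrite lerXn2r ?nnegrE ?invr_ge0 ?sqrtr_ge0// lef_pV2 ?posrE ?sqrtr_gt0//.
  by rewrite ler_wsqrtr.
by rewrite -expR0 ler_expR oppr_le0 divr_ge0 ?mulr_ge0 ?(ltW S0).
Qed.

(** Only the event that [ssum] is comparable to 1 + A is kept: there the exponential is at least
    exp(-1/4), and by [ssum_band] the event has probability at least of order (1 + A)^(-beta). *)
Lemma jint_lb D : exists2 c : R, 0 < c & forall n A, 1 <= kap * n%:R -> 0 <= A ->
  c * (1 + A) `^ (- (D%:R / 2 + beta)) <= jint n D A.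
Proof.
have [B [c [B0 c0 band]]] := ssum_band.
exists ((Num.sqrt B)^-1 ^+ D * expR (- 4^-1) * c).
  by rewrite !mulr_gt0 ?expR_gt0// exprn_gt0// invr_gt0 sqrtr_gt0.
move=> n A N1 A0.
have n0 : (0 < n)%N.
  rewrite lt0n; apply/eqP => nE; move: N1; rewrite nE mulr0; lra.
set r := 1 + A; have r1 : 1 <= r by rewrite lerDl.
have r0 : 0 < r by exact: lt_le_trans r1.
have mB : measurable [set U : 'rV[R]_n | r <= ssum U <= B * r].
  rewrite (_ : [set U | _] = @ssum n @^-1` `[r, B * r]).
    by rewrite -[X in measurable X]setTI; apply: measurable_ssum.
  by apply/seteqP; split=> U /=; rewrite in_itv.
pose K := (Num.sqrt (B * r))^-1 ^+ D * expR (- 4^-1).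
have K0 : 0 <= K by rewrite mulr_ge0 ?expR_ge0// exprn_ge0// invr_ge0 sqrtr_ge0.
have i1 : (L n).-integrable cube (EFin \o (\1_[set U : 'rV[R]_n | r <= ssum U <= B * r] : _ -> R)).
  apply: (integrable_cube (M := 1)); first exact: measurable_indic.
  by move=> U _; rewrite indicE; case: (_ \in _); rewrite ?normr1 ?normr0.
apply: (@le_trans _ _ (K * \int[L n]_(U in cube) (\1_[set U | r <= ssum U <= B * r] U : R))).
  have -> : (Num.sqrt B)^-1 ^+ D * expR (- 4^-1) * c * r `^ (- (D%:R / 2 + beta)) =
    K * (c * r `^ (- beta)).
    rewrite /K opprD powRD; last by rewrite (gt_eqF r0) implybT.
    rewrite -sqrtVX// sqrtrM ?(ltW B0)// invfM exprMn.
    ring.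
  by rewrite ler_wpM2l// band.
rewrite -RintegralZl//; last exact: measurable_cube.
apply: le_Rintegral => //; first exact: measurable_cube.
- by apply: integrableRZ => //; exact: measurable_cube.
- exact: integrable_jint.
move=> U cU; rewrite indicE; case: (boolP (U \in _)) => [|_]; last by rewrite mulr0 jint_integrand_ge0.
rewrite inE/= => /andP[rS SB]; rewrite mulr1.
have S0 : 0 < ssum U by exact: lt_le_trans rS.
apply: ler_pM; rewrite ?expR_ge0 ?exprn_ge0 ?invr_ge0 ?sqrtr_ge0//.
  rewrite lerXn2r ?nnegrE ?invr_ge0 ?sqrtr_ge0// lef_pV2 ?posrE ?sqrtr_gt0 ?mulr_gt0//.
  by rewrite ler_wsqrtr.
rewrite ler_expR lerN2 invfM mulrCA ler_piMr// ler_pdivrMr// mul1r.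
by apply: le_trans rS; rewrite /r lerDr.
Qed.

End stable_sum.


Section ge0_tonelli.
Context d1 d2 (T1 : measurableType d1) (T2 : measurableType d2) (R : realType).
Variables (m1 : {sigma_finite_measure set T1 -> \bar R})
  (m2 : {sigma_finite_measure set T2 -> \bar R}).
Variables (D : set T1) (E : set T2) (f : T1 -> T2 -> R).
Hypotheses (mD : measurable D) (mE : measurable E).
Hypothesis mf : measurable_fun (D `*` E) (fun p => f p.1 p.2).
Hypothesis f0 : forall x y, D x -> E y -> 0 <= f x y.

Let g (p : T1 * T2) : R := ((fun p => f p.1 p.2) \_ (D `*` E)) p.

Let mg : measurable_fun setT (EFin \o g).
Proof.
by apply/measurable_EFinP/(measurable_restrictT _ _).1 => //; exact: measurableX.
Qed.

Let gE x y : g (x, y) = if (x \in D) && (y \in E) then f x y else 0.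
Proof. by rewrite /g patchE in_setX. Qed.

Let g0 p : (0 <= (EFin \o g) p)%E.
Proof.
case: p => x y; rewrite /= lee_fin gE; case: ifP => // /andP[]; rewrite !inE; exact: f0.
Qed.

Let gF x : (\int[m2]_y (g (x, y))%:E)%E =
  ((fun x => \int[m2]_(y in E) (f x y)%:E) \_ D)%E x.
Proof.
rewrite patchE; case: ifPn => xD.
  rewrite [RHS]integral_mkcond; apply: eq_integral => y _.
  by rewrite gE xD andTb patchE; case: ifP.
by apply: integral0_eq => y _; rewrite gE (negbTE xD).
Qed.

Let gG y : (\int[m1]_x (g (x, y))%:E)%E =
  ((fun y => \int[m1]_(x in D) (f x y)%:E) \_ E)%E y.
Proof.
rewrite patchE; case: ifPn => yE.
  rewrite [RHS]integral_mkcond; apply: eq_integral => x _.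
  by rewrite gE yE andbT patchE; case: ifP.
by apply: integral0_eq => x _; rewrite gE (negbTE yE) andbF.
Qed.

Lemma ge0_tonelli :
  (\int[m1]_(x in D) \int[m2]_(y in E) (f x y)%:E =
   \int[m2]_(y in E) \int[m1]_(x in D) (f x y)%:E)%E.
Proof.
rewrite [LHS]integral_mkcond [RHS]integral_mkcond.
have h := @fubini_tonelli _ _ _ _ _ m1 m2 _ mg g0.
apply: etrans (etrans h _); first by apply: eq_integral => x _; rewrite -gF.
by apply: eq_integral => y _; exact: gG.
Qed.

Lemma measurable_tonelli2 :
  measurable_fun E (fun y => \int[m1]_(x in D) (f x y)%:E)%E.
Proof.
apply/(measurable_restrictT _ mE).2 => //.
have := measurable_fun_fubini_tonelli_G (m1 := m1) _ mg g0.
congr (measurable_fun _ _); apply/funext => y; exact: gG.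
Qed.

Lemma measurable_tonelli1 :
  measurable_fun D (fun x => \int[m2]_(y in E) (f x y)%:E)%E.
Proof.
apply/(measurable_restrictT _ mD).2 => //.
have := measurable_fun_fubini_tonelli_F (m2 := m2) _ mg g0.
congr (measurable_fun _ _); apply/funext => x; exact: gF.
Qed.

End ge0_tonelli.

Section Rfubini_bound.
Context d1 d2 (T1 : measurableType d1) (T2 : measurableType d2) (R : realType).

Lemma integral_norm_le (m2 : {measure set T2 -> \bar R}) (E : set T2) (f g : T2 -> R) :
  measurable E -> measurable_fun E f -> (forall y, E y -> `|f y| <= g y) ->
  m2.-integrable E (EFin \o g) ->
  (\int[m2]_(y in E) `|f y|%:E <= (\int[m2]_(y in E) g y)%:E)%E.
Proof.
move=> mE mf fg ig; rewrite EFin_Rintegral//; apply: ge0_le_integral => //.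
- by apply/measurable_EFinP; exact: measurableT_comp.
- by have /integrableP[] := ig.
Qed.

Variables (m1 : {sigma_finite_measure set T1 -> \bar R})
  (m2 : {sigma_finite_measure set T2 -> \bar R}).

Lemma fubini_bound (D : set T1) (E : set T2) (f : T1 -> T2 -> R) (h : T1 -> R) :
  measurable D -> measurable E ->
  measurable_fun (D `*` E) (fun p => f p.1 p.2) ->
  (forall x, D x -> (\int[m2]_(y in E) `|f x y|%:E <= (h x)%:E)%E) ->
  m1.-integrable D (EFin \o h) ->
  (\int[m1]_(x in D) \int[m2]_(y in E) `|f x y|%:E < +oo)%E.
Proof.
move=> mD mE mf fh ih; apply: (@le_lt_trans _ _ (\int[m1]_(x in D) (h x)%:E)%E).
  apply: ge0_le_integral => //.
  - by move=> x _; apply: integral_ge0.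
  - apply: (measurable_tonelli1 m2 mD mE (f := fun x y => `|f x y|)) => //.
    exact: measurableT_comp.
  - by have /integrableP[] := ih.
by rewrite -EFin_Rintegral// ltry.
Qed.

End Rfubini_bound.

Section jump_integral_bound.
Context {R : realType}.
Variable beta : R.
Hypothesis beta01 : 0 < beta < 1.
Hypothesis beta_ge : 2^-1 <= beta.
Local Notation mu := (@lebesgue_measure R).
Local Notation L := (@lebesgue_rV R).

Lemma exprDn_expR_le (y : R) (k : nat) : 0 <= y -> (0 < k)%N ->
  (1 + y) ^+ k <= (4 * k%:R) ^+ k * expR (y / 4).
Proof.
move=> y0 k0; have K0 : 1 <= k%:R :> R by rewrite ler1n.
have Kp : 0 < k%:R :> R by rewrite ltr0n.
have -> : expR (y / 4) = expR (y / (4 * k%:R)) ^+ k.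
  by rewrite -expRM_natl; congr expR; field; rewrite gt_eqF.
rewrite -exprMn lerXn2r ?nnegrE ?mulr_ge0 ?addr_ge0 ?expR_ge0//.
have := expR_ge1Dx (y / (4 * k%:R)) => h.
apply: (@le_trans _ _ (4 * k%:R * (1 + y / (4 * k%:R)))); last first.
  by rewrite ler_wpM2l// mulr_ge0.
rewrite mulrDr mulr1 mulrCA divff ?mulr1; last by rewrite mulf_neq0// gt_eqF.
by rewrite lerD2r; lra.
Qed.

(** In terms of y = A / S the left-hand side is A^(-D/2) y^(D/2) exp(- y/4). The exponential absorbs
    y^(D/2) (1 + y), and the remaining 1 / (1 + y) is at most 1 - exp(- S / A), whose expectation is
    at most A^(-beta). *)
Lemma jint_integrand_ub D (A S : R) : 0 < A -> 0 < S ->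
  (Num.sqrt S)^-1 ^+ D * expR (- (A / (4 * S))) <=
  (4 * D.+1%:R) ^+ D.+1 * A `^ (- (D%:R / 2)) * (1 - expR (- (A^-1 * S))).
Proof.
move=> A0 S0; set y := A / S.
have y0 : 0 < y by rewrite divr_gt0.
have SE : S = A / y by rewrite /y; field; rewrite !gt_eqF.
have v0 : A^-1 * S = y^-1 by rewrite /y; field; rewrite !gt_eqF.
have hexp : (1 + y)^-1 <= 1 - expR (- (A^-1 * S)).
  rewrite v0 expRN lerBrDl -lerBrDr.
  have -> : 1 - (1 + y)^-1 = (1 + y^-1)^-1.
    by field; rewrite !gt_eqF// ?addr_gt0// invr_gt0.
  rewrite lef_pV2 ?posrE ?expR_gt0 ?expR_ge1Dx//.
  by rewrite addr_gt0// invr_gt0.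
have -> : (Num.sqrt S)^-1 ^+ D = A `^ (- (D%:R / 2)) * (Num.sqrt y) ^+ D.
  rewrite -sqrtVX// {1}SE sqrtrM ?(ltW A0)// sqrtrV ?(ltW y0)// invfM invrK exprMn.
  by rewrite mulrC.
have yE : A / (4 * S) = y / 4 by rewrite /y; field; rewrite gt_eqF.
rewrite {}yE -[leLHS]mulrA [leRHS](_ : _ = A `^ (- (D%:R / 2)) *
  ((4 * D.+1%:R) ^+ D.+1 * (1 - expR (- (A^-1 * S))))); last by rewrite [RHS]mulrCA mulrA.
rewrite ler_wpM2l ?powR_ge0//.
apply: (@le_trans _ _ ((4 * D.+1%:R) ^+ D.+1 * (1 + y)^-1)); last first.
  by rewrite ler_wpM2l// exprn_ge0// mulr_ge0.
rewrite ler_pdivlMr ?addr_gt0// mulrAC expRN ler_pdivrMr ?expR_gt0//.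
apply: le_trans (exprDn_expR_le (ltW y0) (ltn0Sn D)).
rewrite exprSr ler_wpM2r ?addr_ge0 ?(ltW y0)//.
rewrite lerXn2r ?nnegrE ?sqrtr_ge0 ?addr_ge0 ?(ltW y0)//.
apply: (@le_trans _ _ (Num.sqrt ((1 + y) ^+ 2))).
  by rewrite ler_wsqrtr//; nra.
by rewrite sqrtr_sqr ger0_norm// addr_ge0// ltW.
Qed.

(** Negative moments of the sum, uniformly in [n]: S^(-D/2) is, up to a constant, the integral of
    exp(- S |xi|^2) over R^D; once the integrals are exchanged, [psi_ub0] bounds the Laplace
    transform by an integrable function of xi. *)
Lemma jint0_ub D : exists2 C : R, 0 < C & forall n, (0 < n)%N -> jint beta n D 0 <= C.
Proof.
have c0 := psi_rate_gt0 beta01.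
pose I : R := \int[L D]_xi expR (- (psi_rate beta * (dotp xi xi) `^ beta)).
have iI : (L D).-integrable setT
  (EFin \o (fun xi : 'rV[R]_D => expR (- (psi_rate beta * (dotp xi xi) `^ beta)))).
  exact: integrable_stretched0.
have pD : 0 < Num.sqrt pi ^+ D :> R by rewrite exprn_gt0// sqrtr_gt0 pi_gt0.
exists ((Num.sqrt pi ^+ D)^-1 * (I + 1)).
  rewrite mulr_gt0 ?invr_gt0// ltr_wpDl// Rintegral_ge0// => x _; exact: expR_ge0.
move=> n n0; rewrite ler_pdivlMl//.
apply: (@le_trans _ _ I); last by rewrite lerDl.
have mc := @measurable_cube R n.
rewrite -lee_fin EFin_Rintegral// EFinM EFin_Rintegral//; last exact: integrable_jint.
rewrite -integralZl//; last exact: integrable_jint.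
have -> : (\int[L n]_(U in cube) ((Num.sqrt pi ^+ D)%:E *
    ((Num.sqrt (ssum beta U))^-1 ^+ D * expR (- (0 / (4 * ssum beta U))))%:E) =
  \int[L n]_(U in cube) \int[L D]_(xi in setT) (expR (- (ssum beta U * dotp xi xi)))%:E)%E.
  apply: eq_integral => U; rewrite inE => cU; have S0 := ssum_gt0 beta01 n0 cU.
  rewrite (integral_gaussd S0) mul0r oppr0 expR0 mulr1 -EFinM -exprMn; congr (_ ^+ D)%:E.
  by rewrite -sqrtrV ?(ltW S0)// -sqrtrM// ltW// pi_gt0.
have mf : measurable_fun (cube `*` setT) (fun p : 'rV[R]_n * 'rV[R]_D =>
    expR (- (ssum beta p.1 * dotp p.2 p.2))).
  apply: (@measurable_funS _ _ _ _ setT) => //.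
  apply: measurableT_comp => //; apply: measurableT_comp => //; apply: measurable_funM.
    by apply: (measurableT_comp (@measurable_ssum _ beta n)).
  exact: (measurableT_comp (@measurable_nsq R D)).
have pos (U : 'rV[R]_n) (xi : 'rV[R]_D) : cube U -> [set: 'rV[R]_D] xi ->
    0 <= expR (- (ssum beta U * dotp xi xi)) by move=> _ _; exact: expR_ge0.
rewrite (ge0_tonelli (L n) (L D) mc measurableT mf pos).
apply: ge0_le_integral => //.
- by move=> xi _; apply: integral_ge0 => U _; rewrite lee_fin expR_ge0.
- exact: (measurable_tonelli2 (L n) mc measurableT mf pos).
- by have /integrableP[] := iI.
move=> xi _; under eq_integral do rewrite mulrC.
by rewrite ssum_laplaceE ?dotp_ge0// lee_fin psi_ub0// dotp_ge0.
Qed.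

(** For A <= 1 the exponential is discarded and [jint0_ub] applies; for larger A,
    [jint_integrand_ub] reduces the claim to the tail estimate [ssum_laplace_tail]. *)
Lemma jint_ub D : exists2 C : R, 0 < C & forall n A, (0 < n)%N -> 0 <= A ->
  jint beta n D A <= C * (1 + A) `^ (- (D%:R / 2 + beta)).
Proof.
have [b0 b1] := andP beta01.
have [C0 C00 hC0] := jint0_ub D.
pose K : R := (4 * D.+1%:R) ^+ D.+1.
have K0 : 0 < K by rewrite exprn_gt0// mulr_gt0.
pose p := D%:R / 2 + beta; have p0 : 0 <= p by rewrite addr_ge0 ?divr_ge0 ?(ltW b0).
exists ((C0 + K) * 2 `^ p); first by rewrite mulr_gt0 ?addr_gt0 ?powR_gt0.
move=> n A n0 A0; have mc := @measurable_cube R n.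
have [A1|A1] := leP A 1.
  apply: (@le_trans _ _ C0).
    apply: le_trans (hC0 n n0); apply: le_Rintegral => //; try exact: integrable_jint.
    move=> U cU; have S0 := ssum_gt0 beta01 n0 cU.
    rewrite ler_wpM2l ?exprn_ge0 ?invr_ge0 ?sqrtr_ge0// ler_expR lerN2 mul0r.
    by rewrite divr_ge0// mulr_ge0// ltW.
  rewrite -mulrA powRN; apply: (@le_trans _ _ ((C0 + K) * 1)); first by rewrite mulr1 lerDl ltW.
  rewrite ler_wpM2l ?addr_ge0 ?(ltW C00) ?(ltW K0)// ler_pdivlMr ?powR_gt0 ?ltr_pwDl// mul1r.
  by apply: powR_le_base => //; [rewrite addr_ge0|lra].
have Ap : 0 < A by exact: lt_trans A1.
apply: (@le_trans _ _ (\int[L n]_(U in cube) (K * A `^ (- (D%:R / 2)) * (1 - expR (- (A^-1 * ssum beta U)))))).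
  apply: le_Rintegral => //; first exact: integrable_jint.
    by apply: integrableRZ => //; apply: integrable_1Bexp_ssum; rewrite invr_ge0.
  by move=> U cU; apply: jint_integrand_ub => //; exact: ssum_gt0.
rewrite RintegralZl//; last by apply: integrable_1Bexp_ssum; rewrite invr_ge0.
have hl := ssum_laplace_tail beta01 n0 (l := A^-1).
rewrite invr_gt0 in hl; have {}hl := hl Ap.
apply: (@le_trans _ _ (K * A `^ (- (D%:R / 2)) * A^-1 `^ beta)).
  by rewrite ler_wpM2l// mulr_ge0 ?powR_ge0// ltW.
have -> : K * A `^ (- (D%:R / 2)) * A^-1 `^ beta = K * A `^ (- p).
  rewrite -[A^-1]powR_inv1 ?(ltW Ap)// -powRrM mulN1r -mulrA -powRD -?opprD//.
  by rewrite (gt_eqF Ap) implybT.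
rewrite -mulrA; apply: ler_pM; rewrite ?powR_ge0 ?(ltW K0)//; first by rewrite lerDr ltW.
rewrite !powRN -[leLHS]mul1r ler_pdivrMr ?powR_gt0// mulrAC ler_pdivlMr ?powR_gt0 ?addr_gt0//.
by rewrite mul1r -powRM ?(ltW Ap)//; apply: powR_le_base => //; [rewrite addr_ge0|lra].
Qed.

End jump_integral_bound.


Lemma exists_large_nat {R : realType} (k : R) : 0 < k ->
  \forall n \near \oo, 1 <= k * n.+1%:R.
Proof.
move=> k0; near=> n; rewrite -ler_pdivrMl// mulr1.
apply: (@le_trans _ _ n%:R); last by rewrite ler_nat.
by near: n; exact: nbhs_infty_ger.
Unshelve. all: by end_near. Qed.

(** * The stable heat kernel *)

Section stable_density.
Context {R : realType} (d : nat).
Variable beta : R.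
Hypothesis beta01 : 0 < beta < 1.
Hypothesis beta_ge : 2^-1 <= beta.
Local Notation L := (@lebesgue_rV R).
Local Notation kap := (kap beta).
Implicit Types x y xi : 'rV[R]_d.

Let b0 : 0 < beta. Proof. by case/andP: beta01. Qed.

Lemma integrable_jint_gauss n D A : (0 < n)%N -> 0 <= A -> (L n).-integrable cube
  (EFin \o (fun U => Num.sqrt (pi / ssum beta U) ^+ D * expR (- (A / (4 * ssum beta U))))).
Proof.
move=> n0 A0; have mc := @measurable_cube R n.
have := integrableRZ mc (Num.sqrt pi ^+ D) (integrable_jint beta01 D n0 A0).
apply: eq_integrable => // U; rewrite inE => cU; have S0 := ssum_gt0 beta01 n0 cU.
by rewrite /= sqrtrM ?pi_ge0// sqrtrV ?(ltW S0)// exprMn -mulrA.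
Qed.

Lemma jint_gauss n D A : (0 < n)%N -> 0 <= A ->
  \int[L n]_(U in cube) (Num.sqrt (pi / ssum beta U) ^+ D * expR (- (A / (4 * ssum beta U))))
   = Num.sqrt pi ^+ D * jint beta n D A.
Proof.
move=> n0 A0; have mc := @measurable_cube R n.
rewrite /jint -RintegralZl//; last exact: integrable_jint.
apply: eq_Rintegral => U; rewrite inE => cU; have S0 := ssum_gt0 beta01 n0 cU.
by rewrite sqrtrM ?pi_ge0// sqrtrV ?(ltW S0)// exprMn -mulrA.
Qed.

Lemma measurable_cos_dotp x : measurable_fun setT (fun xi => cos (dotp x xi)).
Proof. by apply: measurableT_comp; [exact: measurable_cos|exact: measurable_dotp]. Qed.

Lemma jint_fourier n x : (0 < n)%N ->
  \int[L d]_xi (cos (dotp x xi) * psi beta n (dotp xi xi) ^+ n) =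
  Num.sqrt pi ^+ d * jint beta n d (dotp x x).
Proof.
move=> n0; have mc := @measurable_cube R n.
pose f (U : 'rV[R]_n) xi := cos (dotp x xi) * expR (- (ssum beta U * dotp xi xi)).
have mf : measurable_fun (cube `*` setT) (fun p : 'rV[R]_n * 'rV[R]_d => f p.1 p.2).
  apply: (@measurable_funS _ _ _ _ setT) => //; apply: measurable_funM.
    by apply: (measurableT_comp (measurable_cos_dotp x)).
  apply: measurableT_comp => //; apply: measurableT_comp => //; apply: measurable_funM.
    by apply: (measurableT_comp (@measurable_ssum _ beta n)).
  exact: (measurableT_comp (@measurable_nsq R d)).
have intf : (\int[L n]_(U in cube) \int[L d]_(xi in setT) `|f U xi|%:E < +oo)%E.
  apply: (fubini_bound mc measurableT mf); last exact: (integrable_jint_gauss d n0 (lexx 0)).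
  move=> U cU; have S0 := ssum_gt0 beta01 n0 cU.
  rewrite mul0r oppr0 expR0 mulr1 -(integral_gaussd S0).
  rewrite -(EFin_Rintegral measurableT (integrable_gaussd S0 d)).
  apply: integral_norm_le => //.
  - apply: measurable_funM; first exact: measurable_cos_dotp.
    by apply: (measurable_gaussd (ssum beta U)).
  - move=> xi _; rewrite /f normrM [X in _ * X]ger0_norm ?expR_ge0//.
    by rewrite ler_piMl ?expR_ge0// ler_norml cos_geN1 cos_le1.
  - exact: (integrable_gaussd S0 d).
have := Rintegral_fubini mc measurableT mf intf.
have -> : \int[L n]_(U in cube) (\int[L d]_xi f U xi) = Num.sqrt pi ^+ d * jint beta n d (dotp x x).
  rewrite -jint_gauss ?dotp_ge0//; apply: eq_Rintegral => U; rewrite inE => cU.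
  have S0 := ssum_gt0 beta01 n0 cU.
  have := integral_cosD_gaussd S0 0 x; rewrite cos0 mul1r /Rintegral /f => h.
  by under eq_integral do rewrite -[dotp x _]add0r; rewrite h.
move=> ->; apply: eq_Rintegral => xi _; rewrite -(ssum_laplace beta) ?dotp_ge0//.
rewrite -RintegralZl; [|exact: mc|by apply: integrable_exp_ssum; rewrite ?dotp_ge0].
by apply: eq_Rintegral => U _; rewrite /f [ssum _ _ * _]mulrC.
Qed.

(** Together with [jint_fourier] this is Fourier inversion for the mixture, checked by hand on
    Gaussians; the limit in [n] yields it for the stable kernel ([hk1_fourier]). *)
Lemma integral_jint_cos n xi : (0 < n)%N ->
  (L d).-integrable setT (EFin \o (fun x => jint beta n d (dotp x x))) /\
  \int[L d]_x (cos (dotp xi x) * jint beta n d (dotp x x)) =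
  Num.sqrt (4 * pi) ^+ d * psi beta n (dotp xi xi) ^+ n.
Proof.
move=> n0; have mc := @measurable_cube R n.
pose g (x : 'rV[R]_d) (U : 'rV[R]_n) := (Num.sqrt (ssum beta U))^-1 ^+ d *
  expR (- (dotp x x / (4 * ssum beta U))).
pose f z x U := cos (dotp z x) * g x U.
have mg : measurable_fun setT (fun p : 'rV[R]_d * 'rV[R]_n => g p.1 p.2).
  have mS : measurable_fun setT (fun p : 'rV[R]_d * 'rV[R]_n => ssum beta p.2).
    by apply: (measurableT_comp (@measurable_ssum _ beta n)).
  apply: measurable_funM.
    apply: measurable_funX; apply: (measurableT_comp measurable_invr).
    by apply: measurableT_comp mS; apply: continuous_measurable_fun; exact: sqrt_continuous.
  apply: measurableT_comp => //; apply: measurableT_comp => //; apply: measurable_funM.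
    exact: (measurableT_comp (@measurable_nsq R d)).
  by apply: (measurableT_comp measurable_invr); exact: measurable_funM.
have mf z : measurable_fun (setT `*` cube) (fun p : 'rV[R]_d * 'rV[R]_n => f z p.1 p.2).
  apply: (@measurable_funS _ _ _ _ setT) => //; apply: measurable_funM => //.
  by apply: (measurableT_comp (measurable_cos_dotp z)).
have g0 x U : 0 <= g x U by exact: jint_integrand_ge0.
have gE U x : cube U -> g x U = (Num.sqrt (ssum beta U))^-1 ^+ d * gaussd (4 * ssum beta U)^-1 x.
  by move=> _; rewrite /g /gaussd [dotp x x / _]mulrC.
have Ei (U : 'rV[R]_n) : cube U -> 0 < (4 * ssum beta U)^-1.
  by move=> cU; rewrite invr_gt0 mulr_gt0// (ssum_gt0 beta01).
have cstE (U : 'rV[R]_n) : cube U -> (Num.sqrt (ssum beta U))^-1 ^+ d * Num.sqrt (pi / (4 * ssum beta U)^-1) ^+ d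
  = Num.sqrt (4 * pi) ^+ d.
  move=> cU; have S0 := ssum_gt0 beta01 n0 cU; rewrite -exprMn; congr (_ ^+ d).
  rewrite invrK mulrA [pi * 4]mulrC sqrtrM ?mulr_ge0 ?pi_ge0// mulrCA mulVf ?mulr1//.
  by rewrite gt_eqF// sqrtr_gt0.
have gt U z : cube U -> (\int[L d]_x (f z x U)%:E =
    (Num.sqrt (4 * pi) ^+ d * expR (- (dotp z z * ssum beta U)))%:E)%E.
  move=> cU; have S0 := ssum_gt0 beta01 n0 cU.
  have := integral_cosD_gaussd (Ei U cU) 0 z; rewrite cos0 mul1r => h.
  rewrite -(cstE U cU) -mulrA EFinM.
  have -> : dotp z z * ssum beta U = dotp z z / (4 * (4 * ssum beta U)^-1).
    by field; rewrite gt_eqF.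
  rewrite -h -(integralZl measurableT (integrable_cosD_gaussd (Ei U cU) 0 z)).
  apply: eq_integral => x _; rewrite /f gE// /= add0r -EFinM.
  by rewrite mulrCA.
have int0 : (\int[L d]_(x in setT) \int[L n]_(U in cube) (f 0 x U)%:E =
   (Num.sqrt (4 * pi) ^+ d)%:E)%E.
  rewrite (ge0_tonelli (L d) (L n) measurableT mc (mf 0)); last first.
    by move=> x U _ _; rewrite /f dotp0l cos0 mul1r.
  rewrite (eq_integral (cst (Num.sqrt (4 * pi) ^+ d)%:E)); last first.
    by move=> U; rewrite inE => cU; rewrite gt// dotp0l mul0r oppr0 expR0 mulr1.
  by rewrite integral_cst//= [X in (_ * X)%E]lebesgue_cube mule1.
have mf1 z x : measurable_fun cube (f z x).
  apply: (@measurable_funS _ _ _ _ setT) => //; apply: measurable_funM => //.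
  exact: measurable_jint.
have intf z : (\int[L d]_(x in setT) \int[L n]_(U in cube) `|f z x U|%:E < +oo)%E.
  apply: (@le_lt_trans _ _ (Num.sqrt (4 * pi) ^+ d)%:E); last exact: ltry.
  rewrite -int0; apply: ge0_le_integral => //.
  - by move=> x _; apply: integral_ge0.
  - apply: (measurable_tonelli1 (L n) measurableT mc (f := fun x U => `|f z x U|)) => //.
    by apply: measurableT_comp (mf z).
  - apply: (measurable_tonelli1 (L n) measurableT mc (mf 0)) => //.
    by move=> x U _ _; rewrite /f dotp0l cos0 mul1r.
  move=> x _; apply: ge0_le_integral => //.
  - apply/measurable_EFinP/measurableT_comp => //; exact: mf1.
  - by apply/measurable_EFinP; exact: mf1.
  move=> U _; rewrite lee_fin /f dotp0l cos0 mul1r normrM [X in _ * X]ger0_norm//.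
  by rewrite ler_piMl// ler_norml cos_geN1 cos_le1.
have jE x : jint beta n d (dotp x x) = \int[L n]_(U in cube) f 0 x U.
  by apply: eq_Rintegral => U _; rewrite /f dotp0l cos0 mul1r.
have jZ x : cos (dotp xi x) * jint beta n d (dotp x x) = \int[L n]_(U in cube) f xi x U.
  rewrite /jint -RintegralZl//; last exact: (integrable_jint beta01 d n0 (dotp_ge0 x)).
split.
  under [X in _.-integrable _ X]eq_fun do rewrite /= jE.
  exact: (integrable_Rintegral1 measurableT mc (mf 0) (intf 0)).
under eq_Rintegral do rewrite jZ.
rewrite (Rintegral_fubini measurableT mc (mf xi) (intf xi)).
rewrite -(ssum_laplace beta) ?dotp_ge0// -RintegralZl//; last first.
  by apply: integrable_exp_ssum; rewrite ?dotp_ge0.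
by apply: eq_Rintegral => U; rewrite inE => cU; rewrite /Rintegral gt.
Qed.

(* [hk (alpha / 2) t] is p(t, .). *)
Definition hk (t : R) x : R := (2 * pi) ^- d *
  \int[L d]_xi (cos (dotp x xi) * expR (- (t * (dotp xi xi) `^ beta))).

Let kd : R := (2 * pi) ^- d * Num.sqrt pi ^+ d.

Let twopi_gt0 : 0 < 2 * pi :> R. Proof. by rewrite mulr_gt0// pi_gt0. Qed.

Let kd0 : 0 < kd.
Proof. by rewrite mulr_gt0 ?invr_gt0 ?exprn_gt0// ?sqrtr_gt0 ?pi_gt0. Qed.

Let kdE : kd * Num.sqrt (4 * pi) ^+ d = 1.
Proof.
rewrite /kd -mulrA -exprMn -sqrtrM ?pi_ge0// mulrCA -expr2.
have -> : (4 * pi ^+ 2 : R) = (2 * pi) ^+ 2 by ring.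
by rewrite sqrtr_sqr ger0_norm ?(ltW twopi_gt0)// mulVf// gt_eqF// exprn_gt0.
Qed.

Lemma measurable_psi n : measurable_fun setT (fun xi => psi beta n.+1 (dotp xi xi) ^+ n.+1).
Proof.
have mc := @measurable_cube R n.+1.
have mf : measurable_fun (cube `*` setT) (fun p : 'rV[R]_n.+1 * 'rV[R]_d =>
    expR (- (ssum beta p.1 * dotp p.2 p.2))).
  apply: (@measurable_funS _ _ _ _ setT) => //.
  apply: measurableT_comp => //; apply: measurableT_comp => //; apply: measurable_funM.
    by apply: (measurableT_comp (@measurable_ssum _ beta n.+1)).
  exact: (measurableT_comp (@measurable_nsq R d)).
have pos (U : 'rV[R]_n.+1) xi : cube U -> [set: 'rV[R]_d] xi ->
    0 <= expR (- (ssum beta U * dotp xi xi)) by move=> _ _; exact: expR_ge0.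
have := measurable_tonelli2 (L n.+1) mc measurableT mf pos.
move/(measurableT_comp (fine_measurable measurableT)); congr (measurable_fun _ _).
apply/funext => xi /=; rewrite -(ssum_laplace beta) ?dotp_ge0// /Rintegral.
by congr fine; apply: eq_integral => U _; rewrite mulrC.
Qed.

Lemma jint_cvg x : kd * jint beta n.+1 d (dotp x x) @[n --> \oo] --> hk 1 x.
Proof.
have c0 := psi_rate_gt0 beta01.
have := @Rintegral_dct _ _ _ (L d) setT measurableT
  (fun n xi => cos (dotp x xi) * psi beta n.+1 (dotp xi xi) ^+ n.+1)
  (fun xi => cos (dotp x xi) * expR (- (1 * (dotp xi xi) `^ beta)))
  (fun xi => expR (- (psi_rate beta * (dotp xi xi) `^ beta))).
case.
- by move=> n; apply: measurable_funM; [exact: measurable_cos_dotp|exact: measurable_psi].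
- move=> xi _; apply: cvgMr; rewrite mul1r.
  have [->|xi0] := eqVneq (dotp xi xi) 0.
    rewrite powR0 ?gt_eqF// oppr0 expR0; under eq_fun do rewrite psi0 expr1n; exact: cvg_cst.
  by apply: psi_cvg => //; rewrite lt_def xi0 dotp_ge0.
- exact: integrable_stretched0.
- move=> n xi _; rewrite normrM; apply: (@le_trans _ _ (1 * psi beta n.+1 (dotp xi xi) ^+ n.+1)).
    rewrite [X in _ * X <= _]ger0_norm ?exprn_ge0 ?psi_ge0//.
    by rewrite ler_wpM2r ?exprn_ge0 ?psi_ge0// ler_norml cos_geN1 cos_le1.
  by rewrite mul1r; apply: psi_ub0; rewrite ?dotp_ge0.
move=> _ h _; rewrite /hk.
have -> : (fun n => kd * jint beta n.+1 d (dotp x x)) = (fun n => (2 * pi) ^- d *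
   \int[L d]_xi (cos (dotp x xi) * psi beta n.+1 (dotp xi xi) ^+ n.+1)).
  by apply/funext => n; rewrite jint_fourier// mulrA.
exact: cvgMr.
Qed.

Let N1 := exists_large_nat (kap_gt0 beta01).

Lemma hk1_lb : exists2 c : R, 0 < c &
  forall x, c * (1 + dotp x x) `^ (- (d%:R / 2 + beta)) <= hk 1 x.
Proof.
have [c c0 h] := jint_lb beta01 d; exists (kd * c); first exact: mulr_gt0.
move=> x; have cv := @jint_cvg x; apply: (cvgr_to_ge cv).
near=> n; rewrite -mulrA ler_wpM2l ?(ltW kd0)// h ?dotp_ge0//.
by near: n; exact: N1.
Unshelve. all: by end_near. Qed.

(** With v = (A' - A) / (4 S) this is v exp(- v) <= 1 - exp(- v) <= v under the integral; the factor
    1 / S in v raises the dimension parameter from [d] to [d.+2]. This is why [jint] has a parameter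
    [D] of its own. *)
Lemma jint_diff n A A' : (0 < n)%N -> 0 <= A -> A <= A' ->
  (A' - A) / 4 * jint beta n d.+2 A' <= jint beta n d A - jint beta n d A' <=
  (A' - A) / 4 * jint beta n d.+2 A.
Proof.
move=> n0 A0 AA; have A'0 := le_trans A0 AA; have mc := @measurable_cube R n.
rewrite /jint -RintegralB//; try exact: integrable_jint.
have D0 : 0 <= (A' - A) / 4 by rewrite divr_ge0 ?subr_ge0.
have key (S : R) : 0 < S -> forall q e, q = (Num.sqrt S)^-1 -> e = (fun a : R => expR (- (a / (4 * S)))) ->
  (A' - A) / 4 * (q ^+ d.+2 * e A') <= q ^+ d * e A - q ^+ d * e A' <=
  (A' - A) / 4 * (q ^+ d.+2 * e A).
  move=> S0 q e qE eE'; have q2 : q ^+ 2 = S^-1 by rewrite qE exprVn sqr_sqrtr// ltW.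
  have q0 : 0 <= q ^+ d by rewrite exprn_ge0// qE invr_ge0 sqrtr_ge0.
  pose v := (A' - A) / (4 * S).
  have eE : e A' = e A * expR (- v).
    by rewrite eE' -expRD; congr expR; rewrite /v; field; rewrite gt_eqF.
  have -> : q ^+ d.+2 = q ^+ d * S^-1 by rewrite -q2 -exprD addn2.
  have eA0 : 0 <= q ^+ d * e A by rewrite mulr_ge0// eE' expR_ge0.
  have -> : q ^+ d * e A - q ^+ d * e A' = q ^+ d * e A * (1 - expR (- v)).
    by rewrite eE; ring.
  have -> : (A' - A) / 4 * (q ^+ d * S^-1 * e A') = q ^+ d * e A * (v * expR (- v)).
    by rewrite eE /v; field; rewrite gt_eqF.
  have -> : (A' - A) / 4 * (q ^+ d * S^-1 * e A) = q ^+ d * e A * v.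
    by rewrite /v; field; rewrite gt_eqF.
  rewrite !ler_wpM2l ?one_minus_expR_lb//.
  by rewrite lerBlDl -lerBlDr expR_neg_ub.
rewrite -!RintegralZl//; try exact: integrable_jint.
apply/andP; split; apply: le_Rintegral => //.
all: try by apply: integrableRZ => //; exact: integrable_jint.
all: try by apply: integrableRB => //; exact: integrable_jint.
- by move=> U cU; have /andP[] := key _ (ssum_gt0 beta01 n0 cU) _ _ erefl erefl.
- by move=> U cU; have /andP[] := key _ (ssum_gt0 beta01 n0 cU) _ _ erefl erefl.
Qed.

(** As a function of |x|^2 the kernel has, up to a constant, minus the kernel of dimension d + 2 as
    derivative; [jint_lb] and [jint_ub] for [d.+2] bound it on both sides. Stated for increments,
    the estimate passes to the limit in [n] directly. *)
Lemma hk1_sandwich : exists c C : R, [/\ 0 < c, 0 < C & forall x y,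
  dotp x x <= dotp y y ->
  c * ((dotp y y - dotp x x) * (1 + dotp y y) `^ (- (d%:R / 2 + 1 + beta)))
    <= hk 1 x - hk 1 y <=
  C * ((dotp y y - dotp x x) * (1 + dotp x x) `^ (- (d%:R / 2 + 1 + beta)))].
Proof.
have [c c0 hc] := jint_lb beta01 d.+2; have [C C0 hC] := jint_ub beta01 beta_ge d.+2.
exists (kd * (c / 4)), (kd * (C / 4)); split; rewrite ?(mulr_gt0 kd0) ?divr_gt0//.
have DE : d%:R / 2 + 1 + beta = d.+2%:R / 2 + beta :> R.
  by congr (_ + _); rewrite -addn2 natrD; field.
move=> x y xy; rewrite DE; have D0 : 0 <= (dotp y y - dotp x x) / 4 by rewrite divr_ge0 ?subr_ge0.
have cv : kd * (jint beta n.+1 d (dotp x x) - jint beta n.+1 d (dotp y y)) @[n --> \oo] -->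
    hk 1 x - hk 1 y.
  under eq_fun do rewrite mulrBr; apply: cvgB; exact: jint_cvg.
apply/andP; split.
  apply: (cvgr_to_ge cv); near=> n.
  have /andP[h _] := jint_diff (ltn0Sn n) (dotp_ge0 x) xy.
  rewrite -mulrA ler_wpM2l ?(ltW kd0)//; apply: le_trans h.
  apply: (@le_trans _ _ ((dotp y y - dotp x x) / 4 * (c * (1 + dotp y y) `^ (- (d.+2%:R / 2 + beta))))).
    by rewrite le_eqVlt; apply/orP; left; apply/eqP; field.
  by rewrite ler_wpM2l// hc ?dotp_ge0//; near: n; exact: N1.
apply: (cvgr_to_le cv); near=> n.
have /andP[_ h] := jint_diff (ltn0Sn n) (dotp_ge0 x) xy.
rewrite -mulrA ler_wpM2l ?(ltW kd0)//; apply: le_trans h _.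
apply: (@le_trans _ _ ((dotp y y - dotp x x) / 4 * (C * (1 + dotp x x) `^ (- (d.+2%:R / 2 + beta))))).
  by rewrite ler_wpM2l// hC ?dotp_ge0.
by rewrite le_eqVlt; apply/orP; left; apply/eqP; field.
Unshelve. all: by end_near. Qed.

(** The lower bound [jint_lb] is used in reverse: the weight is at most a multiple of a Gaussian
    mixture, which is integrable. *)
Lemma integrable_bracket : (L d).-integrable setT
  (EFin \o (fun x => (1 + dotp x x) `^ (- (d%:R / 2 + beta)))).
Proof.
have [c c0 h] := jint_lb beta01 d.
have [n N] : exists n, 1 <= kap * n.+1%:R.
  by have [n _ H] := N1; exists n; apply: (H n) => /=.
have [i _] := integral_jint_cos (0 : 'rV[R]_d) (ltn0Sn n).
apply: (@integrable_le _ _ _ _ setT measurableT _ (fun x => c^-1 * jint beta n.+1 d (dotp x x))).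
- apply: (measurableT_comp (measurable_powR _)); apply: measurable_funD => //.
  exact: measurable_nsq.
- move=> x _; rewrite ger0_norm ?powR_ge0// ler_pdivlMl// h ?dotp_ge0//.
exact: integrableRZ.
Qed.

(** The bound [jint_ub], uniform in [n], allows passing to the limit in [integral_jint_cos], on the
    left by [jint_cvg] and on the right by [psi_cvg]; [kdE] collects the constants. *)
Lemma hk1_fourier xi : (L d).-integrable setT (EFin \o hk 1) /\
  \int[L d]_x (cos (dotp xi x) * hk 1 x) = expR (- (dotp xi xi) `^ beta).
Proof.
have [C C0 hC] := jint_ub beta01 beta_ge d.
have mj n : measurable_fun setT (fun x => jint beta n.+1 d (dotp x x)).
  by have [/integrableP[/measurable_EFinP]] := integral_jint_cos (0 : 'rV[R]_d) (ltn0Sn n).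
have jb n x : `|kd * jint beta n.+1 d (dotp x x)| <=
    kd * (C * (1 + dotp x x) `^ (- (d%:R / 2 + beta))).
  rewrite normrM (ger0_norm (ltW kd0)) ler_wpM2l ?(ltW kd0)// ger0_norm.
    by rewrite hC ?dotp_ge0.
  by apply: Rintegral_ge0 => // U _; exact: jint_integrand_ge0.
have ig : (L d).-integrable setT
    (EFin \o (fun x => kd * (C * (1 + dotp x x) `^ (- (d%:R / 2 + beta))))).
  by do 2 apply: integrableRZ => //; exact: integrable_bracket.
split.
  have [] // := @Rintegral_dct _ _ _ (L d) setT measurableT
    (fun n x => kd * jint beta n.+1 d (dotp x x)) (hk 1) _ _ _ ig _.
  - by move=> n; exact: measurable_funM.
  - by move=> x _; exact: jint_cvg.
have [] := @Rintegral_dct _ _ _ (L d) setT measurableT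
    (fun n x => cos (dotp xi x) * (kd * jint beta n.+1 d (dotp x x)))
    (fun x => cos (dotp xi x) * hk 1 x) _ _ _ ig _.
- by move=> n; apply: measurable_funM; [exact: measurable_cos_dotp|exact: measurable_funM].
- by move=> x _; apply: cvgMr; exact: jint_cvg.
- move=> n x _; rewrite normrM; apply: le_trans (jb n x).
  by rewrite ler_piMl// ler_norml cos_geN1 cos_le1.
move=> _ h1 _.
have h2 : psi beta n.+1 (dotp xi xi) ^+ n.+1 @[n --> \oo] --> expR (- (dotp xi xi) `^ beta).
  have [->|xi0] := eqVneq (dotp xi xi) 0.
    rewrite powR0 ?gt_eqF// oppr0 expR0; under eq_fun do rewrite psi0 expr1n; exact: cvg_cst.
  by apply: psi_cvg => //; rewrite lt_def xi0 dotp_ge0.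
apply: cvg_unique h1 _ => //; apply: cvg_trans h2; apply: near_eq_cvg; near=> n.
have [i1 i2] := integral_jint_cos xi (ltn0Sn n).
under eq_Rintegral do rewrite mulrCA.
rewrite RintegralZl//; first by rewrite i2 mulrA kdE mul1r.
apply: (@integrable_le _ _ _ _ setT measurableT _ (fun x => `|jint beta n.+1 d (dotp x x)|)).
- by apply: measurable_funM => //; exact: measurable_cos_dotp.
- by move=> x _; rewrite normrM ler_piMl// ler_norml cos_geN1 cos_le1.
exact: integrable_abs.
Unshelve. all: by end_near. Qed.

End stable_density.


Lemma powR_continuous {R : realType} (r x : R) : 0 < x ->
  {for x, continuous (fun z : R => z `^ r)}.
Proof.
move=> x0; apply: differentiable_continuous; apply/derivable1_diffP.
by have [] := is_derive1_powR r x0.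
Qed.

Lemma is_derive_cvg_harmonic {R : realType} (f : R -> R) (x l : R) : is_derive x 1 f l ->
  n.+1%:R * (f (x + n.+1%:R^-1) - f x) @[n --> \oo] --> l.
Proof.
move=> [D E]; have D' : h^-1 *: (f (h *: (1 : R) + x) - f x) @[h --> 0^'] --> 'D_1 f x by exact: D.
rewrite E in D'; move/cvgr_dnbhsP : D' => /(_ (fun n => n.+1%:R^-1)) h.
have : forall n : nat, n.+1%:R^-1 != 0 :> R by move=> n; rewrite invr_neq0.
move=> h1; have h2 : n.+1%:R^-1 @[n --> \oo] --> (0 : R) by exact: cvg_harmonic.
have := h (conj h1 h2); apply: cvg_trans; apply: near_eq_cvg; near=> n.
by rewrite /= invrK /GRing.scale /= mulr1 [x + _]addrC.
Unshelve. all: by end_near. Qed.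

(** * Scaling, gradient and translation estimates for the stable kernel *)

Section heat_kernel_scaling.
Context {R : realType} (d : nat).
Variable beta : R.
Hypothesis beta01 : 0 < beta < 1.
Hypothesis beta_ge : 2^-1 <= beta.
Local Notation L := (@lebesgue_rV R d).
Local Notation hk := (@hk R d beta).
Implicit Types x y xi v : 'rV[R]_d.

Let b0 : 0 < beta. Proof. by case/andP: beta01. Qed.

Definition sym (t : R) xi : R := expR (- (t * (dotp xi xi) `^ beta)).

(* [dk (alpha / 2) v t] is - v . grad p(t, .), so that b . grad_z p(t - s, x - z)
   is [dk (alpha / 2) b (t - s) (x - z)]. *)
Definition dk v (t : R) x : R := (2 * pi) ^- d *
  \int[L]_xi (dotp v xi * sin (dotp x xi) * sym t xi).

Lemma sym_ge0 t xi : 0 <= sym t xi. Proof. exact: expR_ge0. Qed.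

Lemma measurable_sym t : measurable_fun setT (sym t).
Proof. exact: measurable_stretched. Qed.

Lemma measurable_sin_dotp x : measurable_fun setT (fun xi => sin (dotp x xi)).
Proof. by apply: measurableT_comp; [exact: measurable_sin|exact: measurable_dotp]. Qed.

Lemma integrable_sym t : 0 < t -> L.-integrable setT (EFin \o sym t).
Proof. by move=> t0; exact: integrable_stretched0. Qed.

Definition symmaj v t xi : R := enorm v * ((1 + enorm xi) * sym t xi).

Lemma integrable_symmaj v t : 0 < t -> L.-integrable setT (EFin \o symmaj v t).
Proof. by move=> t0; apply: integrableRZ => //; exact: integrable_stretched. Qed.

Lemma dotp_symmaj v t xi (s : R) : `|s| <= 1 -> `|dotp v xi * s * sym t xi| <= symmaj v t xi.
Proof.
move=> s1; rewrite !normrM [X in _ * X]ger0_norm ?sym_ge0// /symmaj mulrA ler_wpM2r ?sym_ge0//.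
apply: (@le_trans _ _ (enorm v * enorm xi * 1)).
  by apply: ler_pM => //; exact: dotp_enorm.
by rewrite mulr1 ler_wpM2l ?enorm_ge0// lerDr.
Qed.

Lemma sin_norm_le1 (s : R) : `|sin s| <= 1.
Proof. by rewrite ler_norml sin_geN1 sin_le1. Qed.

Lemma cos_norm_le1 (s : R) : `|cos s| <= 1.
Proof. by rewrite ler_norml cos_geN1 cos_le1. Qed.

Lemma measurable_dk_integrand v t x :
  measurable_fun setT (fun xi => dotp v xi * sin (dotp x xi) * sym t xi).
Proof.
apply: measurable_funM; last exact: measurable_sym.
by apply: measurable_funM; [exact: measurable_dotp|exact: measurable_sin_dotp].
Qed.

Lemma integrable_dk_integrand v t x : 0 < t ->
  L.-integrable setT (EFin \o (fun xi => dotp v xi * sin (dotp x xi) * sym t xi)).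
Proof.
move=> t0; apply: (@integrable_le _ _ _ _ setT measurableT _ (symmaj v t)).
- exact: measurable_dk_integrand.
- by move=> xi _; apply: dotp_symmaj; exact: sin_norm_le1.
- exact: integrable_symmaj.
Qed.

Lemma measurable_hk_integrand t x : measurable_fun setT (fun xi => cos (dotp x xi) * sym t xi).
Proof. by apply: measurable_funM; [exact: measurable_cos_dotp|exact: measurable_sym]. Qed.

Lemma hk_integrand_le t x xi : `|cos (dotp x xi) * sym t xi| <= sym t xi.
Proof.
by rewrite normrM [X in _ * X]ger0_norm ?sym_ge0// ler_piMl ?sym_ge0// cos_norm_le1.
Qed.

Lemma integrable_hk_integrand t x : 0 < t ->
  L.-integrable setT (EFin \o (fun xi => cos (dotp x xi) * sym t xi)).
Proof.
move=> t0; apply: (@integrable_le _ _ _ _ setT measurableT _ (sym t)).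
- exact: measurable_hk_integrand.
- by move=> xi _; exact: hk_integrand_le.
- exact: integrable_sym.
Qed.

(* [tsc t] is t ^ (- 1 / alpha), the inverse of the length scale at time t. *)
Definition tsc (t : R) : R := t `^ (- (2 * beta)^-1).

Lemma tsc_gt0 t : 0 < t -> 0 < tsc t. Proof. exact: powR_gt0. Qed.

Lemma sym_scale t xi : 0 < t -> sym t (tsc t *: xi) = sym 1 xi.
Proof.
move=> t0; rewrite /sym mul1r dotpZl dotpZr mulrA powRM ?mulr_ge0 ?powR_ge0 ?dotp_ge0//.
rewrite -expr2 /tsc -powR_mulrn ?powR_ge0// -powRrM -powRrM.
have -> : - (2 * beta)^-1 * (2 * beta) = -1 by field; rewrite gt_eqF.
by rewrite powR_inv1 ?(ltW t0)// mulrA divff ?mul1r// gt_eqF.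
Qed.

Lemma hk_scale t x : 0 < t -> hk t x = tsc t ^+ d * hk 1 (tsc t *: x).
Proof.
move=> t0; have a0 := tsc_gt0 t0; rewrite /hk mulrCA; congr (_ * _).
have an0 : tsc t != 0 by rewrite gt_eqF.
rewrite (Rintegral_rV_affine 0 an0 (integrable_hk_integrand x t0)) (ger0_norm (ltW a0)).
apply: (congr1 (fun z => tsc t ^+ d * z)); apply: eq_Rintegral => xi _.
rewrite -/(sym 1 xi); by rewrite addr0 sym_scale// dotpZr -dotpZl.
Qed.

Lemma dk_scale v t x : 0 < t -> dk v t x = tsc t ^+ d.+1 * dk v 1 (tsc t *: x).
Proof.
move=> t0; have a0 := tsc_gt0 t0; rewrite /dk [RHS]mulrCA; congr (_ * _).
have an0 : tsc t != 0 by rewrite gt_eqF.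
rewrite (Rintegral_rV_affine 0 an0 (integrable_dk_integrand v x t0)) (ger0_norm (ltW a0)).
rewrite exprSr -mulrA; congr (_ * _); rewrite -RintegralZl//; last exact: integrable_dk_integrand.
apply: eq_Rintegral => xi _; rewrite addr0 sym_scale// !dotpZr dotpZl; ring.
Qed.

Lemma is_derive_hk v t x (k : R) : 0 < t ->
  is_derive k 1 (fun k => hk t (x - k *: v)) (dk v t (x - k *: v)).
Proof.
move=> t0; pose f (k : R) xi := cos (dotp (x - k *: v) xi) * sym t xi.
have d1 (r : R) xi : is_derive r 1 (f ^~ xi) (dotp v xi * sin (dotp (x - r *: v) xi) * sym t xi).
  have -> : f ^~ xi = sym t xi *: (fun r => cos (dotp x xi + (- dotp v xi) * r) : R).
    apply/funext => z; rewrite /f mulrC dotpBl dotpZl; congr (_ * cos (_ + _)).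
    by rewrite mulNr mulrC.
  have h : is_derive r 1 (fun r : R => dotp x xi + (- dotp v xi) * r) (- dotp v xi).
    have := is_derive_mulrl (- dotp v xi) r => ?.
    have -> : (fun r : R => dotp x xi + (- dotp v xi) * r) =
      cst (dotp x xi) + (fun r => (- dotp v xi) * r) by [].
    by apply: is_derive_eq; rewrite add0r.
  have h2 : is_derive r 1 (fun r : R => cos (dotp x xi + (- dotp v xi) * r) : R) _ :=
    @is_derive1_comp _ cos (fun r => dotp x xi + (- dotp v xi) * r) r _ _ (is_derive_cos _) h.
  have -> : dotp (x - r *: v) xi = dotp x xi + - dotp v xi * r.
    by rewrite dotpBl dotpZl mulNr [r * _]mulrC.
  by apply: is_derive_eq; rewrite /GRing.scale /=; ring.
have par r xi : partial1of2 f r xi = dotp v xi * sin (dotp (x - r *: v) xi) * sym t xi.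
  by rewrite partial1of2E; exact: derive_val.
have Ix : `](k - 1), (k + 1)[%classic k by rewrite /= in_itv/=; apply/andP; split; lra.
have key := @derivable_under_integral R _ _ L f setT
  measurableT k (k - 1) (k + 1) Ix _ _ (symmaj v t) _ (integrable_symmaj v t0).
have key2 := @differentiation_under_integral R _ _ L f setT
  measurableT k (k - 1) (k + 1) Ix _ _ (symmaj v t) _ (integrable_symmaj v t0).
have D1 : forall r xi, `](k - 1), (k + 1)[%classic r -> [set: 'rV[R]_d] xi ->
   derivable (f ^~ xi : R -> R) r 1 by move=> r xi _ _; have := d1 r xi.
have G0 : forall xi, 0 <= symmaj v t xi.
  by move=> xi; rewrite !mulr_ge0 ?sym_ge0 ?addr_ge0 ?enorm_ge0.
have Gub : forall r xi, `](k - 1), (k + 1)[%classic r -> [set: 'rV[R]_d] xi ->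
   `|partial1of2 f r xi| <= symmaj v t xi.
  by move=> r xi _ _; rewrite par; apply: dotp_symmaj; exact: sin_norm_le1.
have i1 r : L.-integrable setT (EFin \o f r) by exact: integrable_hk_integrand.
have h : is_derive k 1 (fun k => \int[L]_xi f k xi)
    (\int[L]_xi (dotp v xi * sin (dotp (x - k *: v) xi) * sym t xi)).
  apply: DeriveDef; first exact: key.
  rewrite -derive1E [LHS]key2//.
  by apply: eq_Rintegral => xi _; rewrite par.
have -> : (fun k => hk t (x - k *: v)) = (2 * pi) ^- d *: (fun k => \int[L]_xi f k xi) by [].
by apply: is_derive_eq.
Qed.

Lemma dk_cvg v t x : 0 < t ->
  n.+1%:R * (hk t (x - n.+1%:R^-1 *: v) - hk t x) @[n --> \oo] --> dk v t x.
Proof.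
move=> t0; have := is_derive_cvg_harmonic (is_derive_hk v x 0 t0).
by rewrite scale0r subr0; under eq_fun do rewrite add0r.
Qed.

(** [hk1_sandwich] without knowing which of the two points is closer to the origin: moving the
    bracket at [x] by the whole increment [e], in the unfavourable direction, is correct in both
    cases. The side condition holds once [y] is close to [x]. *)
Lemma hk1_diff : exists c C : R, [/\ 0 < c, 0 < C & forall x y (e := `|dotp y y - dotp x x|),
  c * (e * (1 + (dotp x x + e)) `^ (- (d%:R / 2 + 1 + beta))) <= `|hk 1 x - hk 1 y| /\
  (0 < 1 + (dotp x x - e) ->
  `|hk 1 x - hk 1 y| <= C * (e * (1 + (dotp x x - e)) `^ (- (d%:R / 2 + 1 + beta))))].
Proof.
have [c [C [c0 C0 sw]]] := hk1_sandwich d beta01 beta_ge.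
exists c, C; split=> // x y e; set N := d%:R / 2 + 1 + beta.
have N0 : - N <= 0 by rewrite oppr_le0 !addr_ge0 ?(ltW b0) ?divr_ge0.
have e0 : 0 <= e by exact: normr_ge0.
have [xy|/ltW yx] := leP (dotp x x) (dotp y y).
  have eE : e = dotp y y - dotp x x by rewrite /e ger0_norm// subr_ge0.
  have /andP[l u] := sw _ _ xy; rewrite -/N -eE in l u.
  have -> : `|hk 1 x - hk 1 y| = hk 1 x - hk 1 y.
    by rewrite ger0_norm// (le_trans _ l)// mulr_ge0 ?(ltW c0)// mulr_ge0 ?powR_ge0.
  split; first by apply: le_trans l; rewrite eE [dotp x x + _]addrC subrK.
  move=> h; apply: le_trans u _; rewrite ler_wpM2l ?(ltW C0)// ler_wpM2l//.
  by apply: powR_ge_base => //; rewrite lerD2l gerBl.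
have eE : e = dotp x x - dotp y y by rewrite /e distrC ger0_norm// subr_ge0.
have /andP[l u] := sw _ _ yx; rewrite -/N -eE in l u.
have -> : `|hk 1 x - hk 1 y| = hk 1 y - hk 1 x.
  by rewrite distrC ger0_norm// (le_trans _ l)// mulr_ge0 ?(ltW c0)// mulr_ge0 ?powR_ge0.
split.
  apply: le_trans l; rewrite ler_wpM2l ?(ltW c0)// ler_wpM2l//.
  by apply: powR_ge_base => //; [rewrite ltr_pwDl ?dotp_ge0|rewrite lerD2l lerDl].
by move=> h; apply: le_trans u _; rewrite eE subKr.
Qed.

(** Difference quotients of [hk1_diff] along [v]: the squared norm changes by [h n] times [g (h n)],
    and [g (h n)] tends to - 2 v . x. The lower bound is what later lets [dk] dominate a weight
    ([wt_le_dk]). *)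
Lemma dk1_bounds v : exists c C : R, [/\ 0 < c, 0 < C & forall x,
  c * (`|dotp v x| * (1 + dotp x x) `^ (- (d%:R / 2 + 1 + beta))) <= `|dk v 1 x| <=
  C * (`|dotp v x| * (1 + dotp x x) `^ (- (d%:R / 2 + 1 + beta)))].
Proof.
have [c [C [c0 C0 sw]]] := hk1_diff.
exists (c * 2), (C * 2); split; rewrite ?mulr_gt0// => x; set N := d%:R / 2 + 1 + beta.
pose h (n : nat) : R := n.+1%:R^-1.
have h0 : h n @[n --> \oo] --> (0 : R) by exact: cvg_harmonic.
pose e n := `|dotp (x - h n *: v) (x - h n *: v) - dotp x x|.
pose g (r : R) := - (2 * dotp v x) + r * dotp v v.
have eE n : e n = h n * `|g (h n)|.
  rewrite -[h n in X in X * _](@ger0_norm _ (h n)) ?invr_ge0// -normrM /e; congr `|_|.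
  by rewrite dotpBl !dotpBr !dotpZl !dotpZr [dotp x v]dotpC /g; ring.
have g0 : `|g (h n)| @[n --> \oo] --> 2 * `|dotp v x|.
  have -> : 2 * `|dotp v x| = `|- (2 * dotp v x) + 0 * dotp v v|.
    by rewrite mul0r addr0 normrN normrM ger0_norm.
  by apply: cvg_norm; apply: cvgD; [exact: cvg_cst|apply: cvgMl].
have e0 : e n @[n --> \oo] --> (0 : R).
  by under eq_fun do rewrite eE; rewrite -[0](mul0r (2 * `|dotp v x|)); exact: cvgM.
have D := @dk_cvg v 1 x ltr01.
have nD : `|n.+1%:R * (hk 1 (x - n.+1%:R^-1 *: v) - hk 1 x)| @[n --> \oo] --> `|dk v 1 x|.
  exact: cvg_norm.
have A0 : 0 < 1 + dotp x x by rewrite ltr_pwDl// dotp_ge0.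
have pc (u : nat -> R) : u n @[n --> \oo] --> dotp x x ->
    (1 + u n) `^ (- N) @[n --> \oo] --> (1 + dotp x x) `^ (- N).
  move=> hu; have : (1 + u n) @[n --> \oo] --> 1 + dotp x x by apply: cvgD => //; exact: cvg_cst.
  move=> hu1; apply: (@cvg_comp _ _ _ (fun n => 1 + u n) (fun z : R => z `^ (- N)) _ _ _ hu1).
  exact: powR_continuous.
have nE n : `|n.+1%:R * (hk 1 (x - n.+1%:R^-1 *: v) - hk 1 x)| =
    (h n)^-1 * `|hk 1 x - hk 1 (x - h n *: v)|.
  by rewrite normrM distrC ger0_norm// invrK.
have hp n : 0 < h n by rewrite invr_gt0.
have ce n (z w : R) : (h n)^-1 * (w * (e n * z)) = w * (`|g (h n)| * z).
  by rewrite eE; field; rewrite gt_eqF// hp.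
have cvC (w s : R) : s = 1 \/ s = - 1 ->
    w * (`|g (h n)| * (1 + (dotp x x + s * e n)) `^ (- N)) @[n --> \oo] -->
    w * 2 * (`|dotp v x| * (1 + dotp x x) `^ (- N)).
  move=> _; rewrite -mulrA [2 * (_ * _)]mulrA; apply: cvgMr; apply: cvgM => //; apply: pc.
  rewrite -[X in _ --> X]addr0 -[X in _ + X](mulr0 s).
  by apply: cvgD; [exact: cvg_cst|exact: cvgMr].
apply/andP; split.
  apply: (ler_cvg_to (cvC c 1 (or_introl erefl)) nD).
  near=> n; rewrite nE mul1r -ce; apply: ler_wpM2l; first by rewrite invr_ge0 ltW.
  by have [] := sw x (x - h n *: v).
apply: (ler_cvg_to nD (cvC C (- 1) (or_intror erefl))).
near=> n; rewrite nE mulN1r -ce; apply: ler_wpM2l; first by rewrite invr_ge0 ltW.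
have [_] := sw x (x - h n *: v); apply.
rewrite addrA subr_gt0 -/(e n).
near: n; apply: (cvgr_lt 0 e0); exact: A0.
Unshelve. all: by end_near. Qed.

Lemma hk_gt0 t x : 0 < t -> 0 < hk t x.
Proof.
move=> t0; have [c c0 lb] := hk1_lb d beta01 beta_ge.
rewrite hk_scale// mulr_gt0 ?exprn_gt0 ?tsc_gt0//.
by apply: lt_le_trans (lb _); rewrite mulr_gt0// powR_gt0// ltr_pwDl// dotp_ge0.
Qed.

Lemma bracket_powD (A r : R) : 0 <= A -> (1 + A) * (1 + A) `^ (- (r + 1 + beta)) =
  (1 + A) `^ (- (r + beta)).
Proof.
move=> A0; have A1 : 0 < 1 + A by rewrite ltr_pwDl.
rewrite -[X in X * _](powRr1 (ltW A1)) -powRD; last by rewrite (gt_eqF A1) implybT.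
by congr (_ `^ _); ring.
Qed.

(** At unit time [dk] has one more power of 1 / (1 + |x|^2) than the kernel, which more than
    compensates the factor v . x; the time factor comes from scaling. *)
Lemma dk_le_hk v : exists2 C : R, 0 < C & forall t x, 0 < t ->
  `|dk v t x| <= C * tsc t * hk t x.
Proof.
have [c [C [c0 C0 h]]] := dk1_bounds v; have [c' c'0 lb] := hk1_lb d beta01 beta_ge.
exists (C * (enorm v + 1) / c'); first by rewrite !mulr_gt0 ?invr_gt0// ltr_wpDl ?enorm_ge0.
move=> t x t0; have a0 := tsc_gt0 t0.
rewrite dk_scale// hk_scale// normrM ger0_norm ?exprn_ge0 ?(ltW a0)//.
set y := tsc t *: x; have /andP[_] := h y.
set N := d%:R / 2 + 1 + beta => hu.
have A0 := dotp_ge0 y; have A1 : 0 < 1 + dotp y y by rewrite ltr_pwDl.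
have -> : C * (enorm v + 1) / c' * tsc t * (tsc t ^+ d * hk 1 y) =
  tsc t ^+ d.+1 * (C * ((enorm v + 1) * (hk 1 y / c'))) by rewrite exprS; ring.
rewrite ler_wpM2l ?exprn_ge0 ?(ltW a0)//; apply: le_trans hu _.
rewrite ler_wpM2l ?(ltW C0)//.
apply: (@le_trans _ _ ((enorm v + 1) * ((1 + dotp y y) * (1 + dotp y y) `^ (- N)))); last first.
  rewrite bracket_powD// ler_wpM2l ?addr_ge0 ?enorm_ge0//.
  by rewrite ler_pdivlMr// mulrC.
rewrite [leRHS]mulrA ler_wpM2r ?powR_ge0//.
apply: le_trans (dotp_enorm _ _) _; apply: ler_pM; rewrite ?enorm_ge0 ?lerDl//.
rewrite -enorm_sqr; have := enorm_ge0 y; nra.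
Qed.

Lemma enorm_cmp (a c e : R) : 0 <= a -> 0 <= c -> 0 <= e -> e <= 1 ->
  a <= c + e -> c <= a + e ->
  [/\ - (e * (2 * (1 + a ^+ 2))) <= c ^+ 2 - a ^+ 2,
      c ^+ 2 - a ^+ 2 <= e * (2 * (1 + a ^+ 2)) & 1 + a ^+ 2 <= 3 * (1 + c ^+ 2)].
Proof.
move=> a0 c0 e0 e1 ac ca.
have h1 : 0 <= (a + e - c) * (a + e + c) by rewrite mulr_ge0 ?subr_ge0 ?addr_ge0.
have h2 : 0 <= e * (1 - e) by rewrite mulr_ge0 ?subr_ge0.
have h3 : 0 <= e * (1 - a) ^+ 2 by rewrite mulr_ge0 ?sqr_ge0.
have h4 : 0 <= (c + e - a) * (c + e + a) by rewrite mulr_ge0 ?subr_ge0 ?addr_ge0.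
have h5 : 0 <= (c - e) ^+ 2 by exact: sqr_ge0.
split; [|nra|nra].
have [ale|cla] := leP a c; first by nra.
have h6 : 0 <= (c + e - a) * (a + c) by rewrite mulr_ge0 ?subr_ge0 ?addr_ge0.
have h7 : 0 <= e * (a - c) by rewrite mulr_ge0 ?subr_ge0 ?(ltW cla).
nra.
Qed.

(** At unit time a displacement e <= 1 changes |x|^2 by at most 2 e (1 + |x|^2), and 1 + |x|^2 is at
    most three times its displaced value ([enorm_cmp]). The factor 1 + |x|^2 brings the bound of
    [hk1_sandwich] back to the decay of the kernel itself. *)
Lemma hk_translate : exists2 C : R, 0 < C & forall t x y, 0 < t ->
  enorm (x - y) * tsc t <= 1 ->
  `|hk t x - hk t y| <= C * (enorm (x - y) * tsc t) * hk t x.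
Proof.
have [c [C [c0 C0 sw]]] := hk1_sandwich d beta01 beta_ge; have [c' c'0 lb] := hk1_lb d beta01 beta_ge.
set N := d%:R / 2 + 1 + beta in sw.
have N0 : 0 <= N by rewrite !addr_ge0 ?(ltW b0) ?divr_ge0.
have K0 : 0 <= C * (2 * 3 `^ N) by rewrite !mulr_ge0 ?powR_ge0 ?(ltW C0).
exists (C * (2 * 3 `^ N) / c'); first by rewrite !mulr_gt0 ?powR_gt0 ?invr_gt0.
have key X Y : enorm (X - Y) <= 1 -> `|hk 1 X - hk 1 Y| <=
    C * (enorm (X - Y) * (2 * 3 `^ N) * (1 + dotp X X) `^ (- (d%:R / 2 + beta))).
  move=> e1; set e := enorm (X - Y); have e0 : 0 <= e by exact: enorm_ge0.
  have XY : enorm X <= enorm Y + e by rewrite addrC -[X in enorm X](subrK Y); exact: enormD.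
  have YX : enorm Y <= enorm X + e.
    by rewrite addrC /e -(enormN (X - Y)) opprB; apply: le_trans (enormD _ _); rewrite subrK.
  have X0 := enorm_ge0 X; have Y0 := enorm_ge0 Y.
  have AX := enorm_sqr X; have AY := enorm_sqr Y.
  have hA : `|dotp Y Y - dotp X X| <= e * (2 * (1 + dotp X X)).
    by rewrite -AX -AY ler_norml; have [-> ->] := enorm_cmp X0 Y0 e0 e1 XY YX.
  have h3 : 1 + dotp X X <= 3 * (1 + dotp Y Y).
    by rewrite -AX -AY; have [] := enorm_cmp X0 Y0 e0 e1 XY YX.
  have A0 := dotp_ge0 X; have B0 := dotp_ge0 Y.
  have r3 : (1 + dotp Y Y) `^ (- N) <= 3 `^ N * (1 + dotp X X) `^ (- N).
    rewrite !powRN ler_pdivlMr ?powR_gt0 ?ltr_pwDl// mulrC.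
    rewrite ler_pdivrMr ?powR_gt0 ?ltr_pwDl// -powRM ?addr_ge0//.
    by apply: powR_le_base => //; rewrite addr_ge0.
  have r1 : (1 + dotp X X) `^ (- N) <= 3 `^ N * (1 + dotp X X) `^ (- N).
    by rewrite ler_peMl ?powR_ge0// -[leLHS](powRr0 3) ler_powR// ler1n.
  have fin (z : R) : z <= 3 `^ N * (1 + dotp X X) `^ (- N) -> 0 <= z ->
     C * (`|dotp Y Y - dotp X X| * z) <=
     C * (e * (2 * 3 `^ N) * (1 + dotp X X) `^ (- (d%:R / 2 + beta))).
    move=> hz z0; rewrite ler_wpM2l ?(ltW C0)//; apply: le_trans (ler_pM _ z0 hA hz) _ => //.
    rewrite -(bracket_powD (d%:R / 2) A0) -/N; clearbody e.
    by move: (1 + dotp X X) (3 `^ N) ((_ + dotp X X) `^ _) => A w p; rewrite le_eqVlt; apply/orP; left; apply/eqP; ring.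
  have [xy|/ltW yx] := leP (dotp X X) (dotp Y Y).
    have /andP[l u] := sw _ _ xy.
    rewrite ger0_norm; last first.
      by apply: le_trans l; rewrite !mulr_ge0 ?(ltW c0) ?powR_ge0 ?subr_ge0.
    apply: le_trans u _; apply: le_trans (fin _ r1 (powR_ge0 _ _)).
    by rewrite ger0_norm// subr_ge0.
  have /andP[l u] := sw _ _ yx.
  rewrite distrC ger0_norm; last first.
    by apply: le_trans l; rewrite !mulr_ge0 ?(ltW c0) ?powR_ge0 ?subr_ge0.
  apply: le_trans u _; apply: le_trans (fin _ r3 (powR_ge0 _ _)).
  by rewrite distrC ger0_norm// subr_ge0.
move=> t x y t0; have a0 := tsc_gt0 t0; set a := tsc t in a0 *.
have eE : enorm (a *: x - a *: y) = enorm (x - y) * a.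
  by rewrite -scalerBr enormZ ger0_norm ?(ltW a0)// mulrC.
rewrite (hk_scale x t0) (hk_scale y t0) -mulrBr normrM ger0_norm ?exprn_ge0 ?(ltW a0)// -/a -eE => h.
rewrite [leRHS]mulrCA ler_wpM2l ?exprn_ge0 ?(ltW a0)//; apply: le_trans (key _ _ h) _.
have := lb (a *: x); rewrite -ler_pdivlMl// => h2.
apply: (@le_trans _ _ (C * (enorm (a *: x - a *: y) * (2 * 3 `^ N) * (c'^-1 * hk 1 (a *: x))))).
  by rewrite !ler_wpM2l ?(ltW C0)// !mulr_ge0 ?enorm_ge0 ?powR_ge0.
by rewrite le_eqVlt; apply/orP; left; apply/eqP; ring.
Qed.

End heat_kernel_scaling.


Lemma hkE {R : realType} d (beta t : R) (x : 'rV[R]_d) : hk beta t x =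
  (2 * pi) ^- d * \int[lebesgue_rV d]_xi (cos (dotp x xi) * sym beta t xi).
Proof. by []. Qed.

Lemma dkE {R : realType} d (beta : R) (v : 'rV[R]_d) t x : dk beta v t x =
  (2 * pi) ^- d * \int[lebesgue_rV d]_xi (dotp v xi * sin (dotp x xi) * sym beta t xi).
Proof. by []. Qed.

Lemma symE {R : realType} d (beta t : R) (xi : 'rV[R]_d) :
  sym beta t xi = expR (- (t * (dotp xi xi) `^ beta)).
Proof. by []. Qed.

(** * Semigroup law and integral bounds *)

Section heat_kernel_semigroup.
Context {R : realType} (d : nat).
Variable beta : R.
Hypothesis beta01 : 0 < beta < 1.
Hypothesis beta_ge : 2^-1 <= beta.
Local Notation L := (@lebesgue_rV R d).
Local Notation hk := (@hk R d beta).
Local Notation dk := (@dk R d beta).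
Local Notation sym := (@sym R d beta).
Local Notation tsc := (tsc beta).
Implicit Types x y xi v : 'rV[R]_d.

Let b0 : 0 < beta. Proof. by case/andP: beta01. Qed.

Lemma hkN t x : hk t (- x) = hk t x.
Proof.
by rewrite !hkE; congr (_ * _); apply: eq_Rintegral => xi _; rewrite dotpNl cosN.
Qed.

Lemma integrable_hk t : 0 < t -> L.-integrable setT (EFin \o hk t).
Proof.
move=> t0; have [i1 _] := hk1_fourier beta01 beta_ge (0 : 'rV[R]_d).
have a0 : tsc t != 0 by rewrite gt_eqF// tsc_gt0.
have := integrableRZ measurableT (tsc t ^+ d) (integrable_rV_affine 0 a0 i1).
apply: eq_integrable => // x _ /=; congr EFin.
by rewrite addr0 -(hk_scale beta01 beta_ge).
Qed.

Lemma measurable_hk t : 0 < t -> measurable_fun setT (hk t).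
Proof. by move=> /integrable_hk/integrableP[/measurable_EFinP]. Qed.

Lemma hk_fourier t xi : 0 < t -> \int[L]_x (cos (dotp xi x) * hk t x) = sym t xi.
Proof.
move=> t0; have [i1 h1] := hk1_fourier beta01 beta_ge ((tsc t)^-1 *: xi).
have a0 := tsc_gt0 beta t0; have an0 : tsc t != 0 by rewrite gt_eqF.
have ic : L.-integrable setT (EFin \o (fun x => cos (dotp ((tsc t)^-1 *: xi) x) * hk 1 x)).
  apply: (@integrable_le _ _ _ _ setT measurableT _ (hk 1)) => //.
    apply: measurable_funM; first exact: measurable_cos_dotp.
    exact: measurable_hk.
  move=> x _; rewrite normrM (ger0_norm (ltW (hk_gt0 beta01 beta_ge x ltr01))).
  by rewrite ler_piMl ?cos_norm_le1// ltW// hk_gt0.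
have -> : sym t xi = sym 1 ((tsc t)^-1 *: xi).
  by rewrite -(sym_scale beta01 _ t0) scalerA (divff an0) scale1r.
rewrite !symE mul1r -h1 (Rintegral_rV_affine 0 an0 ic) (ger0_norm (ltW a0)).
rewrite -RintegralZl//; last exact: (integrable_rV_affine 0 an0 ic).
apply: eq_Rintegral => x _; rewrite addr0 (hk_scale beta01 beta_ge)//.
rewrite dotpZl dotpZr [_^-1 * _]mulrA (mulVf an0) mul1r.
by rewrite mulrCA.
Qed.

Lemma Rintegral_hk t : 0 < t -> \int[L]_x hk t x = 1.
Proof.
move=> t0; have := hk_fourier (0 : 'rV[R]_d) t0.
rewrite !symE dotp0l powR0 ?gt_eqF// mulr0 oppr0 expR0 => <-.
by apply: eq_Rintegral => x _; rewrite dotp0l cos0 mul1r.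
Qed.

Lemma integrable_trig_hk t (c : 'rV[R]_d -> R) : 0 < t -> measurable_fun setT c ->
  (forall x, `|c x| <= 1) -> L.-integrable setT (EFin \o (fun x => c x * hk t x)).
Proof.
move=> t0 mc c1; apply: (@integrable_le _ _ _ _ setT measurableT _ (hk t)).
- by apply: measurable_funM => //; exact: measurable_hk.
- move=> x _; rewrite normrM (ger0_norm (ltW (hk_gt0 beta01 beta_ge x t0))).
  by rewrite ler_piMl// ltW// hk_gt0.
- exact: integrable_hk.
Qed.

Lemma hk_fourier_sin t xi : 0 < t -> \int[L]_x (sin (dotp xi x) * hk t x) = 0.
Proof.
move=> t0; have i : L.-integrable setT (EFin \o (fun x => sin (dotp xi x) * hk t x)).
  by apply: integrable_trig_hk => //; [exact: measurable_sin_dotp|move=> x; exact: sin_norm_le1].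
have h := Rintegral_rV_reflect 0 i.
have : \int[L]_x (sin (dotp xi x) * hk t x) = -1 * \int[L]_x (sin (dotp xi x) * hk t x).
  rewrite -[LHS]h -RintegralZl; [|exact: measurableT|exact: i].
  apply: eq_Rintegral => x _.
  by rewrite sub0r hkN dotpNr sinN mulNr mulN1r.
by rewrite mulN1r => h2; lra.
Qed.

Lemma hk_fourier_cosD t th xi : 0 < t ->
  \int[L]_x (cos (th - dotp xi x) * hk t x) = cos th * sym t xi.
Proof.
move=> t0; have E x : cos (th - dotp xi x) * hk t x =
  cos th * (cos (dotp xi x) * hk t x) + sin th * (sin (dotp xi x) * hk t x).
  by rewrite cosB; ring.
have i1 : L.-integrable setT (EFin \o (fun x => cos (dotp xi x) * hk t x)).
  by apply: integrable_trig_hk => //; [exact: measurable_cos_dotp|move=> x; exact: cos_norm_le1].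
have i2 : L.-integrable setT (EFin \o (fun x => sin (dotp xi x) * hk t x)).
  by apply: integrable_trig_hk => //; [exact: measurable_sin_dotp|move=> x; exact: sin_norm_le1].
under eq_Rintegral do rewrite E.
rewrite RintegralD//; try by apply: integrableRZ.
by rewrite !RintegralZl// hk_fourier// hk_fourier_sin// mulr0 addr0.
Qed.

(** The phase [th] treats both kernels at once: 0 gives the cosine of [hk], - pi / 2 the sine of
    [dk]. *)
Lemma conv_fourier_hk (g : 'rV[R]_d -> R) th s x : 0 < s ->
  L.-integrable setT (EFin \o g) ->
  \int[L]_y ((\int[L]_xi (cos (th + dotp (x - y) xi) * g xi)) * hk s y) =
  \int[L]_xi (cos (th + dotp x xi) * (g xi * sym s xi)).
Proof.
move=> s0 ig; have mg : measurable_fun setT g by have /integrableP[/measurable_EFinP] := ig.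
pose f y xi := cos (th + dotp (x - y) xi) * g xi * hk s y.
have mcos y : measurable_fun setT (fun xi => cos (th + dotp (x - y) xi)).
  apply: measurableT_comp; first exact: measurable_cos.
  by apply: measurable_funD => //; exact: measurable_dotp.
have icg y : L.-integrable setT (EFin \o (fun xi => cos (th + dotp (x - y) xi) * g xi)).
  apply: (@integrable_le _ _ _ _ setT measurableT _ (fun xi => `|g xi|)).
  - exact: measurable_funM.
  - by move=> xi _; rewrite normrM ler_piMl// cos_norm_le1.
  - exact: integrable_abs.
have mf : measurable_fun (setT `*` setT) (fun p : 'rV[R]_d * 'rV[R]_d => f p.1 p.2).
  rewrite setXTT; apply: measurable_funM; last first.
    by apply: (measurableT_comp (measurable_hk s0)).
  apply: measurable_funM; last by apply: (measurableT_comp mg).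
  apply: measurableT_comp; first exact: measurable_cos.
  apply: measurable_funD => //; apply: measurable_dotp => //.
  by apply: measurable_rVB.
have intf : (\int[L]_(y in setT) \int[L]_(xi in setT) `|f y xi|%:E < +oo)%E.
  apply: (fubini_bound measurableT measurableT mf (h := fun y => (\int[L]_xi `|g xi|) * hk s y)).
    move=> y _; rewrite mulrC -RintegralZl//; last exact: integrable_abs.
    apply: integral_norm_le => //; first by apply: measurable_funM => //; exact: measurable_funM.
      move=> xi _; rewrite /f normrM [leRHS]mulrC (ger0_norm (ltW (hk_gt0 beta01 beta_ge y s0))).
      rewrite ler_wpM2r ?(ltW (hk_gt0 beta01 beta_ge y s0))//.
      by rewrite normrM ler_piMl// cos_norm_le1.
    by apply: integrableRZ => //; exact: integrable_abs.
  by apply: integrableRZ => //; exact: integrable_hk.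
have := Rintegral_fubini measurableT measurableT mf intf.
have -> : \int[L]_y (\int[L]_xi f y xi) =
  \int[L]_y ((\int[L]_xi (cos (th + dotp (x - y) xi) * g xi)) * hk s y).
  apply: eq_Rintegral => y _; rewrite mulrC -RintegralZl//.
  by apply: eq_Rintegral => xi _; rewrite /f mulrC.
move=> ->; apply: eq_Rintegral => xi _.
transitivity (\int[L]_y (g xi * (cos (th + dotp x xi - dotp xi y) * hk s y))).
  apply: eq_Rintegral => y _; rewrite /f dotpBl [dotp y xi]dotpC addrA.
  by rewrite mulrAC mulrC.
rewrite RintegralZl//; first by rewrite hk_fourier_cosD// mulrCA.
apply: integrable_trig_hk => //.
  apply: measurableT_comp; first exact: measurable_cos.
  by apply: measurable_funB => //; exact: measurable_dotp.
by move=> y; exact: cos_norm_le1.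
Qed.

Lemma symD t s xi : sym t xi * sym s xi = sym (t + s) xi.
Proof. by rewrite !symE -expRD mulrDl opprD. Qed.

Lemma integrable_bddM (f g : 'rV[R]_d -> R) (M : R) : measurable_fun setT f ->
  (forall x, `|f x| <= M) -> L.-integrable setT (EFin \o g) ->
  L.-integrable setT (EFin \o (fun x => f x * g x)).
Proof.
move=> mf fM ig; have mg : measurable_fun setT g by have /integrableP[/measurable_EFinP] := ig.
apply: (@integrable_le _ _ _ _ setT measurableT _ (fun x => M * `|g x|)).
- exact: measurable_funM.
- by move=> x _; rewrite normrM ler_wpM2r.
- by apply: integrableRZ => //; exact: integrable_abs.
Qed.

Lemma hk_le0 t x : 0 < t -> hk t x <= hk t 0.
Proof.
move=> t0; rewrite !hkE ler_wpM2l ?invr_ge0 ?exprn_ge0 ?mulr_ge0 ?pi_ge0//.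
apply: le_Rintegral => //; try exact: integrable_hk_integrand.
move=> xi _; rewrite dotp0l cos0 mul1r; exact: le_trans (ler_norm _) (hk_integrand_le _ _ _ _).
Qed.

Lemma hk_norm_le t x : 0 < t -> `|hk t x| <= hk t 0.
Proof. by move=> t0; rewrite ger0_norm ?hk_le0// ltW// hk_gt0. Qed.

Lemma measurable_hkB t x : 0 < t -> measurable_fun setT (fun y => hk t (x - y)).
Proof.
by move=> t0; apply: (measurableT_comp (measurable_hk t0)); exact: measurable_rVB.
Qed.

Lemma measurable_dk v t : 0 < t -> measurable_fun setT (dk v t).
Proof.
move=> t0; apply: (@measurable_fun_cvg _ _ _ setT
  (fun n x => n.+1%:R * (hk t (x - n.+1%:R^-1 *: v) - hk t x))).
  move=> n; apply: measurable_funM => //; apply: measurable_funB; last exact: measurable_hk.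
  by apply: (measurableT_comp (measurable_hk t0)); exact: measurable_rVB.
by move=> x _; exact: dk_cvg.
Qed.

Lemma measurable_dkB v t x : 0 < t -> measurable_fun setT (fun y => dk v t (x - y)).
Proof.
by move=> t0; apply: (measurableT_comp (measurable_dk v t0)); exact: measurable_rVB.
Qed.

Lemma integrable_dk v t : 0 < t -> L.-integrable setT (EFin \o dk v t).
Proof.
move=> t0; have [C C0 h] := dk_le_hk beta01 beta_ge v.
apply: (@integrable_le _ _ _ _ setT measurableT _ (fun x => C * tsc t * hk t x)).
- exact: measurable_dk.
- by move=> x _; exact: h.
- by apply: integrableRZ => //; exact: integrable_hk.
Qed.

Lemma dk_bdd v t : 0 < t -> exists M, forall x, `|dk v t x| <= M.
Proof.
move=> t0; have [C C0 h] := dk_le_hk beta01 beta_ge v.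
exists (C * tsc t * hk t 0) => x; apply: le_trans (h _ _ t0) _.
by rewrite ler_wpM2l ?hk_le0// mulr_ge0 ?(ltW C0)// ltW// tsc_gt0.
Qed.

Let twopi_gt0 : 0 < 2 * pi :> R. Proof. by rewrite mulr_gt0// pi_gt0. Qed.

Lemma hk_conv t s x : 0 < t -> 0 < s -> \int[L]_y (hk t (x - y) * hk s y) = hk (t + s) x.
Proof.
move=> t0 s0; have it : L.-integrable setT (EFin \o sym t) by exact: integrable_sym.
have cf := conv_fourier_hk 0 x s0 it.
pose I y := (\int[L]_xi (cos (0 + dotp (x - y) xi) * sym t xi)) * hk s y.
have p0 : (2 * pi) ^+ d != 0 :> R by rewrite gt_eqF// exprn_gt0.
have E y : hk t (x - y) * hk s y = (2 * pi) ^- d * I y.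
  rewrite /I (hkE _ t) -mulrA; congr (_ * _); congr (_ * _).
  by apply: eq_Rintegral => xi _; rewrite add0r.
have iI : L.-integrable setT (EFin \o I).
  have : L.-integrable setT (EFin \o (fun y => (2 * pi) ^+ d * (hk t (x - y) * hk s y))).
    apply: integrableRZ => //; apply: (integrable_bddM (M := hk t 0)).
    - exact: measurable_hkB.
    - by move=> y; exact: hk_norm_le.
    - exact: integrable_hk.
  by apply: eq_integrable => // y _ /=; rewrite E mulrA divff// mul1r.
under eq_Rintegral do rewrite E.
rewrite RintegralZl; [|exact: measurableT|exact: iI]; rewrite cf !hkE.
by congr (_ * _); apply: eq_Rintegral => xi _; rewrite add0r symD.
Qed.

Lemma sin_cosB (a : R) : sin a = cos (- (pi / 2) + a).
Proof. by rewrite addrC cosB cos_pihalf sin_pihalf mulr0 add0r mulr1. Qed.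

Lemma dk_conv v t s x : 0 < t -> 0 < s ->
  \int[L]_y (dk v t (x - y) * hk s y) = dk v (t + s) x.
Proof.
move=> t0 s0; pose g xi := dotp v xi * sym t xi.
have ig : L.-integrable setT (EFin \o g).
  apply: (@integrable_le _ _ _ _ setT measurableT _ (symmaj beta v t)).
  - by apply: measurable_funM; [exact: measurable_dotp|exact: measurable_sym].
  - move=> xi _; have := @dotp_symmaj _ _ beta v t xi 1; rewrite mulr1; apply.
    by rewrite normr1.
  - exact: integrable_symmaj.
have cf := conv_fourier_hk (- (pi / 2)) x s0 ig.
pose I y := (\int[L]_xi (cos (- (pi / 2) + dotp (x - y) xi) * g xi)) * hk s y.
have p0 : (2 * pi) ^+ d != 0 :> R by rewrite gt_eqF// exprn_gt0.
have E y : dk v t (x - y) * hk s y = (2 * pi) ^- d * I y.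
  rewrite /I dkE -mulrA; congr (_ * _); congr (_ * _); apply: eq_Rintegral => xi _.
  by rewrite -sin_cosB /g mulrCA mulrA.
have iI : L.-integrable setT (EFin \o I).
  have : L.-integrable setT (EFin \o (fun y => (2 * pi) ^+ d * (dk v t (x - y) * hk s y))).
    apply: integrableRZ => //; have [M hM] := dk_bdd v t0; apply: (integrable_bddM (M := M)).
    - exact: measurable_dkB.
    - by [].
    - exact: integrable_hk.
  by apply: eq_integrable => // y _ /=; rewrite E mulrA divff// mul1r.
under eq_Rintegral do rewrite E.
rewrite RintegralZl; [|exact: measurableT|exact: iI]; rewrite cf !dkE.
by congr (_ * _); apply: eq_Rintegral => xi _; rewrite -sin_cosB /g -mulrA symD mulrCA mulrA.
Qed.

Lemma sym_mono s t xi : s <= t -> sym t xi <= sym s xi.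
Proof. by move=> st; rewrite ler_expR lerN2 ler_wpM2r ?powR_ge0. Qed.

Lemma sym_cont xi (t : R) : {for t, continuous (fun s => sym s xi)}.
Proof.
apply: continuous_comp; last exact: continuous_expR.
by apply: cvgN; apply: cvgMl.
Qed.

Lemma dk_cont v x (t : R) : 0 < t -> {for t, continuous (fun s => dk v s x)}.
Proof.
move=> t0; apply: cvgMr.
have h := @continuity_under_integral R _ _ L
  (fun s xi => dotp v xi * sin (dotp x xi) * sym s xi) setT
  measurableT (t / 2) (t * 2) _ _ (symmaj beta v (t / 2)) _ _ t; apply: h.
- by move=> s; rewrite /= in_itv/= => /andP[h _]; apply: integrable_dk_integrand => //; lra.
- apply: aeW => xi _ s _; apply: cvgMr; exact: sym_cont.
- by apply: integrable_symmaj => //; lra.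
- move=> s; rewrite /= in_itv/= => /andP[h _]; apply: aeW => xi _.
  apply: le_trans (dotp_symmaj _ _ _ _ (sin_norm_le1 _)) _.
  rewrite ler_wpM2l ?enorm_ge0// ler_wpM2l ?addr_ge0 ?enorm_ge0//.
  by apply: sym_mono; exact: ltW.
- by rewrite inE /= in_itv/=; apply/andP; split; lra.
Qed.

Lemma Rintegral_dk_le v : exists2 C : R, 0 < C & forall t, 0 < t ->
  \int[L]_x `|dk v t x| <= C * tsc t.
Proof.
have [C C0 h] := dk_le_hk beta01 beta_ge v; exists C => // t t0.
have -> : C * tsc t = \int[L]_x (C * tsc t * hk t x).
  by rewrite RintegralZl ?Rintegral_hk ?mulr1//; exact: integrable_hk.
apply: le_Rintegral => //.
- by apply: integrable_abs => //; exact: integrable_dk.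
- by apply: integrableRZ => //; exact: integrable_hk.
- by move=> x _; exact: h.
Qed.

(** [hk_translate] covers displacements shorter than the length scale t^(1/alpha); for longer ones
    the bound exceeds the trivial one, twice the mass. *)
Lemma Rintegral_hk_translate v : exists2 C : R, 0 < C & forall t s, 0 < t -> 0 <= s ->
  \int[L]_x `|hk t (x - s *: v) - hk t x| <= C * (s * tsc t).
Proof.
have [C C0 h] := hk_translate d beta01 beta_ge; pose e := enorm v.
have e0 : 0 <= e := enorm_ge0 v.
exists ((C + 2) * (e + 1)); first by rewrite mulr_gt0// ?(addr_gt0 C0)// ltr_wpDl.
move=> t s t0 s0; have a0 := tsc_gt0 beta t0.
have it := integrable_hk t0.
have its : L.-integrable setT (EFin \o (fun x => hk t (x - s *: v))).
  exact: (integrable_rV_translate (- (s *: v)) it).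
have iB : L.-integrable setT (EFin \o (fun x => `|hk t (x - s *: v) - hk t x|)).
  by apply: integrable_abs => //; exact: integrableRB.
have h0 x : 0 < hk t x by exact: hk_gt0.
have [small|big] := leP (s * e * tsc t) 1.
  apply: (@le_trans _ _ (\int[L]_x (C * (s * e * tsc t) * hk t x))).
    apply: le_Rintegral => //; first exact: integrableRZ.
    move=> x _; have := h t x (x - s *: v) t0.
    rewrite subKr enormZ (ger0_norm s0) -/e distrC; exact.
  rewrite RintegralZl// Rintegral_hk// mulr1.
  have -> : C * (s * e * tsc t) = C * e * (s * tsc t) by ring.
  rewrite ler_wpM2r ?mulr_ge0 ?(ltW a0)//; apply: ler_pM; rewrite ?(ltW C0)// ?lerDl//.
apply: (@le_trans _ _ (\int[L]_x (hk t (x - s *: v) + hk t x))).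
  apply: le_Rintegral => //; first exact: integrableRD.
  move=> x _; apply: le_trans (ler_normB _ _) _.
  by rewrite !(ger0_norm (ltW (h0 _))).
rewrite RintegralD// (Rintegral_rV_translate (- (s *: v)) it) Rintegral_hk//.
have -> : (C + 2) * (e + 1) * (s * tsc t) = (C + 2) * (s * e * tsc t) + (C + 2) * (s * tsc t) by ring.
apply: (@le_trans _ _ ((C + 2) * (s * e * tsc t))).
  have := ltW C0; nra.
by rewrite lerDl !mulr_ge0 ?addr_ge0 ?(ltW a0) ?(ltW C0).
Qed.

End heat_kernel_semigroup.


(** * Mild solutions *)

Section mild_solution_facts.
Context {R : realType} (d : nat).
Variable alpha : R.
Hypothesis alpha12 : 1 < alpha < 2.
Local Notation L := (@lebesgue_rV R d).
Local Notation beta := (alpha / 2).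
Implicit Types x y z xi v : 'rV[R]_d.

Lemma half_alpha01 : 0 < beta < 1.
Proof. by case/andP: alpha12 => a1 a2; apply/andP; split; lra. Qed.

Lemma half_alpha_ge : 2^-1 <= beta.
Proof. by case/andP: alpha12 => a1 a2; lra. Qed.

Lemma enorm_powR x : enorm x `^ alpha = (dotp x x) `^ beta.
Proof.
rewrite /enorm -powR12_sqrt ?dotp_ge0// -powRrM; congr (_ `^ _).
by rewrite mulrC.
Qed.

Lemma heat_kernelE t x : heat_kernel alpha t x = hk beta t x.
Proof.
rewrite /heat_kernel hkE /cintegral /=; congr (_ * _); apply: eq_Rintegral => xi _.
by rewrite /cexpi /= mulr0 subr0 cosN symE enorm_powR.
Qed.

Lemma stable_semigroupE t f x :
  stable_semigroup alpha t f x = \int[L]_y (hk beta t (x - y) * f y).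
Proof. by apply: eq_Rintegral => y _; rewrite heat_kernelE. Qed.

Lemma derive_hk v t x z : 0 < t ->
  'D_v (fun z => hk beta t (x - z)) z = dk beta v t (x - z).
Proof.
move=> t0; have [_ E] := is_derive_hk half_alpha_ge v (x - z) 0 t0.
rewrite scale0r subr0 in E; rewrite -E /derive.
apply: (congr1 (fun F : R -> R => lim (F @ (0 : R)^'))); apply/funext => h; rewrite /= addr0 scale0r subr0 /GRing.scale /= mulr1.
by rewrite [scalemx h v + z]addrC opprD addrA.
Qed.

Lemma dk_sum (b : 'rV[R]_d) t x : 0 < t ->
  dk beta b t x = \sum_(i < d) b ord0 i * dk beta (delta_mx ord0 i) t x.
Proof.
move=> t0; rewrite dkE.
have E xi : dotp b xi * sin (dotp x xi) * sym beta t xi =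
  \sum_(i < d) b ord0 i * (dotp (delta_mx ord0 i) xi * sin (dotp x xi) * sym beta t xi).
  rewrite {1}/dotp -mulrA mulr_suml; apply: eq_bigr => i _.
  have -> : dotp (delta_mx ord0 i) xi = xi ord0 i.
    rewrite /dotp (bigD1 i)//= mxE !eqxx mul1r big1 ?addr0// => j ji.
    by rewrite mxE (negbTE ji) andbF mul0r.
  by rewrite !mulrA.
under eq_Rintegral do rewrite E.
have ii (i : 'I_d) : L.-integrable setT (EFin \o (fun xi => dotp (delta_mx ord0 i) xi *
    sin (dotp x xi) * sym beta t xi)).
  by apply: integrable_dk_integrand => //; exact: half_alpha_ge.
rewrite Rintegral_sum//; last by move=> i; exact: integrableRZ.
rewrite mulr_sumr; apply: eq_bigr => i _.
by rewrite RintegralZl// dkE mulrCA.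
Qed.

Definition flux (q a : R) : R := a * `|a| `^ q.

Lemma duhamel_integrandE q b u t x s z : s < t ->
  duhamel_integrand alpha q b u t x s z = dk beta b (t - s) (x - z) * flux q (u s z).
Proof.
move=> st; rewrite /duhamel_integrand; apply: (congr1 (fun r => r * flux q (u s z))).
have -> : (fun z => heat_kernel alpha (t - s) (x - z)) = (fun z => hk beta (t - s) (x - z)).
  by apply/funext => w; exact: heat_kernelE.
rewrite /dotp dk_sum ?subr_gt0//; apply: eq_bigr => i _; congr (_ * _).
by rewrite mxE derive_hk ?subr_gt0.
Qed.

Lemma lebesgue_rV_gt0 : (0 < L setT)%E.
Proof.
apply: (@lt_le_trans _ _ (L cube)); first by rewrite [L cube]lebesgue_cube.
by apply: le_measure; rewrite ?inE//; exact: measurable_cube.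
Qed.

Lemma Loo_le_ae (f : 'rV[R]_d -> \bar R) (e : \bar R) : ('N[L]_+oo[f] <= e)%E <->
  {ae L, forall x, (`|f x| <= e)%E}.
Proof.
by rewrite unlock /= lebesgue_rV_gt0; split => /ess_supP.
Qed.

Section facts.
Variables (q : R) (b : 'rV[R]_d) (u0 : 'rV[R]_d -> R) (u : R -> 'rV[R]_d -> R).
Hypothesis sol : mild_solution alpha q b u0 u.

Lemma sol_integrable t : 0 <= t -> L.-integrable setT (EFin \o u t).
Proof. by move=> t0; apply/Lfun1_integrable; exact: (mild_L1 sol). Qed.

Lemma sol_cont t e : 0 <= t -> 0 < e -> exists2 r : R, 0 < r &
  forall s, 0 <= s -> `|s - t| < r -> \int[L]_x `|u s x - u t x| < e.
Proof.
move=> t0 e0; have h := mild_continuous_L1 sol t0.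
have /h : nbhs (0 : \bar R)%E [set x | (x < e%:E)%E].
  by apply: open_nbhs_nbhs; split; [exact: open_ereal_lt_ereal|rewrite /= lte_fin].
move=> /nbhs_ballP[r /= r0 H]; exists r => // s s0 st.
have := H s; rewrite /ball /= distrC => /(_ st); rewrite in_itv/= andbT => /(_ s0).
rewrite Lnorm1 /Rintegral /=.
have i1 : L.-integrable setT (EFin \o (fun x => `|u s x - u t x|)).
  by apply: integrable_abs => //; apply: integrableRB => //; exact: sol_integrable.
by rewrite -lte_fin fineK//; exact: integrable_fin_num.
Qed.

(** Continuity in L^oo gives a bound near each time, and compactness makes it uniform. The bound may
    blow up as [a] tends to 0, where no such continuity is assumed. *)
Lemma sol_bdd a c : 0 < a -> exists2 B : R, 0 < B &
  forall s, a <= s <= c -> {ae L, forall x, `|u s x| <= B}.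
Proof.
move=> a0.
have /compact_near_coveringP := @segment_compact R a c.
move=> /(_ R (pinfty_nbhs R) (fun B s => {ae L, forall x, `|u s x| <= B}) _) [].
  move=> t; rewrite /= in_itv/= => /andP[at_ _]; have t0 : 0 < t by exact: lt_le_trans at_.
  have h := mild_continuous_Loo sol t0.
  have /h : nbhs (0 : \bar R)%E [set x | (x < 1%:E)%E].
    by apply: open_nbhs_nbhs; split; [exact: open_ereal_lt_ereal|rewrite /= lte_fin].
  move=> /nbhs_ballP[r /= r0 H].
  have : u t \in Lfun L +oo%E by exact: (mild_Loo sol).
  rewrite inE => /andP[_]; rewrite inE /= /finite_norm => fin.
  have N0 : (0 <= 'N[L]_+oo[EFin \o u t])%E by exact: Lnorm_ge0.
  pose N := fine 'N[L]_+oo[EFin \o u t].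
  have NE : ('N[L]_+oo[EFin \o u t] = N%:E)%E by rewrite fineK// ge0_fin_numE.
  exists (ball t r, [set B | N + 1 < B]).
    by split; [exact: nbhsx_ballx|apply: nbhs_pinfty_gt; rewrite num_real].
  move=> [s B] /= [st NB].
  have /ltW /Loo_le_ae h1 := H s st.
  have /Loo_le_ae h2 : ('N[L]_+oo[EFin \o u t] <= N%:E)%E by rewrite NE.
  apply: filterS2 h1 h2 => x /=; rewrite !lee_fin => h1 h2.
  apply: le_trans (ltW NB); rewrite -[u s x](subrK (u t x)) addrC.
  by apply: le_trans (ler_normD _ _) _; exact: lerD.
move=> M [_ H]; exists (Num.max M 0 + 1).
  by rewrite ltr_pwDr// le_max lexx orbT.
move=> s sac; apply: (H (Num.max M 0 + 1)).
  by rewrite ltr_pwDr// le_max lexx.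
by rewrite /= in_itv.
Qed.

Lemma sol_init : {ae L, forall x, u 0 x = u0 x}.
Proof. by apply: filterS (mild_init sol) => x /= /(_ I). Qed.

Lemma sol_conv t x : 0 < t ->
  (\int[lebesgue_measure]_(s in `]0%R, t[)
    \int[L]_z `|dk beta b (t - s) (x - z) * flux q (u s z)|%:E < +oo)%E.
Proof.
move=> t0; apply: le_lt_trans (mild_convergence sol x t0).
rewrite le_eqVlt; apply/orP; left; apply/eqP; apply: eq_integral => s.
rewrite inE /= in_itv/= => /andP[_ st]; apply: eq_integral => z _.
by rewrite (duhamel_integrandE q b u x z st).
Qed.

Lemma sol_duhamel t x : 0 < t -> u t x = \int[L]_y (hk beta t (x - y) * u0 y) +
  \int[lebesgue_measure]_(s in `]0, t[)
    (\int[L]_z (dk beta b (t - s) (x - z) * flux q (u s z))).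
Proof.
move=> t0; rewrite (mild_duhamel sol x t0) stable_semigroupE.
apply: (congr1 (fun r => \int[L]_y (hk beta t (x - y) * u0 y) + r)).
apply: eq_Rintegral => s; rewrite inE /= in_itv/= => /andP[_ st].
by apply: eq_Rintegral => z _; rewrite (duhamel_integrandE q b u x z st).
Qed.

End facts.
End mild_solution_facts.


(** * Convolution *)

Section convolution.
Context {R : realType} (d : nat).
Local Notation L := (@lebesgue_rV R d).
Implicit Types (x y z a : 'rV[R]_d) (k l f g h : 'rV[R]_d -> R).

Definition N1 f : R := \int[L]_x `|f x|.

Definition conv k f x : R := \int[L]_y (k (x - y) * f y).

(** Boundedness is asked besides integrability so that the convolution with an integrable function
    converges at every point; the identities below then hold everywhere and not only almost
    everywhere. *)
Definition ker k : Prop := (exists M, forall x, `|k x| <= M) /\ L.-integrable setT (EFin \o k).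

Lemma integrable_measurable f : L.-integrable setT (EFin \o f) -> measurable_fun setT f.
Proof. by move=> /integrableP[/measurable_EFinP]. Qed.

Lemma N1_ge0 f : 0 <= N1 f.
Proof. by apply: Rintegral_ge0 => x _; exact: normr_ge0. Qed.

Lemma le_N1 f g : L.-integrable setT (EFin \o f) -> L.-integrable setT (EFin \o g) ->
  (forall x, `|f x| <= `|g x|) -> N1 f <= N1 g.
Proof.
move=> fi gi fg; by apply: le_Rintegral => //; exact: integrable_abs.
Qed.

Lemma N1D f g : L.-integrable setT (EFin \o f) -> L.-integrable setT (EFin \o g) ->
  N1 (fun x => f x + g x) <= N1 f + N1 g.
Proof.
move=> fi gi; rewrite /N1 -RintegralD//; try exact: integrable_abs.
apply: le_Rintegral => //; first by apply: integrable_abs => //; exact: integrableRD.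
  by apply: integrableRD => //; exact: integrable_abs.
by move=> x _; exact: ler_normD.
Qed.

Lemma N1B f g : L.-integrable setT (EFin \o f) -> L.-integrable setT (EFin \o g) ->
  N1 (fun x => f x - g x) <= N1 f + N1 g.
Proof.
move=> fi gi; rewrite /N1 -RintegralD//; try exact: integrable_abs.
apply: le_Rintegral => //; first by apply: integrable_abs => //; exact: integrableRB.
  by apply: integrableRD => //; exact: integrable_abs.
by move=> x _; exact: ler_normB.
Qed.

Lemma N1BC f g : N1 (fun x => f x - g x) = N1 (fun x => g x - f x).
Proof. by apply: eq_Rintegral => x _; rewrite distrC. Qed.

Lemma N1_triangle f g h : L.-integrable setT (EFin \o f) -> L.-integrable setT (EFin \o g) ->
  L.-integrable setT (EFin \o h) ->
  N1 (fun x => f x - h x) <= N1 (fun x => f x - g x) + N1 (fun x => g x - h x).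
Proof.
move=> fi gi hi; have -> : N1 (fun x => f x - h x) = N1 (fun x => (f x - g x) + (g x - h x)).
  by apply: eq_Rintegral => x _; rewrite addrA subrK.
by apply: N1D; exact: integrableRB.
Qed.

Lemma N1Z c f : L.-integrable setT (EFin \o f) -> N1 (fun x => c * f x) = `|c| * N1 f.
Proof.
move=> fi; rewrite /N1 -RintegralZl//; last exact: integrable_abs.
by apply: eq_Rintegral => x _; rewrite normrM.
Qed.

Lemma N1_sum I (r : seq I) (F : I -> 'rV[R]_d -> R) :
  (forall i, L.-integrable setT (EFin \o F i)) ->
  N1 (fun x => \sum_(i <- r) F i x) <= \sum_(i <- r) N1 (F i).
Proof.
move=> Fi; elim: r => [|i r IH].
  rewrite big_nil /N1; under eq_Rintegral do rewrite big_nil normr0.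
  by rewrite Rintegral_cst// mul0r.
rewrite big_cons; apply: le_trans (lerD (lexx _) IH).
have -> : N1 (fun x => \sum_(j <- i :: r) F j x) = N1 (fun x => F i x + \sum_(j <- r) F j x).
  by apply: eq_Rintegral => x _; rewrite big_cons.
by apply: N1D => //; exact: integrableR_sum.
Qed.

Lemma N1_translate a f : L.-integrable setT (EFin \o f) -> N1 (fun x => f (x - a)) = N1 f.
Proof. by move=> fi; exact: (Rintegral_rV_translate (- a) (integrable_abs fi)). Qed.

Lemma integrable_translateB a f : L.-integrable setT (EFin \o f) ->
  L.-integrable setT (EFin \o (fun x => f (x - a))).
Proof. by move=> fi; exact: (integrable_rV_translate (- a) fi). Qed.

Lemma integrable_reflect a f : L.-integrable setT (EFin \o f) ->
  L.-integrable setT (EFin \o (fun x => f (a - x))).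
Proof. exact: integrable_rV_reflect. Qed.

Lemma N1_eq0 f : L.-integrable setT (EFin \o f) -> N1 f = 0 -> {ae L, forall x, f x = 0}.
Proof.
move=> fi f0; have mf := integrable_measurable fi.
have : (\int[L]_x `|(EFin \o f) x| = 0)%E.
  by rewrite -[RHS]/(0%:E) -f0 (EFin_Rintegral measurableT (integrable_abs fi)).
move/(ae_eq_integral_abs L measurableT _).1 => /(_ _) h.
have : ae_eq L setT (EFin \o f) (cst 0%E) by apply: h; exact/measurable_EFinP.
by apply: filterS => x /= /(_ I) [].
Qed.

Lemma ae_Rintegral f g : {ae L, forall x, f x = g x} ->
  measurable_fun setT f -> measurable_fun setT g ->
  \int[L]_x f x = \int[L]_x g x.
Proof.
move=> fg mf mg; rewrite /Rintegral; congr fine; apply: ae_eq_integral => //.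
- exact/measurable_EFinP.
- exact/measurable_EFinP.
by apply: filterS fg => x /= ->.
Qed.

Lemma ker_measurable k : ker k -> measurable_fun setT k.
Proof. by case=> _; exact: integrable_measurable. Qed.

Lemma measurable_slice k x : ker k -> measurable_fun setT (fun y => k (x - y)).
Proof.
by move=> kk; apply: (measurableT_comp (ker_measurable kk)); exact: measurable_rVB.
Qed.

Lemma ker_slice k f x : ker k -> L.-integrable setT (EFin \o f) ->
  L.-integrable setT (EFin \o (fun y => k (x - y) * f y)).
Proof.
move=> kk fi; have [[M kM] _] := kk; apply: (integrable_bddM (M := M)) => //.
exact: measurable_slice.
Qed.

Lemma ker_abs k : ker k -> ker (fun x => `|k x|).
Proof.
by move=> [[M kM] ik]; split; [exists M => x; rewrite normr_id|exact: integrable_abs].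
Qed.

Lemma kerB k l : ker k -> ker l -> ker (fun x => k x - l x).
Proof.
move=> [[M kM] ik] [[M' lM] il]; split; last exact: integrableRB.
by exists (M + M') => x; apply: le_trans (ler_normB _ _) _; exact: lerD.
Qed.

Lemma kerZ c k : ker k -> ker (fun x => c * k x).
Proof.
move=> [[M kM] ik]; split; last exact: integrableRZ.
by exists (`|c| * M) => x; rewrite normrM ler_wpM2l.
Qed.

Lemma ker_translate a k : ker k -> ker (fun x => k (x - a)).
Proof. by move=> [[M kM] ik]; split; [exists M|exact: integrable_translateB]. Qed.

Section fubini_conv.
Variables (k f : 'rV[R]_d -> R).
Hypotheses (kk : ker k) (fi : L.-integrable setT (EFin \o f)).

Let mconv : measurable_fun (setT `*` setT)
  (fun p : 'rV[R]_d * 'rV[R]_d => k (p.2 - p.1) * f p.1).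
Proof.
rewrite setXTT; apply: measurable_funM.
  by apply: (measurableT_comp (ker_measurable kk)); exact: measurable_rVB.
exact: (measurableT_comp (integrable_measurable fi)).
Qed.

Let fconv : (\int[L]_(y in setT) \int[L]_(x in setT) `|k (x - y) * f y|%:E < +oo)%E.
Proof.
apply: (fubini_bound measurableT measurableT mconv (h := fun y => N1 k * `|f y|)).
  move=> y _; rewrite -(N1_translate y kk.2) mulrC -RintegralZl//; last first.
    by apply: integrable_abs => //; exact: integrable_translateB kk.2.
  apply: integral_norm_le => //.
  - apply: measurable_funM => //; apply: (measurableT_comp (ker_measurable kk)).
    exact: measurable_rVB.
  - by move=> x _; rewrite normrM mulrC.
  by apply: integrableRZ => //; apply: integrable_abs => //; exact: integrable_translateB kk.2.
by apply: integrableRZ => //; exact: integrable_abs.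
Qed.

Lemma integrable_conv : L.-integrable setT (EFin \o conv k f).
Proof. exact: (integrable_Rintegral2 measurableT measurableT mconv fconv). Qed.

Lemma Rintegral_conv : \int[L]_x conv k f x = (\int[L]_x k x) * \int[L]_x f x.
Proof.
rewrite -(Rintegral_fubini measurableT measurableT mconv fconv) -RintegralZl//.
apply: eq_Rintegral => y _; rewrite -(Rintegral_rV_translate (- y) kk.2) mulrC.
rewrite -RintegralZl//; last exact: integrable_translateB kk.2.
by apply: eq_Rintegral => x _; rewrite mulrC.
Qed.

End fubini_conv.

Lemma conv_abs_le k f x : ker k -> L.-integrable setT (EFin \o f) ->
  `|conv k f x| <= conv (fun x => `|k x|) (fun y => `|f y|) x.
Proof.
move=> kk fi; apply: ler_norm_Rintegral => //.
- by have := ker_slice x kk fi => /integrable_measurable.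
- by move=> y _; rewrite normrM.
- exact: (ker_slice x (ker_abs kk) (integrable_abs fi)).
Qed.

Lemma N1_conv k f : ker k -> L.-integrable setT (EFin \o f) -> N1 (conv k f) <= N1 k * N1 f.
Proof.
move=> kk fi; rewrite -(Rintegral_conv (ker_abs kk) (integrable_abs fi)).
apply: le_Rintegral => //.
- by apply: integrable_abs => //; exact: integrable_conv.
- by apply: integrable_conv; [exact: ker_abs|exact: integrable_abs].
- by move=> x _; exact: conv_abs_le.
Qed.

Lemma conv_bdd k f M x : ker k -> L.-integrable setT (EFin \o f) ->
  (forall x, `|k x| <= M) -> `|conv k f x| <= M * N1 f.
Proof.
move=> kk fi kM; rewrite -RintegralZl//; last exact: integrable_abs.
apply: ler_norm_Rintegral => //.
- by have := ker_slice x kk fi => /integrable_measurable.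
- by move=> y _; rewrite normrM ler_wpM2r.
- by apply: integrableRZ => //; exact: integrable_abs.
Qed.

Lemma ker_conv k f : ker k -> L.-integrable setT (EFin \o f) -> ker (conv k f).
Proof.
move=> kk fi; split; last exact: integrable_conv.
by have [[M kM] _] := kk; exists (M * N1 f) => x; exact: conv_bdd.
Qed.

Lemma convBr k f g x : ker k -> L.-integrable setT (EFin \o f) ->
  L.-integrable setT (EFin \o g) ->
  conv k (fun y => f y - g y) x = conv k f x - conv k g x.
Proof.
move=> kk fi gi; rewrite /conv -RintegralB//; try exact: ker_slice.
by apply: eq_Rintegral => y _; rewrite mulrBr.
Qed.

Lemma convBl k l f x : ker k -> ker l -> L.-integrable setT (EFin \o f) ->
  conv (fun y => k y - l y) f x = conv k f x - conv l f x.
Proof.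
move=> kk kl fi; rewrite /conv -RintegralB//; try exact: ker_slice.
by apply: eq_Rintegral => y _; rewrite mulrBl.
Qed.

Lemma convZr k c f x : ker k -> L.-integrable setT (EFin \o f) ->
  conv k (fun y => c * f y) x = c * conv k f x.
Proof.
move=> kk fi; rewrite /conv -RintegralZl//; last exact: ker_slice.
by apply: eq_Rintegral => y _; rewrite mulrCA.
Qed.

Lemma convZl k c f x : ker k -> L.-integrable setT (EFin \o f) ->
  conv (fun y => c * k y) f x = c * conv k f x.
Proof.
move=> kk fi; rewrite /conv -RintegralZl//; last exact: ker_slice.
by apply: eq_Rintegral => y _; rewrite mulrA.
Qed.

Lemma conv_translate k f a x : ker k -> L.-integrable setT (EFin \o f) ->
  conv k (fun y => f (y - a)) x = conv (fun z => k (z - a)) f x.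
Proof.
move=> kk fi; rewrite /conv.
have i := ker_slice (x - a) kk fi.
transitivity (\int[L]_y (k (x - a - y) * f y)).
  rewrite -(Rintegral_rV_translate (- a) i); apply: eq_Rintegral => y _.
  by rewrite opprB addrA subrK.
by apply: eq_Rintegral => y _; rewrite addrAC.
Qed.

Lemma conv_assoc k l f x : ker k -> ker l -> L.-integrable setT (EFin \o f) ->
  conv k (conv l f) x = conv (conv k l) f x.
Proof.
move=> kk kl fi; have [[M kM] _] := kk.
pose F y z := k (x - y) * (l (y - z) * f z).
have mF : measurable_fun (setT `*` setT) (fun p : 'rV[R]_d * 'rV[R]_d => F p.1 p.2).
  rewrite setXTT; apply: measurable_funM.
    by apply: (measurableT_comp (ker_measurable kk)); exact: measurable_rVB.
  apply: measurable_funM.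
    by apply: (measurableT_comp (ker_measurable kl)); exact: measurable_rVB.
  exact: (measurableT_comp (integrable_measurable fi)).
have fF : (\int[L]_(y in setT) \int[L]_(z in setT) `|F y z|%:E < +oo)%E.
  apply: (fubini_bound measurableT measurableT mF
    (h := fun y => M * conv (fun x => `|l x|) (fun y => `|f y|) y)).
    have i y : L.-integrable setT (EFin \o (fun z => `|l (y - z)| * `|f z|)).
      exact: (ker_slice y (ker_abs kl) (integrable_abs fi)).
    move=> y _; rewrite -RintegralZl//.
    apply: integral_norm_le => //.
    - have := ker_slice y kl fi => /integrable_measurable ms.
      exact: measurable_funM.
    - by move=> z _; rewrite /F !normrM ler_wpM2r// mulr_ge0.
    exact: integrableRZ.
  by apply: integrableRZ => //; apply: integrable_conv; [exact: ker_abs|exact: integrable_abs].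
transitivity (\int[L]_y (\int[L]_z F y z)).
  apply: eq_Rintegral => y _; rewrite -RintegralZl//; exact: ker_slice.
rewrite (Rintegral_fubini measurableT measurableT mF fF).
apply: eq_Rintegral => z _; rewrite /conv mulrC.
have i : L.-integrable setT (EFin \o (fun w => k (x - z - w) * l w)) by exact: ker_slice kl.2.
rewrite -(Rintegral_rV_translate (- z) i) -RintegralZl//; last exact: integrable_translateB i.
by apply: eq_Rintegral => y _; rewrite /F opprB addrA subrK mulrA mulrC.
Qed.

End convolution.


(** * Convolutions depending on time *)

Lemma seq_continuous {R : realType} (f : R -> R) (p : R) :
  (forall u : nat -> R, u n @[n --> \oo] --> p -> f (u n) @[n --> \oo] --> f p) ->
  {for p, continuous f}.
Proof.
move=> h; apply/continuous_withinNx; apply/cvgr_dnbhsP => u [_ up]; exact: h.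
Qed.

Section time_convolution.
Context {R : realType} (d : nat).
Local Notation L := (@lebesgue_rV R d).
Local Notation mu := (@lebesgue_measure R).
Local Notation TR := (measurableTypeR R).
Implicit Types (x y z : 'rV[R]_d) (k f g h : 'rV[R]_d -> R) (F K : R -> 'rV[R]_d -> R).

Definition L1cont F (a c : R) : Prop :=
  (forall s, a < s < c -> L.-integrable setT (EFin \o F s)) /\
  (forall s e, a < s < c -> 0 < e -> exists2 r : R, 0 < r & forall s', a < s' < c ->
     `|s' - s| < r -> N1 (fun x => F s' x - F s x) < e).

(** The bound is uniform only away from the right end: the model is the gradient kernel at time T -
    s with c <= T, which blows up as s tends to T. *)
Definition kerfam K (a c : R) : Prop :=
  [/\ forall s, a < s < c -> ker (K s),
      forall s x, a < s < c -> {for s, continuous (fun s => K s x)} &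
      forall c', c' < c -> exists M, forall s x, a < s < c' -> `|K s x| <= M].

Lemma L1cont_sub F a c a' c' : a <= a' -> c' <= c -> L1cont F a c -> L1cont F a' c'.
Proof.
move=> aa cc [iF cF]; have sub s : a' < s < c' -> a < s < c.
  by move=> /andP[h1 h2]; rewrite (le_lt_trans aa h1) (lt_le_trans h2 cc).
split=> [s /sub|s e /sub sac e0]; first exact: iF.
by have [r r0 h] := cF s e sac e0; exists r => // s' /sub; exact: h.
Qed.

Lemma L1cont_abs F a c : L1cont F a c -> L1cont (fun s x => `|F s x|) a c.
Proof.
move=> [iF cF]; split=> [s sac|s e sac e0]; first by apply: integrable_abs => //; exact: iF.
have [r r0 h] := cF s e sac e0; exists r => // s' s'ac s's.
apply: le_lt_trans (h s' s'ac s's); apply: le_N1.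
- by apply: integrableRB => //; apply: integrable_abs => //; exact: iF.
- by apply: integrableRB => //; exact: iF.
- by move=> x; exact: ler_dist_dist.
Qed.

(** Kernel and function move together: with the function frozen at [s0] dominated convergence
    applies, and the change of the function costs at most [M] times its L^1 distance. *)
Lemma cvg_pairing K F a c s0 x M : a < s0 < c -> L1cont F a c ->
  (forall s, a < s < c -> ker (K s)) ->
  (forall s y, a < s < c -> `|K s y| <= M) ->
  (forall y, {for s0, continuous (fun s => K s y)}) ->
  {for s0, continuous (fun s => conv (K s) (F s) x)}.
Proof.
move=> s0ac [iF cF] kK bK cK.
have M0 : 0 <= M by apply: le_trans (bK s0 0 s0ac).
apply: seq_continuous => u us0.
(* Dominated convergence wants its hypotheses for all [n], so the finitely many terms outside the
   interval are replaced by [s0]. *)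
pose v n := if a < u n < c then u n else s0.
have vac n : a < v n < c by rewrite /v; case: ifP.
have uv : \forall n \near \oo, u n = v n.
  near=> n; rewrite /v ifT//; apply/andP; split; near: n.
    by apply: (cvgr_gt s0 us0); case/andP: s0ac.
  by apply: (cvgr_lt s0 us0); case/andP: s0ac.
have vs0 : v n @[n --> \oo] --> s0.
  by apply: cvg_trans us0; apply: near_eq_cvg; apply: filterS uv => n /= ->.
suff : conv (K (v n)) (F (v n)) x @[n --> \oo] --> conv (K s0) (F s0) x.
  by apply: cvg_trans; apply: near_eq_cvg; apply: filterS uv => n /= ->.
have iF0 := iF _ s0ac.
have E n : conv (K (v n)) (F (v n)) x = conv (K (v n)) (F s0) x +
    conv (K (v n)) (fun y => F (v n) y - F s0 y) x.
  by rewrite (convBr x (kK _ (vac n)) (iF _ (vac n)) iF0) addrC subrK.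
rewrite (funext E) -[conv (K s0) (F s0) x]addr0; apply: cvgD.
  have [] := @Rintegral_dct _ _ _ L setT measurableT
    (fun n y => K (v n) (x - y) * F s0 y) (fun y => K s0 (x - y) * F s0 y)
    (fun y => M * `|F s0 y|).
  - move=> n; apply: measurable_funM; last exact: integrable_measurable.
    by apply: measurable_slice; exact: kK.
  - move=> y _; apply: cvgMl.
    exact: (@cvg_comp _ _ _ v (fun s => K s (x - y)) _ _ _ vs0 (cK (x - y))).
  - by apply: integrableRZ => //; exact: integrable_abs.
  - by move=> n y _; rewrite normrM ler_wpM2r// bK.
  by [].
apply/cvgrPdist_lt => e e0.
have [r r0 h] := cF s0 (e / (M + 1)) s0ac (divr_gt0 e0 (ltr_wpDl M0 ltr01)).
near=> n; rewrite sub0r normrN.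
apply: (@le_lt_trans _ _ (M * N1 (fun y => F (v n) y - F s0 y))).
  apply: conv_bdd; [exact: kK|by apply: integrableRB => //; exact: iF|].
  by move=> y; exact: bK.
have : N1 (fun y => F (v n) y - F s0 y) < e / (M + 1).
  apply: h => //; rewrite distrC; near: n; move/cvgrPdist_lt : vs0; exact.
rewrite ltr_pdivlMr ?ltr_wpDl// => h1.
have := N1_ge0 (fun y => F (v n) y - F s0 y); nra.
Unshelve. all: by end_near. Qed.

Lemma conv_time_cont K F a c x s0 : kerfam K a c -> L1cont F a c -> a < s0 < c ->
  {for s0, continuous (fun s => conv (K s) (F s) x)}.
Proof.
move=> [kK cK bK] cF /andP[as0 s0c].
pose c' := (s0 + c) / 2; have [s0c' c'c] : s0 < c' /\ c' < c by rewrite /c'; split; lra.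
have [M hM] := bK c' c'c.
have sub s : a < s < c' -> a < s < c by move=> /andP[-> h]; rewrite (lt_trans h c'c).
apply: (@cvg_pairing K F a c' s0 x M).
- by rewrite as0.
- by apply: L1cont_sub cF => //; exact: ltW.
- by move=> s /sub; exact: kK.
- by [].
- by move=> y; apply: cK; rewrite as0.
Qed.

Lemma conv_time_meas K F a c : kerfam K a c -> L1cont F a c ->
  measurable_fun (`]a, c[ `*` [set: 'rV[R]_d])
    (fun p : TR * 'rV[R]_d => conv (K p.1) (F p.1) p.2).
Proof.
move=> kK cF; apply: (@measurable_caratheodory _ _ R a c (fun s x => conv (K s) (F s) x)).
  move=> s sac; apply: integrable_measurable; apply: integrable_conv.
    by have [h _ _] := kK; exact: h.
  by have [h _] := cF; exact: h.
by move=> s x sac; exact: (@conv_time_cont K F a c x s kK cF sac).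
Qed.

Lemma measurable_time_slice (g : R -> 'rV[R]_d -> R) (a c : R) x :
  measurable_fun (`]a, c[ `*` [set: 'rV[R]_d]) (fun p : TR * 'rV[R]_d => g p.1 p.2) ->
  measurable_fun `]a, c[ (fun s => g s x).
Proof.
move=> mg; apply: (@measurable_comp _ _ _ TR _ _ (`]a, c[ `*` [set: 'rV[R]_d])
  (fun p : TR * 'rV[R]_d => g p.1 p.2) _ (fun s => (s, x))) => //.
- exact: measurableX.
- by move=> _ [s sac <-].
- by apply: (@measurable_funS _ _ _ _ setT) => //; exact: measurable_pair2.
Qed.

Section time_integral.
Variables (g : R -> 'rV[R]_d -> R) (a c : R) (m : R -> R).
Hypothesis mg : measurable_fun (`]a, c[ `*` [set: 'rV[R]_d]) (fun p : TR * 'rV[R]_d => g p.1 p.2).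
Hypothesis ig : forall s, a < s < c -> L.-integrable setT (EFin \o g s).
Hypothesis gm : forall s, a < s < c -> N1 (g s) <= m s.
Hypothesis im : mu.-integrable `]a, c[ (EFin \o m).

Let gmE s : `]a, c[%classic s -> (\int[L]_(x in setT) `|g s x|%:E <= (m s)%:E)%E.
Proof.
rewrite /= in_itv/= => sac; rewrite -(EFin_Rintegral measurableT (integrable_abs (ig sac))).
by rewrite lee_fin gm.
Qed.

Lemma time_integral_fin : (\int[mu]_(s in `]a, c[) \int[L]_(x in setT) `|g s x|%:E < +oo)%E.
Proof.
exact: (@fubini_bound _ _ TR _ R mu L _ _ g m (measurable_itv `]a, c[) measurableT mg gmE im).
Qed.

Lemma integrable_time_integral :
  L.-integrable setT (EFin \o (fun x => \int[mu]_(s in `]a, c[) g s x)).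
Proof.
exact: (@integrable_Rintegral2 _ _ TR _ R mu L _ _ g (measurable_itv `]a, c[) measurableT mg time_integral_fin).
Qed.

(** Minkowski's integral inequality, by Tonelli. *)
Lemma N1_time_integral : N1 (fun x => \int[mu]_(s in `]a, c[) g s x) <= \int[mu]_(s in `]a, c[) m s.
Proof.
rewrite -lee_fin /N1 (EFin_Rintegral measurableT (integrable_abs integrable_time_integral)).
rewrite EFin_Rintegral//.
have mag : measurable_fun (`]a, c[ `*` [set: 'rV[R]_d]) (fun p : TR * 'rV[R]_d => `|g p.1 p.2|).
  exact: measurableT_comp.
apply: (@le_trans _ _ (\int[L]_x \int[mu]_(s in `]a, c[) `|g s x|%:E)%E).
  apply: ge0_le_integral => //.
  - apply/measurable_EFinP; apply: measurableT_comp => //.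
    exact: integrable_measurable integrable_time_integral.
  - by apply: (measurable_tonelli2 mu (measurable_itv `]a, c[) measurableT (f := fun s x => `|g s x|) mag).
  move=> x _; apply: (@le_trans _ _ (`|\int[mu]_(s in `]a, c[) (g s x)%:E|)%E).
    by rewrite /Rintegral; case: (\int[mu]_(s in _) _)%E => //=; rewrite ?normr0 ?leey.
  apply: le_abse_integral => //; apply/measurable_EFinP.
  exact: measurable_time_slice.
rewrite -(ge0_tonelli mu L (measurable_itv `]a, c[) measurableT (f := fun s x => `|g s x|) mag)//.
apply: ge0_le_integral => //.
- by move=> s _; exact: integral_ge0.
- by apply: (measurable_tonelli1 L (measurable_itv `]a, c[) measurableT (f := fun s x => `|g s x|) mag).
- by have /integrableP[] := im.
Qed.

End time_integral.

(** Absolute convergence stays a hypothesis because it has two sources: weights in [rerr_periodic],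
    a sup bound in [restart_everywhere]. *)
Lemma conv_time_fubini K F a c k x : ker k -> kerfam K a c -> L1cont F a c ->
  (forall y, mu.-integrable `]a, c[ (EFin \o (fun s => conv (K s) (F s) y))) ->
  (\int[mu]_(s in `]a, c[) \int[L]_(y in setT) `|k (x - y) * conv (K s) (F s) y|%:E < +oo)%E ->
  conv k (fun y => \int[mu]_(s in `]a, c[) conv (K s) (F s) y) x =
  \int[mu]_(s in `]a, c[) conv (conv k (K s)) (F s) x.
Proof.
move=> kk kK cF isl fin.
have mf : measurable_fun (`]a, c[ `*` [set: 'rV[R]_d])
    (fun p : TR * 'rV[R]_d => k (x - p.2) * conv (K p.1) (F p.1) p.2).
  apply: measurable_funM; last exact: conv_time_meas.
  apply: (@measurable_funS _ _ _ _ setT) => //.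
  by apply: (measurableT_comp (measurable_slice x kk)).
transitivity (\int[L]_y (\int[mu]_(s in `]a, c[) (k (x - y) * conv (K s) (F s) y))).
  by apply: eq_Rintegral => y _; rewrite RintegralZl//; exact: isl.
rewrite -(@Rintegral_fubini _ _ _ _ R mu L `]a, c[ setT
  (fun s y => k (x - y) * conv (K s) (F s) y) (measurable_itv `]a, c[) measurableT mf fin).
apply: eq_Rintegral => s; rewrite inE /= in_itv/= => sac.
rewrite -conv_assoc//; first by have [h _ _] := kK; exact: h.
by have [h _] := cF; exact: h.
Qed.

End time_convolution.


(** * The flux, and L^1 estimates modulo null sets *)

Section flux.
Context {R : realType}.
Variable q : R.
Hypothesis q0 : 0 < q.
Local Notation f := (flux q).

Lemma fluxN (a : R) : f (- a) = - f a.
Proof. by rewrite /flux normrN mulNr. Qed.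

Lemma flux0 : f 0 = 0.
Proof. by rewrite /flux mul0r. Qed.

Lemma flux_norm (a : R) : `|f a| = `|a| * `|a| `^ q.
Proof. by rewrite /flux normrM [X in _ * X]ger0_norm ?powR_ge0. Qed.

Lemma flux_norm_le (a B : R) : `|a| <= B -> `|f a| <= B `^ q * `|a|.
Proof. by move=> aB; rewrite flux_norm mulrC ler_wpM2r//; apply: powR_le_base => //; exact: ltW. Qed.

Lemma fluxE (a : R) : 0 <= a -> f a = a `^ (q + 1).
Proof.
move=> a0; rewrite /flux ger0_norm// powRD; last by rewrite gt_eqF ?addr_gt0.
by rewrite powRr1// mulrC.
Qed.

Lemma flux_homo_ge0 (a c : R) : 0 <= a -> a <= c -> f a <= f c.
Proof.
move=> a0 ac; rewrite !fluxE//; last exact: le_trans ac.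
by apply: powR_le_base => //; rewrite addr_ge0// ltW.
Qed.

Lemma flux_homo (a c : R) : a <= c -> f a <= f c.
Proof.
move=> ac; have [a0|/ltW a0] := leP 0 a; first exact: flux_homo_ge0.
have [c0|/ltW c0] := leP 0 c.
  apply: (@le_trans _ _ 0); last by rewrite mulr_ge0// powR_ge0.
  by rewrite mulr_le0_ge0// powR_ge0.
rewrite -lerN2 -!fluxN; apply: flux_homo_ge0; first by rewrite oppr_ge0.
by rewrite lerN2.
Qed.

(** The mean value theorem; a = 0 is treated directly, since [powR_continuous] covers positive
    points only. *)
Let lip_ge0 (a c B : R) : 0 <= a -> a <= c -> c <= B ->
  f c - f a <= (q + 1) * B `^ q * (c - a).
Proof.
move=> a0 ac cB; have c0 := le_trans a0 ac; have B0 := le_trans c0 cB.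
have p0 : 0 < q + 1 by rewrite addr_gt0.
have Bq : c `^ q <= B `^ q by apply: powR_le_base => //; exact: ltW.
move: a0; rewrite le_eqVlt => /predU1P[<-|a0].
  rewrite flux0 !subr0 -[X in X <= _]ger0_norm; last by rewrite mulr_ge0// powR_ge0.
  rewrite flux_norm ger0_norm// mulrC ler_wpM2r//.
  apply: le_trans Bq _; by rewrite ler_peMl ?powR_ge0// lerDr ltW.
move: ac; rewrite le_eqVlt => /predU1P[->|ac]; first by rewrite !subrr mulr0.
rewrite !fluxE ?(ltW a0)//.
have d1 (x : R) : x \in `]a, c[ ->
    is_derive x 1 (fun x : R => x `^ (q + 1)) ((q + 1) * x `^ (q + 1 - 1)).
  by rewrite in_itv/= => /andP[ax _]; apply: is_derive1_powR; exact: lt_trans ax.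
have [|x] := MVT ac d1.
  apply: continuous_in_subspaceT => x; rewrite inE/= in_itv/= => /andP[ax _].
  by apply: powR_continuous; exact: lt_le_trans ax.
rewrite in_itv/= => /andP[ax xc] ->.
rewrite addrK ler_wpM2r ?subr_ge0 ?(ltW ac)// ler_wpM2l ?(ltW p0)//.
apply: powR_le_base; rewrite ?(ltW q0)//; first exact: ltW (lt_trans a0 ax).
exact: le_trans (ltW xc) cB.
Qed.

Lemma flux_lip (a c B : R) : `|a| <= B -> `|c| <= B ->
  `|f a - f c| <= (q + 1) * B `^ q * `|a - c|.
Proof.
move=> aB cB.
wlog ac : a c aB cB / a <= c.
  move=> h; have [/h|/ltW/h] := leP a c; first exact.
  by rewrite distrC [`|a - c|]distrC; exact.
rewrite distrC [`|a - c|]distrC !ger0_norm ?subr_ge0 ?flux_homo//.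
have B0 := le_trans (normr_ge0 _) aB.
have [a0|/ltW a0] := leP 0 a.
  by apply: lip_ge0 => //; rewrite -[c]ger0_norm// (le_trans a0).
have [c0|/ltW c0] := leP 0 c.
  have := flux_norm_le aB; have := flux_norm_le cB.
  have fc0 : 0 <= f c by rewrite mulr_ge0// powR_ge0.
  have fa0 : f a <= 0 by rewrite mulr_le0_ge0// powR_ge0.
  rewrite (ger0_norm fc0) (ger0_norm c0) (ler0_norm fa0) (ler0_norm a0) => h1 h2.
  have h3 : B `^ q <= (q + 1) * B `^ q by rewrite ler_peMl ?powR_ge0// lerDr ltW.
  apply: (@le_trans _ _ (B `^ q * (c - a))); first by rewrite mulrBr -mulrN lerD.
  by rewrite ler_wpM2r// subr_ge0.
have -> : c - a = - a - - c by rewrite opprK addrC.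
have -> : f c - f a = f (- a) - f (- c) by rewrite !fluxN opprK addrC.
apply: lip_ge0; rewrite ?oppr_ge0 ?lerN2//.
by rewrite -(ler0_norm a0).
Qed.

End flux.

Section ae_L1.
Context {R : realType} (d : nat).
Local Notation L := (@lebesgue_rV R d).
Implicit Types (f g : 'rV[R]_d -> R).

Lemma integrable_le_ae f g : measurable_fun setT f ->
  {ae L, forall x, `|f x| <= g x} -> L.-integrable setT (EFin \o g) ->
  L.-integrable setT (EFin \o f).
Proof.
move=> mf fg /integrableP[mg ig]; apply/integrableP; split; first exact/measurable_EFinP.
apply: le_lt_trans ig; apply: ae_ge0_le_integral => //.
- by apply: measurableT_comp => //; exact/measurable_EFinP.
- exact: measurableT_comp.
- by apply: filterS fg => x h _; rewrite lee_fin (le_trans h)// ler_norm.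
Qed.

Lemma le_Rintegral_ae f g : L.-integrable setT (EFin \o f) -> L.-integrable setT (EFin \o g) ->
  (forall x, 0 <= f x) -> {ae L, forall x, f x <= g x} -> (forall x, 0 <= g x) ->
  \int[L]_x f x <= \int[L]_x g x.
Proof.
move=> fi gi f0 fg g0; rewrite -lee_fin !EFin_Rintegral//; apply: ae_ge0_le_integral => //.
- by move=> x _; rewrite lee_fin.
- by have /integrableP[] := fi.
- by move=> x _; rewrite lee_fin.
- by have /integrableP[] := gi.
- by apply: filterS fg => x h _; rewrite lee_fin.
Qed.

Lemma le_N1_ae f g : L.-integrable setT (EFin \o f) -> L.-integrable setT (EFin \o g) ->
  {ae L, forall x, `|f x| <= `|g x|} -> N1 f <= N1 g.
Proof.
by move=> fi gi fg; apply: le_Rintegral_ae => //; exact: integrable_abs.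
Qed.

Lemma measurable_flux q : measurable_fun setT (flux q : R -> R).
Proof.
apply: measurable_funM => //; apply: (measurableT_comp (measurable_powR _)) => //.
Qed.

Lemma integrable_flux q B f : 0 < q -> L.-integrable setT (EFin \o f) ->
  {ae L, forall x, `|f x| <= B} -> L.-integrable setT (EFin \o (fun x => flux q (f x))).
Proof.
move=> q0 fi fB; apply: (@integrable_le_ae _ (fun x => B `^ q * `|f x|)).
- by apply: (measurableT_comp (measurable_flux q)); exact: integrable_measurable.
- by apply: filterS fB => x; exact: flux_norm_le.
- by apply: integrableRZ => //; exact: integrable_abs.
Qed.

Lemma N1_flux_lip q B f g : 0 < q -> L.-integrable setT (EFin \o f) ->
  L.-integrable setT (EFin \o g) ->
  {ae L, forall x, `|f x| <= B} -> {ae L, forall x, `|g x| <= B} ->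
  N1 (fun x => flux q (f x) - flux q (g x)) <= (q + 1) * B `^ q * N1 (fun x => f x - g x).
Proof.
move=> q0 fi gi fB gB; have K0 : 0 <= (q + 1) * B `^ q by rewrite mulr_ge0 ?powR_ge0 ?addr_ge0 ?ltW.
rewrite -[X in X * N1 _](ger0_norm K0) -N1Z; last exact: integrableRB.
apply: le_N1_ae.
- by apply: integrableRB => //; exact: (integrable_flux (B := B)).
- by apply: integrableRZ => //; exact: integrableRB.
- apply: filterS2 fB gB => x hf hg; rewrite [leRHS]normrM (ger0_norm K0); exact: flux_lip.
Qed.

End ae_L1.

Section solution_flux.
Context {R : realType} (d : nat) (alpha q : R) (b : 'rV[R]_d)
  (u0 : 'rV[R]_d -> R) (u : R -> 'rV[R]_d -> R).
Hypothesis alpha12 : 1 < alpha < 2.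
Hypothesis q0 : 0 < q.
Hypothesis sol : mild_solution alpha q b u0 u.

(** Around [s] the solution stays bounded on [s / 2, 2 s], and on bounded sets the flux is
    Lipschitz. *)
Lemma L1cont_flux c : L1cont (fun s x => flux q (u s x)) 0 c.
Proof.
split=> [s /andP[s0 _]|s e /andP[s0 _] e0].
  have [B _ hB] := sol_bdd sol s s0; apply: (integrable_flux (B := B)) => //.
    by apply: sol_integrable sol _ _; exact: ltW.
  by apply: hB; rewrite lexx.
have s20 : 0 < s / 2 by rewrite divr_gt0.
have [B B0 hB] := sol_bdd sol (2 * s) s20.
pose K := (q + 1) * B `^ q; have K0 : 0 < K by rewrite mulr_gt0 ?powR_gt0 ?addr_gt0.
have [r r0 h] := sol_cont sol (ltW s0) (divr_gt0 e0 K0).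
exists (Num.min r (s / 2)); first by rewrite lt_min r0.
move=> s' /andP[s'0 _]; rewrite lt_min => /andP[h1 h2].
have h3 := h s' (ltW s'0) h1.
apply: le_lt_trans (N1_flux_lip (B := B) q0 _ _ _ _) _.
- by apply: sol_integrable sol _ _; exact: ltW.
- by apply: sol_integrable sol _ _; exact: ltW.
- apply: hB; move: h2; rewrite ltr_norml => /andP[]; lra.
- by apply: hB; lra.
by rewrite mulrC -ltr_pdivlMr.
Qed.

End solution_flux.


(** * A weight comparable to the gradient kernel *)

Section kernel_weights.
Context {R : realType} (d : nat).
Variable beta : R.
Hypothesis beta01 : 0 < beta < 1.
Hypothesis beta_ge : 2^-1 <= beta.
Variable b : 'rV[R]_d.
Local Notation L := (@lebesgue_rV R d).
Local Notation hkb := (@hk R d beta).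
Local Notation dkb := (@dk R d beta b).
Local Notation tsc := (tsc beta).
Implicit Types (x y z X : 'rV[R]_d).

Let b0 : 0 < beta. Proof. by case/andP: beta01. Qed.

Lemma ker_hk t : 0 < t -> ker (hkb t).
Proof.
move=> t0; split; last exact: integrable_hk.
by exists (hkb t 0) => x; exact: hk_norm_le.
Qed.

Lemma ker_dk t : 0 < t -> ker (dkb t).
Proof. by move=> t0; split; [exact: dk_bdd|exact: integrable_dk]. Qed.

Lemma tsc_anti s t : 0 < s -> s <= t -> tsc t <= tsc s.
Proof.
by move=> s0 st; apply: powR_ge_base => //; rewrite oppr_le0 invr_ge0 mulr_ge0// ltW.
Qed.

Lemma hk0_anti s t : 0 < s -> s <= t -> hkb t 0 <= hkb s 0.
Proof.
move=> s0 st; have t0 : 0 < t by exact: lt_le_trans st.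
rewrite !hkE ler_wpM2l ?invr_ge0 ?exprn_ge0 ?mulr_ge0 ?pi_ge0//.
apply: le_Rintegral => //; try exact: integrable_hk_integrand.
by move=> xi _; rewrite dotp0l cos0 !mul1r; exact: sym_mono.
Qed.

Lemma kerfam_dk T a c : c <= T -> kerfam (fun s => dkb (T - s)) a c.
Proof.
move=> cT; split.
- by move=> s /andP[_ sc]; apply: ker_dk; rewrite subr_gt0 (lt_le_trans sc).
- move=> s x /andP[_ sc]; have Ts : 0 < T - s by rewrite subr_gt0 (lt_le_trans sc).
  apply: (@continuous_comp _ _ _ (fun s => T - s) (fun t => dkb t x)).
    by apply: cvgB; [exact: cvg_cst|].
  exact: dk_cont.
move=> c' c'c; have t00 : 0 < T - c' by rewrite subr_gt0 (lt_le_trans c'c).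
have [C C0 h] := dk_le_hk beta01 beta_ge b.
exists (C * tsc (T - c') * hkb (T - c') 0) => s x /andP[_ sc'].
have le : T - c' <= T - s by rewrite lerD2l lerN2 ltW.
have t0 : 0 < T - s by exact: lt_le_trans le.
apply: le_trans (h _ _ t0) _; apply: ler_pM.
- by rewrite mulr_ge0 ?(ltW C0)// ltW// tsc_gt0.
- by rewrite ltW// hk_gt0.
- by rewrite ler_wpM2l ?(ltW C0)// tsc_anti.
- by apply: le_trans (hk_le0 _ _ _) _ => //; exact: hk0_anti.
Qed.

Local Notation N := (d%:R / 2 + 1 + beta).
Local Notation r X := (1 + dotp X X).

(* For t in a compact subset of ]0, +oo[, this weight dominates |dk t| and the
   increments of [hk t] along b, and is dominated by |dk t| + |dk t (. + b)| if b != 0.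
   Absolute convergence of the Duhamel integral at x and at x + b thus bounds
   the integral of [wt (x - .)] against the flux, although the flux need not be
   bounded in L^1 near time 0. *)
Definition wt X : R := (1 + `|dotp b X|) * (r X) `^ (- N).

Let N0 : 0 <= N. Proof. by rewrite !addr_ge0 ?(ltW b0) ?divr_ge0. Qed.
Let r0 X : 0 < r X. Proof. by rewrite ltr_pwDl ?dotp_ge0. Qed.
Let rN X : 0 <= (r X) `^ (- N). Proof. exact: powR_ge0. Qed.

Let pow_cmp (A A' m : R) : 0 < m -> 0 < A' -> m * A' <= A -> A `^ (- N) <= m `^ (- N) * A' `^ (- N).
Proof.
move=> m0 A'0 h; rewrite -powRM ?(ltW m0) ?(ltW A'0)//.
by apply: powR_ge_base; rewrite ?oppr_le0// mulr_gt0.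
Qed.

Let pow_le (x y : R) n : 0 <= x -> x <= y -> x ^+ n <= y ^+ n.
Proof. by move=> x0 xy; apply: lerXn2r; rewrite ?nnegrE// (le_trans x0). Qed.

Lemma wt_ge0 X : 0 <= wt X.
Proof. by rewrite mulr_ge0 ?addr_ge0. Qed.

Lemma bracket_scale_lb (a1 a : R) X : 0 < a1 -> a1 <= a -> Num.min 1 (a1 ^+ 2) * r X <= r (a *: X).
Proof.
move=> a10 a1a; have a0 := lt_le_trans a10 a1a.
rewrite dotpZl dotpZr mulrA -expr2.
have h1 : Num.min 1 (a1 ^+ 2) <= 1 by rewrite ge_min lexx.
have h2 : Num.min 1 (a1 ^+ 2) <= a ^+ 2.
  by rewrite ge_min; apply/orP; right; rewrite lerXn2r// nnegrE ltW.
by rewrite mulrDr mulr1 lerD// ler_wpM2r ?dotp_ge0.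
Qed.

Lemma bracket_scale_ub (a2 a : R) X : 0 < a -> a <= a2 -> r (a *: X) <= (1 + a2 ^+ 2) * r X.
Proof.
move=> a0 aa2; have a20 := lt_le_trans a0 aa2.
rewrite dotpZl dotpZr mulrA -expr2.
have h2 : a ^+ 2 <= a2 ^+ 2 by rewrite lerXn2r// nnegrE ltW.
have := dotp_ge0 X; have := sqr_ge0 a2; nra.
Qed.

Lemma bracket_shift X : r (X + b) <= (2 + 2 * dotp b b) * r X.
Proof.
rewrite dotpDl !dotpDr [dotp X b]dotpC.
have h : 0 <= dotp (X - b) (X - b) by exact: dotp_ge0.
move: h; rewrite dotpBl !dotpBr [dotp X b]dotpC.
have := dotp_ge0 X; have := dotp_ge0 b; nra.
Qed.

Let min1_gt0 (a : R) : 0 < a -> 0 < Num.min 1 (a ^+ 2).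
Proof. by move=> a0; rewrite lt_min ltr01 exprn_gt0. Qed.

Lemma dk_le_wt t1 t2 : 0 < t1 -> exists2 C : R, 0 < C &
  forall t X, t1 <= t <= t2 -> `|dkb t X| <= C * wt X.
Proof.
move=> t10; have [c [C [c0 C0 h]]] := dk1_bounds beta01 beta_ge b.
have [t20|t2le] := ltP 0 t2; last first.
  by exists 1 => // t X /andP[h1 h2]; have := le_trans h1 (le_trans h2 t2le); rewrite leNgt t10.
pose a2 := tsc t1; pose a1 := tsc t2; have a10 : 0 < a1 by exact: tsc_gt0.
have a20 : 0 < a2 by exact: tsc_gt0.
pose m := Num.min 1 (a1 ^+ 2); have m0 : 0 < m by exact: min1_gt0.
exists (a2 ^+ d.+2 * C * m `^ (- N)); first by rewrite (mulr_gt0 (mulr_gt0 (exprn_gt0 _ a20) C0))// powR_gt0.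
move=> t X /andP[t1t tt2]; have t0 := lt_le_trans t10 t1t.
have a0 := tsc_gt0 beta t0.
have a1a : a1 <= tsc t by exact: tsc_anti.
have aa2 : tsc t <= a2 by exact: tsc_anti.
rewrite dk_scale// normrM ger0_norm ?exprn_ge0 ?(ltW a0)//.
have /andP[_ hu] := h (tsc t *: X).
apply: (@le_trans _ _ (a2 ^+ d.+1 * (C * (a2 * (1 + `|dotp b X|) * (m `^ (- N) * (r X) `^ (- N)))))).
  apply: ler_pM; rewrite ?exprn_ge0 ?(ltW a0)//; first by apply: pow_le => //; exact: ltW.
  apply: le_trans hu _; rewrite ler_wpM2l ?(ltW C0)//; apply: ler_pM => //.
    rewrite dotpZr normrM (ger0_norm (ltW a0)); apply: ler_pM; rewrite ?(ltW a0)//.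
    by rewrite lerDr.
  by apply: pow_cmp => //; exact: bracket_scale_lb.
by rewrite /wt le_eqVlt; apply/orP; left; apply/eqP; rewrite [in RHS]exprS; ring.
Qed.

(** [dk t X] vanishes where b . X = 0, so it cannot dominate the weight alone; but b . (X + b) = b .
    X + |b|^2, and the two products cannot be small together. *)
Lemma wt_le_dk t1 t2 : b != 0 -> 0 < t1 -> exists2 C : R, 0 < C &
  forall t X, t1 <= t <= t2 -> wt X <= C * (`|dkb t X| + `|dkb t (X + b)|).
Proof.
move=> bn0 t10; have [c [C [c0 C0 h]]] := dk1_bounds beta01 beta_ge b.
have [t20|t2le] := ltP 0 t2; last first.
  by exists 1 => // t X /andP[h1 h2]; have := le_trans h1 (le_trans h2 t2le); rewrite leNgt t10.
pose e := dotp b b; have e0 : 0 < e by rewrite lt_def dotp_ge0 dotp_eq0 bn0.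
pose a2 := tsc t1; pose a1 := tsc t2; have a10 : 0 < a1 by exact: tsc_gt0.
have a20 : 0 < a2 by exact: tsc_gt0.
pose M := 1 + a2 ^+ 2; have M0 : 0 < M by rewrite addr_gt0// exprn_gt0.
pose S := 2 + 2 * e; have S0 : 0 < S by rewrite addr_gt0// mulr_gt0.
pose K := a1 ^+ d.+2 * c * (M * S) `^ (- N).
have K0 : 0 < K by rewrite (mulr_gt0 (mulr_gt0 (exprn_gt0 _ a10) c0))// powR_gt0// mulr_gt0.
(* With p = b . X, the sum |p| + |p + e| is at least both e and |p|; half of each gives k (1 +
   |p|). *)
pose k := Num.min (e / 2) 2^-1.
have k0 : 0 < k by rewrite lt_min; apply/andP; split; lra.
exists ((K * k)^-1); first by rewrite invr_gt0 mulr_gt0.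
move=> t X /andP[t1t tt2]; have t0 := lt_le_trans t10 t1t.
have a0 := tsc_gt0 beta t0.
have a1a : a1 <= tsc t by exact: tsc_anti.
have aa2 : tsc t <= a2 by exact: tsc_anti.
have S1 : 1 <= S by rewrite /S; have := ltW e0; lra.
have low Y : r Y <= S * r X -> K * (`|dotp b Y| * (r X) `^ (- N)) <= `|dkb t Y|.
  move=> rY; rewrite dk_scale// normrM ger0_norm ?exprn_ge0 ?(ltW a0)//.
  have /andP[hl _] := h (tsc t *: Y).
  apply: le_trans (ler_wpM2l _ hl); last by rewrite exprn_ge0 ?(ltW a0).
  rewrite dotpZr normrM (ger0_norm (ltW a0)).
  apply: (@le_trans _ _ (a1 ^+ d.+1 * (c * (a1 * `|dotp b Y| * ((M * S) `^ (- N) * (r X) `^ (- N)))))).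
    by rewrite /K le_eqVlt; apply/orP; left; apply/eqP; rewrite [in LHS]exprS; ring.
  apply: ler_pM; rewrite ?exprn_ge0 ?mulr_ge0 ?(ltW a10) ?(ltW c0) ?powR_ge0//.
    by apply: pow_le => //; exact: ltW.
  rewrite ler_wpM2l ?(ltW c0)//; apply: ler_pM; rewrite ?mulr_ge0 ?(ltW a10) ?powR_ge0//.
    by rewrite ler_wpM2r.
  rewrite -powRM ?mulr_ge0 ?(ltW M0) ?(ltW S0) ?(ltW (r0 _))//.
  apply: powR_ge_base; rewrite ?oppr_le0//.
  apply: le_trans (bracket_scale_ub _ a0 aa2) _.
  by rewrite -mulrA ler_wpM2l// ltW.
have l1 := low X; have l2 := low (X + b).
have {}l1 : K * (`|dotp b X| * (r X) `^ (- N)) <= `|dkb t X|.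
  by apply: l1; rewrite ler_peMl// ltW.
have {}l2 : K * (`|dotp b (X + b)| * (r X) `^ (- N)) <= `|dkb t (X + b)|.
  by apply: l2; exact: bracket_shift.
have Kk := mulr_gt0 K0 k0; rewrite ler_pdivlMl//; apply: le_trans (lerD l1 l2).
rewrite -mulrDr -mulrA ler_wpM2l ?(ltW K0)// /wt mulrA -mulrDl ler_wpM2r//.
rewrite dotpDr -/e; set p := dotp b X.
have k1 : k <= e / 2 by rewrite ge_min lexx.
have k2 : k <= 2^-1 by rewrite ge_min lexx orbT.
have t1' : e <= `|p| + `|p + e|.
  have := ler_normB (p + e) p; rewrite addrAC subrr add0r (ger0_norm (ltW e0)); lra.
have p0 := normr_ge0 p; have pe0 := normr_ge0 (p + e).
have : k * `|p| <= 2^-1 * `|p| by rewrite ler_wpM2r.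
lra.
Qed.

(** The shift changes the squared norm of the rescaled point by a^2 (2 b . X + |b|^2), hence the
    factor 1 + |b . X| in the weight. *)
Lemma hk_shift_le_wt t : 0 < t -> exists2 C : R, 0 < C &
  forall X, `|hkb t (X + b) - hkb t X| <= C * wt X.
Proof.
move=> t0; have [c [C [c0 C0 sw]]] := hk1_sandwich d beta01 beta_ge.
pose a := tsc t; have a0 : 0 < a by exact: tsc_gt0.
pose e := dotp b b; have e0 : 0 <= e by exact: dotp_ge0.
pose S := 2 + 2 * e; have S0 : 0 < S by rewrite ltr_pwDl// mulr_ge0.
pose m := Num.min 1 (a ^+ 2); have m0 : 0 < m by exact: min1_gt0.
pose m' := m / S; have m'0 : 0 < m' by rewrite divr_gt0.
exists (a ^+ d * (C * (a ^+ 2 * (2 + e)) * m' `^ (- N))).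
  have aa := exprn_gt0 2 a0; rewrite (mulr_gt0 (exprn_gt0 d a0))// (mulr_gt0 (mulr_gt0 C0 _))// ?powR_gt0//.
  by rewrite mulr_gt0// ltr_pwDl.
move=> X; rewrite (hk_scale beta01 beta_ge (X + b) t0) (hk_scale beta01 beta_ge X t0) -/a -mulrBr normrM ger0_norm ?exprn_ge0 ?(ltW a0)//.
rewrite -mulrA ler_wpM2l ?exprn_ge0 ?(ltW a0)// /wt.
pose D := `|dotp (a *: (X + b)) (a *: (X + b)) - dotp (a *: X) (a *: X)|.
have hD : D <= a ^+ 2 * (2 + e) * (1 + `|dotp b X|).
  rewrite /D !dotpZl !dotpZr dotpDl !dotpDr [dotp X b]dotpC.
  have -> : a * (a * (dotp X X + dotp b X + (dotp b X + dotp b b))) - a * (a * dotp X X) =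
    a ^+ 2 * (2 * dotp b X + e) by rewrite /e; ring.
  rewrite normrM (ger0_norm (exprn_ge0 _ (ltW a0))) -mulrA ler_wpM2l ?exprn_ge0 ?(ltW a0)//.
  apply: le_trans (ler_normD _ _) _; rewrite normrM (ger0_norm e0) (@ger0_norm _ 2)//.
  have := normr_ge0 (dotp b X); nra.
have S1 : 1 <= S by rewrite /S; lra.
have r1 : m' * r X <= r (a *: X).
  apply: le_trans (bracket_scale_lb X a0 (lexx a)); rewrite ler_wpM2r ?(ltW (r0 _))//.
  by rewrite ler_pdivrMr// ler_peMr// ltW.
have r2 : m' * r X <= r (a *: (X + b)).
  apply: le_trans (bracket_scale_lb (X + b) a0 (lexx a)).
  rewrite /m' -mulrA ler_wpM2l ?(ltW m0)// ler_pdivrMl//.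
  have := bracket_shift (- (X + b)); rewrite opprD subrK dotpNl dotpNr opprK.
  by rewrite -opprD dotpNl dotpNr opprK.
have D0 : 0 <= D by exact: normr_ge0.
have fin (Y : 'rV[R]_d) : m' * r X <= r Y -> C * (D * (r Y) `^ (- N)) <=
    C * (a ^+ 2 * (2 + e)) * m' `^ (- N) * ((1 + `|dotp b X|) * r X `^ (- N)).
  move=> hY; have h2 := pow_cmp m'0 (r0 X) hY.
  apply: (@le_trans _ _ (C * (a ^+ 2 * (2 + e) * (1 + `|dotp b X|) * (m' `^ (- N) * r X `^ (- N))))).
    by rewrite ler_wpM2l ?(ltW C0)//; apply: ler_pM.
  by rewrite le_eqVlt; apply/orP; left; apply/eqP; ring.
have [xy|/ltW yx] := leP (dotp (a *: X) (a *: X)) (dotp (a *: (X + b)) (a *: (X + b))).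
  have /andP[l u] := sw _ _ xy.
  rewrite distrC ger0_norm; last first.
    by apply: le_trans l; rewrite !mulr_ge0 ?(ltW c0) ?subr_ge0.
  apply: le_trans u _; apply: le_trans (fin _ r1).
  by rewrite /D ger0_norm// subr_ge0.
have /andP[l u] := sw _ _ yx.
rewrite ger0_norm; last by apply: le_trans l; rewrite !mulr_ge0 ?(ltW c0) ?subr_ge0.
apply: le_trans u _; apply: le_trans (fin _ r2).
by rewrite /D distrC ger0_norm// subr_ge0.
Qed.

(** The part of a product of two weights that is integrated out in [conv_wt_le]. The square of 1 +
    |b . X| is still at most a multiple of 1 + |X|^2, so that [integrable_bracket] applies. *)
Let V X : R := (1 + `|dotp b X|) ^+ 2 * (r X) `^ (- N).

Let V0 X : 0 <= V X. Proof. by rewrite mulr_ge0// sqr_ge0. Qed.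

Let measurable_pow : measurable_fun setT (fun X => (r X) `^ (- N)).
Proof.
apply: (measurableT_comp (measurable_powR _)); apply: measurable_funD => //.
exact: measurable_nsq.
Qed.

Let measurable_dotpb : measurable_fun setT (fun X => `|dotp b X|).
Proof. by apply: measurableT_comp => //; exact: measurable_dotp. Qed.

Let iV : L.-integrable setT (EFin \o V).
Proof.
apply: (@integrable_le _ _ _ _ setT measurableT _
  (fun X => 2 * (1 + dotp b b) * (r X) `^ (- (d%:R / 2 + beta)))).
- apply: measurable_funM => //; apply: measurable_funX; exact: measurable_funD.
- move=> X _; rewrite ger0_norm ?V0// -bracket_powD ?dotp_ge0// mulrA ler_wpM2r//.
  have h := dotp_CS b X; have e0 := dotp_ge0 b; have x0 := dotp_ge0 X.
  rewrite -(real_normK (num_real (dotp b X))) in h.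
  have h2 : 0 <= (`|dotp b X| - 1) ^+ 2 by exact: sqr_ge0.
  nra.
- by apply: integrableRZ => //; exact: integrable_bracket.
Qed.

Lemma ker_wt : ker wt.
Proof.
split.
  exists (2 + dotp b b) => X; rewrite ger0_norm ?wt_ge0// /wt.
  have h : (r X) `^ (- N) <= (r X)^-1.
    rewrite -[leRHS]powR_inv1 ?(ltW (r0 X))//; apply: ler_powR; first by rewrite lerDl dotp_ge0.
    have hd : 0 <= d%:R / 2 :> R by rewrite divr_ge0.
    by have hb := ltW b0; lra.
  apply: (@le_trans _ _ ((1 + `|dotp b X|) * (r X)^-1)); first by rewrite ler_wpM2l// addr_ge0.
  rewrite ler_pdivrMr ?r0//.
  have hc := dotp_CS b X; have e0 := dotp_ge0 b; have x0 := dotp_ge0 X.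
  rewrite -(real_normK (num_real (dotp b X))) in hc.
  have h2 : 0 <= (`|dotp b X| - 1) ^+ 2 by exact: sqr_ge0.
  have h3 : 0 <= dotp b b * dotp X X by rewrite mulr_ge0.
  nra.
apply: (@integrable_le _ _ _ _ setT measurableT _ V) => //.
- by apply: measurable_funM => //; exact: measurable_funD.
- move=> X _; rewrite ger0_norm ?wt_ge0// /wt /V ler_wpM2r// expr2 ler_peMl ?addr_ge0//.
  by rewrite lerDl.
Qed.

(** If X = Y + Y', one of the two brackets is at least a quarter of that of [X]. Its weight is then
    at most a multiple of [wt X] times 1 + |b . Y'|, and this factor joins the other weight to form
    the integrable [V]. *)
Lemma conv_wt_le : exists2 C : R, 0 < C & forall X, conv wt wt X <= C * wt X.
Proof.
pose C := 4 `^ N * (2 * \int[L]_X V X); have C0 : 0 <= C.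
  by rewrite !mulr_ge0 ?powR_ge0// Rintegral_ge0.
exists (C + 1); first by rewrite ltr_pwDr.
move=> X; apply: (@le_trans _ _ (C * wt X)); last by rewrite ler_wpM2r ?wt_ge0// lerDl.
have iVr := integrable_reflect X iV.
have -> : C * wt X = \int[L]_y (4 `^ N * wt X * (V y + V (X - y))).
  rewrite RintegralZl//; last exact: integrableRD.
  rewrite RintegralD// (Rintegral_rV_reflect X iV) /C; ring.
apply: le_Rintegral => //.
- exact: ker_slice ker_wt ker_wt.2.
- by apply: integrableRZ => //; exact: integrableRD.
move=> y _; pose Z := X - y.
have ZE : X - y = Z by []; have XE : X = Z + y by rewrite subrK.
clearbody Z.
have tri : r X <= 4 * r y \/ r X <= 4 * r Z.
  have h : 0 <= dotp (Z - y) (Z - y) by exact: dotp_ge0.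
  have : dotp X X <= 2 * dotp Z Z + 2 * dotp y y.
    move: h; rewrite XE dotpBl !dotpBr dotpDl !dotpDr [dotp y Z]dotpC; lra.
  have [yZ|Zy] := leP (dotp Z Z) (dotp y y); [left|right]; lra.
have key Y Y' : X = Y + Y' -> r X <= 4 * r Y -> wt Y * wt Y' <= 4 `^ N * wt X * V Y'.
  move=> XE' rXY; rewrite /wt.
  have h1 : (r Y) `^ (- N) <= 4 `^ N * (r X) `^ (- N).
    rewrite !powRN ler_pdivlMr ?powR_gt0// mulrC ler_pdivrMr ?powR_gt0//.
    by rewrite -powRM ?(ltW (r0 _))//; apply: powR_le_base; rewrite ?(ltW (r0 _)).
  have h2 : 1 + `|dotp b Y| <= (1 + `|dotp b X|) * (1 + `|dotp b Y'|).
    have -> : dotp b Y = dotp b X - dotp b Y' by rewrite XE' dotpDr addrK.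
    have := ler_normB (dotp b X) (dotp b Y').
    have := normr_ge0 (dotp b X); have := normr_ge0 (dotp b Y'); nra.
  apply: (@le_trans _ _ ((1 + `|dotp b X|) * (1 + `|dotp b Y'|) * (4 `^ N * r X `^ (- N)) *
    ((1 + `|dotp b Y'|) * r Y' `^ (- N)))).
    by rewrite ler_wpM2r ?mulr_ge0 ?addr_ge0//; apply: ler_pM; rewrite ?addr_ge0.
  by rewrite /V le_eqVlt; apply/orP; left; apply/eqP; ring.
have K0 : 0 <= 4 `^ N * wt X by rewrite mulr_ge0 ?powR_ge0// wt_ge0.
rewrite ZE mulrDr; case: tri => h.
  apply: le_trans (_ : 4 `^ N * wt X * V Z <= _); last by rewrite lerDr mulr_ge0.
  by rewrite mulrC; apply: key => //; rewrite addrC.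
apply: le_trans (_ : 4 `^ N * wt X * V y <= _); last by rewrite lerDl mulr_ge0.
exact: key.
Qed.

End kernel_weights.


(** * The singular time kernel, and periodic functions *)

Section time_kernel.
Context {R : realType}.
Variable beta : R.
Hypothesis beta01 : 0 < beta < 1.
Hypothesis beta_gt : 2^-1 < beta.
Local Notation mu := (@lebesgue_measure R).
Local Notation tsc := (tsc beta).

Definition kexp : R := 1 - (2 * beta)^-1.

Lemma kexp_gt0 : 0 < kexp.
Proof.
rewrite subr_gt0 invf_lt1; last by case/andP: beta01 => ? ?; rewrite mulr_gt0.
by rewrite mulrC -ltr_pdivrMr// mul1r.
Qed.

Let b0 : 0 < beta. Proof. by case/andP: beta01. Qed.

(** The integral of [tsc] over ]0, r[, finite because 2 beta > 1. *)
Definition kint (r : R) : R := r `^ kexp / kexp.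

Lemma kint_ge0 r : 0 <= kint r.
Proof. by rewrite divr_ge0 ?powR_ge0// ltW// kexp_gt0. Qed.

Lemma kint_homo r s : 0 <= r -> r <= s -> kint r <= kint s.
Proof.
move=> r0 rs; rewrite ler_wpM2r ?invr_ge0 ?(ltW kexp_gt0)//.
by apply: powR_le_base => //; rewrite ltW// kexp_gt0.
Qed.

Lemma integral_refl_itv (f : R -> R) (T a c : R) : measurable_fun setT f -> (forall x, 0 <= f x) ->
  (\int[mu]_(s in `]a, c[) (f (T - s))%:E = \int[mu]_(s in `](T - c)%R, (T - a)%R[) (f s)%:E)%E.
Proof.
move=> mf f0; rewrite [LHS]integral_mkcond [RHS]integral_mkcond.
pose g s := ((EFin \o f) \_ `](T - c), (T - a)[%classic) s.
have mg : measurable_fun setT g.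
  apply/(measurable_restrictT _ _).1 => //; apply/measurable_EFinP.
  by apply: (@measurable_funS _ _ _ _ setT) mf.
have g0 s : (0 <= g s)%E by rewrite /g patchE; case: ifP => //= _; rewrite lee_fin.
have n1 : -1 != 0 :> R by rewrite oppr_eq0 oner_eq0.
rewrite [RHS](ge0_integral_affine1 T n1 mg g0) normrN1 mul1e; apply: eq_integral => s _.
rewrite /g !patchE !mem_itv_oo mulN1r addrC /=.
congr (if _ then _ else _); rewrite !ltrBlDr !ltrBrDr.
by rewrite andbC; congr andb; apply/idP/idP => h; lra.
Qed.

Lemma measurable_tsc : measurable_fun setT tsc.
Proof. exact: measurable_powR. Qed.

Lemma integral_tsc_le (T a c : R) : a < c -> c <= T ->
  (\int[mu]_(s in `]a, c[) (tsc (T - s))%:E <= (kint (T - a) - kint (T - c))%:E)%E.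
Proof.
move=> ac cT; rewrite (integral_refl_itv _ _ _ measurable_tsc) => [|x]; last exact: powR_ge0.
have k0 := kexp_gt0.
have kE : - (2 * beta)^-1 + 1 = kexp by rewrite addrC.
have xy : T - c < T - a by rewrite ltrD2l ltrN2.
have : 0 <= T - c by rewrite subr_ge0.
rewrite le_eqVlt => /predU1P[h|h].
  rewrite -h /kint powR0 ?gt_eqF// mul0r subr0 -kE.
  apply: le_trans (integral_powR0 _ _) => //; last 2 first.
  - by move: k0; rewrite -kE; lra.
  - by rewrite h.
  apply: ge0_subset_integral => //=.
  - by apply/measurable_EFinP; exact: (measurable_funS _ _ measurable_tsc).
  - by move=> s _; rewrite lee_fin powR_ge0.
  - by move=> s /=; rewrite !in_itv/= => /andP[-> /ltW].
have ks : - (2 * beta)^-1 + 1 != 0 by rewrite kE gt_eqF.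
rewrite /kint -mulrBl -kE -(integral_powR ks h xy).
apply: ge0_subset_integral => //=.
- by apply/measurable_EFinP; exact: (measurable_funS _ _ measurable_tsc).
- by move=> s _; rewrite lee_fin powR_ge0.
- by move=> s /=; rewrite !in_itv/= => /andP[/ltW -> /ltW].
Qed.

Lemma integrable_tsc (T a c : R) : a < c -> c <= T ->
  mu.-integrable `]a, c[ (EFin \o (fun s => tsc (T - s))).
Proof.
move=> ac cT; apply: integrable_ge0P => //.
- apply: (@measurable_funS _ _ _ _ setT) => //; apply: (measurableT_comp measurable_tsc).
  exact: measurable_funB.
- by move=> s _; exact: powR_ge0.
- by apply: le_lt_trans (integral_tsc_le ac cT) _; rewrite ltry.
Qed.

Lemma Rintegral_tsc_le (T a c : R) : a < c -> c <= T ->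
  \int[mu]_(s in `]a, c[) tsc (T - s) <= kint (T - a) - kint (T - c).
Proof.
move=> ac cT; rewrite -lee_fin EFin_Rintegral//; last exact: integrable_tsc.
exact: integral_tsc_le.
Qed.

End time_kernel.

Section periodic.
Context {R : realType} (d : nat).
Local Notation L := (@lebesgue_rV R d).

(** The integral of |E| over the half-space b . x >= r is unchanged when [r] grows by |b|^2, and
    tends to 0 as [r] grows: it is 0 for every [r]. Letting [r] decrease exhausts the space. *)
Lemma periodic_L1 (E : 'rV[R]_d -> R) (b : 'rV[R]_d) : b != 0 ->
  L.-integrable setT (EFin \o E) -> (forall x, E (x + b) = E x) -> N1 E = 0.
Proof.
move=> bn0 iE per; have mE := integrable_measurable iE.
pose e := dotp b b; have e0 : 0 < e by rewrite lt_def dotp_ge0 dotp_eq0 bn0.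
pose h (r : R) x : R := `|E x| * (r <= dotp b x)%R%:R.
have mh r : measurable_fun setT (h r).
  apply: measurable_funM; first exact: measurableT_comp.
  have -> : (fun x : 'rV[R]_d => (r <= dotp b x)%R%:R : R) = \1_[set x | r <= dotp b x].
    by apply/funext => x; rewrite indicE; congr (nat_of_bool _)%:R; apply/idP/idP; rewrite inE.
  apply: measurable_indic.
  rewrite (_ : [set x | _] = dotp b @^-1` `[r, +oo[).
    by rewrite -[X in measurable X]setTI; apply: measurable_dotp.
  by apply/seteqP; split=> x /=; rewrite in_itv/= andbT.
have hE r x : `|h r x| <= `|E x|.
  by rewrite /h normrM normr_id ler_piMr//; case: (r <= _); rewrite ?normr1 ?normr0.
have ih r : L.-integrable setT (EFin \o h r).
  by apply: (@integrable_le _ _ _ _ setT measurableT _ (fun x => `|E x|)) => //; exact: integrable_abs.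
have shift r : \int[L]_x h r x = \int[L]_x h (r + e) x.
  rewrite -(Rintegral_rV_translate b (ih (r + e))); apply: eq_Rintegral => x _.
  by rewrite /h per dotpDr lerD2r.
have shiftn n r : \int[L]_x h r x = \int[L]_x h (r + n%:R * e) x.
  elim: n => [|n IH]; first by rewrite mul0r addr0.
  by rewrite IH shift -addrA -[X in n%:R * e + X]mul1r -mulrDl natr1.
have cvn (r : R) : \forall n \near \oo, r < n.+1%:R * e.
  have e10 : 0 < e / (`|r| + 1) by rewrite divr_gt0// ltr_wpDl.
  have := exists_large_nat e10; apply: filterS => n.
  rewrite mulrAC ler_pdivlMr ?ltr_wpDl// mul1r mulrC; have := ler_norm r; lra.
have I0 r : \int[L]_x h r x = 0.
  have [] := @Rintegral_dct _ _ _ L setT measurableT (fun n x => h (r + n.+1%:R * e) x) (cst 0)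
    (fun x => `|E x|).
  - by move=> n; exact: mh.
  - move=> x _; apply: cvg_near_cst; have := cvn (dotp b x - r); apply: filterS => n hn.
    by rewrite /h lt_geF ?mulr0//; move: hn; lra.
  - exact: integrable_abs.
  - by move=> n x _; exact: hE.
  move=> _ cv _; move: cv; rewrite Rintegral_cst// mul0r => cv.
  have cv2 : (\int[L]_x h (r + n.+1%:R * e) x) @[n --> \oo] --> \int[L]_x h r x.
    by under eq_fun do rewrite -shiftn; exact: cvg_cst.
  exact: (cvg_unique _ cv2 cv).
have [] := @Rintegral_dct _ _ _ L setT measurableT (fun n x => h (- (n.+1%:R * e)) x)
    (fun x => `|E x|) (fun x => `|E x|).
- by move=> n; exact: mh.
- move=> x _; apply: cvg_near_cst; have := cvn (- dotp b x); apply: filterS => n hn.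
  by rewrite /h (_ : (_ <= _) = true) ?mulr1//; move: hn; lra.
- exact: integrable_abs.
- by move=> n x _; exact: hE.
move=> _ cv _.
have cv2 : (\int[L]_x h (- (n.+1%:R * e)) x) @[n --> \oo] --> (0 : R).
  by under eq_fun do rewrite I0; exact: cvg_cst.
exact: (cvg_unique _ cv cv2).
Qed.

End periodic.


Lemma conv_comm {R : realType} (d : nat) (k l : 'rV[R]_d -> R) x : ker k -> ker l ->
  conv k l x = conv l k x.
Proof.
move=> kk kl; have i := ker_slice x kk kl.2.
rewrite /conv -(Rintegral_rV_reflect x i); apply: eq_Rintegral => y _.
by rewrite subKr mulrC.
Qed.

Lemma integrable_itv_sub {R : realType} (f : R -> R) (a c a' c' : R) : a <= a' -> c' <= c ->
  (@lebesgue_measure R).-integrable `]a, c[ (EFin \o f) ->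
  (@lebesgue_measure R).-integrable `]a', c'[ (EFin \o f).
Proof.
move=> aa cc; apply: integrableS => //; apply: subset_itv; rewrite ?bnd_simp//.
Qed.

Lemma Rintegral_itv_split {R : realType} (f : R -> R) (a c m : R) : a < m -> m < c ->
  (@lebesgue_measure R).-integrable `]a, c[ (EFin \o f) ->
  \int[@lebesgue_measure R]_(s in `]a, c[) f s =
  \int[@lebesgue_measure R]_(s in `]a, m[) f s + \int[@lebesgue_measure R]_(s in `]m, c[) f s.
Proof.
move=> am mc fi; have := Rintegral_itvB (x := m) fi.
rewrite !bnd_simp => /(_ (ltW am) mc) <-.
rewrite -Rintegral_itv_bndo_bndc; first by rewrite addrCA subrr addr0.
by apply: integrable_itv_sub fi => //; exact: ltW.
Qed.

Lemma rerr_shift_arith (R : comPzRingType) (A B D E G H : R) :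
  A - B = D - E + (G - H) -> A - D - G = B - E - H.
Proof. by move=> /(canRL (subrK _)) ->; ring. Qed.

Lemma first_half_refl (R : realType) (tau r : R) : 0 < r -> r < tau / 2 ->
  tau / 2 <= tau - r <= tau.
Proof. by move=> r0 rt; apply/andP; split; lra. Qed.

(** * Restarting the mild formula *)

Section restart.
Context {R : realType} (d : nat) (alpha q : R) (b : 'rV[R]_d)
  (u0 : 'rV[R]_d -> R) (u : R -> 'rV[R]_d -> R).
Hypothesis alpha12 : 1 < alpha < 2.
Hypothesis q0 : 0 < q.
Hypothesis sol : mild_solution alpha q b u0 u.
Hypothesis iu0 : (@lebesgue_rV R d).-integrable setT (EFin \o u0).
Local Notation L := (@lebesgue_rV R d).
Local Notation mu := (@lebesgue_measure R).
Local Notation beta := (alpha / 2).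
Local Notation hkb := (@hk R d beta).
Local Notation dkb := (@dk R d beta b).
Local Notation tsc := (tsc beta).
Implicit Types (x y z X : 'rV[R]_d).

Let b01 := half_alpha01 alpha12.
Let bge := half_alpha_ge alpha12.
Let bgt : 2^-1 < beta. Proof. by case/andP: alpha12 => a1 _; lra. Qed.

Let F s x := flux q (u s x).

Let LF c : L1cont F 0 c. Proof. exact: (L1cont_flux q0 sol c). Qed.

Let iF s : 0 < s -> L.-integrable setT (EFin \o F s).
Proof. by move=> s0; have [h _] := LF (s + 1); apply: h; rewrite s0 ltrDl ltr01. Qed.

Definition duh (c T : R) x := \int[mu]_(s in `]0, c[) conv (dkb (T - s)) (F s) x.

Lemma sol_duhamel_conv t x : 0 < t -> u t x = conv (hkb t) u0 x + duh t t x.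
Proof. by move=> t0; exact: (sol_duhamel alpha12 sol x t0). Qed.

Lemma sol_N1_bdd a c : 0 <= a -> exists2 M : R, 0 < M & forall s, a <= s <= c -> N1 (u s) <= M.
Proof.
move=> a0.
have /compact_near_coveringP := @segment_compact R a c.
move=> /(_ R (pinfty_nbhs R) (fun M s => 0 <= s -> N1 (u s) <= M) _) [].
  move=> t; rewrite /= in_itv/= => /andP[at_ _]; have t0 := le_trans a0 at_.
  have [r r0 h] := sol_cont sol t0 ltr01.
  exists (ball t r, [set M | N1 (u t) + 1 < M]).
    by split; [exact: nbhsx_ballx|apply: nbhs_pinfty_gt; rewrite num_real].
  move=> [s M] /= [st NM] s0; apply: le_trans (ltW NM).
  have hs : N1 (fun x => u s x - u t x) < 1 by apply: h => //; rewrite distrC.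
  have -> : N1 (u s) = N1 (fun x => u t x + (u s x - u t x)).
    by apply: eq_Rintegral => x _; rewrite addrC subrK.
  apply: le_trans (N1D _ _) _; first exact: sol_integrable sol _ _.
    by apply: integrableRB => //; exact: sol_integrable sol _ _.
  by rewrite lerD2l ltW.
move=> M [_ H]; exists (Num.max M 0 + 1); first by rewrite ltr_pwDr// le_max lexx orbT.
move=> s sac; apply: (H (Num.max M 0 + 1)).
- by rewrite ltr_pwDr// le_max lexx.
- by rewrite /= in_itv.
- by case/andP: sac => h _; exact: le_trans h.
Qed.

Lemma flux_N1_bdd a c : 0 < a -> exists2 M : R, 0 < M & forall s, a <= s <= c -> N1 (F s) <= M.
Proof.
move=> a0; have [B B0 hB] := sol_bdd sol c a0; have [M M0 hM] := sol_N1_bdd c (ltW a0).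
exists (B `^ q * M); first by rewrite mulr_gt0// powR_gt0.
move=> s sac; have s0 : 0 < s by case/andP: sac => h _; exact: lt_le_trans h.
have is_ : L.-integrable setT (EFin \o u s) by apply: sol_integrable sol _ _; exact: ltW.
apply: (@le_trans _ _ (B `^ q * N1 (u s))); last by rewrite ler_wpM2l ?powR_ge0// hM.
rewrite -[X in X * N1 _](ger0_norm (powR_ge0 B q)) -N1Z//; apply: le_N1_ae.
- exact: iF.
- exact: integrableRZ.
- by apply: filterS (hB s sac) => x h; rewrite [leRHS]normrM (ger0_norm (powR_ge0 B q)) flux_norm_le.
Qed.

(** The bound is the hypothesis [mild_convergence]; measurability in time is added from the
    continuity of the kernels and of the flux. *)
Lemma integrable_abs_slice t x : 0 < t -> mu.-integrable `]0, t[
  (EFin \o (fun s => conv (fun X => `|dkb (t - s) X|) (fun y => `|F s y|) x)).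
Proof.
move=> t0; have kf := kerfam_dk b01 bge b 0 (lexx t).
have kfa : kerfam (fun s X => `|dkb (t - s) X|) 0 t.
  have [k1 k2 k3] := kf; split.
  - by move=> s st; apply: ker_abs; exact: k1.
  - move=> s X st; apply: (@continuous_comp _ _ _ (fun s => dkb (t - s) X) Num.norm).
      exact: k2.
    exact: norm_continuous.
  - by move=> c' /k3[M hM]; exists M => s X sc; rewrite normr_id; exact: hM.
apply: integrable_ge0P => //.
- exact: (@measurable_time_slice R d (fun s => conv (fun X => `|dkb (t - s) X|) (fun y => `|F s y|))
    0 t x (conv_time_meas kfa (L1cont_abs (LF t)))).
- by move=> s _; apply: Rintegral_ge0 => y _; rewrite mulr_ge0.
apply: le_lt_trans (sol_conv alpha12 sol x t0).
rewrite le_eqVlt; apply/orP; left; apply/eqP; apply: eq_integral => s.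
rewrite inE /= in_itv/= => /andP[s0 st]; have ts : 0 < t - s by rewrite subr_gt0.
rewrite EFin_Rintegral//; last exact: (ker_slice x (ker_abs (ker_dk b01 bge b ts)) (integrable_abs (iF s0))).
by apply: eq_integral => y _; rewrite [in RHS]normrM.
Qed.

Lemma integrable_dk_slice t x : 0 < t -> mu.-integrable `]0, t[
  (EFin \o (fun s => conv (dkb (t - s)) (F s) x)).
Proof.
move=> t0; have kf := kerfam_dk b01 bge b 0 (lexx t).
apply: (@integrable_le _ _ _ mu _ _ _
  (fun s => conv (fun X => `|dkb (t - s) X|) (fun y => `|F s y|) x)) => //.
- exact: (@measurable_time_slice R d (fun s => conv (dkb (t - s)) (F s)) 0 t x
    (conv_time_meas kf (LF t))).
- move=> s; rewrite /= in_itv/= => /andP[s0 st]; apply: conv_abs_le; last exact: iF.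
  by apply: ker_dk => //; rewrite subr_gt0.
- exact: integrable_abs_slice.
Qed.

Let tsc_int (T a c : R) : a < c -> c <= T ->
  mu.-integrable `]a, c[ (EFin \o (fun s => tsc (T - s))).
Proof. exact: integrable_tsc. Qed.

(** Away from time 0 the flux is bounded in L^1, so the only possible singularity is that of
    [tsc (T - s)] at s = T, which is integrable. *)
Lemma window_integral (a c T : R) : 0 < a -> a < c -> c <= T ->
  L.-integrable setT (EFin \o (fun x => \int[mu]_(s in `]a, c[) conv (dkb (T - s)) (F s) x)).
Proof.
move=> a0 ac cT; have [M M0 hM] := flux_N1_bdd c a0.
have [C C0 hC] := Rintegral_dk_le b01 bge b.
have Fac : L1cont F a c by apply: L1cont_sub (LF c) => //; exact: ltW.
have kf := kerfam_dk b01 bge b a cT.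
have sub s : a < s < c -> 0 < s /\ 0 < T - s.
  by move=> /andP[h1 h2]; rewrite (lt_trans a0 h1) subr_gt0 (lt_le_trans h2 cT).
apply: (integrable_time_integral (m := fun s => C * M * tsc (T - s)) (conv_time_meas kf Fac)).
- by move=> s /sub[s0 Ts]; apply: integrable_conv; [exact: ker_dk|exact: iF].
- move=> s sac; have [s0 Ts] := sub s sac.
  apply: le_trans (N1_conv (ker_dk b01 bge b Ts) (iF s0)) _.
  rewrite mulrAC; apply: ler_pM; rewrite ?N1_ge0//; first exact: hC.
  by apply: hM; case/andP: sac => /ltW -> /ltW ->.
- by apply: integrableRZ => //; exact: tsc_int.
Qed.

(* The defect of the mild formula restarted at [tau].  Fubini is available
   only for its increments along b, whence [rerr_periodic]. *)
Definition rerr (tau h : R) x := conv (hkb h) (u tau) x - conv (hkb (h + tau)) u0 x -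
  duh tau (h + tau) x.

(** Duhamel's formula at tau + h cancels the part of the time integral before [tau], where the flux
    is not under control; what remains is integrable in x. *)
Lemma rerrE tau h x : 0 < tau -> 0 < h -> rerr tau h x = conv (hkb h) (u tau) x - u (tau + h) x +
  \int[mu]_(s in `]tau, tau + h[) conv (dkb (tau + h - s)) (F s) x.
Proof.
move=> t0 h0; have th0 : 0 < tau + h by rewrite addr_gt0.
rewrite (sol_duhamel_conv x th0) /rerr /duh [h + tau]addrC.
rewrite (Rintegral_itv_split t0 _ (integrable_dk_slice x th0)) ?ltrDl//; ring.
Qed.

Lemma integrable_rerr tau h : 0 < tau -> 0 < h -> L.-integrable setT (EFin \o rerr tau h).
Proof.
move=> t0 h0; have -> : rerr tau h = fun x => conv (hkb h) (u tau) x - u (tau + h) x +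
  \int[mu]_(s in `]tau, tau + h[) conv (dkb (tau + h - s)) (F s) x.
  by apply/funext => x; exact: rerrE.
apply: integrableRD => //; last by apply: window_integral => //; rewrite ltrDl.
apply: integrableRB => //; last by apply: sol_integrable sol _ _; rewrite ltW// addr_gt0.
by apply: integrable_conv; [exact: ker_hk|apply: sol_integrable sol _ _; exact: ltW].
Qed.

Let conv_shift (k f : 'rV[R]_d -> R) x a : conv (fun X => k (X + a)) f x = conv k f (x + a).
Proof. by apply: eq_Rintegral => y _; rewrite addrAC. Qed.

Let ker_shift (k : 'rV[R]_d -> R) a : ker k -> ker (fun X => k (X + a)).
Proof. by move=> kk; have := ker_translate (- a) kk; rewrite opprK. Qed.

Lemma duh_integrable tau : 0 < tau -> L.-integrable setT (EFin \o duh tau tau).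
Proof.
move=> t0; have -> : duh tau tau = fun x => u tau x - conv (hkb tau) u0 x.
  by apply/funext => x; rewrite (sol_duhamel_conv x t0) addrAC subrr add0r.
apply: integrableRB => //; first by apply: sol_integrable sol _ _; exact: ltW.
by apply: integrable_conv => //; exact: ker_hk.
Qed.

(** The mild formula at [tau] is convolved with the increment [k] of [hkb h] along [b]; by the
    semigroup laws this produces the terms of [rerr] at x + b minus those at x, provided the time
    integral commutes with [k]. Justifying this exchange is most of the proof. *)
Lemma rerr_periodic tau h x : b != 0 -> 0 < tau -> 0 < h -> rerr tau h (x + b) = rerr tau h x.
Proof.
move=> bn0 t0 h0; pose k X := hkb h (X + b) - hkb h X.
have kh := ker_hk d b01 bge h0; have kt := ker_hk d b01 bge t0.
have kk : ker k by apply: kerB; [exact: ker_shift kh|exact: kh].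
have convk f X : L.-integrable setT (EFin \o f) ->
    conv k f X = conv (hkb h) f (X + b) - conv (hkb h) f X.
  by move=> fi; rewrite /k (convBl X (ker_shift b kh) kh fi) conv_shift.
have iu : L.-integrable setT (EFin \o u tau) by apply: sol_integrable sol _ _; exact: ltW.
have dki s X : 0 < tau - s -> conv k (dkb (tau - s)) X = dkb (h + tau - s) (X + b) - dkb (h + tau - s) X.
  move=> ts; have kd := ker_dk b01 bge b ts.
  rewrite convk; last exact: kd.2.
  rewrite !(conv_comm _ kh kd) /conv.
  rewrite (dk_conv b01 bge b (X + b) ts h0) (dk_conv b01 bge b X ts h0).
  by rewrite [tau - s + h]addrC addrA.
have iconv : L.-integrable setT (EFin \o conv (hkb tau) u0) by exact: integrable_conv.
have idt := duh_integrable t0.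
have kuE : conv k (u tau) x = conv k (conv (hkb tau) u0) x + conv k (duh tau tau) x.
  have -> : duh tau tau = fun y => u tau y - conv (hkb tau) u0 y.
    by apply/funext => y; rewrite (sol_duhamel_conv y t0) addrAC subrr add0r.
  by rewrite (convBr x kk iu iconv) addrC subrK.
have k1 : conv k (conv (hkb tau) u0) x =
    conv (hkb (h + tau)) u0 (x + b) - conv (hkb (h + tau)) u0 x.
  have khh := ker_hk d b01 bge (addr_gt0 h0 t0).
  rewrite (conv_assoc x kk kt iu0) -conv_shift -(convBl x (ker_shift b khh) khh iu0).
  apply: eq_Rintegral => y _; rewrite convk; last exact: kt.2.
  by rewrite /conv !hk_conv.
have k2 : conv k (duh tau tau) x = duh tau (h + tau) (x + b) - duh tau (h + tau) x.
  have kf := kerfam_dk b01 bge b 0 (lexx tau).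
  have hti : tau <= h + tau by rewrite lerDr ltW.
  have isl y : mu.-integrable `]0, tau[ (EFin \o (fun s => conv (dkb (h + tau - s)) (F s) y)).
    by apply: integrable_itv_sub (lexx 0) hti _; apply: integrable_dk_slice; exact: addr_gt0.
  rewrite /duh (conv_time_fubini kk kf (LF tau)); last 2 first.
  - by move=> y; exact: integrable_dk_slice.
  - have t20 : 0 < tau / 2 by rewrite divr_gt0.
    have [C1 C10 h1] := hk_shift_le_wt b01 bge b h0.
    have [C2 C20 h2] := dk_le_wt b01 bge b tau t20.
    have [C3 C30 h3] := conv_wt_le b01 b.
    have [C4 C40 h4] := wt_le_dk b01 bge tau bn0 t20.
    have [Mk hMk] := kk.1.
    have [MF MF0 hMF] := flux_N1_bdd tau t20.
    have [C5 C50 h5] := Rintegral_dk_le b01 bge b.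
    have Mk0 : 0 <= Mk by exact: le_trans (hMk 0).
    pose A y s := conv (fun X => `|dkb (tau - s) X|) (fun y => `|F s y|) y.
    have A0 y s : 0 <= A y s by apply: Rintegral_ge0 => z _; rewrite mulr_ge0.
    pose K := C1 * C2 * C3 * C4.
    have K0 : 0 <= K by rewrite !mulr_ge0// ltW.
    (* For s < tau / 2 the first term is used: the convolution of |k| with |dk (tau - s)| is at most
       a multiple of conv wt wt, hence of wt, hence of |dk (tau - s)| at two points, and [A] is
       integrable in time at x and at x + b. For later s the second term uses the L^1 bound of the
       flux. *)
    pose m s := K * (A x s + A (x + b) s) + Mk * C5 * MF * tsc (tau - s).
    have mf : measurable_fun (`]0, tau[ `*` [set: 'rV[R]_d])
      (fun p : measurableTypeR R * 'rV[R]_d => k (x - p.2) * conv (dkb (tau - p.1)) (F p.1) p.2).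
      apply: measurable_funM; last exact: (conv_time_meas kf (LF tau)).
      apply: (@measurable_funS _ _ _ _ setT) => //.
      by apply: (measurableT_comp (measurable_slice x kk)).
    apply: (@fubini_bound _ _ (measurableTypeR R) _ R mu L _ _
      (fun s y => k (x - y) * conv (dkb (tau - s)) (F s) y) m _ measurableT mf) => //.
      move=> s; rewrite /= in_itv/= => /andP[s0 st]; have ts : 0 < tau - s by rewrite subr_gt0.
      have kd := ker_dk b01 bge b ts; have iFs := iF s0.
      have kab := ker_abs kk; have kda := ker_abs kd; have iFa := integrable_abs iFs.
      have iAs : L.-integrable setT (EFin \o (fun y => A y s)) by exact: integrable_conv.
      apply: (@le_trans _ _ (conv (fun X => `|k X|) (fun y => A y s) x)%:E).
        apply: integral_norm_le => //.
        + by have := ker_slice x kk (integrable_conv kd iFs) => /integrable_measurable.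
        + by move=> y _; rewrite normrM ler_wpM2l//; exact: conv_abs_le.
        + exact: (ker_slice x kab iAs).
      rewrite lee_fin; have tsc0 : 0 <= tsc (tau - s) by exact: powR_ge0.
      have [sl|sg] := ltP s (tau / 2); last first.
        apply: (@le_trans _ _ (Mk * C5 * MF * tsc (tau - s))); last first.
          by rewrite lerDr mulr_ge0// addr_ge0.
        have -> : Mk * C5 * MF * tsc (tau - s) = Mk * (C5 * tsc (tau - s) * MF) by ring.
        apply: le_trans (ler_norm _) _; apply: le_trans (conv_bdd (M := Mk) _ kab iAs _) _.
          by move=> y; rewrite normr_id.
        rewrite ler_wpM2l//; apply: le_trans (N1_conv kda iFa) _.
        have NN f : N1 (fun y : 'rV[R]_d => `|f y|) = N1 f.
          by apply: eq_Rintegral => y _; rewrite normr_id.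
        rewrite !NN; apply: ler_pM; rewrite ?N1_ge0//; first exact: h5.
        by apply: hMF; rewrite sg ltW.
      have tsb := first_half_refl s0 sl.
      rewrite (conv_assoc x kab kda iFa).
      have kw := ker_wt b01 b.
      have bnd X : conv (fun X => `|k X|) (fun X => `|dkb (tau - s) X|) X <= C1 * C2 * C3 * wt beta b X.
        apply: (@le_trans _ _ (C1 * C2 * conv (wt beta b) (wt beta b) X)); last first.
          by rewrite -[leRHS]mulrA ler_wpM2l// mulr_ge0// ltW.
        rewrite -RintegralZl//; last exact: (ker_slice X kw kw.2).
        apply: le_Rintegral => //; first exact: (ker_slice X kab kda.2).
          by apply: integrableRZ => //; exact: (ker_slice X kw kw.2).
        move=> y _; apply: le_trans (ler_pM _ _ (h1 _) (h2 _ _ tsb)) _ => //.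
        by rewrite le_eqVlt; apply/orP; left; apply/eqP; ring.
      apply: (@le_trans _ _ (K * (A x s + A (x + b) s))); last first.
        by rewrite lerDl !mulr_ge0// ltW.
      have i1 := ker_slice x kda iFa; have i2 := ker_slice (x + b) kda iFa.
      have i12 := integrableRD measurableT i1 i2.
      rewrite -(RintegralD measurableT i1 i2) -(RintegralZl K measurableT i12).
      apply: le_Rintegral => //.
      + exact: (ker_slice x (ker_conv kab kda.2) iFa).
      + exact: integrableRZ.
      move=> y _; rewrite -mulrDl mulrA ler_wpM2r//.
      apply: le_trans (bnd _) _; rewrite /K -[leRHS]mulrA.
      have C123 : 0 <= C1 * C2 * C3 by rewrite !mulr_ge0// ltW.
      by have := ler_wpM2l C123 (h4 _ (x - y) tsb); rewrite [x - y + b]addrAC.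
    apply: integrableRD => //; last by apply: integrableRZ => //; exact: tsc_int.
    by apply: integrableRZ => //; apply: integrableRD => //; exact: integrable_abs_slice.
  rewrite -RintegralB//; apply: eq_Rintegral => s; rewrite inE /= in_itv/= => /andP[s0 st].
  have ts : 0 < tau - s by rewrite subr_gt0.
  have hts : 0 < h + tau - s by rewrite -addrA addr_gt0.
  have kdh := ker_dk b01 bge b hts; have iFs := iF s0.
  rewrite -conv_shift -(convBl x (ker_shift b kdh) kdh iFs).
  by apply: eq_Rintegral => y _; rewrite dki.
have := kuE; rewrite k1 k2 (convk _ x iu) /rerr => kuE'.
exact: rerr_shift_arith kuE'.
Qed.

(** Translation by [b] says nothing when b = 0, but then the Duhamel term vanishes and the claim is
    the semigroup law. *)
Lemma rerr_eq0 tau h : 0 < tau -> 0 < h -> {ae L, forall x, rerr tau h x = 0}.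
Proof.
move=> t0 h0; have [bE|bn0] := eqVneq b 0; last first.
  apply: N1_eq0; first exact: integrable_rerr.
  exact: (periodic_L1 bn0 (integrable_rerr t0 h0) (fun x => rerr_periodic x bn0 t0 h0)).
apply: aeW => x.
have d0 c T y : duh c T y = 0.
  rewrite /duh /Rintegral integral0_eq// => s _; congr EFin.
  rewrite /conv /Rintegral integral0_eq// => z _; congr EFin.
  rewrite dkE bE [X in _ * X * _](_ : _ = 0) ?mulr0 ?mul0r//.
  by rewrite /Rintegral integral0_eq// => xi _; rewrite dotp0l !mul0r.
rewrite /rerr d0 subr0.
have kh := ker_hk d b01 bge h0; have kt := ker_hk d b01 bge t0.
have -> : u tau = conv (hkb tau) u0.
  by apply/funext => y; rewrite (sol_duhamel_conv y t0) d0 addr0.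
rewrite conv_assoc//; apply/eqP; rewrite subr_eq0; apply/eqP.
by apply: eq_Rintegral => y _; rewrite /conv hk_conv.
Qed.

Lemma restart tau h : 0 < tau -> 0 < h -> {ae L, forall x, u (tau + h) x =
  conv (hkb h) (u tau) x + \int[mu]_(s in `]tau, tau + h[) conv (dkb (tau + h - s)) (F s) x}.
Proof.
move=> t0 h0; apply: filterS (rerr_eq0 t0 h0) => x; rewrite rerrE// => hx; lra.
Qed.

End restart.


Lemma is_derive_cvg_seq {R : realType} (f : R -> R) (x l : R) (s : nat -> R) :
  is_derive x 1 f l -> (forall n, s n != 0) -> s n @[n --> \oo] --> 0 ->
  (s n)^-1 * (f (x + s n) - f x) @[n --> \oo] --> l.
Proof.
move=> [D E] s0 sc; have D' : h^-1 *: (f (h *: (1 : R) + x) - f x) @[h --> 0^'] --> 'D_1 f x by exact: D.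
rewrite E in D'; move/cvgr_dnbhsP : D' => /(_ s (conj s0 sc)).
apply: cvg_trans; apply: near_eq_cvg; apply: nearW => n.
by rewrite /= /GRing.scale /= mulr1 [x + _]addrC.
Qed.

(** Dominated convergence speaks of sequences; if no modulus worked for [e], choosing a bad point
    below r0 / (n + 1) for each [n] would contradict it. *)
Lemma seq_modulus {R : realType} (g : R -> R) (r0 : R) : 0 < r0 ->
  (forall s : nat -> R, (forall n, 0 < s n < r0) -> s n @[n --> \oo] --> 0 ->
    g (s n) @[n --> \oo] --> 0) ->
  forall e, 0 < e -> exists2 r : R, 0 < r & forall s, 0 < s < r -> g s < e.
Proof.
move=> r00 h e e0; apply/not_exists2P => H.
have /choice[s sP] : forall n : nat, exists s, 0 < s < r0 * n.+1%:R^-1 /\ e <= g s.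
  move=> n; have rn : 0 < r0 * n.+1%:R^-1 by rewrite mulr_gt0// invr_gt0.
  have [|/existsNP[s /not_implyP[s1 /negP]]] := H (r0 * n.+1%:R^-1); first by [].
  by rewrite -leNgt => s2; exists s.
have c0 : r0 * n.+1%:R^-1 @[n --> \oo] --> 0.
  by rewrite -[X in _ --> X](mulr0 r0); apply: cvgMr; exact: cvg_harmonic.
have s0 : s n @[n --> \oo] --> 0.
  apply: (squeeze_cvgr _ (cvg_cst 0) c0); apply: nearW => n.
  by have [/andP[/ltW -> /ltW ->]] := sP n.
have sr n : 0 < s n < r0.
  have [/andP[-> h2] _] := sP n; rewrite (lt_le_trans h2)// ler_piMr ?(ltW r00)//.
  by rewrite invf_le1// ler1n.
have /cvgrPdist_lt/(_ e e0) := h s sr s0.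
move=> -[N _ /(_ N (leqnn N))]; rewrite sub0r normrN => hN.
by have [_] := sP N; rewrite leNgt (le_lt_trans (ler_norm _) hN).
Qed.

Lemma N1_dct {R : realType} (d : nat) (f_ : nat -> 'rV[R]_d -> R) (f g : 'rV[R]_d -> R) :
  (forall n, measurable_fun setT (f_ n)) -> (forall x, f_ n x @[n --> \oo] --> f x) ->
  (@lebesgue_rV R d).-integrable setT (EFin \o g) -> (forall n x, `|f_ n x| <= g x) ->
  N1 (fun x => f_ n x - f x) @[n --> \oo] --> 0.
Proof.
move=> mf ff gi fg.
by have [_ _] := Rintegral_dct measurableT mf (fun x _ => ff x) gi (fun n x _ => fg n x).
Qed.

(** * The monotone splitting scheme *)

Section kernel_consistency.
Context {R : realType} (d : nat).
Variable beta : R.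
Hypothesis beta01 : 0 < beta < 1.
Hypothesis beta_ge : 2^-1 <= beta.
Variable b : 'rV[R]_d.
Local Notation L := (@lebesgue_rV R d).
Local Notation hkb := (@hk R d beta).
Local Notation dkb := (@dk R d beta b).
Local Notation tsc := (tsc beta).
Implicit Types (x y z X : 'rV[R]_d).

Lemma N1_hk t : 0 < t -> N1 (hkb t) = 1.
Proof.
move=> t0; rewrite -(Rintegral_hk d beta01 beta_ge t0).
by apply: eq_Rintegral => x _; rewrite ger0_norm// ltW// hk_gt0.
Qed.

Lemma N1_conv_hk k s : ker k -> 0 < s -> N1 (conv k (hkb s)) <= N1 k.
Proof.
move=> kk s0; have ks := ker_hk d beta01 beta_ge s0.
by apply: le_trans (N1_conv kk ks.2) _; rewrite N1_hk// mulr1.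
Qed.

(** The kernel at a later time is the kernel at [eta] convolved with a probability density, so an
    L^1 bound proved at the single time [eta] propagates to all later times. *)
Lemma N1_smooth (K : R -> 'rV[R]_d -> R) (eta t : R) : 0 < eta -> eta <= t -> ker (K eta) ->
  (forall s x, 0 < s -> K (eta + s) x = conv (K eta) (hkb s) x) -> N1 (K t) <= N1 (K eta).
Proof.
move=> e0; rewrite le_eqVlt => /predU1P[<- //|et] kK h.
have s0 : 0 < t - eta by rewrite subr_gt0.
have -> : K t = conv (K eta) (hkb (t - eta)).
  by apply/funext => x; rewrite -h// addrC subrK.
exact: N1_conv_hk.
Qed.

Lemma dk_time_modulus (eta e : R) : 0 < eta -> 0 < e -> exists2 r : R, 0 < r &
  forall t s, eta <= t -> 0 < s < r -> N1 (fun X => dkb (t + s) X - dkb t X) < e.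
Proof.
move=> t0 e0.
have [r r0 h] : exists2 r : R, 0 < r & forall s, 0 < s < r ->
    N1 (fun X => dkb (eta + s) X - dkb eta X) < e.
  apply: (seq_modulus (r0 := 1)) => // s s01 sc.
  have [C C0 hC] := dk_le_wt beta01 beta_ge b (eta + 1) t0.
  have sn0 n : 0 < eta + s n by have /andP[h _] := s01 n; rewrite addr_gt0.
  apply: (@N1_dct _ _ (fun n => dkb (eta + s n)) (dkb eta) (fun X => C * wt beta b X)).
  - by move=> n; apply: ker_measurable; exact: ker_dk.
  - move=> X; have hc := @dk_cont _ _ _ beta_ge b X _ t0.
    apply: (cvg_comp (fun n => eta + s n) (fun t => dkb t X)) hc.
    have : eta + s n @[n --> \oo] --> eta + 0 by exact: (cvgD (cvg_cst eta) sc).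
    by rewrite addr0.
  - by apply: integrableRZ => //; exact: (ker_wt beta01 b).2.
  - move=> n X; apply: hC; have /andP[h1 h2] := s01 n.
    by rewrite lerDl lerD2l !ltW.
exists r => // t s et srr; have /andP[s0 _] := srr.
apply: le_lt_trans (h s srr).
have es : 0 < eta + s by rewrite addr_gt0.
have k1 := ker_dk beta01 beta_ge b es; have k2 := ker_dk beta01 beta_ge b t0.
apply: (@N1_smooth (fun t X => dkb (t + s) X - dkb t X)) => //; first exact: kerB.
move=> r' x r'0; have kr := ker_hk d beta01 beta_ge r'0.
rewrite (convBl x k1 k2 kr.2) /conv (dk_conv beta01 beta_ge b x es r'0).
by rewrite (dk_conv beta01 beta_ge b x t0 r'0) addrAC.
Qed.

(** The backward difference quotient along [b], which takes the place of [dkb t] in the Duhamel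
    formula of the scheme ([scheme_duhamel]). *)
Definition hkquot (eps t : R) X : R := eps^-1 * (hkb t (X - eps *: b) - hkb t X).

Lemma ker_hkquot eps t : 0 < t -> ker (hkquot eps t).
Proof.
move=> t0; have kt := ker_hk d beta01 beta_ge t0.
by apply: kerZ; apply: kerB => //; exact: ker_translate.
Qed.

Lemma hkquot_conv eps t s x : 0 < t -> 0 < s ->
  conv (hkquot eps t) (hkb s) x = hkquot eps (t + s) x.
Proof.
move=> t0 s0; have kt := ker_hk d beta01 beta_ge t0; have ks := ker_hk d beta01 beta_ge s0.
have kts := ker_translate (eps *: b) kt.
rewrite (convZl _ x (kerB kts kt) ks.2) (convBl x kts kt ks.2); congr (_ * (_ - _)).
  rewrite -[RHS](hk_conv beta01 beta_ge (x - eps *: b) t0 s0).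
  by apply: eq_Rintegral => y _; rewrite addrAC.
by rewrite -[RHS](hk_conv beta01 beta_ge x t0 s0).
Qed.

Lemma hkquot_modulus (eta e : R) : 0 < eta -> 0 < e -> exists2 r : R, 0 < r &
  forall t eps, eta <= t -> 0 < eps < r -> N1 (fun X => hkquot eps t X - dkb t X) < e.
Proof.
move=> t0 e0; pose A := enorm b * tsc eta + 1.
have A0 : 0 < A by rewrite ltr_wpDl// mulr_ge0 ?enorm_ge0// powR_ge0.
have [r r0 h] : exists2 r : R, 0 < r & forall s, 0 < s < r ->
    N1 (fun X => hkquot s eta X - dkb eta X) < e.
  apply: (seq_modulus (r0 := A^-1)) => //; first by rewrite invr_gt0.
  move=> s s01 sc.
  have [C C0 hC] := hk_translate d beta01 beta_ge.
  apply: (@N1_dct _ _ (fun n => hkquot (s n) eta) (dkb eta) (fun X => C * A * hkb eta X)).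
  - by move=> n; apply: ker_measurable; exact: ker_hkquot.
  - move=> X; have sn0 n : s n != 0 by have /andP[h _] := s01 n; rewrite gt_eqF.
    have := is_derive_cvg_seq (is_derive_hk beta_ge b X 0 t0) sn0 sc.
    by rewrite scale0r subr0; under eq_fun do rewrite add0r.
  - by apply: integrableRZ => //; exact: (ker_hk d beta01 beta_ge t0).2.
  - move=> n X; have /andP[h1 h2] := s01 n.
    have E : enorm (X - (X - s n *: b)) = s n * enorm b by rewrite subKr enormZ gtr0_norm.
    have bA : enorm b * tsc eta <= A by rewrite lerDl.
    have le1 : enorm (X - (X - s n *: b)) * tsc eta <= 1.
      rewrite E -mulrA; apply: (@le_trans _ _ (s n * A)); first by rewrite ler_wpM2l// ltW.
      by rewrite -ler_pdivlMr// div1r ltW.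
    rewrite /hkquot normrM ger0_norm ?invr_ge0 ?(ltW h1)// ler_pdivrMl// distrC.
    apply: le_trans (hC _ _ _ t0 le1) _; rewrite E.
    have H0 : 0 <= C * hkb eta X by rewrite mulr_ge0 ?(ltW C0)// ltW// hk_gt0.
    have -> : C * (s n * enorm b * tsc eta) * hkb eta X = s n * (C * hkb eta X) * (enorm b * tsc eta).
      by ring.
    have -> : s n * (C * A * hkb eta X) = s n * (C * hkb eta X) * A by ring.
    by rewrite ler_wpM2l// mulr_ge0// ltW.
exists r => // t s et srr; have /andP[s0 _] := srr.
apply: le_lt_trans (h s srr).
have k1 := ker_hkquot s t0; have k2 := ker_dk beta01 beta_ge b t0.
apply: (@N1_smooth (fun t X => hkquot s t X - dkb t X)) => //; first exact: kerB.
move=> r' x r'0; have kr := ker_hk d beta01 beta_ge r'0.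
by rewrite (convBl x k1 k2 kr.2) hkquot_conv// /conv (dk_conv beta01 beta_ge b x t0 r'0).
Qed.
(** Two consistency errors at once: freezing the kernel over a time step, and replacing the
    derivative by a quotient. Only times above [eta] are covered; below, [N1_dk_hkquot_crude]
    serves, and smallness comes from the shortness of the time interval. *)
Lemma N1_dk_hkquot_small (eta e : R) : 0 < eta -> 0 < e -> exists2 r : R, 0 < r &
  forall s t eps, eta <= s -> s < t -> t < s + r -> 0 < eps < r ->
  N1 (fun X => dkb s X - hkquot eps t X) <= e.
Proof.
move=> t0 e0; have e20 : 0 < e / 2 by rewrite divr_gt0.
have [r1 r10 h1] := dk_time_modulus t0 e20; have [r2 r20 h2] := hkquot_modulus t0 e20.
exists (Num.min r1 r2); first by rewrite lt_min r10.
move=> s t eps es st tsr /andP[eps0]; rewrite lt_min => /andP[_ epsr2].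
have s0 := lt_le_trans t0 es; have tt0 := lt_trans s0 st.
have ks := ker_dk beta01 beta_ge b s0; have kt := ker_dk beta01 beta_ge b tt0.
have kq := ker_hkquot eps tt0.
apply: le_trans (N1_triangle ks.2 kt.2 kq.2) _; rewrite [leRHS]splitr; apply: lerD.
  rewrite N1BC; have -> : t = s + (t - s) by rewrite addrC subrK.
  apply/ltW/h1 => //; rewrite subr_gt0 st ltrBlDl/=.
  by apply: lt_le_trans tsr _; rewrite lerD2l ge_min lexx.
rewrite N1BC; apply/ltW/h2; last by rewrite eps0.
exact: le_trans es (ltW st).
Qed.

Lemma N1_dk_hkquot_crude : exists2 C : R, 0 < C &
  [/\ forall t, 0 < t -> N1 (dkb t) <= C * tsc t,
     forall t eps, 0 < t -> 0 < eps -> N1 (hkquot eps t) <= C * tsc t &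
     forall s t eps, 0 < s -> s < t -> 0 < eps ->
       N1 (fun X => dkb s X - hkquot eps t X) <= C * tsc s].
Proof.
have [C1 C10 h1] := Rintegral_dk_le beta01 beta_ge b.
have [C2 C20 h2] := Rintegral_hk_translate beta01 beta_ge b.
have h3 t eps : 0 < t -> 0 < eps -> N1 (hkquot eps t) <= C2 * tsc t.
  move=> t0 eps0; have kt := ker_hk d beta01 beta_ge t0.
  rewrite N1Z; last by apply: integrableRB => //; [exact: (ker_translate _ kt).2|exact: kt.2].
  rewrite ger0_norm ?invr_ge0 ?(ltW eps0)// ler_pdivrMl//.
  by apply: le_trans (h2 t eps t0 (ltW eps0)) _; rewrite mulrCA.
have T0 t : 0 <= tsc t by exact: powR_ge0.
exists (C1 + C2); first by rewrite addr_gt0.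
split=> [t t0|t eps t0 eps0|s t eps s0 st eps0].
- by apply: le_trans (h1 t t0) _; rewrite ler_wpM2r// lerDl ltW.
- by apply: le_trans (h3 t eps t0 eps0) _; rewrite ler_wpM2r// lerDr ltW.
have t0 := lt_trans s0 st.
have kq := ker_hkquot eps t0; have ks := ker_dk beta01 beta_ge b s0.
apply: le_trans (N1B ks.2 kq.2) _; rewrite mulrDl; apply: lerD; first exact: h1.
apply: le_trans (h3 t eps t0 eps0) _; rewrite ler_wpM2l ?(ltW C20)//.
exact: (tsc_anti beta01 s0 (ltW st)).
Qed.

End kernel_consistency.


Section translate_ae.
Context {R : realType} (d : nat).
Local Notation L := (@lebesgue_rV R d).

Lemma ae_translate (P : set 'rV[R]_d) (a : 'rV[R]_d) :
  {ae L, forall x, P x} -> {ae L, forall x, P (x - a)}.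
Proof.
move=> [N [mN N0 hN]]; exists ((fun x => x - a) @^-1` N); split.
- by rewrite -[X in measurable X]setTI; apply: measurable_rVB.
- have mI : measurable_fun setT (EFin \o \1_N : 'rV[R]_d -> \bar R).
    by apply/measurable_EFinP; exact: measurable_indic.
  have := ge0_integral_rV_translate (- a) mI (fun x => ltac:(by rewrite lee_fin)).
  have mA : measurable ((fun x => x - a) @^-1` N).
    by rewrite -[X in measurable X]setTI; apply: measurable_rVB.
  have EI A : measurable A -> (\int[L]_x (\1_A x)%:E = L A)%E.
    by move=> mA'; rewrite integral_indic// setIT.
  by rewrite [X in _ = X -> _](EI _ mN) N0 => <-; rewrite -(EI _ mA).
- by move=> x /=; apply: hN.
Qed.

End translate_ae.

Lemma integrable_itv_cst {R : realType} (a c k : R) :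
  (@lebesgue_measure R).-integrable `]a, c[ (EFin \o (fun=> k)).
Proof.
apply: (@integrable_le _ _ _ (@lebesgue_measure R) _ (measurable_itv _) _ (fun=> `|k|)) => //.
apply: integrable_ge0P => //; rewrite integral_cst//= lebesgue_measure_itv/= lte_fin.
by case: ifP => _; rewrite ?mule0 ?ltry// -EFinB -EFinM ltry.
Qed.

Section time_kernel_bounds.
Context {R : realType}.
Variable beta : R.
Hypothesis beta01 : 0 < beta < 1.
Hypothesis beta_gt : 2^-1 < beta.
Local Notation mu := (@lebesgue_measure R).
Local Notation tsc := (tsc beta).
Local Notation kint := (kint beta).

Let k0 : 0 < kexp beta. Proof. exact: kexp_gt0. Qed.

Lemma kint0 : kint 0 = 0.
Proof. by rewrite /kint powR0 ?gt_eqF// mul0r. Qed.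

Lemma kint_small e : 0 < e -> exists2 r : R, 0 < r & kint r <= e.
Proof.
move=> e0; have ek : 0 < e * kexp beta by exact: mulr_gt0.
exists ((e * kexp beta) `^ (kexp beta)^-1); first exact: powR_gt0.
by rewrite /kint -powRrM mulVf ?gt_eqF// powRr1 ?(ltW ek)// mulfK// gt_eqF.
Qed.

(** [tsc] decreases, so its value at the right end of an interval is at most its average there.
    Written with [kint], Riemann sums become telescoping sums. *)
Lemma mul_tsc_le t h : 0 < h -> h <= t -> h * tsc t <= kint t - kint (t - h).
Proof.
move=> h0 ht; have t0 := lt_le_trans h0 ht.
have th : 0 < t - (t - h) by rewrite subKr.
have := @Rintegral_tsc_le _ beta beta01 beta_gt t 0 h h0 ht; rewrite subr0; apply: le_trans.
have -> : h * tsc t = \int[mu]_(s in `]0, h[) tsc t.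
  rewrite Rintegral_cst//= lebesgue_measure_itv/= lte_fin h0 -EFinB subr0/=.
  by rewrite mulrC.
apply: le_Rintegral => //.
- exact: integrable_itv_cst.
- exact: integrable_tsc.
move=> s; rewrite /= in_itv/= => /andP[s0 sh]; apply: tsc_anti => //; last by rewrite gerBl ltW.
by rewrite subr_gt0 (lt_le_trans sh).
Qed.

Lemma telescope_sub_rev (g : nat -> R) m : \sum_(j < m) (g (m - j)%N - g (m - j).-1) = g m - g 0%N.
Proof.
elim: m => [|m IH]; first by rewrite big_ord0 subrr.
rewrite big_ord_recl subn0 /=; under eq_bigr do rewrite /bump /= add1n subSS.
by rewrite IH addrA subrK.
Qed.

End time_kernel_bounds.

Lemma L1cont_uniform {R : realType} (d : nat) (F : R -> 'rV[R]_d -> R) (a c a' c' e : R) :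
  a < a' -> c' < c -> L1cont F a c -> 0 < e -> exists2 r : R, 0 < r &
  forall s s', a' <= s <= c' -> a' <= s' <= c' -> `|s' - s| < r ->
    N1 (fun x => F s' x - F s x) <= e.
Proof.
move=> aa cc [iF cF] e0.
have sub s : a' <= s <= c' -> a < s < c.
  by move=> /andP[h1 h2]; rewrite (lt_le_trans aa h1) (le_lt_trans h2 cc).
have /compact_near_coveringP := @segment_compact R a' c'.
move=> /(_ R (0^'+) (fun r s => a' <= s <= c' -> forall s', a' <= s' <= c' -> `|s' - s| < r ->
    N1 (fun x => F s' x - F s x) <= e) _) [].
  move=> t; rewrite /= in_itv/= => tac.
  have e20 : 0 < e / 2 by rewrite divr_gt0.
  have [r r0 hr] := cF t _ (sub t tac) e20.
  have r20 : 0 < r / 2 by rewrite divr_gt0.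
  exists (ball t (r / 2), [set x | x < r / 2]); first split => /=.
  - exact: nbhsx_ballx.
  - exact: nbhs_right_lt.
  move=> [s r'] /= [st r'r] sac s' s'ac s's.
  have st' : `|s - t| < r / 2 by rewrite distrC.
  have i1 := iF _ (sub s sac); have i2 := iF _ (sub s' s'ac); have i3 := iF _ (sub t tac).
  apply: le_trans (N1_triangle i2 i3 i1) _; rewrite [leRHS]splitr; apply: lerD.
    apply/ltW/hr; first exact: sub.
    have -> : s' - t = (s' - s) + (s - t) by rewrite addrA subrK.
    apply: le_lt_trans (ler_normD _ _) _; rewrite [ltRHS]splitr; apply: ltrD => //.
    exact: lt_trans r'r.
  rewrite N1BC; apply/ltW/hr; first exact: sub.
  by apply: lt_le_trans st' _; rewrite ler_pdivrMr// ler_peMr ?ler1n// ltW.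
move=> r /= r0 H; have r20 : 0 < r / 2 by rewrite divr_gt0.
exists (r / 2) => // s s' sac s'ac s's; apply: (H (r / 2)) => //.
by rewrite /ball_/= sub0r normrN gtr0_norm// ltr_pdivrMr// ltr_pMr// ltr1n.
Qed.


Lemma ae_le_Rintegral {R : realType} (d : nat) (f g : 'rV[R]_d -> R) :
  (@lebesgue_rV R d).-integrable setT (EFin \o f) ->
  (@lebesgue_rV R d).-integrable setT (EFin \o g) ->
  {ae @lebesgue_rV R d, forall x, f x <= g x} ->
  \int[@lebesgue_rV R d]_x f x <= \int[@lebesgue_rV R d]_x g x.
Proof.
move=> fi gi fg; rewrite -subr_ge0 -RintegralB//.
have i := integrableRB measurableT gi fi.
rewrite (@ae_Rintegral _ _ _ (fun x => `|g x - f x|)); first exact: N1_ge0.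
- by apply: filterS fg => x h; rewrite ger0_norm// subr_ge0.
- exact: integrable_measurable.
- exact: (integrable_measurable (integrable_abs i)).
Qed.

(** * Excess over a level, and the monotone step *)

Section positive_part.
Context {R : realType} (d : nat).
Local Notation L := (@lebesgue_rV R d).
Implicit Types (f g v w : 'rV[R]_d -> R) (k : R).

Definition excess k v x : R := Num.max (v x - k) 0.

Lemma excess_ge0 k v x : 0 <= excess k v x.
Proof. by rewrite le_max lexx orbT. Qed.

Lemma excess_le k v x : 0 <= k -> excess k v x <= `|v x|.
Proof. by move=> k0; rewrite ge_max normr_ge0 andbT (le_trans _ (ler_norm _))// gerBl. Qed.

Lemma integrable_excess k v : 0 <= k -> L.-integrable setT (EFin \o v) ->
  L.-integrable setT (EFin \o excess k v).
Proof.
move=> k0 iv; apply: (@integrable_le _ _ _ L setT measurableT _ (fun x => `|v x|)).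
- have mv := measurable_funB (integrable_measurable iv) (measurable_cst k).
  have -> : excess k v = (v \- cst k) \max cst 0 by [].
  exact: measurable_maxr.
- by move=> x _; rewrite ger0_norm ?excess_ge0// excess_le.
- exact: integrable_abs.
Qed.

(** Carries sign, sup bound and mass at once: for k >= 0 and integrable [v] it vanishes exactly when
    v <= k almost everywhere, its values at level 0 for [v] and its opposite add up to the L^1 norm,
    and it is Lipschitz in L^1, so that estimates on the scheme survive the limit. *)
Definition pos k v : R := \int[L]_x excess k v x.

Lemma pos_ge0 k v : 0 <= pos k v.
Proof. by apply: Rintegral_ge0 => x _; exact: excess_ge0. Qed.

Lemma pos_eq0 k v : 0 <= k -> L.-integrable setT (EFin \o v) ->
  pos k v = 0 <-> {ae L, forall x, v x <= k}.
Proof.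
move=> k0 iv; have ie := integrable_excess k0 iv; split=> [p0|vk].
  have : {ae L, forall x, excess k v x = 0}.
    apply: N1_eq0 => //; rewrite -[RHS]p0.
    by apply: eq_Rintegral => x _; rewrite ger0_norm ?excess_ge0.
  apply: filterS => x; rewrite /excess => h.
  by rewrite -subr_le0 -h le_max lexx.
have -> : 0 = \int[L]_(x in [set: 'rV[R]_d]) (0 : R).
  by rewrite /Rintegral integral0.
apply: ae_Rintegral => //; last exact: integrable_measurable.
by apply: filterS vk => x vx; apply/max_r; rewrite subr_le0.
Qed.

Lemma pos_lip k v w : 0 <= k -> L.-integrable setT (EFin \o v) ->
  L.-integrable setT (EFin \o w) -> pos k v <= pos k w + N1 (fun x => v x - w x).
Proof.
move=> k0 iv iw; have ivw := integrable_abs (integrableRB measurableT iv iw).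
have ie := integrable_excess k0 iw.
rewrite /pos /N1 -RintegralD//; apply: le_Rintegral => //.
- exact: integrable_excess.
- exact: integrableRD.
move=> x _; rewrite /excess; have := ler_norm (v x - w x).
have := normr_ge0 (v x - w x); case: (leP (v x - k) 0) => h1; case: (leP (w x - k) 0) => h2 h3 h4; lra.
Qed.

Lemma N1_pos v : L.-integrable setT (EFin \o v) -> N1 v = pos 0 v + pos 0 (fun x => - v x).
Proof.
move=> iv; have inv : L.-integrable setT (EFin \o (fun x => - v x)).
  by have := integrableRZ measurableT (-1) iv; under eq_fun do rewrite mulN1r.
rewrite /pos -RintegralD//; try exact: integrable_excess.
apply: eq_Rintegral => x _; rewrite /excess !subr0.
have [v0|v0] := leP 0 (v x).
  by rewrite ger0_norm// [Num.max (- _) _]max_r ?addr0// oppr_le0.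
by rewrite ltr0_norm// [Num.max (- _) _]max_l ?add0r// oppr_ge0 ltW.
Qed.

Lemma integrableN v : L.-integrable setT (EFin \o v) ->
  L.-integrable setT (EFin \o (fun x => - v x)).
Proof.
by move=> iv; have := integrableRZ measurableT (-1) iv; under eq_fun do rewrite mulN1r.
Qed.

Lemma ae_norm_le B v : 0 <= B -> L.-integrable setT (EFin \o v) ->
  pos B v = 0 -> pos B (fun x => - v x) = 0 -> {ae L, forall x, `|v x| <= B}.
Proof.
move=> B0 iv /(pos_eq0 B0 iv) h1 /(pos_eq0 B0 (integrableN iv)) h2.
by apply: filterS2 h1 h2 => x h1 h2; rewrite ler_norml h1 andbT lerNl.
Qed.

End positive_part.

Lemma advection_arith (R : fieldType) (a h e p p' : R) :
  a - h / e * (p - p') = a + h * (e^-1 * (p' - p)).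
Proof. by ring. Qed.

Section conv_linear.
Context {R : realType} (d : nat).
Local Notation L := (@lebesgue_rV R d).
Implicit Types (f g k : 'rV[R]_d -> R).

Lemma convDr k f g x : ker k -> L.-integrable setT (EFin \o f) ->
  L.-integrable setT (EFin \o g) ->
  conv k (fun y => f y + g y) x = conv k f x + conv k g x.
Proof.
move=> kk fi gi; rewrite /conv -RintegralD//; try exact: ker_slice.
by apply: eq_Rintegral => y _; rewrite mulrDr.
Qed.

Lemma conv_sum k I (r : seq I) (F : I -> 'rV[R]_d -> R) x : ker k ->
  (forall i, L.-integrable setT (EFin \o F i)) ->
  conv k (fun y => \sum_(i <- r) F i y) x = \sum_(i <- r) conv k (F i) x.
Proof.
move=> kk iF; elim: r => [|i r IH].
  rewrite big_nil /conv /Rintegral integral0_eq// => y _.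
  by rewrite big_nil mulr0.
rewrite big_cons -IH -convDr//; last exact: integrableR_sum.
by apply: eq_Rintegral => y _; rewrite big_cons.
Qed.

End conv_linear.

Section step.
Context {R : realType} (d : nat).
Variables (beta q : R) (b : 'rV[R]_d).
Hypothesis beta01 : 0 < beta < 1.
Hypothesis beta_ge : 2^-1 <= beta.
Hypothesis q0 : 0 < q.
Local Notation L := (@lebesgue_rV R d).
Local Notation f := (flux q).
Local Notation hkb := (@hk R d beta).
Implicit Types (v w : 'rV[R]_d -> R) (k : R).

(** Jensen's inequality for the convex function max (a - k, 0): the kernel is a probability density,
    so the excess of an average is at most the average of the excess. *)
Lemma pos_conv_hk k v h : 0 <= k -> 0 < h -> L.-integrable setT (EFin \o v) ->
  pos k (conv (hkb h) v) <= pos k v.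
Proof.
move=> k0 h0 iv; have kh := ker_hk d beta01 beta_ge h0.
have ie := integrable_excess k0 iv.
have -> : pos k v = \int[L]_x conv (hkb h) (excess k v) x.
  by rewrite Rintegral_conv// (Rintegral_hk d beta01 beta_ge h0) mul1r.
apply: le_Rintegral => //; [apply: integrable_excess => //; exact: integrable_conv|exact: integrable_conv|].
move=> x _; rewrite {1}/excess ge_max; apply/andP; split; last first.
  by apply: Rintegral_ge0 => y _; rewrite mulr_ge0 ?excess_ge0// ltW// hk_gt0.
have ihk : L.-integrable setT (EFin \o (fun y => hkb h (x - y))).
  exact: integrable_reflect kh.2.
have E : \int[L]_y hkb h (x - y) = 1.
  by rewrite (Rintegral_rV_reflect x kh.2) (Rintegral_hk d beta01 beta_ge h0).
rewrite lerBlDr -[X in _ + X]mulr1 -E -RintegralZl//.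
have i1 := ker_slice x kh ie; have i2 := integrableRZ measurableT k ihk.
rewrite -RintegralD//; apply: le_Rintegral => //; first exact: ker_slice.
  exact: integrableRD.
move=> y _; rewrite [k * _]mulrC -mulrDr ler_wpM2l ?(ltW (hk_gt0 beta01 beta_ge _ h0))//.
by rewrite -lerBlDr le_max lexx.
Qed.

(* An upwind step for v_t + b . grad (f v) = 0.  For lam f' <= 1 it is the sum
   of the nondecreasing maps a |-> a - lam (f a) and a |-> lam (f a), applied to
   v and to a translate of v; this is what makes the scheme monotone. *)
Definition advection (lam eps : R) v x : R := v x - lam * (f (v x) - f (v (x - eps *: b))).

Lemma advectionN lam eps v x : advection lam eps (fun y => - v y) x = - advection lam eps v x.
Proof. by rewrite /advection !fluxN; ring. Qed.

Section bounded.
Variables (B lam eps : R).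
Hypothesis lam0 : 0 <= lam.
Hypothesis lamB : lam * ((q + 1) * B `^ q) <= 1.

Let lam_flux (a c : R) : `|a| <= B -> `|c| <= B -> c <= a -> lam * (f a - f c) <= a - c.
Proof.
move=> aB cB ca; have := flux_lip q0 aB cB; have ac0 : 0 <= a - c by rewrite subr_ge0.
rewrite [X in _ <= _ * X]ger0_norm// => h.
apply: le_trans (ler_wpM2l lam0 (le_trans (ler_norm _) h)) _.
by rewrite mulrA ler_piMl.
Qed.

(** A discrete entropy inequality: the excess changes by a difference of entropy fluxes, which
    cancel after integration since one is a translate of the other. The condition on [lam] makes a -
    lam (f a) nondecreasing on [-B, B]. *)
Lemma advection_pointwise k (a a' : R) : 0 <= k -> k <= B -> `|a| <= B -> `|a'| <= B ->
  Num.max (a - lam * (f a - f a') - k) 0 <=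
  Num.max (a - k) 0 - lam * Num.max (f a - f k) 0 + lam * Num.max (f a' - f k) 0.
Proof.
move=> k0 kB aB a'B; have kB' : `|k| <= B by rewrite ger0_norm.
have m0 : 0 <= lam * Num.max (f a' - f k) 0 by rewrite mulr_ge0// le_max lexx orbT.
have m1 : lam * (f a' - f k) <= lam * Num.max (f a' - f k) 0.
  by rewrite ler_wpM2l// le_max lexx.
have [ka|/ltW ak] := leP k a.
  have h1 : f k <= f a := flux_homo q0 ka.
  have h2 := lam_flux aB kB' ka.
  rewrite [Num.max (a - k) 0]max_l ?subr_ge0// [Num.max (f a - f k) 0]max_l ?subr_ge0//.
  by rewrite ge_max; apply/andP; split; lra.
have h1 : f a <= f k := flux_homo q0 ak.
have h2 := lam_flux kB' aB ak.
rewrite [Num.max (a - k) 0]max_r ?subr_le0// [Num.max (f a - f k) 0]max_r ?subr_le0//.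
by rewrite ge_max; apply/andP; split; lra.
Qed.

Section function.
Variable v : 'rV[R]_d -> R.
Hypothesis iv : L.-integrable setT (EFin \o v).
Hypothesis vB : {ae L, forall x, `|v x| <= B}.

Let ifv : L.-integrable setT (EFin \o (fun x => f (v x))).
Proof. exact: integrable_flux vB. Qed.

Lemma integrable_advection : L.-integrable setT (EFin \o advection lam eps v).
Proof.
apply: integrableRB => //; apply: integrableRZ => //; apply: integrableRB => //.
exact: (integrable_translateB (eps *: b) ifv).
Qed.

Lemma pos_advection k : 0 <= k -> k <= B -> pos k (advection lam eps v) <= pos k v.
Proof.
move=> k0 kB; have fk0 : 0 <= f k by rewrite -(flux0 q); exact: flux_homo.
have ie := integrable_excess k0 iv.
have ief := integrableRZ measurableT lam (integrable_excess fk0 ifv).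
pose p x := lam * excess (f k) (fun x => f (v x)) x.
have ip : L.-integrable setT (EFin \o p) by [].
have ip' := integrable_translateB (eps *: b) ip.
have iep := integrableRB measurableT ie ip.
have -> : pos k v = \int[L]_x (excess k v x - p x + p (x - eps *: b)).
  rewrite RintegralD// RintegralB// (Rintegral_rV_translate (- (eps *: b)) ip).
  by rewrite subrK.
apply: ae_le_Rintegral.
- by apply: integrable_excess => //; exact: integrable_advection.
- exact: integrableRD.
- apply: filterS2 vB (ae_translate (eps *: b) vB) => x h1 h2.
  exact: advection_pointwise.
Qed.

Definition step h w := conv (hkb h) (advection lam eps w).

Lemma integrable_step h : 0 < h -> L.-integrable setT (EFin \o step h v).
Proof.
by move=> h0; apply: integrable_conv; [exact: ker_hk|exact: integrable_advection].
Qed.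

Lemma stepN h : 0 < h -> step h (fun y => - v y) = fun x => - step h v x.
Proof.
move=> h0; have kh := ker_hk d beta01 beta_ge h0; have it := integrable_advection.
apply/funext => x; rewrite -[RHS]mulN1r -(convZr _ x kh it).
by apply: eq_Rintegral => y _; rewrite advectionN mulN1r.
Qed.

Lemma pos_step h k : 0 < h -> 0 <= k -> k <= B -> pos k (step h v) <= pos k v.
Proof.
move=> h0 k0 kB; apply: le_trans (pos_conv_hk k0 h0 integrable_advection) _.
exact: pos_advection.
Qed.

End function.

Section iteration.
Variables (h : R) (v : 'rV[R]_d -> R).
Hypothesis h0 : 0 < h.
Hypothesis B0 : 0 <= B.

Let ok w := L.-integrable setT (EFin \o w) /\ {ae L, forall x, `|w x| <= B}.

Let okN w : ok w -> ok (fun x => - w x).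
Proof.
move=> [iw wB]; split; first exact: integrableN.
by apply: filterS wB => x; rewrite normrN.
Qed.

(** [pos_step] at level [B], for [w] and, the flux being odd, for its opposite. *)
Lemma step_bdd w : ok w -> ok (step h w).
Proof.
move=> kw; have [iw wB] := kw; have [inw nwB] := okN kw.
have isw := integrable_step iw wB h0; split=> //.
apply: ae_norm_le => //.
  apply/eqP; rewrite eq_le pos_ge0 andbT; apply: le_trans (pos_step iw wB h0 B0 (lexx B)) _.
  rewrite le_eqVlt; apply/orP; left; apply/eqP/(pos_eq0 B0 iw).
  by apply: filterS wB => x; apply: le_trans; exact: ler_norm.
rewrite -(stepN iw wB h0).
apply/eqP; rewrite eq_le pos_ge0 andbT; apply: le_trans (pos_step inw nwB h0 B0 (lexx B)) _.
rewrite le_eqVlt; apply/orP; left; apply/eqP/(pos_eq0 B0 inw).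
by apply: filterS nwB => x; apply: le_trans; exact: ler_norm.
Qed.

Definition scheme n := iter n (step h) v.

Hypothesis vok : ok v.

Lemma scheme_bdd n : ok (scheme n).
Proof. by elim: n => //= n IH; exact: step_bdd. Qed.

Lemma pos_scheme k n : 0 <= k -> k <= B -> pos k (scheme n) <= pos k v.
Proof.
move=> k0 kB; elim: n => //= n IH; have [iw wB] := scheme_bdd n.
exact: le_trans (pos_step iw wB h0 k0 kB) IH.
Qed.

Lemma pos_schemeN k n : 0 <= k -> k <= B ->
  pos k (fun x => - scheme n x) <= pos k (fun x => - v x).
Proof.
move=> k0 kB; elim: n => //= n IH; have [iw wB] := scheme_bdd n.
have [inw nwB] := okN (scheme_bdd n).
rewrite -(stepN iw wB h0); exact: le_trans (pos_step inw nwB h0 k0 kB) IH.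
Qed.

Hypothesis eps0 : 0 < eps.
Hypothesis lamE : lam = h / eps.
Local Notation hkq := (hkquot beta b eps).

(** The translation moves from the flux to the kernel, and lam = h / eps turns the upwind difference
    into [h] times the quotient [hkq]. *)
Lemma stepE w x : ok w ->
  step h w x = conv (hkb h) w x + h * conv (hkq h) (fun y => f (w y)) x.
Proof.
move=> [iw wB]; have kh := ker_hk d beta01 beta_ge h0.
have ifw : L.-integrable setT (EFin \o (fun x => f (w x))) by exact: integrable_flux wB.
have ifw' := integrable_translateB (eps *: b) ifw.
have ifd := integrableRB measurableT ifw ifw'.
rewrite /step (convBr x kh iw (integrableRZ measurableT lam ifd)) (convZr _ x kh ifd).
rewrite (convBr x kh ifw ifw') (conv_translate _ _ kh ifw).
have kht := ker_translate (eps *: b) kh.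
rewrite /hkquot (convZl _ x (kerB kht kh) ifw) (convBl x kht kh ifw) lamE.
exact: advection_arith.
Qed.

Lemma conv_hk_hkquot t g x : 0 < t -> L.-integrable setT (EFin \o g) ->
  conv (hkb h) (conv (hkq t) g) x = conv (hkq (t + h)) g x.
Proof.
move=> t0 ig; have kh := ker_hk d beta01 beta_ge h0.
have kq := ker_hkquot beta01 beta_ge b eps t0.
rewrite (conv_assoc x kh kq ig); apply: eq_Rintegral => y _.
by rewrite (conv_comm _ kh kq) (hkquot_conv beta01 beta_ge).
Qed.

(** An exact counterpart of the mild formula: the time integral becomes a left-point rule with
    weight [h], and the gradient becomes [hkq]. The scheme can thus be compared with the solution
    term by term. *)
Lemma scheme_duhamel n x : scheme n.+1 x = conv (hkb (n.+1%:R * h)) v x +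
  \sum_(j < n.+1) h * conv (hkq ((n.+1 - j)%:R * h)) (fun y => f (scheme j y)) x.
Proof.
have ik (j : nat) : L.-integrable setT (EFin \o (fun x => f (scheme j x))).
  by have [i1 i2] := scheme_bdd j; exact: integrable_flux i2.
have kh := ker_hk d beta01 beta_ge h0; have [iv vB] := vok.
have kq (t : R) : 0 < t -> ker (hkq t) by exact: ker_hkquot.
have SE (m : nat) : m%:R * h + h = m.+1%:R * h by rewrite mulrSr mulrDl mul1r.
have nh (m : nat) : 0 < m.+1%:R * h by rewrite mulr_gt0.
elim: n x => [|n IH] x.
  by rewrite big_ord1 subn0 !mul1r /scheme /= stepE.
have -> : scheme n.+2 x = step h (scheme n.+1) x by [].
rewrite (stepE x (scheme_bdd n.+1)).
rewrite big_ord_recr /= subSnn mul1r addrA; congr (_ + _).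
have knh := ker_hk d beta01 beta_ge (nh n).
pose S y := \sum_(j < n.+1) h * conv (hkq ((n.+1 - j)%:R * h)) (fun y => f (scheme j y)) y.
have jn (j : 'I_n.+1) : 0 < (n.+1 - j)%:R * h.
  by rewrite mulr_gt0// ltr0n subn_gt0.
have iS : L.-integrable setT (EFin \o S).
  apply: integrableR_sum => // j _; apply: integrableRZ => //; apply: integrable_conv => //.
  exact: kq.
have -> : conv (hkb h) (scheme n.+1) x = conv (hkb h) (fun y => conv (hkb (n.+1%:R * h)) v y + S y) x.
  by apply: eq_Rintegral => y _; rewrite IH.
have iT (j : 'I_n.+1) : L.-integrable setT
    (EFin \o (fun y => h * conv (hkq ((n.+1 - j)%:R * h)) (fun y => f (scheme j y)) y)).
  by apply: integrableRZ => //; apply: integrable_conv => //; exact: kq.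
rewrite (convDr x kh (integrable_conv knh iv) iS) (conv_assoc x kh knh iv); congr (_ + _).
  apply: eq_Rintegral => y _; rewrite (conv_comm _ kh knh) /conv.
  by rewrite (hk_conv beta01 beta_ge _ (nh n) h0) SE.
rewrite (conv_sum _ x kh iT); apply: eq_bigr => j _.
rewrite (convZr _ x kh (integrable_conv (kq _ (jn j)) (ik j))) (conv_hk_hkquot _ (jn j) (ik j)).
have jl : (j <= n.+1)%N by exact/ltnW/ltn_ord.
by rewrite SE (subSn jl).
Qed.

End iteration.
End bounded.
End step.


(** The weights telescope to at most 1/2, so that by strong induction the earlier errors, each at
    most 2 delta, contribute at most delta. *)
Lemma discrete_gronwall {R : realType} (e g : nat -> R) (K delta : R) n :
  (forall m, 0 <= e m) -> 0 <= K -> 0 <= delta -> (forall i, g i.-1 <= g i) ->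
  K * (g n - g 0%N) <= 2^-1 ->
  (forall m, (m <= n)%N -> e m <= \sum_(j < m) K * (g (m - j)%N - g (m - j).-1) * e j + delta) ->
  forall m, (m <= n)%N -> e m <= 2 * delta.
Proof.
move=> e0 K0 d0 gi Kn h.
have gmono m k : (m <= k)%N -> g m <= g k.
  elim: k => [|k IH]; first by rewrite leqn0 => /eqP ->.
  by rewrite leq_eqVlt => /predU1P[-> //|]; rewrite ltnS => /IH /le_trans; apply; exact: gi k.+1.
elim/ltn_ind => m IH mn; apply: le_trans (h m mn) _.
have -> : 2 * delta = delta + delta by ring.
rewrite lerD2r; apply: (@le_trans _ _ (\sum_(j < m) K * (g (m - j)%N - g (m - j).-1) * (2 * delta))).
  apply: ler_sum => j _; rewrite ler_wpM2l//; first by rewrite mulr_ge0// subr_ge0.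
  by apply: IH => //; exact: leq_trans (ltnW (ltn_ord j)) mn.
rewrite -mulr_suml -mulr_sumr telescope_sub_rev.
have h1 : K * (g m - g 0%N) <= 2^-1 by apply: le_trans Kn; rewrite ler_wpM2l// lerD2r gmono.
rewrite mulrA -[leRHS]mul1r ler_wpM2r//; lra.
Qed.

Lemma Rintegral_grid {R : realType} (f : R -> R) (a h : R) n : 0 < h ->
  (@lebesgue_measure R).-integrable `]a, (a + n.+1%:R * h)[ (EFin \o f) ->
  \int[@lebesgue_measure R]_(s in `]a, (a + n.+1%:R * h)[) f s =
  \sum_(j < n.+1) \int[@lebesgue_measure R]_(s in `](a + j%:R * h), (a + j.+1%:R * h)[) f s.
Proof.
move=> h0; elim: n => [|n IH] fi; first by rewrite big_ord1 mul0r addr0.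
have lt1 : a < a + n.+1%:R * h by rewrite ltrDl mulr_gt0.
have lt2 : a + n.+1%:R * h < a + n.+2%:R * h by rewrite ltrD2l ltr_pM2r// ltr_nat.
rewrite (Rintegral_itv_split lt1 lt2 fi) IH; last exact: integrable_itv_sub (ltW lt2) fi.
by rewrite [RHS]big_ord_recr.
Qed.

(** * Convergence of the scheme on short windows *)

Section window_error.
Context {R : realType} (d : nat).
Variable beta : R.
Hypothesis beta01 : 0 < beta < 1.
Hypothesis beta_gt : 2^-1 < beta.
Variable b : 'rV[R]_d.
Local Notation L := (@lebesgue_rV R d).
Local Notation mu := (@lebesgue_measure R).
Local Notation dkb := (@dk R d beta b).
Local Notation tsc := (tsc beta).
Local Notation kint := (kint beta).
Let beta_ge : 2^-1 <= beta := ltW beta_gt.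

Variables (F : R -> 'rV[R]_d -> R) (sigma h T eps C p e0 om M : R).
Hypothesis h0 : 0 < h.
Hypothesis hT : sigma + h <= T.
Hypothesis LF : L1cont F sigma (sigma + h).
Hypothesis iF : L.-integrable setT (EFin \o F sigma).
Hypothesis isl : forall x, mu.-integrable `]sigma, (sigma + h)[
  (EFin \o (fun s => conv (dkb (T - s)) (F s) x)).
Hypothesis C0 : 0 <= C.
Hypothesis p0 : 0 <= p.
Hypothesis hC : forall t, 0 < t -> N1 (dkb t) <= C * tsc t.
Hypothesis hom : forall s, sigma < s < sigma + h -> N1 (fun x => F s x - F sigma x) <= om.
Hypothesis hM : N1 (F sigma) <= M.
Hypothesis hk : forall s, sigma < s < sigma + h ->
  N1 (fun X => dkb (T - s) X - hkquot beta b eps (T - sigma) X) <= p * tsc (T - s) + e0.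

Let W x := \int[mu]_(s in `]sigma, (sigma + h)[) conv (dkb (T - s)) (F s) x.
Let Q := conv (hkquot beta b eps (T - sigma)) (F sigma).

(** Over one time step the flux is frozen first and the kernel next. The hypothesis [hk] is meant
    for two uses: e0 = 0 near the singularity of the kernel, p = 0 away from it. *)
Lemma window_error :
  L.-integrable setT (EFin \o (fun x => W x - h * Q x)) /\
  N1 (fun x => W x - h * Q x) <= (C * om + p * M) * (kint (T - sigma) - kint (T - sigma - h)) + e0 * M * h.
Proof.
have sh : sigma < sigma + h by rewrite ltrDl.
have Ts : 0 < T - sigma by rewrite subr_gt0 (lt_le_trans sh).
have kq := ker_hkquot beta01 beta_ge b eps Ts.
pose g s x := conv (dkb (T - s)) (F s) x - Q x.
have kT s : sigma < s < sigma + h -> ker (dkb (T - s)).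
  by move=> /andP[_ h2]; apply: ker_dk => //; rewrite subr_gt0 (lt_le_trans h2).
have iFs s : sigma < s < sigma + h -> L.-integrable setT (EFin \o F s) by case: LF => hF _; exact: hF.
have iQ : L.-integrable setT (EFin \o Q) by exact: integrable_conv.
have mg : measurable_fun (`]sigma, (sigma + h)[ `*` [set: 'rV[R]_d])
    (fun p : measurableTypeR R * 'rV[R]_d => g p.1 p.2).
  apply: measurable_funB; first exact: (conv_time_meas (kerfam_dk beta01 beta_ge b sigma hT) LF).
  apply: (@measurable_funS _ _ _ _ setT) => //.
  by apply: (measurableT_comp (integrable_measurable iQ)).
have ig s : sigma < s < sigma + h -> L.-integrable setT (EFin \o g s).
  by move=> ss; apply: integrableRB => //; apply: integrable_conv; [exact: kT|exact: iFs].
pose m s := (C * om + p * M) * tsc (T - s) + e0 * M.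
have gm s : sigma < s < sigma + h -> N1 (g s) <= m s.
  move=> ss; have ks := kT s ss; have is_ := iFs s ss.
  have Ts' : 0 < T - s by rewrite subr_gt0; case/andP: ss => _ h2; exact: lt_le_trans hT.
  have iFF := integrableRB measurableT is_ iF.
  have -> : g s = fun x => conv (dkb (T - s)) (fun y => F s y - F sigma y) x +
      conv (fun X => dkb (T - s) X - hkquot beta b eps (T - sigma) X) (F sigma) x.
    apply/funext => x; rewrite (convBr x ks is_ iF) (convBl x ks kq iF) /g /Q.
    by rewrite addrA subrK.
  apply: le_trans (N1D (integrable_conv ks iFF) (integrable_conv (kerB ks kq) iF)) _.
  have -> : m s = C * tsc (T - s) * om + (p * tsc (T - s) + e0) * M by rewrite /m; ring.
  apply: lerD.
    apply: le_trans (N1_conv ks iFF) _; apply: ler_pM; rewrite ?N1_ge0//; [exact: hC|exact: hom].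
  apply: le_trans (N1_conv (kerB ks kq) iF) _; apply: ler_pM; rewrite ?N1_ge0//; exact: hk.
have it : mu.-integrable `]sigma, (sigma + h)[ (EFin \o (fun s => tsc (T - s))).
  exact: integrable_tsc.
have ic (c : R) := integrable_itv_cst sigma (sigma + h) c.
have im : mu.-integrable `]sigma, (sigma + h)[ (EFin \o m).
  by apply: integrableRD => //; apply: integrableRZ.
have cstE (c : R) : \int[mu]_(s in `]sigma, (sigma + h)[) c = c * h.
  by rewrite Rintegral_cst//= lebesgue_measure_itv/= lte_fin sh -EFinB/= addrAC subrr add0r.
have E : (fun x => W x - h * Q x) = fun x => \int[mu]_(s in `]sigma, (sigma + h)[) g s x.
  apply/funext => x; rewrite /g RintegralB; [|exact: measurable_itv|exact: isl|exact: ic].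
  by rewrite cstE mulrC.
rewrite E; split; first exact: (integrable_time_integral mg ig gm im).
apply: le_trans (N1_time_integral mg ig gm im) _.
have K0 : 0 <= C * om + p * M.
  have mid : sigma < sigma + h / 2 < sigma + h by apply/andP; split; lra.
  by rewrite addr_ge0 ?mulr_ge0//; [apply: le_trans (hom mid)|apply: le_trans hM]; exact: N1_ge0.
rewrite /m RintegralD; [|exact: measurable_itv|exact: integrableRZ|exact: ic].
rewrite cstE lerD2r RintegralZl; [|exact: measurable_itv|exact: it].
rewrite ler_wpM2l//.
apply: le_trans (Rintegral_tsc_le beta01 beta_gt sh hT) _.
by rewrite opprD addrA.
Qed.

End window_error.


Lemma mulr_natB1 (R : pzRingType) (h : R) i : (0 < i)%N -> i%:R * h - h = i.-1%:R * h.
Proof. by case: i => // i _; rewrite -[in LHS]addn1 natrD mulrDl mul1r addrK. Qed.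

Lemma mul_chain_le (R : numDomainType) (h N K N' P S : R) : 0 <= h -> 0 <= K -> 0 <= N' ->
  N <= K * N' -> h * K <= P -> N' <= S -> h * N <= P * S.
Proof.
move=> h0 K0 N0 h1 h2 h3; apply: le_trans (ler_wpM2l h0 h1) _.
by rewrite mulrA; apply: ler_pM; rewrite ?mulr_ge0.
Qed.

Lemma mulB_sub_arith (R : comPzRingType) (h x y z : R) : h * x - z = h * (x - y) - (z - h * y).
Proof. by ring. Qed.

Section scheme_convergence.
Context {R : realType} (d : nat) (alpha q : R) (b : 'rV[R]_d)
  (u0 : 'rV[R]_d -> R) (u : R -> 'rV[R]_d -> R).
Hypothesis alpha12 : 1 < alpha < 2.
Hypothesis q0 : 0 < q.
Hypothesis sol : mild_solution alpha q b u0 u.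
Hypothesis iu0 : (@lebesgue_rV R d).-integrable setT (EFin \o u0).
Local Notation L := (@lebesgue_rV R d).
Local Notation mu := (@lebesgue_measure R).
Local Notation beta := (alpha / 2).
Local Notation hkb := (@hk R d beta).
Local Notation dkb := (@dk R d beta b).
Local Notation tsc := (tsc beta).
Local Notation kint := (kint beta).
Implicit Types (x y z X : 'rV[R]_d).

Let b01 := half_alpha01 alpha12.
Let bge := half_alpha_ge alpha12.
Let bgt : 2^-1 < beta. Proof. by case/andP: alpha12 => a1 _; lra. Qed.

Let F s x := flux q (u s x).

Let LF c : L1cont F 0 c. Proof. exact: (L1cont_flux q0 sol c). Qed.

Let iF s : 0 < s -> L.-integrable setT (EFin \o F s).
Proof. by move=> s0; have [h _] := LF (s + 1); apply: h; rewrite s0 ltrDl ltr01. Qed.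

Let iu s : 0 < s -> L.-integrable setT (EFin \o u s).
Proof. by move=> s0; apply: sol_integrable sol _ _; exact: ltW. Qed.

Section grid.
Variables (a c B M lam C tau h om r2 e1 : R) (n : nat).
Hypothesis a0 : 0 < a.
Hypothesis B0 : 0 <= B.
Hypothesis hB : forall s, a <= s <= c -> {ae L, forall x, `|u s x| <= B}.
Hypothesis hM : forall s, a <= s <= c -> N1 (F s) <= M.
Hypothesis C0 : 0 <= C.
Hypothesis hC1 : forall t, 0 < t -> N1 (dkb t) <= C * tsc t.
Hypothesis hC2 : forall t eps, 0 < t -> 0 < eps -> N1 (hkquot beta b eps t) <= C * tsc t.
Hypothesis hC3 : forall s t eps, 0 < s -> s < t -> 0 < eps ->
  N1 (fun X => dkb s X - hkquot beta b eps t X) <= C * tsc s.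
Hypothesis lam0 : 0 < lam.
Hypothesis lamB : lam * ((q + 1) * B `^ q) <= 1.
Hypothesis h0 : 0 < h.
Hypothesis atau : a <= tau.
Hypothesis nc : tau + n%:R * h <= c.
Hypothesis om0 : 0 <= om.
Hypothesis r20 : 0 <= r2.
Hypothesis e10 : 0 <= e1.
Hypothesis hom : forall s s', a <= s -> s < s' -> s' < s + h -> s' <= c ->
  N1 (fun x => F s' x - F s x) <= om.
Local Notation eps := (h / lam).
Hypothesis hsm : forall s t, r2 - h <= s -> s < t -> t < s + h ->
  N1 (fun X => dkb s X - hkquot beta b eps t X) <= e1.

Let M0 : 0 <= M.
Proof.
apply: le_trans (hM (s := tau) _); first exact: N1_ge0.
by rewrite atau (le_trans _ nc)// lerDl mulr_ge0// ltW.
Qed.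

Let g1 (i : nat) := kint (i%:R * h).
(** Constant beyond [r2]: its increments charge only the steps close to the final time, where the
    kernel estimate is crude. *)
Let g2 (i : nat) := kint (Num.min (i%:R * h) r2).
Let W (m j : nat) x := \int[mu]_(s in `](tau + j%:R * h), (tau + j.+1%:R * h)[)
  conv (dkb (tau + m%:R * h - s)) (F s) x.
Let Q (m j : nat) := conv (hkquot beta b eps ((m - j)%:R * h)) (F (tau + j%:R * h)).

Let eps0 : 0 < eps. Proof. exact: divr_gt0. Qed.
Let tau0 : 0 < tau. Proof. exact: lt_le_trans atau. Qed.

Let le_grid (i j : nat) : (i <= j)%N -> tau + i%:R * h <= tau + j%:R * h.
Proof. by move=> ij; rewrite lerD2l ler_wpM2r ?(ltW h0)// ler_nat. Qed.

Let gridS (j : nat) : tau + j.+1%:R * h = tau + j%:R * h + h.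
Proof. by rewrite mulrSr mulrDl mul1r addrA. Qed.

Let grid_ge (j : nat) : a <= tau + j%:R * h.
Proof. by rewrite (le_trans atau)// lerDl mulr_ge0// ltW. Qed.

Let g1_mono i : g1 i.-1 <= g1 i.
Proof.
apply: (kint_homo b01 bgt); first by rewrite mulr_ge0// ltW.
by rewrite ler_wpM2r ?(ltW h0)// ler_nat leq_pred.
Qed.

Let g2_mono i : g2 i.-1 <= g2 i.
Proof.
apply: (kint_homo b01 bgt); first by rewrite le_min mulr_ge0 ?(ltW h0).
by rewrite le_min !ge_min lexx orbT andbT ler_wpM2r ?(ltW h0)// ler_nat leq_pred.
Qed.

Lemma grid_window m j : (j < m)%N -> (m <= n)%N ->
  L.-integrable setT (EFin \o (fun x => W m j x - h * Q m j x)) /\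
  N1 (fun x => W m j x - h * Q m j x) <=
  C * om * (g1 (m - j)%N - g1 (m - j).-1) + C * M * (g2 (m - j)%N - g2 (m - j).-1) + e1 * M * h.
Proof.
move=> jm mn; set i := (m - j)%N; have i0 : (0 < i)%N by rewrite subn_gt0.
pose sg := tau + j%:R * h; pose T := tau + m%:R * h.
have sg0 : 0 < sg := lt_le_trans a0 (grid_ge j).
have shT : sg + h <= T by rewrite -gridS; exact: le_grid.
have Tc : T <= c by apply: le_trans nc; exact: le_grid.
have TE : T - sg = i%:R * h.
  by rewrite /T /sg /i natrB ?(ltnW jm)//; ring.
have TE1 : T - sg - h = i.-1%:R * h.
  by rewrite TE (mulr_natB1 _ i0).
have W1 : W m j = fun x => \int[mu]_(s in `]sg, (sg + h)[) conv (dkb (T - s)) (F s) x.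
  by rewrite /W gridS.
have LFs : L1cont F sg (sg + h) by apply: L1cont_sub (LF (sg + h)) => //; exact: ltW.
have isl x : mu.-integrable `]sg, (sg + h)[ (EFin \o (fun s => conv (dkb (T - s)) (F s) x)).
  apply: (integrable_itv_sub (ltW sg0) shT).
  exact: (integrable_dk_slice alpha12 q0 sol x (lt_le_trans (addr_gt0 sg0 h0) shT)).
have homs s : sg < s < sg + h -> N1 (fun x => F s x - F sg x) <= om.
  move=> /andP[h1 h2]; apply: hom => //; first exact: grid_ge.
  exact: le_trans (ltW h2) (le_trans shT Tc).
have hMs : N1 (F sg) <= M.
  by apply: hM; rewrite grid_ge (le_trans _ (le_trans shT Tc))// lerDl ltW.
have we p e0 (p0 : 0 <= p) := @window_error _ _ _ b01 bgt b F sg h T eps C p e0 om M h0 shT LFs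
  (iF sg0) isl C0 p0 hC1 homs hMs.
rewrite W1 /Q -TE.
(* Within [r2] of the final time the crude bound [hC3] is paid for by [g2]; earlier, the consistency
   error [e1] applies. *)
have [ir|ri] := leP (i%:R * h) r2.
  have hk s : sg < s < sg + h ->
      N1 (fun X => dkb (T - s) X - hkquot beta b eps (T - sg) X) <= C * tsc (T - s) + 0.
    move=> /andP[h1 h2]; rewrite addr0; apply: hC3 => //; last by rewrite ltrD2l ltrN2.
    by rewrite subr_gt0 (lt_le_trans h2).
  have [w1 w2] := we C 0 C0 hk; split=> //; apply: le_trans w2 _.
  have ir' : i.-1%:R * h <= r2.
    by apply: le_trans ir; rewrite ler_wpM2r ?(ltW h0)// ler_nat leq_pred.
  rewrite TE1 TE !mul0r addr0 /g1 /g2 !min_l// mulrDl lerDl.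
  by rewrite !mulr_ge0// ltW.
have hk s : sg < s < sg + h ->
    N1 (fun X => dkb (T - s) X - hkquot beta b eps (T - sg) X) <= 0 * tsc (T - s) + e1.
  move=> /andP[h1 h2]; rewrite mul0r add0r; apply: hsm.
  - rewrite lerBlDr; apply: (le_trans (ltW ri)); rewrite -TE.
    by rewrite -lerBlDr; lra.
  - by rewrite ltrD2l ltrN2.
  - by lra.
have [w1 w2] := we 0 e1 (lexx 0) hk; split=> //; apply: le_trans w2 _.
rewrite TE1 TE mul0r addr0 lerD2r lerDl mulr_ge0 ?mulr_ge0// subr_ge0.
exact: g2_mono.
Qed.

Local Notation w := (scheme beta q b lam eps h (u tau)).
Let e m := N1 (fun x => w m x - u (tau + m%:R * h) x).
Let delta := C * om * kint (n%:R * h) + C * M * kint r2 + e1 * M * (n%:R * h).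

Let delta_ge0 : 0 <= delta.
Proof.
have k0 := kint_ge0 b01 bgt.
have nh : 0 <= n%:R * h by rewrite mulr_ge0// ltW.
have d1 : 0 <= C * om * kint (n%:R * h) := mulr_ge0 (mulr_ge0 C0 om0) (k0 _).
have d2 : 0 <= C * M * kint r2 := mulr_ge0 (mulr_ge0 C0 M0) (k0 _).
have d3 : 0 <= e1 * M * (n%:R * h) := mulr_ge0 (mulr_ge0 e10 M0) nh.
exact: addr_ge0 (addr_ge0 d1 d2) d3.
Qed.

Let uB (j : nat) : (j <= n)%N -> {ae L, forall x, `|u (tau + j%:R * h) x| <= B}.
Proof. by move=> jn; apply: hB; rewrite grid_ge (le_trans _ nc)// le_grid. Qed.

Let wB m : L.-integrable setT (EFin \o w m) /\ {ae L, forall x, `|w m x| <= B}.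
Proof.
apply: (@scheme_bdd _ _ beta q b b01 bge q0 B lam eps (ltW lam0) lamB h (u tau) h0 B0).
split; first exact: iu.
by have := uB (leq0n n); rewrite mul0r addr0.
Qed.

Lemma solution_grid m : {ae L, forall x, u (tau + m.+1%:R * h) x =
  conv (hkb (m.+1%:R * h)) (u tau) x + \sum_(j < m.+1) W m.+1 j x}.
Proof.
have mh : 0 < m.+1%:R * h by rewrite mulr_gt0.
apply: filterS (restart alpha12 q0 sol iu0 tau0 mh) => x ->; congr (_ + _).
rewrite Rintegral_grid//.
apply: integrable_itv_sub (ltW tau0) (lexx _) _.
exact: (integrable_dk_slice alpha12 q0 sol x (addr_gt0 tau0 mh)).
Qed.

(** Difference of the two Duhamel formulas: each term splits into a stability part, the Lipschitz
    constant of the flux times an earlier error, and the local error of [grid_window]. The local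
    parts then telescope into [delta]. *)
Lemma grid_error m : (m <= n)%N ->
  e m <= \sum_(j < m) C * ((q + 1) * B `^ q) * (g1 (m - j)%N - g1 (m - j).-1) * e j + delta.
Proof.
case: m => [_|m mn].
  rewrite big_ord0 add0r /e mul0r addr0 /=.
  have -> : N1 (fun x => u tau x - u tau x) = 0.
    by rewrite /N1 /Rintegral integral0_eq// => x _; rewrite subrr normr0.
  exact: delta_ge0.
pose D j x := h * conv (hkquot beta b eps ((m.+1 - j)%:R * h))
   (fun y => flux q (w j y) - F (tau + j%:R * h) y) x - (W m.+1 j x - h * Q m.+1 j x).
have ifw j : L.-integrable setT (EFin \o (fun y => flux q (w j y))).
  by have [i1 i2] := wB j; exact: integrable_flux i2.
have iFj j : L.-integrable setT (EFin \o F (tau + j%:R * h)).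
  by apply: iF; exact: lt_le_trans (grid_ge j).
have ih (j : 'I_m.+1) : 0 < (m.+1 - j)%:R * h by rewrite mulr_gt0// ltr0n subn_gt0.
have kq (j : 'I_m.+1) := ker_hkquot b01 bge b eps (ih j).
have iW (j : 'I_m.+1) := grid_window (ltn_ord j) mn.
have iq (j : 'I_m.+1) := integrable_conv (kq j) (integrableRB measurableT (ifw j) (iFj j)).
have iD (j : 'I_m.+1) : L.-integrable setT (EFin \o D j).
  by apply: integrableRB => //; [exact: integrableRZ|exact: (iW j).1].
have ED : {ae L, forall x, w m.+1 x - u (tau + m.+1%:R * h) x = \sum_(j < m.+1) D j x}.
  apply: filterS (solution_grid m) => x ->.
  have ut : L.-integrable setT (EFin \o u tau) /\ {ae L, forall x, `|u tau x| <= B}.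
    exact: (wB 0).
  have lamE : lam = h / eps by rewrite invf_div mulrCA divff ?mulr1// gt_eqF.
  rewrite (scheme_duhamel b b01 bge q0 (ltW lam0) lamB h0 B0 ut lamE).
  rewrite opprD addrACA subrr add0r -sumrB; apply: eq_bigr => j _.
  by rewrite /D /Q (convBr x (kq j) (ifw j) (iFj j)); exact: mulB_sub_arith.
have iu1 : L.-integrable setT (EFin \o u (tau + m.+1%:R * h)).
  by apply: iu; exact: lt_le_trans (grid_ge _).
have iwu := integrableRB measurableT (wB m.+1).1 iu1.
have isD : L.-integrable setT (EFin \o (fun x => \sum_(j < m.+1) D j x)) by exact: integrableR_sum.
apply: (@le_trans _ _ (N1 (fun x => \sum_(j < m.+1) D j x))).
  by apply: le_N1_ae => //; apply: filterS ED => x ->.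
apply: le_trans (N1_sum _ iD) _.
have iWZ (j : 'I_m.+1) : N1 (D j) <=
    C * ((q + 1) * B `^ q) * (g1 (m.+1 - j)%N - g1 (m.+1 - j).-1) * e j +
    (C * om * (g1 (m.+1 - j)%N - g1 (m.+1 - j).-1) + C * M * (g2 (m.+1 - j)%N - g2 (m.+1 - j).-1) +
     e1 * M * h).
  apply: le_trans (N1B (integrableRZ measurableT h (iq j)) (iW j).1) _; apply: lerD; last exact: (iW j).2.
  rewrite (N1Z h (iq j)) gtr0_norm//.
  have h1 := N1_conv (kq j) (integrableRB measurableT (ifw j) (iFj j)).
  have iuj : L.-integrable setT (EFin \o u (tau + j%:R * h)) by apply: iu; exact: lt_le_trans (grid_ge _).
  have jn : (j <= n)%N by apply: leq_trans mn; exact: ltnW.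
  have h2 := N1_flux_lip q0 (wB j).1 iuj (wB j).2 (uB jn).
  have h3 : h * N1 (hkquot beta b eps ((m.+1 - j)%:R * h)) <= C * (g1 (m.+1 - j)%N - g1 (m.+1 - j).-1).
    apply: (@le_trans _ _ (C * (h * tsc ((m.+1 - j)%:R * h)))).
      by rewrite mulrCA ler_wpM2l ?(ltW h0)// hC2.
    rewrite ler_wpM2l//.
    have i0 : (0 < m.+1 - j)%N by rewrite subn_gt0.
    have hi : h <= (m.+1 - j)%:R * h by rewrite ler_peMl ?(ltW h0)// ler1n.
    apply: le_trans (mul_tsc_le b01 bgt h0 hi) _.
    by rewrite (mulr_natB1 _ i0).
  have := mul_chain_le (ltW h0) (N1_ge0 _) (N1_ge0 _) h1 h3 h2; move/le_trans; apply.
  by rewrite le_eqVlt; apply/orP; left; apply/eqP; rewrite /e; ring.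
apply: le_trans (ler_sum _ (fun j _ => iWZ j)) _.
rewrite big_split /= lerD2l !big_split /= -!mulr_sumr !telescope_sub_rev.
rewrite /delta; apply: lerD; first apply: lerD.
- rewrite ler_wpM2l ?mulr_ge0// /g1 mul0r (kint0 b01 bgt) subr0.
  by apply: (kint_homo b01 bgt); rewrite ?mulr_ge0 ?(ltW h0)// ler_wpM2r ?(ltW h0)// ler_nat.
- rewrite ler_wpM2l ?mulr_ge0// /g2 mul0r [Num.min 0 _]min_l// (kint0 b01 bgt) subr0.
  by apply: (kint_homo b01 bgt); rewrite ?le_min ?mulr_ge0 ?(ltW h0)// ge_min lexx orbT.
- apply: ler_wpM2l; first exact: mulr_ge0.
  by rewrite sumr_const card_ord -[h *+ _]mulr_natl ler_wpM2r ?(ltW h0)// ler_nat.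
Qed.

Lemma grid_cvg : C * ((q + 1) * B `^ q) * kint (n%:R * h) <= 2^-1 -> e n <= 2 * delta.
Proof.
move=> small; apply: (@discrete_gronwall _ e g1 (C * ((q + 1) * B `^ q)) delta n) => //.
- by move=> m; exact: N1_ge0.
- by rewrite !mulr_ge0 ?powR_ge0// addr_ge0// ltW.
- by rewrite /g1 mul0r (kint0 b01 bgt) subr0.
- exact: grid_error.
Qed.

End grid.

Lemma mul_ratio_le (x e : R) : 0 <= x -> 0 <= e -> x * (e / (6 * (x + 1))) <= e / 6.
Proof.
move=> x0 e0; have x1 : 0 < x + 1 by rewrite ltr_wpDl.
have -> : x * (e / (6 * (x + 1))) = e / 6 * (x / (x + 1)).
  by field; rewrite gt_eqF// -?natr1; lra.
by rewrite ler_piMr ?divr_ge0// ler_pdivrMr// mul1r lerDl.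
Qed.

(** [T1] depends on the sup bound [B] but not on the starting time, so the windows can be chained
    over any interval on which [B] is a bound ([time_chain]). *)
Lemma scheme_cvg B : 0 <= B -> exists2 T1 : R, 0 < T1 &
  forall a c lam tau T e, 0 < a -> (forall s, a <= s <= c -> {ae L, forall x, `|u s x| <= B}) ->
  0 < lam -> lam * ((q + 1) * B `^ q) <= 1 -> a <= tau -> 0 < T -> T <= T1 -> tau + T <= c -> 0 < e ->
  exists N : nat, forall n, (N <= n)%N ->
    N1 (fun x => scheme beta q b lam (T / n.+1%:R / lam) (T / n.+1%:R) (u tau) n.+1 x - u (tau + T) x) <= e.
Proof.
move=> B0; have [C C0 [hC1 hC2 hC3]] := N1_dk_hkquot_crude b01 bge b.
pose Lf := (q + 1) * B `^ q; have Lf0 : 0 <= Lf by rewrite mulr_ge0 ?powR_ge0 ?addr_ge0 ?(ltW q0).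
have K0 : 0 <= C * Lf by rewrite mulr_ge0// ltW.
have K1 : 0 < 2 * (C * Lf + 1) by rewrite mulr_gt0// ltr_wpDl.
have [T1 T10 hT1] : exists2 r : R, 0 < r & kint r <= (2 * (C * Lf + 1))^-1.
  by apply: kint_small => //; rewrite invr_gt0.
exists T1 => // a c lam tau T e a0 hB lam0 lamB atau T0 TT1 Tc e0.
have [M M0 hM] := flux_N1_bdd q0 sol c a0.
have k0 := kint_ge0 b01 bgt.
have CT0 : 0 <= C * kint T by rewrite mulr_ge0 ?(ltW C0)//.
have CM0 : 0 <= C * M by rewrite mulr_ge0 ?ltW.
have MT0 : 0 <= M * T by rewrite mulr_ge0 ?ltW.
have ratio (x : R) : 0 <= x -> 0 < e / (6 * (x + 1)).
  by move=> x0; rewrite divr_gt0// mulr_gt0// ltr_wpDl.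
(* Each of the three terms of the local error gets e / 6, and [grid_cvg] doubles their sum. *)
pose om := e / (6 * (C * kint T + 1)); have om0 : 0 < om := ratio _ CT0.
pose e1 := e / (6 * (M * T + 1)); have e10 : 0 < e1 := ratio _ MT0.
have [r2 r20 hr2] := kint_small b01 bgt (ratio _ CM0).
have r220 : 0 < r2 / 2 by rewrite divr_gt0.
have [r3 r30 hr3] := N1_dk_hkquot_small b01 bge b r220 e10.
have a20 : 0 < a / 2 by rewrite divr_gt0.
have a2a : a / 2 < a by rewrite ltr_pdivrMr// ltr_pMr// ltr1n.
have cc1 : c < c + 1 by rewrite ltrDl.
have LFa : L1cont F (a / 2) (c + 1) by apply: L1cont_sub (LF (c + 1)) => //; exact: ltW.
have [r4 r40 hr4] := L1cont_uniform a2a cc1 LFa om0.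
(* The step must be below r2 / 2 for the kernels to stay at times above r2 / 2, below [r4] for the
   flux, and both [h] and the space step h / lam must be below [r3] for consistency. *)
pose rr := Num.min (Num.min (r2 / 2) r4) (Num.min r3 (r3 * lam)).
have rr0 : 0 < rr by rewrite !lt_min r220 r40 r30 mulr_gt0.
pose N := Num.bound (T / rr); have hN : T / rr < N%:R by apply: archi_boundP; rewrite divr_ge0 ?ltW.
exists N => n Nn; set h := T / n.+1%:R.
have h0 : 0 < h by rewrite divr_gt0.
have hrr : h < rr.
  rewrite ltr_pdivrMr// mulrC -ltr_pdivrMr//; apply: (lt_le_trans hN).
  by rewrite ler_nat (leq_trans Nn).
move: (hrr); rewrite !lt_min => /andP[/andP[hr2' hr4'] /andP[hr3' hr3'']].
have nh : n.+1%:R * h = T by rewrite /h mulrCA divff ?mulr1.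
have hom s s' : a <= s -> s < s' -> s' < s + h -> s' <= c -> N1 (fun x => F s' x - F s x) <= om.
  move=> as_ ss' s'h s'c; apply: hr4.
  - by rewrite as_ (ltW (lt_le_trans ss' s'c)).
  - by rewrite s'c (le_trans as_ (ltW ss')).
  - by rewrite gtr0_norm ?subr_gt0// ltrBlDl (lt_trans s'h)// ltrD2l.
have hsm s t : r2 - h <= s -> s < t -> t < s + h ->
    N1 (fun X => dkb s X - hkquot beta b (h / lam) t X) <= e1.
  move=> rs st ts; apply: hr3 => //.
  - lra.
  - by apply: lt_trans ts _; rewrite ltrD2l.
  - by rewrite divr_gt0//= ltr_pdivrMr.
have nc : tau + n.+1%:R * h <= c by rewrite nh.
have := @grid_cvg a c B M lam C tau h om r2 e1 n.+1 a0 B0 hB hM (ltW C0) hC1 hC2 hC3 lam0 lamB h0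
  atau nc (ltW om0) (ltW r20) (ltW e10) hom hsm.
rewrite nh => H; apply: le_trans (H _) _.
  apply: (@le_trans _ _ (C * Lf * (2 * (C * Lf + 1))^-1)).
    rewrite ler_wpM2l//; apply: le_trans hT1; apply: (kint_homo b01 bgt) => //; exact: ltW.
  rewrite ler_pdivrMr//; lra.
have d1 : C * om * kint T <= e / 6 by rewrite mulrAC; exact: mul_ratio_le CT0 (ltW e0).
have d2 : C * M * kint r2 <= e / 6.
  by apply: le_trans (mul_ratio_le CM0 (ltW e0)); rewrite ler_wpM2l.
have d3 : e1 * M * T <= e / 6 by rewrite -mulrA mulrC; exact: mul_ratio_le MT0 (ltW e0).
lra.
Qed.

End scheme_convergence.


Lemma time_chain {R : realType} (P : R -> Prop) (t1 t2 T1 : R) : t1 < t2 -> 0 < T1 ->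
  (forall tau T, t1 <= tau -> 0 < T -> T <= T1 -> tau + T <= t2 -> P tau -> P (tau + T)) ->
  P t1 -> P t2.
Proof.
move=> t12 T10 step P1; have d0 : 0 < t2 - t1 by rewrite subr_gt0.
pose n := Num.bound ((t2 - t1) / T1).
have hn : (t2 - t1) / T1 < n%:R by apply: archi_boundP; rewrite divr_ge0 ?ltW.
have n0 : 0 < n%:R :> R by apply: le_lt_trans hn; rewrite divr_ge0 ?ltW.
clearbody n; pose h := (t2 - t1) / n%:R; have h0 : 0 < h by rewrite divr_gt0.
have hT1 : h <= T1 by rewrite ler_pdivrMr// mulrC -ler_pdivrMr// ltW.
have E : t2 = t1 + n%:R * h by rewrite /h mulrCA divff ?gt_eqF// mulr1 addrC subrK.
have H j : (j <= n)%N -> P (t1 + j%:R * h).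
  elim: j => [|j IH] jn; first by rewrite mul0r addr0.
  have -> : t1 + j.+1%:R * h = t1 + j%:R * h + h by rewrite -[j.+1]addn1 natrD mulrDl mul1r addrA.
  apply: step => //.
  - by rewrite lerDl mulr_ge0// ltW.
  - rewrite E -addrA lerD2l -[X in _ + X]mul1r -mulrDl ler_wpM2r ?(ltW h0)//.
    by rewrite natr1 ler_nat.
  - by apply: IH; exact: ltnW.
by rewrite E; exact: H.
Qed.

(** * Comparison principle and decay of the sup norm *)

Section order_consequences.
Context {R : realType} (d : nat) (alpha q : R) (b : 'rV[R]_d)
  (u0 : 'rV[R]_d -> R) (u : R -> 'rV[R]_d -> R).
Hypothesis alpha12 : 1 < alpha < 2.
Hypothesis q0 : 0 < q.
Hypothesis sol : mild_solution alpha q b u0 u.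
Hypothesis iu0 : (@lebesgue_rV R d).-integrable setT (EFin \o u0).
Local Notation L := (@lebesgue_rV R d).
Local Notation beta := (alpha / 2).

Let b01 := half_alpha01 alpha12.
Let bge := half_alpha_ge alpha12.

Let iu s : 0 <= s -> L.-integrable setT (EFin \o u s).
Proof. by move=> s0; apply: sol_integrable sol _ _. Qed.

Lemma lip_coef (B : R) : 0 <= B -> exists2 lam : R, 0 < lam & lam * ((q + 1) * B `^ q) <= 1.
Proof.
move=> B0; have L0 : 0 <= (q + 1) * B `^ q by rewrite mulr_ge0 ?powR_ge0 ?addr_ge0 ?(ltW q0).
have L1 : 0 < (q + 1) * B `^ q + 1 by rewrite ltr_wpDl.
exists ((q + 1) * B `^ q + 1)^-1; first by rewrite invr_gt0.
by rewrite mulrC ler_pdivrMr// mul1r lerDl.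
Qed.

(** The scheme never increases [pos k], and convergence in L^1 hands the inequality to the solution,
    one window at a time. Taking [B] at least [k] keeps the level in the range where the step is
    monotone. *)
Lemma pos_decr k t1 t2 : 0 <= k -> 0 < t1 -> t1 < t2 ->
  pos k (u t2) <= pos k (u t1) /\ pos k (fun x => - u t2 x) <= pos k (fun x => - u t1 x).
Proof.
move=> k0 t10 t12; have [B1 B10 hB1] := sol_bdd sol t2 t10.
pose B := Num.max B1 k; have kB : k <= B by rewrite le_max lexx orbT.
have B0 : 0 <= B := le_trans k0 kB.
have hB s : t1 <= s <= t2 -> {ae L, forall x, `|u s x| <= B}.
  by move=> /hB1; apply: filterS => x h; rewrite le_max h.
have [lam lam0 lamB] := lip_coef B0.
have [T1 T10 H] := scheme_cvg alpha12 q0 sol iu0 B0.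
pose P t := pos k (u t) <= pos k (u t1) /\ pos k (fun x => - u t x) <= pos k (fun x => - u t1 x).
suff : P t2 by [].
apply: (time_chain t12 T10) => // tau T t1tau T0 TT1 Tt2 [P1 P2].
have tau0 : 0 < tau by exact: lt_le_trans t1tau.
have iuT : L.-integrable setT (EFin \o u (tau + T)) by apply: iu; rewrite ltW// addr_gt0.
have ok : L.-integrable setT (EFin \o u tau) /\ {ae L, forall x, `|u tau x| <= B}.
  split; first by apply: iu; exact: ltW.
  by apply: hB; rewrite t1tau (le_trans _ Tt2)// lerDl ltW.
have key e : 0 < e -> pos k (u (tau + T)) <= pos k (u tau) + e /\
    pos k (fun x => - u (tau + T) x) <= pos k (fun x => - u tau x) + e.
  move=> e0; have [N /(_ N (leqnn N)) hN] := H _ _ _ _ _ _ t10 hB lam0 lamB t1tau T0 TT1 Tt2 e0.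
  set h := T / N.+1%:R in hN; have h0 : 0 < h by rewrite divr_gt0.
  have [iw wB] := scheme_bdd b b01 bge q0 (h / lam) (ltW lam0) lamB h0 B0 ok N.+1.
  have p1 := pos_scheme b b01 bge q0 (h / lam) (ltW lam0) lamB h0 B0 ok N.+1 k0 kB.
  have p2 := pos_schemeN b b01 bge q0 (h / lam) (ltW lam0) lamB h0 B0 ok N.+1 k0 kB.
  rewrite N1BC in hN; split.
    by apply: le_trans (pos_lip k0 iuT iw) _; apply: lerD.
  apply: le_trans (pos_lip k0 (integrableN iuT) (integrableN iw)) _; apply: lerD => //.
  apply: le_trans hN; rewrite N1BC le_eqVlt; apply/orP; left; apply/eqP.
  by apply: eq_Rintegral => x _; congr (`|_|); rewrite opprK addrC.
by split; [apply: le_trans P1|apply: le_trans P2]; apply/ler_addgt0Pr => e /key [].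
Qed.

(** The scheme cannot start at time 0, near which no sup bound is known yet; L^1 continuity of the
    solution closes the gap. *)
Lemma pos_le_init k t : 0 <= k -> 0 < t ->
  pos k (u t) <= pos k (u 0) /\ pos k (fun x => - u t x) <= pos k (fun x => - u 0 x).
Proof.
move=> k0 t0; have iu00 := iu (lexx 0).
have key e : 0 < e -> pos k (u t) <= pos k (u 0) + e /\
    pos k (fun x => - u t x) <= pos k (fun x => - u 0 x) + e.
  move=> e0; have [r r0 hr] := sol_cont sol (lexx 0) e0.
  pose s := Num.min (r / 2) (t / 2).
  have s0 : 0 < s by rewrite lt_min !divr_gt0.
  have st : s < t by rewrite gt_min orbC ltr_pdivrMr// ltr_pMr// ltr1n.
  have sr : `|s - 0| < r by rewrite subr0 gtr0_norm// gt_min ltr_pdivrMr// ltr_pMr// ltr1n.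
  have [p1 p2] := pos_decr k0 s0 st; have hs := hr s (ltW s0) sr.
  have ius := iu (ltW s0); split.
    apply: le_trans p1 _; apply: le_trans (pos_lip k0 ius iu00) _.
    by rewrite lerD2l ltW.
  apply: le_trans p2 _; apply: le_trans (pos_lip k0 (integrableN ius) (integrableN iu00)) _.
  rewrite lerD2l; apply: le_trans (ltW hs); rewrite le_eqVlt; apply/orP; left; apply/eqP.
  by apply: eq_Rintegral => x _; rewrite -opprD normrN.
by split; apply/ler_addgt0Pr => e /key [].
Qed.

Lemma sol_ge0 t : {ae L, forall x, 0 <= u0 x} -> 0 < t -> {ae L, forall x, 0 <= u t x}.
Proof.
move=> u00 t0; have [_ h] := pos_le_init (lexx 0) t0.
have iut := iu (ltW t0).
have h0 : pos 0 (fun x => - u 0 x) = 0.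
  apply/(pos_eq0 (lexx 0) (integrableN (iu (lexx 0)))).
  by apply: filterS2 u00 (sol_init sol) => x h1 h2; rewrite oppr_le0 h2.
rewrite h0 in h; have : pos 0 (fun x => - u t x) = 0 by apply/eqP; rewrite eq_le h pos_ge0.
by move/(pos_eq0 (lexx 0) (integrableN iut)); apply: filterS => x; rewrite oppr_le0.
Qed.

Lemma sol_le A t : 0 <= A -> {ae L, forall x, u0 x <= A} -> 0 < t -> {ae L, forall x, u t x <= A}.
Proof.
move=> A0 u0A t0; have [h _] := pos_le_init A0 t0; have iut := iu (ltW t0).
have h0 : pos A (u 0) = 0.
  apply/(pos_eq0 A0 (iu (lexx 0))).
  by apply: filterS2 u0A (sol_init sol) => x h1 h2; rewrite h2.
by rewrite h0 in h; apply/(pos_eq0 A0 iut)/eqP; rewrite eq_le h pos_ge0.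
Qed.

Lemma sol_mass t : 0 < t -> N1 (u t) <= N1 (u 0).
Proof.
move=> t0; have [h1 h2] := pos_le_init (lexx 0) t0.
by rewrite (N1_pos (iu (ltW t0))) (N1_pos (iu (lexx 0))); exact: lerD.
Qed.

End order_consequences.


Lemma powR_bernoulli {R : realType} (x p : R) : 0 <= x -> 0 <= p -> 1 - p * x <= (1 + x) `^ (- p).
Proof.
move=> x0 p0; have x1 : 0 < 1 + x by rewrite ltr_pwDl.
rewrite /powR gt_eqF//; apply: le_trans (expR_ge1Dx _).
by rewrite mulNr lerD2l lerN2 ler_wpM2l// le_ln1Dx// (lt_le_trans _ x0)// ltrN10.
Qed.

(** * Decay of the sup norm by diffusion *)

Section sup_decay_kernel.
Context {R : realType} (d : nat).
Variable beta : R.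
Hypothesis d_ge1 : (1 <= d)%N.
Hypothesis beta01 : 0 < beta < 1.
Hypothesis beta_ge : 2^-1 <= beta.
Local Notation L := (@lebesgue_rV R d).
Local Notation hkb := (@hk R d beta).
Local Notation tsc := (tsc beta).
Implicit Types (x y : 'rV[R]_d) (v : 'rV[R]_d -> R).

Let b0 : 0 < beta. Proof. by case/andP: beta01. Qed.
Let dR : 0 < d%:R :> R. Proof. by rewrite ltr0n. Qed.

Definition box (rho : R) : set 'rV[R]_d := [set y | forall i, `[- rho, rho]%classic (coord_rV i y)].

Lemma measurable_box rho : measurable (box rho).
Proof.
rewrite (_ : box rho = \bigcap_(i in [set: 'I_d]) (coord_rV i @^-1` `[- rho, rho]%classic)).
  apply: fin_bigcap_measurable => // i _.
  by rewrite -[X in measurable X]setTI; exact: measurable_coord_rV.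
by apply/seteqP; split=> x /= Ax i; [move=> _|]; exact: Ax.
Qed.

Lemma lebesgue_box rho : 0 <= rho -> L (box rho) = ((2 * rho) ^+ d)%:E.
Proof.
move=> r0; rewrite (@lebesgue_rV_box R d (fun=> `[- rho, rho]%classic)); last first.
  by move=> i; exact: measurable_itv.
rewrite (eq_bigr (fun=> (2 * rho)%:E)); last first.
  move=> i _; rewrite lebesgue_measure_itv/= lte_fin; case: ifP => [_|/negbT].
    by rewrite -EFinB; congr EFin; ring.
  rewrite -leNgt => h; congr EFin; lra.
by rewrite prodEFin prodr_const card_ord.
Qed.

Lemma box_dotp rho y : 0 <= rho -> box rho y -> dotp y y <= d%:R * rho ^+ 2.
Proof.
move=> r0 yb; rewrite /dotp (@le_trans _ _ (\sum_(i < d) rho ^+ 2))//.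
  apply: ler_sum => i _; rewrite -expr2 -real_normK ?num_real// lerXn2r ?nnegrE//.
  by have := yb i; rewrite /= in_itv/= => h; rewrite ler_norml.
by rewrite sumr_const card_ord mulr_natl.
Qed.

(** Beyond the length scale h^(1/alpha) the kernel is at least of order h |y|^(- d - alpha).
    Linearity in [h] is what makes the loss per step of the scheme proportional to the step. *)
Lemma hk_box_lb : exists2 c : R, 0 < c & forall h rho y, 0 < h -> 0 < rho -> 1 <= tsc h * rho ->
  box rho y -> c * h * rho `^ (- (d%:R + 2 * beta)) <= hkb h y.
Proof.
have [c c0 hc] := hk1_lb d beta01 beta_ge.
pose N := d%:R / 2 + beta; have N0 : 0 <= N by rewrite addr_ge0 ?divr_ge0// ltW.
exists (c * (1 + d%:R) `^ (- N)); first by rewrite mulr_gt0// powR_gt0// ltr_pwDl.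
move=> h rho y h0 r0 ar yb; pose a := tsc h; have a0 : 0 < a by exact: tsc_gt0.
rewrite (hk_scale beta01 beta_ge y h0) -/a.
apply: (@le_trans _ _ (a ^+ d * (c * ((1 + d%:R) * (a * rho) ^+ 2) `^ (- N)))); last first.
  rewrite ler_wpM2l ?exprn_ge0 ?(ltW a0)//; apply: le_trans (hc _).
  rewrite ler_wpM2l ?(ltW c0)//; apply: powR_ge_base.
  - by rewrite oppr_le0.
  - by rewrite ltr_pwDl// dotp_ge0.
  - rewrite dotpZl dotpZr mulrA -expr2 exprMn mulrDl mul1r.
    apply: lerD; first by rewrite -exprMn exprn_ege1.
    by rewrite mulrCA ler_wpM2l ?sqr_ge0// box_dotp// ltW.
have ar0 : 0 < a * rho by rewrite mulr_gt0.
rewrite powRM ?sqr_ge0 ?addr_ge0// -[(a * rho) ^+ 2]powR_mulrn ?(ltW ar0)//.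
rewrite -powRrM powRM ?(ltW a0) ?(ltW r0)// -[a ^+ d]powR_mulrn ?(ltW a0)//.
have E : a `^ d%:R * a `^ (2 * - N) = h.
  rewrite -powRD; last by apply/implyP => _; rewrite gt_eqF.
  rewrite /a /tsc -powRrM.
  have -> : - (2 * beta)^-1 * (d%:R + 2 * - N) = 1.
    by rewrite /N; field; rewrite gt_eqF.
  by rewrite powRr1// ltW.
have -> : - (d%:R + 2 * beta) = 2 * - N by rewrite /N; field.
by rewrite -{1}E le_eqVlt; apply/orP; left; apply/eqP; ring.
Qed.

(** The gap A - v is averaged instead of v. On the box, whose volume times [A] is at least 2 M, the
    mass of v is at most M, so the gap has mass at least M there. *)
Lemma conv_hk_box c h rho A M v x : 0 < h -> 0 <= rho -> 0 <= c -> 0 < A ->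
  (forall y, box rho y -> c <= hkb h y) -> L.-integrable setT (EFin \o v) ->
  {ae L, forall x, 0 <= v x} -> {ae L, forall x, v x <= A} -> N1 v <= M ->
  2 * M <= A * (2 * rho) ^+ d -> conv (hkb h) v x <= A - c * M.
Proof.
move=> h0 r0 c0 A0 hc iv v0 vA vM hM; have kh := ker_hk d beta01 beta_ge h0.
have mb := measurable_box rho.
have ib : L.-integrable setT (EFin \o (\1_(box rho) : 'rV[R]_d -> R)).
  apply: integrable_ge0P => //.
    have -> : (\int[L]_x (\1_(box rho) x)%:E = ((2 * rho) ^+ d)%:E)%E.
      by rewrite integral_indic// setIT; exact: lebesgue_box.
    by rewrite ltry.
have kb : ker (\1_(box rho) : 'rV[R]_d -> R).
  by split=> //; exists 1 => y; rewrite indicE ger0_norm ?ler0n// lern1 leq_b1.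
have i1 := integrable_reflect x kh.2; have i2 := integrable_reflect x ib.
have i3 := ker_slice x kb iv.
have iA := integrableRZ measurableT A i1.
have icA := integrableRZ measurableT (c * A) i2.
have ic := integrableRZ measurableT c i3.
have i4 := integrableRB measurableT iA icA.
have i5 := integrableRD measurableT i4 ic.
(* The integrand expands (A - v) (hkb h - c 1_box) >= 0. *)
apply: (@le_trans _ _ (\int[L]_y (A * hkb h (x - y) - c * A * \1_(box rho) (x - y) +
    c * (\1_(box rho) (x - y) * v y)))).
  apply: ae_le_Rintegral => //; first exact: ker_slice.
  apply: filterS2 v0 vA => y h1 h2.
  have hk0 : 0 <= hkb h (x - y) by rewrite ltW// hk_gt0.
  have : c * \1_(box rho) (x - y) <= hkb h (x - y).
    rewrite indicE; case: (boolP (x - y \in box rho)) => [|_]; last by rewrite mulr0.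
    by rewrite inE mulr1; exact: hc.
  have Av : 0 <= A - v y by rewrite subr_ge0.
  by move=> /(ler_wpM2r Av); lra.
rewrite RintegralD// RintegralB//.
rewrite (RintegralZl A measurableT i1) (RintegralZl (c * A) measurableT i2) (RintegralZl c measurableT i3).
rewrite (Rintegral_rV_reflect x kh.2) (Rintegral_rV_reflect x ib) (Rintegral_hk d beta01 beta_ge h0).
have -> : \int[L]_y (\1_(box rho) y : R) = (2 * rho) ^+ d.
  by rewrite /Rintegral integral_indic// setIT [X in fine X]lebesgue_box.
have : \int[L]_y (\1_(box rho) (x - y) * v y) <= M.
  apply: le_trans vM; apply: le_Rintegral => //; first exact: integrable_abs.
  move=> y _; rewrite indicE; case: (_ \in _); rewrite ?mul1r ?mul0r; [exact: ler_norm|exact: normr_ge0].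
have := ler_wpM2l c0 hM; move=> h1 /(ler_wpM2l c0) h2; rewrite mulr1; lra.
Qed.

Local Notation theta := (2 * beta / d%:R).

(** The box is adapted to the height by A (2 rho)^d = 2 M, whence rho^(- d - alpha) is a multiple of
    A^(1 + alpha / d). Smallness of h A^theta says that [rho] is beyond the diffusion length, as
    [hk_box_lb] requires. *)
Lemma peak_decay M : 0 < M -> exists c k0 : R, [/\ 0 < c, 0 < k0 &
  forall A h v x, 0 < A -> 0 < h -> h * A `^ theta <= k0 -> L.-integrable setT (EFin \o v) ->
    {ae L, forall x, 0 <= v x} -> {ae L, forall x, v x <= A} -> N1 v <= M ->
    conv (hkb h) v x <= A - c * h * (A * A `^ theta)].
Proof.
move=> M0; have [c c0 hc] := hk_box_lb.
have M20 : 0 < 2 * M by rewrite mulr_gt0.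
have th0 : 0 < theta by rewrite divr_gt0// mulr_gt0.
exists (c * 2 `^ (d%:R + 2 * beta) * (2 * M) `^ (- (1 + theta)) * M), (2^-1 `^ (2 * beta) * (2 * M) `^ theta).
split; [by rewrite !mulr_gt0 ?powR_gt0|by rewrite mulr_gt0 ?powR_gt0// invr_gt0|].
move=> A h v x A0 h0 hA iv v0 vA vM.
pose r := (2 * M / A) `^ d%:R^-1; have MA : 0 < 2 * M / A by rewrite divr_gt0.
have r0 : 0 < r by exact: powR_gt0.
pose rho := 2^-1 * r; have rho0 : 0 < rho by rewrite mulr_gt0// invr_gt0.
have rd : A * (2 * rho) ^+ d = 2 * M.
  rewrite /rho mulrA divff ?mul1r// -powR_mulrn ?(ltW r0)// /r -powRrM mulVf ?gt_eqF//.
  by rewrite powRr1 ?(ltW MA)// mulrCA divff ?mulr1// gt_eqF.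
have rE (p : R) : rho `^ p = 2^-1 `^ p * (2 * M / A) `^ (d%:R^-1 * p).
  by rewrite /rho powRM ?invr_ge0 ?(ltW r0)// /r -powRrM.
have hrho : h <= rho `^ (2 * beta).
  rewrite -(@ler_pM2r _ (A `^ theta)) ?powR_gt0//; apply: le_trans hA _.
  have -> : rho `^ (2 * beta) * A `^ theta = 2^-1 `^ (2 * beta) * (2 * M / A * A) `^ theta.
    by rewrite rE [d%:R^-1 * _]mulrC [(2 * M / A * A) `^ _]powRM ?(ltW MA) ?(ltW A0)// mulrA.
  by rewrite divfK ?gt_eqF.
have ar : 1 <= tsc h * rho.
  have := tsc_anti beta01 h0 hrho.
  rewrite {1}/tsc -powRrM mulrN divff ?gt_eqF ?mulr_gt0// powR_inv1 ?(ltW rho0)// => h1.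
  by apply: le_trans (ler_wpM2r (ltW rho0) h1); rewrite mulVf ?gt_eqF.
have E : c * 2 `^ (d%:R + 2 * beta) * (2 * M) `^ (- (1 + theta)) * M * h * (A * A `^ theta) =
    c * h * rho `^ (- (d%:R + 2 * beta)) * M.
  have p1 : 2^-1 `^ (- (d%:R + 2 * beta)) = 2 `^ (d%:R + 2 * beta) :> R.
    by rewrite -[2^-1](@powR_inv1 R) ?ler0n// -powRrM mulN1r opprK.
  have p2 : A * A `^ theta = A^-1 `^ (- (1 + theta)).
    rewrite -[A^-1]powR_inv1 ?(ltW A0)// -powRrM mulN1r opprK powRD; last first.
      by apply/implyP => _; rewrite gt_eqF.
    by rewrite powRr1// ltW.
  rewrite rE p1 p2; have -> : d%:R^-1 * - (d%:R + 2 * beta) = - (1 + theta).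
    by field; rewrite gt_eqF.
  rewrite [(2 * M / A) `^ _]powRM ?invr_ge0 ?(ltW A0) ?(ltW M20)//; ring.
rewrite E; apply: (conv_hk_box (rho := rho)) => //.
- exact: ltW.
- by rewrite !mulr_ge0 ?powR_ge0 ?ltW.
- by move=> y yb; exact: hc.
- by rewrite rd.
Qed.

End sup_decay_kernel.

Section decay.
Context {R : realType}.
Variable theta : R.
Hypothesis th0 : 0 < theta.

(* The solution of y' = - (c / theta) y ^ (1 + theta) with y 0 = A. *)
Definition decay (A c s : R) := (A `^ (- theta) + c * s) `^ (- theta^-1).

Lemma decay_gt0 A c s : 0 < A -> 0 <= c -> 0 <= s -> 0 < decay A c s.
Proof. by move=> A0 c0 s0; rewrite powR_gt0// ltr_pwDl ?powR_gt0// mulr_ge0. Qed.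

Lemma decay0 A c : 0 < A -> decay A c 0 = A.
Proof.
move=> A0; rewrite /decay mulr0 addr0 -powRrM mulrNN divff ?gt_eqF//.
by rewrite powRr1// ltW.
Qed.

Lemma decay_anti A c s t : 0 < A -> 0 <= c -> 0 <= s -> s <= t -> decay A c t <= decay A c s.
Proof.
move=> A0 c0 s0 st; apply: powR_ge_base; first by rewrite oppr_le0 invr_ge0 ltW.
  by rewrite ltr_pwDl ?powR_gt0// mulr_ge0.
by rewrite lerD2l ler_wpM2l.
Qed.

(** An explicit Euler step stays below the exact solution because that solution is convex in time;
    here this is Bernoulli's inequality for a negative power. *)
Lemma decay_step A c s h : 0 < A -> 0 <= c -> 0 <= s -> 0 <= h ->
  decay A (c * theta) s - c * h * (decay A (c * theta) s * (decay A (c * theta) s) `^ theta) <=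
  decay A (c * theta) (s + h).
Proof.
move=> A0 c0 s0 h0; set y := decay A (c * theta) s.
have ct0 : 0 <= c * theta by rewrite mulr_ge0// ltW.
have y0 : 0 < y by exact: decay_gt0.
pose D := A `^ (- theta) + c * theta * s; have D0 : 0 < D by rewrite ltr_pwDl ?powR_gt0// mulr_ge0.
have yth : y `^ theta = D^-1.
  by rewrite /y /decay -/D -powRrM mulNr mulVf ?gt_eqF// powR_inv1// ltW.
have x0 : 0 <= c * theta * h / D by rewrite mulr_ge0 ?invr_ge0 ?(ltW D0)// mulr_ge0.
have -> : decay A (c * theta) (s + h) = y * (1 + c * theta * h / D) `^ (- theta^-1).
  rewrite /y /decay -/D -powRM ?(ltW D0)//; last by rewrite addr_ge0.
  have DE : D * (1 + c * theta * h / D) = D + c * theta * h.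
    by rewrite mulrDr mulr1 [D * (_ / _)]mulrCA divff ?mulr1// gt_eqF.
  by rewrite DE /D mulrDr addrA.
have ti0 : 0 <= theta^-1 by rewrite invr_ge0 ltW.
have := ler_wpM2l (ltW y0) (powR_bernoulli x0 ti0); apply: le_trans.
rewrite yth le_eqVlt; apply/orP; left; apply/eqP.
by field; rewrite !gt_eqF.
Qed.

End decay.

Section sup_decay.
Context {R : realType} (d : nat) (alpha q : R) (b : 'rV[R]_d)
  (u0 : 'rV[R]_d -> R) (u : R -> 'rV[R]_d -> R).
Hypothesis d_ge1 : (1 <= d)%N.
Hypothesis alpha12 : 1 < alpha < 2.
Hypothesis q0 : 0 < q.
Hypothesis sol : mild_solution alpha q b u0 u.
Hypothesis iu0 : (@lebesgue_rV R d).-integrable setT (EFin \o u0).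
Local Notation L := (@lebesgue_rV R d).
Local Notation beta := (alpha / 2).
Local Notation theta := (2 * beta / d%:R).

Let b01 := half_alpha01 alpha12.
Let bge := half_alpha_ge alpha12.
Let th0 : 0 < theta.
Proof.
have d0 : 0 < d%:R :> R by rewrite ltr0n.
have t0 : 0 < 2 :> R by [].
by case/andP: b01 => h _; exact: (divr_gt0 (mulr_gt0 t0 h) d0).
Qed.

Let iu s : 0 <= s -> L.-integrable setT (EFin \o u s).
Proof. by move=> s0; apply: sol_integrable sol _ _. Qed.

(** In each step of the scheme, advection preserves the current bound, the sign and the mass bound,
    and diffusion lowers the bound as in [peak_decay]; by [decay_step] the bounds stay below
    [decay]. With theta = alpha / d the latter is of order s^(- d / alpha). *)
Lemma sup_decay M : 0 < M -> exists2 c : R, 0 < c & forall A t1 t2, 0 < A -> 0 < t1 -> t1 < t2 ->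
  (forall t, 0 < t -> {ae L, forall x, 0 <= u t x}) ->
  (forall t, 0 < t -> {ae L, forall x, u t x <= A}) ->
  (forall t, 0 < t -> N1 (u t) <= M) ->
  {ae L, forall x, u t2 x <= decay theta A c (t2 - t1)}.
Proof.
move=> M0; have [c [k0 [c0 k00 pk]]] := peak_decay d_ge1 b01 bge M0.
exists (c * theta); first exact: mulr_gt0 c0 th0.
move=> A t1 t2 A0 t10 t12 uge0 uA uM; have A0' := ltW A0.
have cth : 0 <= c * theta := mulr_ge0 (ltW c0) (ltW th0).
have hB s : t1 <= s <= t2 -> {ae L, forall x, `|u s x| <= A}.
  move=> /andP[h1 _]; have s0 := lt_le_trans t10 h1.
  by apply: filterS2 (uge0 s s0) (uA s s0) => x h2 h3; rewrite ger0_norm.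
have [lam lam0 lamB] := lip_coef q0 A0'.
have [T1 T10 H] := scheme_cvg alpha12 q0 sol iu0 A0'.
pose Y s := decay theta A (c * theta) s.
pose P t := {ae L, forall x, u t x <= Y (t - t1)}.
suff : P t2 by [].
apply: (time_chain t12 T10); last first.
  by rewrite /P /Y subrr (decay0 th0 _ A0); exact: (uA t1 t10).
move=> tau T t1tau T0 TT1 Tt2 Ptau.
have tau0 : 0 < tau by exact: lt_le_trans t1tau.
pose s0 := tau - t1; have s00 : 0 <= s0 by rewrite subr_ge0.
have tT0 : 0 < tau + T by rewrite addr_gt0.
have YT0 : 0 <= Y (s0 + T) by rewrite ltW// decay_gt0// addr_ge0// ltW.
have ok : L.-integrable setT (EFin \o u tau) /\ {ae L, forall x, `|u tau x| <= A}.
  split; first by apply: iu; exact: ltW.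
  by apply: hB; rewrite t1tau (le_trans _ Tt2)// lerDl ltW.
rewrite /P; have -> : tau + T - t1 = s0 + T by rewrite /s0 addrAC.
apply/(pos_eq0 YT0 (iu (ltW tT0)))/eqP; rewrite eq_le pos_ge0 andbT.
apply/ler_addgt0Pr => e e0; rewrite add0r.
have [N hN] := H _ _ _ _ _ _ t10 hB lam0 lamB t1tau T0 TT1 Tt2 e0.
(* Large enough for convergence and for the smallness condition of [peak_decay] at height [A], which
   then holds at all lower heights. *)
pose n := maxn N (Num.bound (T * A `^ theta / k0)).
have {}hN := hN n (leq_maxl _ _).
set h := T / n.+1%:R in hN; have h0 : 0 < h by rewrite divr_gt0.
have hA : h * A `^ theta <= k0.
  have Ak0 : 0 <= T * A `^ theta / k0 by rewrite divr_ge0 ?(ltW k00)// mulr_ge0 ?powR_ge0 ?(ltW T0).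
  have hb : T * A `^ theta / k0 <= n.+1%:R.
    apply: (@le_trans _ _ (Num.bound (T * A `^ theta / k0))%:R); first exact: ltW (archi_boundP Ak0).
    by rewrite ler_nat (leq_trans (leq_maxr N _)).
  rewrite /h mulrAC ler_pdivrMr ?ltr0n// [leRHS]mulrC.
  by rewrite -ler_pdivrMr.
have sb := scheme_bdd b b01 bge q0 (h / lam) (ltW lam0) lamB h0 A0' ok.
have sn j : pos 0 (fun x => - scheme beta q b lam (h / lam) h (u tau) j x) = 0.
  apply/eqP; rewrite eq_le pos_ge0 andbT.
  apply: le_trans (pos_schemeN b b01 bge q0 (h / lam) (ltW lam0) lamB h0 A0' ok j (lexx 0) A0') _.
  rewrite le_eqVlt; apply/orP; left; apply/eqP/(pos_eq0 (lexx 0) (integrableN ok.1)).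
  by apply: filterS (uge0 tau tau0) => x; rewrite oppr_le0.
have sm j : pos 0 (scheme beta q b lam (h / lam) h (u tau) j) <= M.
  apply: le_trans (pos_scheme b b01 bge q0 (h / lam) (ltW lam0) lamB h0 A0' ok j (lexx 0) A0') _.
  by apply: le_trans (uM tau tau0); rewrite (N1_pos ok.1) lerDl pos_ge0.
have YA j : 0 <= j -> Y (s0 + j) <= A.
  move=> j0; have s0j := addr_ge0 s00 j0.
  by rewrite -[leRHS](decay0 th0 (c * theta) A0); exact: (decay_anti th0 A0 cth (lexx 0) s0j).
have Y0 j : 0 <= j -> 0 < Y (s0 + j).
  by move=> j0; apply: decay_gt0 => //; exact: addr_ge0.
have key j : {ae L, forall x, scheme beta q b lam (h / lam) h (u tau) j x <= Y (s0 + j%:R * h)}.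
  elim: j => [|j IH]; first by rewrite mul0r addr0.
  have jh : 0 <= j%:R * h by rewrite mulr_ge0// ltW.
  have [iw wB] := sb j; set w := scheme _ _ _ _ _ _ _ j in IH iw wB.
  set Aj := Y (s0 + j%:R * h) in IH; have Aj0 : 0 < Aj by exact: Y0.
  have AjA : Aj <= A by exact: YA.
  have it := integrable_advection b q0 lam (h / lam) iw wB.
  have t1' : {ae L, forall x, advection q b lam (h / lam) w x <= Aj}.
    apply/(pos_eq0 (ltW Aj0) it)/eqP; rewrite eq_le pos_ge0 andbT.
    apply: le_trans (pos_advection b q0 (h / lam) (ltW lam0) lamB iw wB (ltW Aj0) AjA) _.
    by rewrite le_eqVlt; apply/orP; left; apply/eqP/(pos_eq0 (ltW Aj0) iw).
  have nw : advection q b lam (h / lam) (fun y => - w y) = fun x => - advection q b lam (h / lam) w x.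
    by apply/funext => x; exact: advectionN.
  have nwB : {ae L, forall x, `|- w x| <= A} by apply: filterS wB => x; rewrite normrN.
  have n0 : pos 0 (fun x => - advection q b lam (h / lam) w x) = 0.
    apply/eqP; rewrite eq_le pos_ge0 andbT -nw -[leRHS](sn j).
    exact: (pos_advection b q0 (h / lam) (ltW lam0) lamB (integrableN iw) nwB (lexx 0) A0').
  have t0' : {ae L, forall x, 0 <= advection q b lam (h / lam) w x}.
    by move/(pos_eq0 (lexx 0) (integrableN it)) : n0; apply: filterS => x; rewrite oppr_le0.
  have m0 : N1 (advection q b lam (h / lam) w) <= M.
    rewrite (N1_pos it) n0 addr0; apply: le_trans (sm j).
    exact: (pos_advection b q0 (h / lam) (ltW lam0) lamB iw wB (lexx 0) A0').
  have hAj : h * Aj `^ theta <= k0.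
    apply: le_trans hA; rewrite ler_wpM2l ?(ltW h0)//.
    by apply: powR_le_base => //; exact: ltW.
  apply: aeW => x; apply: le_trans (pk _ _ _ x Aj0 h0 hAj it t0' t1' m0) _.
  have := decay_step th0 A0 (ltW c0) (addr_ge0 s00 jh) (ltW h0).
  have -> : s0 + j.+1%:R * h = s0 + j%:R * h + h by rewrite -natr1 mulrDl mul1r addrA.
  by [].
apply: le_trans (pos_lip YT0 (iu (ltW tT0)) (sb n.+1).1) _.
have -> : pos (Y (s0 + T)) (scheme beta q b lam (h / lam) h (u tau) n.+1) = 0.
  apply/(pos_eq0 YT0 (sb n.+1).1).
  have := key n.+1; have -> : n.+1%:R * h = T by rewrite /h mulrCA divff ?mulr1.
  by [].
by rewrite add0r N1BC.
Qed.

End sup_decay.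


(** * Comparison with the semigroup *)

Section kernel_domination.
Context {R : realType} (d : nat).
Variable beta : R.
Hypothesis beta01 : 0 < beta < 1.
Hypothesis beta_ge : 2^-1 <= beta.
Local Notation L := (@lebesgue_rV R d).
Local Notation hkb := (@hk R d beta).
Implicit Types (x : 'rV[R]_d) (f g : 'rV[R]_d -> R).

Lemma conv_hk_ge0 t g x : 0 < t -> L.-integrable setT (EFin \o g) ->
  {ae L, forall x, 0 <= g x} -> 0 <= conv (hkb t) g x.
Proof.
move=> t0 ig g0; have kh := ker_hk d beta01 beta_ge t0.
have -> : 0 = \int[L]_(y in [set: 'rV[R]_d]) (0 : R) by rewrite /Rintegral integral0.
apply: ae_le_Rintegral; [exact: integrable0|exact: ker_slice|].
by apply: filterS g0 => y gy; rewrite mulr_ge0// ltW// hk_gt0.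
Qed.

Lemma conv_hk_le t g A x : 0 < t -> L.-integrable setT (EFin \o g) ->
  {ae L, forall x, g x <= A} -> conv (hkb t) g x <= A.
Proof.
move=> t0 ig gA; have kh := ker_hk d beta01 beta_ge t0.
have ihk := integrable_reflect x kh.2.
have <- : \int[L]_y (A * hkb t (x - y)) = A.
  by rewrite (RintegralZl A measurableT ihk) (Rintegral_rV_reflect x kh.2)
    (Rintegral_hk d beta01 beta_ge t0) mulr1.
apply: ae_le_Rintegral; [exact: ker_slice|exact: integrableRZ|].
by apply: filterS gA => y gy; rewrite mulrC ler_wpM2r// ltW// hk_gt0.
Qed.

Lemma conv_hk_gt0 t g x : 0 < t -> L.-integrable setT (EFin \o g) ->
  {ae L, forall x, 0 <= g x} -> 0 < N1 g -> 0 < conv (hkb t) g x.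
Proof.
move=> t0 ig g0 Ng; have kh := ker_hk d beta01 beta_ge t0.
rewrite lt_def conv_hk_ge0// andbT; apply/eqP => h; move: Ng.
suff -> : N1 g = 0 by rewrite ltxx.
have hp y : 0 < hkb t (x - y) by exact: hk_gt0.
have z : {ae L, forall y, hkb t (x - y) * g y = 0}.
  apply: N1_eq0; first exact: ker_slice.
  rewrite -[RHS]h; apply: ae_Rintegral.
  - by apply: filterS g0 => y gy; rewrite ger0_norm// mulr_ge0// ltW.
  - exact: (integrable_measurable (integrable_abs (ker_slice x kh ig))).
  - exact: (integrable_measurable (ker_slice x kh ig)).
have -> : 0 = \int[L]_(y in [set: 'rV[R]_d]) (0 : R) by rewrite /Rintegral integral0.
apply: ae_Rintegral => //; last exact: (integrable_measurable (integrable_abs ig)).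
apply: filterS z => y /eqP; rewrite mulf_eq0 gt_eqF ?hp//= => /eqP ->.
by rewrite normr0.
Qed.

Lemma conv_dk_le (b : 'rV[R]_d) C t f g x :
  (forall t x, 0 < t -> `|dk beta b t x| <= C * tsc beta t * hkb t x) ->
  0 < t -> L.-integrable setT (EFin \o f) -> L.-integrable setT (EFin \o g) ->
  {ae L, forall x, `|f x| <= g x} ->
  `|conv (dk beta b t) f x| <= C * tsc beta t * conv (hkb t) g x.
Proof.
move=> hC t0 if_ ig fg; have kh := ker_hk d beta01 beta_ge t0.
have kd := ker_dk beta01 beta_ge b t0.
apply: le_trans (conv_abs_le x kd if_) _.
rewrite -(RintegralZl (C * tsc beta t) measurableT (ker_slice x kh ig)).
apply: ae_le_Rintegral.
- exact: (ker_slice x (ker_abs kd) (integrable_abs if_)).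
- by apply: integrableRZ => //; exact: ker_slice.
apply: filterS fg => y fy; rewrite mulrA.
by apply: ler_pM => //; exact: hC.
Qed.

End kernel_domination.

Section mild_bound.
Context {R : realType} (d : nat) (alpha q : R) (b : 'rV[R]_d)
  (u0 : 'rV[R]_d -> R) (u : R -> 'rV[R]_d -> R).
Hypothesis alpha12 : 1 < alpha < 2.
Hypothesis q0 : 0 < q.
Hypothesis sol : mild_solution alpha q b u0 u.
Hypothesis iu0 : (@lebesgue_rV R d).-integrable setT (EFin \o u0).
Local Notation L := (@lebesgue_rV R d).
Local Notation mu := (@lebesgue_measure R).
Local Notation beta := (alpha / 2).
Local Notation hkb := (@hk R d beta).
Local Notation dkb := (@dk R d beta b).
Local Notation tsc := (tsc beta).
Implicit Types (x y z X : 'rV[R]_d).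

Let b01 := half_alpha01 alpha12.
Let bge := half_alpha_ge alpha12.
Let bgt : 2^-1 < beta. Proof. by case/andP: alpha12 => a1 _; lra. Qed.
Let F s x := flux q (u s x).
Let LF c : L1cont F 0 c. Proof. exact: (L1cont_flux q0 sol c). Qed.
Let iF s : 0 < s -> L.-integrable setT (EFin \o F s).
Proof. by move=> s0; have [h _] := LF (s + 1); apply: h; rewrite s0 ltrDl ltr01. Qed.
Let iu s : 0 < s -> L.-integrable setT (EFin \o u s).
Proof. by move=> s0; apply: sol_integrable sol _ _; exact: ltW. Qed.

Variables (A C1 sigma C : R).
Hypothesis A0 : 0 <= A.
Hypothesis uge0 : forall t, 0 < t -> {ae L, forall x, 0 <= u t x}.
Hypothesis uA : forall t, 0 < t -> {ae L, forall x, u t x <= A}.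
Hypothesis C10 : 0 <= C1.
Hypothesis sigma01 : 0 < sigma < 1.
Hypothesis C0 : 0 <= C.
Hypothesis hF : forall s, 0 < s -> {ae L, forall x, `|F s x| <= C1 * s `^ (- sigma) * u s x}.
Hypothesis hC : forall t x, 0 < t -> `|dkb t x| <= C * tsc t * hkb t x.

(** With the sup bound at hand the flux is bounded up to time 0, so Fubini applies to the kernel
    itself and the identity holds at every point, whereas [restart] holds almost everywhere. *)
Lemma restart_everywhere t T x : 0 < t -> t < T ->
  conv (hkb (T - t)) (u t) x = conv (hkb T) u0 x +
    \int[mu]_(s in `]0, t[) conv (dkb (T - s)) (F s) x.
Proof.
move=> t0 tT; have Tt : 0 < T - t by rewrite subr_gt0.
have kT := ker_hk d b01 bge Tt; have kt := ker_hk d b01 bge t0.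
have icu0 := integrable_conv kt iu0; have id := duh_integrable alpha12 sol iu0 t0.
have -> : u t = fun y => conv (hkb t) u0 y + duh alpha q b u t t y.
  by apply/funext => y; exact: (sol_duhamel_conv alpha12 sol y t0).
rewrite (convDr x kT icu0 id) (conv_assoc x kT kt iu0); congr (_ + _).
  apply: eq_Rintegral => y _; congr (_ * _).
  by rewrite /conv (hk_conv b01 bge _ Tt t0) subrK.
have kf := kerfam_dk b01 bge b 0 (lexx t).
rewrite /duh (conv_time_fubini kT kf (LF t)).
- apply: eq_Rintegral => s; rewrite inE /= in_itv/= => /andP[s0 st].
  have ts : 0 < t - s by rewrite subr_gt0.
  have kd := ker_dk b01 bge b ts.
  apply: eq_Rintegral => y _; congr (_ * _); rewrite (conv_comm _ kT kd).
  by rewrite /conv (dk_conv b01 bge b _ ts Tt) addrC addrA subrK.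
- by move=> y; exact: (integrable_dk_slice alpha12 q0 sol y t0).
pose N := C * (A `^ q * A); have N0 : 0 <= N by rewrite !mulr_ge0 ?powR_ge0.
have mf : measurable_fun (`]0, t[ `*` [set: 'rV[R]_d])
    (fun p : measurableTypeR R * 'rV[R]_d => hkb (T - t) (x - p.2) * conv (dkb (t - p.1)) (F p.1) p.2).
  apply: measurable_funM; last exact: (conv_time_meas kf (LF t)).
  apply: (@measurable_funS _ _ _ _ setT) => //.
  by apply: (measurableT_comp (measurable_slice x kT)).
apply: (@fubini_bound _ _ (measurableTypeR R) _ R mu L _ _
  (fun s y => hkb (T - t) (x - y) * conv (dkb (t - s)) (F s) y) (fun s => N * tsc (t - s)) _ measurableT mf).
- exact: measurable_itv.
- move=> s; rewrite /= in_itv/= => /andP[s0 st]; have ts : 0 < t - s by rewrite subr_gt0.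
  have kd := ker_dk b01 bge b ts; have iFs := iF s0.
  have FA : {ae L, forall x, `|F s x| <= A `^ q * A}.
    apply: filterS2 (uge0 s0) (uA s0) => y h1 h2.
    have h3 : `|u s y| <= A by rewrite ger0_norm.
    by apply: le_trans (flux_norm_le q0 h3) _; rewrite ler_wpM2l ?powR_ge0.
  have cb y : `|conv (dkb (t - s)) (F s) y| <= N * tsc (t - s).
    apply: le_trans (conv_dk_le b01 bge y hC ts iFs (integrable_abs iFs) _) _.
      by apply: aeW => z; exact: lexx.
    have -> : N * tsc (t - s) = C * tsc (t - s) * (A `^ q * A) by rewrite /N mulrAC.
    have Ct : 0 <= C * tsc (t - s) by rewrite mulr_ge0 ?powR_ge0.
    apply: (ler_wpM2l Ct).
    by apply: conv_hk_le => //; exact: integrable_abs.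
  have ihk := integrable_reflect x kT.2.
  have -> : (N * tsc (t - s))%:E = (\int[L]_y (N * tsc (t - s) * hkb (T - t) (x - y)))%:E.
    by rewrite (RintegralZl _ measurableT ihk) (Rintegral_rV_reflect x kT.2)
      (Rintegral_hk d b01 bge Tt) mulr1.
  apply: integral_norm_le => //.
  + by have := ker_slice x kT (integrable_conv kd iFs) => /integrable_measurable.
  + move=> y _; have h := hk_gt0 b01 bge (x - y) Tt.
    by rewrite normrM gtr0_norm// mulrC ler_wpM2r// ltW.
  + exact: integrableRZ.
- by apply: integrableRZ => //; exact: integrable_tsc.
Qed.

Let m T s := tsc (T / 2) * s `^ (- sigma) + (T / 2) `^ (- sigma) * tsc (T - s).

(** The singularities at 0 and at T are separated at T / 2, the other factor being bounded by its
    value there. *)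
Lemma singular_product_le T s : 0 < s -> s < T -> tsc (T - s) * s `^ (- sigma) <= m T s.
Proof.
move=> s0 sT; have T2 : 0 < T / 2 by rewrite divr_gt0// (lt_trans s0).
have sg0 : 0 <= sigma by case/andP: sigma01 => /ltW.
have h1 : 0 <= tsc (T / 2) * s `^ (- sigma) by rewrite mulr_ge0 ?powR_ge0.
have h2 : 0 <= (T / 2) `^ (- sigma) * tsc (T - s) by rewrite mulr_ge0 ?powR_ge0.
have [h|h] := leP s (T / 2).
  apply: (@le_trans _ _ (tsc (T / 2) * s `^ (- sigma))); last by rewrite lerDl.
  rewrite ler_wpM2r ?powR_ge0//; apply: tsc_anti => //; lra.
apply: (@le_trans _ _ ((T / 2) `^ (- sigma) * tsc (T - s))); last by rewrite lerDr.
rewrite mulrC ler_wpM2r ?powR_ge0//; apply: powR_ge_base => //; first by rewrite oppr_le0.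
exact: ltW.
Qed.

(* A bound for the integral of (T - s) ^ (- 1 / alpha) s ^ (- sigma) over ]0, T[. *)
Definition kappa T := tsc (T / 2) * (T `^ (1 - sigma) / (1 - sigma)) +
  (T / 2) `^ (- sigma) * kint beta T.

Lemma majorant_integral t T : 0 < t -> t <= T ->
  mu.-integrable `]0, t[ (EFin \o m T) /\ \int[mu]_(s in `]0, t[) m T s <= kappa T.
Proof.
move=> t0 tT; have T0 := lt_le_trans t0 tT.
have sg1 : - sigma + 1 = 1 - sigma by rewrite addrC.
have sN1 : -1 < - sigma by case/andP: sigma01 => _ h; rewrite ltrN2.
have ms : measurable_fun setT (fun s : R => s `^ (- sigma)) by exact: measurable_powR.
have pint : (\int[mu]_(s in `]0%R, t[) (s `^ (- sigma))%:E <= (T `^ (1 - sigma) / (1 - sigma))%:E)%E.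
  apply: (@le_trans _ _ (\int[mu]_(s in `]0%R, T]) (s `^ (- sigma))%:E)%E).
    apply: ge0_subset_integral => //=.
    - by apply/measurable_EFinP; exact: (measurable_funS _ _ ms).
    - by move=> s _; rewrite lee_fin powR_ge0.
    - by move=> s /=; rewrite !in_itv/= => /andP[-> /ltW/le_trans]; apply.
  by rewrite -sg1; exact: integral_powR0.
have i1 : mu.-integrable `]0, t[ (EFin \o (fun s => s `^ (- sigma))).
  apply: integrable_ge0P => //.
  - exact: (measurable_funS _ _ ms).
  - by move=> s _; exact: powR_ge0.
  - by apply: le_lt_trans pint _; rewrite ltry.
have i2 : mu.-integrable `]0, t[ (EFin \o (fun s => tsc (T - s))) by exact: integrable_tsc.
have j1 : mu.-integrable `]0, t[ (EFin \o (fun s => tsc (T / 2) * s `^ (- sigma))).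
  exact: integrableRZ.
have j2 : mu.-integrable `]0, t[ (EFin \o (fun s => (T / 2) `^ (- sigma) * tsc (T - s))).
  exact: integrableRZ.
split; first exact: integrableRD.
rewrite /m RintegralD; [|exact: measurable_itv|exact: j1|exact: j2].
rewrite RintegralZl; [|exact: measurable_itv|exact: i1].
rewrite RintegralZl; [|exact: measurable_itv|exact: i2].
apply: lerD; rewrite ler_wpM2l ?powR_ge0//.
  by rewrite -lee_fin EFin_Rintegral.
apply: le_trans (Rintegral_tsc_le b01 bgt t0 tT) _.
by rewrite subr0 gerBl kint_ge0.
Qed.

(** The pointwise gradient bound turns the Duhamel integrand into the backward value (P_(T-s)
    u(s))(x) times tsc (T - s) s^(- sigma), whose time integral is at most [kappa T]. *)
Lemma duhamel_le t T x B : 0 <= B -> 0 < t -> t <= T ->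
  (forall s, 0 < s -> s < t -> conv (hkb (T - s)) (u s) x <= B) ->
  `|\int[mu]_(s in `]0, t[) conv (dkb (T - s)) (F s) x| <= C * C1 * B * kappa T.
Proof.
move=> B0 t0 tT hB; have [im mk] := majorant_integral t0 tT.
have CB : 0 <= C * C1 * B by rewrite !mulr_ge0.
apply: (@le_trans _ _ (\int[mu]_(s in `]0, t[) (C * C1 * B * m T s))); last first.
  rewrite RintegralZl; [|exact: measurable_itv|exact: im].
  by rewrite ler_wpM2l.
apply: ler_norm_Rintegral.
- exact: measurable_itv.
- exact: (@measurable_time_slice R d (fun s => conv (dkb (T - s)) (F s)) 0 t x
    (conv_time_meas (kerfam_dk b01 bge b 0 tT) (LF t))).
- move=> s; rewrite /= in_itv/= => /andP[s0 st]; have sT := lt_le_trans st tT.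
  have Ts : 0 < T - s by rewrite subr_gt0.
  have ius := iu s0; have iFs := iF s0; have kh := ker_hk d b01 bge Ts.
  apply: le_trans (conv_dk_le b01 bge x hC Ts iFs
    (integrableRZ measurableT (C1 * s `^ (- sigma)) ius) (hF s0)) _.
  rewrite (convZr _ x kh ius).
  have := singular_product_le s0 sT; move/(ler_wpM2l CB); apply: le_trans.
  have h := hB s s0 st.
  have -> : C * tsc (T - s) * (C1 * s `^ (- sigma) * conv (hkb (T - s)) (u s) x) =
    C * C1 * (tsc (T - s) * s `^ (- sigma)) * conv (hkb (T - s)) (u s) x by ring.
  have -> : C * C1 * B * (tsc (T - s) * s `^ (- sigma)) = C * C1 * (tsc (T - s) * s `^ (- sigma)) * B.
    by ring.
  by rewrite ler_wpM2l// !mulr_ge0// powR_ge0.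
- by apply: integrableRZ => //; exact: measurable_itv.
Qed.

(** Iterates the Duhamel inequality from the constant bound [A]: if B is a bound for all earlier
    times, so is y0 + B / 2, and these bounds tend to 2 y0. *)
Lemma backward_bound T x : 0 < T -> C * C1 * kappa T <= 2^-1 -> 0 <= conv (hkb T) u0 x ->
  forall t, 0 < t -> t < T -> conv (hkb (T - t)) (u t) x <= 2 * conv (hkb T) u0 x.
Proof.
move=> T0 small; set y0 := conv (hkb T) u0 x => y00.
have e0 n : 0 <= 2^-1 ^+ n :> R by rewrite exprn_ge0// invr_ge0.
have H n : forall t, 0 < t -> t < T -> conv (hkb (T - t)) (u t) x <= 2 * y0 + A * 2^-1 ^+ n.
  elim: n => [|n IH] t t0 tT.
    rewrite expr0 mulr1; apply: (@le_trans _ _ A); last by rewrite lerDr mulr_ge0.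
    by apply: conv_hk_le => //; [rewrite subr_gt0|exact: iu|exact: uA].
  rewrite (restart_everywhere x t0 tT) -/y0.
  pose B := 2 * y0 + A * 2^-1 ^+ n; have B0 : 0 <= B by rewrite addr_ge0 ?mulr_ge0.
  have h := duhamel_le B0 t0 (ltW tT) (fun s s0 st => IH s s0 (lt_trans st tT)).
  have h2 : C * C1 * B * kappa T <= B / 2.
    by rewrite mulrAC mulrC ler_wpM2l.
  have -> : 2 * y0 + A * 2^-1 ^+ n.+1 = y0 + B / 2 by rewrite /B exprS; field.
  by rewrite lerD2l; apply: le_trans (ler_norm _) (le_trans h h2).
move=> t t0 tT; apply/ler_addgt0Pr => e ee0; pose n := Num.bound (A / e).
have hn : A / e < n%:R by apply: archi_boundP; rewrite divr_ge0// ltW.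
apply: le_trans (H n t t0 tT) _; rewrite lerD2l exprVn ler_pdivrMr ?exprn_gt0//.
rewrite mulrC -ler_pdivrMr//; apply: le_trans (ltW hn) _.
by rewrite -natrX ler_nat ltnW// ltn_expl.
Qed.

Lemma solution_close T x : 0 < T -> C * C1 * kappa T <= 2^-1 -> 0 <= conv (hkb T) u0 x ->
  `|u T x - conv (hkb T) u0 x| <= C * C1 * (2 * conv (hkb T) u0 x) * kappa T.
Proof.
move=> T0 small y0; rewrite (sol_duhamel_conv alpha12 sol x T0) addrAC subrr add0r.
apply: duhamel_le => //; first by rewrite mulr_ge0.
by move=> s s0 sT; exact: backward_bound.
Qed.

End mild_bound.


(** * Powers of time and the final rate *)

Lemma powR_vanish {R : realType} (K delta e : R) : 0 < K -> 0 < delta -> 0 < e ->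
  exists2 T0 : R, 0 < T0 & forall T, T0 <= T -> K * T `^ (- delta) <= e.
Proof.
move=> K0 d0 e0; have Ke : 0 < K / e by rewrite divr_gt0.
exists ((K / e) `^ delta^-1); first exact: powR_gt0.
move=> T hT; rewrite -ler_pdivlMl//.
apply: (@le_trans _ _ (((K / e) `^ delta^-1) `^ (- delta))).
  by apply: powR_ge_base => //; [rewrite oppr_le0 ltW|exact: powR_gt0].
rewrite -powRrM mulrN mulVf ?gt_eqF// powR_inv1 ?(ltW Ke)// invf_div.
by rewrite mulrC.
Qed.

Lemma cvg_mul_vanish {R : realType} (f : R -> \bar R) (K delta gamma T0 : R) :
  0 < K -> 0 < delta -> (forall t, 0 <= f t)%E ->
  (forall t, T0 <= t -> (f t <= (K * t `^ (- (gamma + delta)))%:E)%E) ->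
  ((t `^ gamma)%:E * f t)%E @[t --> +oo] --> 0%E.
Proof.
move=> K0 d0 f0 fK.
apply: (@squeeze_cvge _ _ _ R (fun=> 0%E) _ (fun t => (K * t `^ (- delta))%:E)); last 2 first.
- exact: cvg_cst.
- apply/fine_cvgP; split; first exact: nearW.
  apply/cvgrPdist_le => e e0; have [T1 T10 hT1] := powR_vanish K0 d0 e0.
  near=> t; rewrite sub0r normrN ger0_norm/= ?mulr_ge0 ?powR_ge0 ?(ltW K0)//.
  by apply: hT1; near: t; apply: nbhs_pinfty_ge; exact: num_real.
near=> t; have t0 : 0 < t by near: t; apply: nbhs_pinfty_gt; exact: num_real.
rewrite mule_ge0 ?lee_fin ?powR_ge0//=.
have tT : T0 <= t by near: t; apply: nbhs_pinfty_ge; exact: num_real.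
apply: le_trans (lee_wpmul2l _ (fK t tT)) _; first by rewrite lee_fin powR_ge0.
rewrite -EFinM lee_fin mulrCA ler_wpM2l ?(ltW K0)// -powRD; last first.
  by apply/implyP => _; rewrite gt_eqF.
by rewrite opprD addrA subrr add0r.
Unshelve. all: by end_near. Qed.

(** Of the decay (a + c s)^(- p) only the power s^(- sigma) is kept and the rest is bounded at s =
    0: the full power s^(- p) might not be integrable at 0. *)
Lemma powR_split_le {R : realType} (a c s p sigma : R) : 0 < a -> 0 < c -> 0 < s -> 0 <= sigma -> sigma <= p ->
  (a + c * s) `^ (- p) <= c `^ (- sigma) * a `^ (- (p - sigma)) * s `^ (- sigma).
Proof.
move=> a0 c0 s0 sg0 sp; have cs0 : 0 < c * s by rewrite mulr_gt0.
have D0 : 0 < a + c * s by rewrite addr_gt0.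
have -> : - p = - sigma + - (p - sigma) by ring.
rewrite powRD; last by apply/implyP => _; rewrite gt_eqF.
rewrite mulrAC -powRM ?(ltW c0) ?(ltW s0)//.
apply: ler_pM; rewrite ?powR_ge0//; apply: powR_ge_base => //.
- by rewrite oppr_le0.
- by rewrite lerDr ltW.
- by rewrite oppr_le0 subr_ge0.
- by rewrite lerDl ltW.
Qed.

(** Scaling in T; the exponent sigma + 1 / alpha - 1 is the decay rate of the relative error and has
    to exceed gamma. *)
Lemma kappaE {R : realType} (alpha sigma T : R) : 0 < T ->
  kappa alpha sigma T = (2^-1 `^ (- (2 * (alpha / 2))^-1) / (1 - sigma) +
    2^-1 `^ (- sigma) / kexp (alpha / 2)) * T `^ (- (sigma + (2 * (alpha / 2))^-1 - 1)).
Proof.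
move=> T0; rewrite /kappa /kint /tsc; set r := (2 * (alpha / 2))^-1; set k := kexp (alpha / 2).
have T1 : T != 0 by rewrite gt_eqF.
have h (p : R) : (T / 2) `^ p = 2^-1 `^ p * T `^ p.
  by rewrite powRM ?invr_ge0 ?(ltW T0)// mulrC.
rewrite !h mulrDl; congr (_ + _).
  have -> : - (sigma + r - 1) = - r + (1 - sigma) by ring.
  by rewrite [T `^ (- r + _)]powRD ?T1 ?implybT//; ring.
have -> : - (sigma + r - 1) = - sigma + k by rewrite /k /kexp -/r; ring.
by rewrite [T `^ (- sigma + _)]powRD ?T1 ?implybT//; ring.
Qed.

Theorem proposition5p2 (R : realType) (d : nat) (alpha q : R) (b : 'rV[R]_d)
    (u0 : 'rV[R]_d -> R) (u : R -> 'rV[R]_d -> R)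
    (d_ge1 : (1 <= d)%N)
    (alpha_gt1 : 1 < alpha) (alpha_lt2 : alpha < 2)
    (q_gt : (alpha - 1) / d%:R < q)
    (u0_L1 : u0 \in Lfun (lebesgue_rV d) 1%E)
    (u0_Loo : u0 \in Lfun (lebesgue_rV d) +oo%E)
    (u0_ge0 : {ae lebesgue_rV d, forall x, 0 <= u0 x})
    (u0_norm_gt0 : (0 < 'N[lebesgue_rV d]_1[EFin \o u0])%E)
    (u_solution : mild_solution alpha q b u0 u) :
  forall gamma : R, 0 < gamma ->
    gamma < Num.min (d%:R * (q - (alpha - 1) / d%:R)) 1 / alpha ->
    ((t `^ gamma)%:E *
      'N[lebesgue_rV d]_+oo
        [(fun x => (1 - u t x / stable_semigroup alpha t u0 x)%:E)])%E
      @[t --> +oo] --> 0%E.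
Proof.
move=> gamma gamma0 gamma_lt; have sol := u_solution.
have alpha12 : 1 < alpha < 2 by rewrite alpha_gt1.
have a0 : 0 < alpha by exact: lt_trans alpha_gt1.
have dR : 0 < d%:R :> R by rewrite ltr0n.
have q0 : 0 < q by apply: le_lt_trans q_gt; rewrite divr_ge0 ?(ltW dR)// subr_ge0 ltW.
have b01 := half_alpha01 alpha12; have bge := half_alpha_ge alpha12.
have a2 : 2 * (alpha / 2) = alpha by rewrite mulrC divfK.
have iu0 : (@lebesgue_rV R d).-integrable setT (EFin \o u0) by exact/Lfun1_integrable.
have N1u0 : 0 < N1 u0.
  by move: u0_norm_gt0; rewrite Lnorm1 -(EFin_Rintegral measurableT (integrable_abs iu0)) lte_fin.
have [A A0 u0A] : exists2 A : R, 0 < A & {ae @lebesgue_rV R d, forall x, u0 x <= A}.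
  move: u0_Loo; rewrite inE => /andP[_]; rewrite inE /= /finite_norm => fin.
  have N0 : (0 <= 'N[@lebesgue_rV R d]_+oo[EFin \o u0])%E by exact: Lnorm_ge0.
  pose N := fine 'N[@lebesgue_rV R d]_+oo[EFin \o u0].
  have NE : ('N[@lebesgue_rV R d]_+oo[EFin \o u0] = N%:E)%E by rewrite fineK// ge0_fin_numE.
  have N0' : 0 <= N by rewrite -lee_fin -NE.
  exists (N + 1); first by rewrite ltr_pwDr.
  have /Loo_le_ae : ('N[@lebesgue_rV R d]_+oo[EFin \o u0] <= N%:E)%E by rewrite NE.
  apply: filterS => x /=; rewrite lee_fin => h.
  by apply: le_trans (ler_norm _) (le_trans h _); rewrite lerDl.
have uge0 t : 0 < t -> {ae @lebesgue_rV R d, forall x, 0 <= u t x}.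
  exact: (sol_ge0 alpha12 q0 sol iu0 u0_ge0).
have uA t : 0 < t -> {ae @lebesgue_rV R d, forall x, u t x <= A}.
  exact: (sol_le alpha12 q0 sol iu0 (ltW A0) u0A).
pose M := N1 (u 0) + 1; have M0 : 0 < M by rewrite ltr_pwDr// N1_ge0.
have uM t : 0 < t -> N1 (u t) <= M.
  by move=> t0; apply: le_trans (sol_mass alpha12 q0 sol iu0 t0) _; rewrite lerDl.
have [c c0 dec] := sup_decay d_ge1 alpha12 q0 sol iu0 M0.
pose theta := 2 * (alpha / 2) / d%:R; have thE : theta = alpha / d%:R by rewrite /theta a2.
have th0 : 0 < theta by rewrite thE divr_gt0.
pose p := q / theta; pose top := Num.min p 1; pose bot := gamma + 1 - alpha^-1.
(* The two inequalities are the two terms of the minimum bounding [gamma]: d (q - q0) corresponds to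
   sigma < q d / alpha, and 1 to the integrability of s^(- sigma) at 0. *)
have bt : bot < top.
  move: gamma_lt; rewrite ltr_pdivlMr// !lt_min => /andP[g1 g2].
  have g1' : gamma * alpha < d%:R * q - (alpha - 1).
    by move: g1; rewrite mulrBr [d%:R * (_ / _)]mulrCA divff ?mulr1// gt_eqF.
  apply/andP; split; last first.
    by have : gamma < alpha^-1 by [rewrite -div1r ltr_pdivlMr]; rewrite /bot; lra.
  have -> : p = d%:R * q / alpha by rewrite /p thE invf_div mulrCA mulrA.
  rewrite ltr_pdivlMr// /bot mulrBl mulrDl mul1r mulVf ?gt_eqF//; lra.
have ai1 : alpha^-1 < 1 by rewrite invf_lt1.
pose sigma := (bot + top) / 2.
have sb : bot < sigma by rewrite /sigma; lra.
have st : sigma < top by rewrite /sigma; lra.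
have [sp s1] : sigma < p /\ sigma < 1 by move: st; rewrite lt_min => /andP[].
have bot0 : 0 < bot by rewrite /bot; lra.
have s0 : 0 < sigma by exact: lt_trans sb.
pose C1 := (c / 2) `^ (- sigma) * (A `^ (- theta)) `^ (- (p - sigma)).
have C10 : 0 < C1 by rewrite mulr_gt0 ?powR_gt0 ?divr_gt0.
have hF s : 0 < s -> {ae @lebesgue_rV R d, forall x, `|flux q (u s x)| <= C1 * s `^ (- sigma) * u s x}.
  (* [sup_decay] starts from a positive time; starting at s / 2 leaves half of the time, hence the
     factor c / 2 in [C1]. *)
  move=> s_0; have s20 : 0 < s / 2 by rewrite divr_gt0.
  have s2s : s / 2 < s by rewrite ltr_pdivrMr// ltr_pMr// ltr1n.
  apply: filterS2 (uge0 s s_0) (dec A (s / 2) s A0 s20 s2s uge0 uA uM) => x h1 h2.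
  have h3 : `|u s x| <= decay theta A c (s - s / 2) by rewrite ger0_norm.
  apply: le_trans (flux_norm_le q0 h3) _; rewrite ger0_norm// ler_wpM2r//.
  have -> : decay theta A c (s - s / 2) `^ q = (A `^ (- theta) + c / 2 * s) `^ (- p).
    rewrite /decay.
    have -> : c * (s - s / 2) = c / 2 * s by field.
    by rewrite -powRrM mulNr [theta^-1 * q]mulrC.
  apply: powR_split_le => //; rewrite ?powR_gt0 ?divr_gt0//; exact: ltW.
have [C C0 hC] := dk_le_hk b01 bge b.
have sigma01 : 0 < sigma < 1 by rewrite s0.
have CC0 : 0 < C * C1 by rewrite mulr_gt0.
pose om := sigma + alpha^-1 - 1; have omg : gamma < om by move: sb; rewrite /om /bot; lra.
pose K0 := 2^-1 `^ (- alpha^-1) / (1 - sigma) + 2^-1 `^ (- sigma) / kexp (alpha / 2).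
have kap T : 0 < T -> kappa alpha sigma T = K0 * T `^ (- om).
  by move=> T0; rewrite kappaE// a2.
have K00 : 0 < K0.
  have bgt : 2^-1 < alpha / 2 by lra.
  have h := kexp_gt0 b01 bgt.
  by rewrite addr_gt0// divr_gt0 ?powR_gt0 ?invr_gt0// subr_gt0.
have om0 : 0 < om by exact: lt_trans omg.
have h20 : 0 < 2^-1 :> R by rewrite invr_gt0.
(* From [T0] on the total weight is at most 1/2, as [backward_bound] requires. *)
have [T0 T00 hT0] := powR_vanish (mulr_gt0 CC0 K00) om0 h20.
have K20 : 0 < 2 * (C * C1 * K0) by rewrite mulr_gt0// mulr_gt0.
(* The surplus [om - gamma] is the power of t left over after multiplication by t^gamma. *)
have od : 0 < om - gamma by rewrite subr_gt0.
apply: (cvg_mul_vanish (T0 := T0) K20 od) => [t|t tT0]; first exact: Lnorm_ge0.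
have t0 := lt_le_trans T00 tT0.
apply/Loo_le_ae; apply: aeW => x; rewrite stable_semigroupE.
pose y := conv (hk (alpha / 2) t) u0 x.
have y0 : 0 < y by exact: (conv_hk_gt0 b01 bge x t0 iu0 u0_ge0 N1u0).
have small : C * C1 * kappa alpha sigma t <= 2^-1 by rewrite kap// mulrA; exact: hT0.
have := solution_close alpha12 q0 sol iu0 (ltW A0) uge0 uA (ltW C10) sigma01 (ltW C0) hF hC t0 small
  (ltW y0).
rewrite -/y -[\int[lebesgue_rV d]_y1 _]/y => close.
rewrite lee_fin; have -> : 1 - u t x / y = (y - u t x) / y by rewrite mulrBl divff// gt_eqF.
rewrite normrM normfV [X in _ / X]gtr0_norm// ler_pdivrMr// distrC; apply: le_trans close _.
rewrite kap// [gamma + _]addrC subrK le_eqVlt; apply/orP; left; apply/eqP; ring.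
Qed.
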